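(* There is a deterministic algorithm that, given a prime $p$ and a squarefree polynomial $f \in \mathbb{F}_p[X]$ of degree $n \ge 1$ that fully splits over $\mathbb{F}_p$, finds a root of $f$ in $\mathbb{F}_p$ in time $(n+p^{1/2})p^{o(1)}$.
   Context: $\mathbb{F}_p$ is the finite field of $p$ elements, $p$ prime. A polynomial fully splits over $\mathbb{F}_p$ if it is a product of linear factors in $\mathbb{F}_p[X]$. Time may be measured either in arithmetic operations in $\mathbb{F}_p$ or in bit operations (these agree up to a factor $p^{o(1)}$). Here $o(1)$ denotes a quantity tending to $0$ as $p\to\infty$, uniformly in $n$ and $f$. *)

(* Defs.v *)
From mathcomp Require Import all_boot all_order all_algebra.
From mathcomp Require Import all_classical all_reals all_analysis.

Set Implicit Arguments.
Unset Strict Implicit.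
Unset Printing Implicit Defensive.

Import GRing.Theory.

(* The model of computation is a random access machine with logarithmic cost:
   time is counted in bit operations.  An algorithm is a while program over one
   memory of natural numbers with indirect addressing.  Cells are unbounded, but
   every number and every address that is handled is charged by its binary
   length.  A program is a finite object that does not depend on the input. *)

Local Open Scope nat_scope.

Definition bitlen (k : nat) : nat := (trunc_log 2 k).+1.

Definition memory := nat -> nat.

Definition update (m : memory) (i v : nat) : memory :=
  [eta m with i |-> v].

Variant arith := AAdd | ASub | AMul | ADiv | AMod.

Inductive expr :=
| Const of nat
| Read of expr
| Op of arith & expr & expr.

Inductive cmd :=
| Skip
| Write of expr & expr
| Seq of cmd & cmd
| If of expr & cmd & cmd
| While of expr & cmd.

Definition arith_val (o : arith) (a b : nat) : nat :=
  match o with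
  | AAdd => a + b
  | ASub => a - b
  | AMul => a * b
  | ADiv => a %/ b
  | AMod => a %% b
  end.

(* Bit cost of the schoolbook methods. *)
Definition arith_cost (o : arith) (a b : nat) : nat :=
  match o with
  | AAdd | ASub => bitlen a + bitlen b
  | AMul | ADiv | AMod => bitlen a * bitlen b
  end.

Fixpoint eval (m : memory) (e : expr) : nat :=
  match e with
  | Const k => k
  | Read a => m (eval m a)
  | Op o a b => arith_val o (eval m a) (eval m b)
  end.

Fixpoint eval_cost (m : memory) (e : expr) : nat :=
  match e with
  | Const k => bitlen k
  | Read a => eval_cost m a + bitlen (eval m a) + bitlen (m (eval m a))
  | Op o a b =>
      eval_cost m a + eval_cost m b + arith_cost o (eval m a) (eval m b)
  end.

(* [exec c m m' t]: started on the memory m, the program c halts with the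
   memory m' after t bit operations. A test succeeds when it is nonzero. *)
Inductive exec : cmd -> memory -> memory -> nat -> Prop :=
| exec_skip m : exec Skip m m 1
| exec_write m a e :
    exec (Write a e) m (update m (eval m a) (eval m e))
      (eval_cost m a + eval_cost m e
       + bitlen (eval m a) + bitlen (eval m e))
| exec_seq c1 c2 m1 m2 m3 t1 t2 :
    exec c1 m1 m2 t1 -> exec c2 m2 m3 t2 ->
    exec (Seq c1 c2) m1 m3 (t1 + t2)
| exec_if e c1 c2 m1 m2 t :
    exec (if eval m1 e != 0 then c1 else c2) m1 m2 t ->
    exec (If e c1 c2) m1 m2 ((eval_cost m1 e).+1 + t)
| exec_while_stop e c m :
    eval m e = 0 -> exec (While e c) m m (eval_cost m e).+1
| exec_while_step e c m1 m2 m3 t1 t2 :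
    eval m1 e <> 0 ->
    exec c m1 m2 t1 -> exec (While e c) m2 m3 t2 ->
    exec (While e c) m1 m3 ((eval_cost m1 e).+1 + t1 + t2).

Lemma exec_deterministic c m m1 m2 t1 t2 :
  exec c m m1 t1 -> exec c m m2 t2 -> m1 = m2 /\ t1 = t2.
Proof.
move=> h; elim: h m2 t2 => {c m m1 t1}.
- by move=> m m2 t2 h; inversion h.
- by move=> m a e m2 t2 h; inversion h.
- move=> c1 c2 m1 m2 m3 t1 t2 _ ih1 _ ih2 m' t' h; inversion h; subst.
  match goal with H : exec c1 _ _ _ |- _ => case: (ih1 _ _ H) => ? ? end.
  by subst; match goal with H : exec c2 _ _ _ |- _ =>
    case: (ih2 _ _ H) => ? ?; subst end.
- move=> e c1 c2 m1 m2 t _ ih m' t' h; inversion h; subst.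
  by match goal with H : exec _ _ _ _ |- _ =>
    case: (ih _ _ H) => ? ?; subst end.
- by move=> e c m e0 m' t' h; inversion h.
- move=> e c m1 m2 m3 t1 t2 e0 _ ih1 _ ih2 m' t' h; inversion h; subst=> //.
  match goal with H : exec c _ _ _ |- _ => case: (ih1 _ _ H) => ? ? end.
  by subst; match goal with H : exec (While e c) _ _ _ |- _ =>
    case: (ih2 _ _ H) => ? ?; subst end.
Qed.

Local Open Scope ring_scope.

(* Dense input: p, then the degree of f, then its coefficients from degree 0
   upwards, as residues in [0, p); all the other cells are 0. *)
Definition input (p : nat) (f : {poly 'F_p}) : memory := fun j =>
  match j with
  | 0%N => p
  | 1%N => (size f).-1
  | i.+2 => nat_of_ord (f`_i)%R
  end.

Definition squarefree_poly (F : fieldType) (f : {poly F}) : Prop :=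
  forall g : {poly F}, g ^+ 2 %| f -> g \is a GRing.unit.

Definition fully_splits (F : fieldType) (f : {poly F}) : Prop :=
  exists rs : seq F, f %= \prod_(z <- rs) ('X - z%:P).

(* The output of a run is the content of cell 0, the residue in [0, p) of
   the root. *)
Definition finds_root (c : cmd) (p : nat) (f : {poly 'F_p}) (t : nat) : Prop :=
  exists2 m : memory, exec c (input f) m t &
  exists2 x : 'F_p, root f x & m 0%N = nat_of_ord x.

(* Main.v *)
(** The polynomial f is replaced by the squarefree polynomial g of a shrinking nonempty set X of its
roots.  For a = 1, 2, ... the set X is split by the quadratic character of x + a, that is by the
values of (X + a)^((p-1)/2) - 1 modulo g, and then by the values of g(X + a), and one nonempty part
is kept.  After step a no two elements of X differ by at most a, and x + b has the same quadratic
character for all x in X, apart from zeros, for every b <= a.  Such a set is small: #|X| * a is at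
most (#|X| + sqrt p) (log p)^O(1).  When a exceeds sqrt p this follows from Stepanov's bound for the
character sums over windows of shifts.  When a is smaller, X is first spread out by the maps
x |-> (x + c) / q with q prime, and the collisions between the images are counted by walks along
close pairs.  Hence the sizes of X summed over all steps amount to at most n + sqrt p, up to
logarithmic factors.

A step takes time #|X| p^o(1).  Products are computed by a transform in base D = 2^v modulo p^D + 1,
where p is a root of unity of order 2 D, with v near sqrt(log p) so that D = p^o(1).  To select the
roots where w does not vanish, e = w^(p-1) mod g is the indicator function of the part S to be kept;
e g' mod g gives the power sums of S, and Newton's iteration turns them into the polynomial of S. *)

From mathcomp Require Import all_boot all_order all_algebra all_field.
From mathcomp Require Import zify ring lra.
Require Import Defs.

Set Implicit Arguments.
Unset Strict Implicit.
Unset Printing Implicit Defensive.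

Import Order.TTheory GRing.Theory Num.Theory.

(** * Character sums *)

(** Points that share a window of about log p characters form at most p (log p)^O(1) pairs, by the
    second moment of the character sums. For [X] and its A shifts this gives only |X|^2 A <= p up to
    logarithms, which falls short of |X| A <= sqrt p. Dividing by a prime q below A / log p keeps
    windows, because (x + c) / q + i = (x + c + q i) / q, so that a pair in [X] yields about A^2
    pairs (q and c vary) instead of A, provided that the points (x + c) / q rarely coincide. A
    coincidence makes q z - q' x small. Cauchy's inequality reduces this to q = q', that is to small
    q (z - x), and a chain of such steps with distinct primes writes the total difference as a
    fraction in lowest terms, from which the chain can be read off once the order of its primes is
    known. Too many chains would give two fractions congruent modulo p and too close to differ.
    Separation makes the fraction remember the chain, which is why [X] is split by g(X + a) as well.
    Since p^o(1) absorbs powers of log p and of D, exponents are rounded up freely. *)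

Section Stepanov.
Local Open Scope ring_scope.

(** The numerics of Stepanov's method: [mu] is about half of sqrt p and [d] is the number of linear
    factors. From [p < 4 * mu.+1 ^ 2] follows p <= 16 mu^2, and 113 > 7 * 16, so in the range where
    the final bound is not trivial [d] is small against [mu]. *)
Lemma stepanov_arith1 d mu p :
  (0 < d -> 0 < mu -> 113 * d * mu < p -> p < 4 * mu.+1 ^ 2 -> 7 * d <= mu)%N.
Proof.
move=> d0 mu0 h1 h2.
have h3 : (mu * (113 * d) < mu * (16 * mu))%N.
  by move: h1 h2; rewrite !expnS expn0; nia.
by rewrite ltn_pmul2l // in h3; lia.
Qed.

(** Fewer linear conditions than unknowns. Both sides have the leading term 2 mu (c - d); the
    surplus 3 d + 3 in the number of blocks pays for the degrees added by differentiation. *)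
Lemma stepanov_arith2 d mu c :
  (7 * d <= mu -> 0 < d -> 2 * mu ^ 2 <= c ->
  2 * mu * (c - d + 2 * mu * d + (mu + (3 * d + 3))) < 2 * ((mu + (3 * d + 3)) * (c - d)))%N.
Proof.
move=> h1 d0 h2.
have z1 : (mu * mu <= c - d)%N by move: h2; rewrite !expnS expn0; nia.
move: (c - d)%N z1 => z z1.
have e1 : ((3 * d + 3) * (mu * mu) <= (3 * d + 3) * z)%N by rewrite leq_mul2l z1 orbT.
have e2 : (mu * (2 * mu * d + mu + (3 * d + 3)) < mu * ((3 * d + 3) * mu))%N.
  by rewrite ltn_pmul2l; nia.
move: e1 e2; rewrite !mulnDl !mulnDr; lia.
Qed.

Lemma stepanov_arith3 d mu c p y :
  (0 < d -> 0 < mu -> p < 4 * mu.+1 ^ 2 -> p = c.*2.+1 ->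
  y * (2 * mu) < (mu + (3 * d + 3)) * p + c * d -> 2 * y <= p + 112 * d * mu)%N.
Proof.
move=> d0 mu0 mu2 pc h.
have mm := leq_pmulr mu mu0.
have pmu : (p <= 16 * (mu * mu))%N by move: mu2; rewrite !expnS expn0; lia.
have e2 : (2 * (c * d) <= p * d)%N by rewrite mulnA leq_mul2r pc; lia.
have e3 : (3 * p <= 3 * d * p)%N by rewrite leq_mul2r; lia.
have e4 : (d * p <= d * (16 * (mu * mu)))%N by rewrite leq_mul2l pmu orbT.
suff : (mu * (2 * y) <= mu * (p + 112 * d * mu))%N by rewrite leq_pmul2l.
have -> : (mu * (p + 112 * d * mu) = mu * p + 7 * (d * (16 * (mu * mu))))%N by ring.
have -> : (mu * (2 * y) = y * (2 * mu))%N by ring.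
have : (y * (2 * mu) < mu * p + 3 * d * p + 3 * p + c * d)%N by move: h; rewrite !mulnDl !addnA.
by move: e3 e4; rewrite -(mulnA 3%N d p); lia.
Qed.

Lemma linear_system_solution (F : fieldType) (T I : finType) (a : T -> I -> F) :
  (#|T| < #|I|)%N ->
  exists2 x : I -> F, (exists i, x i != 0) &
    forall t, \sum_i x i * a t i = 0.
Proof.
move=> ltTI; pose M := \matrix_(i < #|I|, t < #|T|) a (enum_val t) (enum_val i).
have /rowV0Pn[u /sub_kermxP uM u0] : kermx M != 0.
  rewrite -mxrank_eq0 mxrank_ker subn_eq0 -ltnNge.
  exact: leq_ltn_trans (rank_leq_col M) ltTI.
exists (fun i => u 0 (enum_rank i)).
  have /rV0Pn[j uij] := u0.
  by exists (enum_val j); rewrite enum_valK.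
move=> t; have /matrixP/(_ 0 (enum_rank t)) := uM.
rewrite !mxE => uMt; rewrite -[RHS]uMt (reindex (@enum_val I predT)) /=; last first.
  exact/onW_bij/enum_val_bij.
by apply: eq_bigr => i _; rewrite enum_valK mxE enum_rankK.
Qed.

(** The k-th derivative at y is k! times a coefficient of the Taylor expansion at y, and k! is
    invertible for k < p; hence the order [m] of vanishing is limited by the characteristic. *)
Lemma dvdp_XsubC_exp (F : fieldType) (P : {poly F}) (y : F) (m p : nat) :
  p \in [pchar F] -> (m <= p)%N -> (forall k, (k < m)%N -> (P^`(k)).[y] = 0) ->
  ('X - y%:P) ^+ m %| P.
Proof.
move=> pF mp dP; have pr := pcharf_prime pF.
have -> : P = \sum_(i < size (P^:P)) (P^`N(i).[y])%:P * ('X - y%:P) ^+ i.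
  rewrite -{1}[P]comp_polyXr /comp_poly -{1}['X](subrK y%:P) addrC.
  rewrite nderiv_taylor; last by rewrite /GRing.comm mulrC.
  by apply: eq_bigr => i _; rewrite nderivn_map horner_map.
apply: (big_ind (fun q => _ %| q)); first exact: dvdp0.
  by move=> a b; apply: dvdp_add.
move=> [i /= _] _; case: (ltnP i m) => im; last by rewrite dvdp_mull // dvdp_exp2l.
have := dP i im; rewrite nderivn_def hornerMn => /eqP.
rewrite -mulr_natr mulf_eq0 => /orP[/eqP->|]; first by rewrite mul0r dvdp0.
rewrite -(dvdn_pcharf pF) fact_prod (@big_morph _ _ (dvdn p) false orb) //; first last.
- by rewrite dvdn1; case: p pr {pF mp dP} => [|[|]].
- by move=> a b; rewrite Euclid_dvdM.
rewrite big_has => /hasP[j]; rewrite mem_index_iota => /andP[j0 ji] /dvdn_leq; lia.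
Qed.

(** Unless both polynomials vanish, the multiplicity of the root b is odd on the left and even on
    the right. *)
Lemma nonsquare_aux (F : fieldType) (b : F) (E r s : {poly F}) (k : F) :
  ~~ root E b -> k != 0 -> ('X - b%:P) * E * r ^+ 2 = k *: s ^+ 2 ->
  r = 0 /\ s = 0.
Proof.
move=> Eb k0 e.
have E0 : E != 0 by apply: contraNneq Eb => ->; rewrite root0.
have [r0|r0] := eqVneq r 0.
  split=> //; apply/eqP; move/eqP: e; rewrite r0 expr0n mulr0 eq_sym scaler_eq0.
  by rewrite (negPf k0) expf_eq0.
have s0 : s != 0.
  apply: contra_neq r0 => s0; apply/eqP; move/eqP: e.
  rewrite s0 expr0n scaler0 !mulf_eq0 polyXsubC_eq0 (negPf E0) /=.
  by rewrite orbb.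
have := congr1 (mup b) e.
rewrite -mulrA mupM ?mulf_neq0 ?expf_neq0 ?polyXsubC_eq0 //.
rewrite (mupMr _ Eb) -mul_polyC mupMr ?rootC //.
rewrite -['X - _]expr1 mup_XsubCX eqxx !expr2 !mupM //; lia.
Qed.

Variables (p : nat) (S : {set 'F_p}) (c : nat).
Hypothesis (pp : prime p) (pc : p = c.*2.+1).
Notation F := 'F_p.
Let D : {poly F} := \prod_(b in S) ('X - b%:P).
Let d := #|S|.
Hypothesis (d0 : (0 < d)%N) (D0 : D.[0] != 0).

Let pcharF : p \in [pchar F]. Proof. exact: pchar_Fp. Qed.
Let pcharP : p \in [pchar {poly F}]. Proof. by rewrite (rmorph_pchar (polyC : {rmorphism _ -> _})). Qed.

Lemma fermatF (y : F) : y ^+ p = y.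
Proof. by rewrite -{2}(expf_card y) card_Fp. Qed.

Lemma size_D : size D = d.+1.
Proof. by rewrite /D -big_enum /= size_prod_XsubC -cardE. Qed.

Lemma frobenius_mod_Xp (Q : {poly F}) : 'X^p %| Q ^+ p - (Q.[0])%:P.
Proof.
have -> : (Q.[0])%:P = (Q.[0])%:P ^+ p :> {poly F} by rewrite -polyC_exp fermatF.
have pn : [pchar {poly F}].-nat p by rewrite (eq_pnat _ (pcharf_eq pcharP)) pnat_id.
have -> : Q ^+ p = (Q - (Q.[0])%:P) ^+ p + (Q.[0])%:P ^+ p.
  by rewrite -exprDn_pchar // subrK.
rewrite addrK; apply: dvdp_exp2r.
by rewrite -['X]subr0 -polyC0 dvdp_XsubCl rootE !hornerE subrr.
Qed.

(** Multiplying by D (r - s D^c) turns D^(2c+1) into D^p, which is the constant D(0) modulo X^p. The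
    result D r^2 - D(0) s^2 has degree below p, so it vanishes, and D is squarefree, so D r^2 is not
    a nonzero constant times a square. This is where D(0) != 0 enters. *)
Lemma stepanov_nonvanishing (delta : nat) (r s : {poly F}) :
  (0 < delta)%N -> (size r <= delta)%N -> (size s <= delta)%N -> (d + delta.*2 <= p.+1)%N ->
  'X^p %| r + s * D ^+ c -> r = 0 /\ s = 0.
Proof.
move=> dl0 sr ss dd dv.
have [b bS] : exists b, b \in S by apply/set0Pn; rewrite -card_gt0.
pose E := \prod_(a in S :\ b) ('X - a%:P).
have DE : D = ('X - b%:P) * E by rewrite /D (big_setD1 b).
apply: (@nonsquare_aux _ b E r s D.[0]) => //.
  rewrite /root horner_prod prodf_seq_neq0; apply/allP=> a _ /=.
  apply/implyP; rewrite !inE => /andP[ab _].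
  by rewrite !hornerE subr_eq0 eq_sym.
rewrite -DE; apply/eqP; rewrite -subr_eq0.
set Z := (X in X == 0).
have dvZ : 'X^p %| Z.
  have -> : Z = D * (r + s * D ^+ c) * (r - s * D ^+ c) + s ^+ 2 * (D ^+ p - (D.[0])%:P).
    have -> : D ^+ p = D * D ^+ c * D ^+ c.
      by rewrite -mulrA -exprD addnn -exprS; congr (_ ^+ _).
    rewrite /Z -mul_polyC; ring.
  by rewrite dvdp_add ?(dvdp_mull _ (frobenius_mod_Xp _)) // dvdp_mulr // dvdp_mull.
apply: contraLR dvZ => Z0; apply/negP=> /dvdp_leq -/(_ Z0).
rewrite size_polyXn leqNgt => /negP; apply.
rewrite /Z; apply: leq_trans (size_polyD _ _) _.
rewrite size_polyN geq_max; apply/andP; split.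
  apply: leq_trans (size_polyMleq _ _) _; rewrite size_D addSn /=.
  by apply: leq_trans (leq_add (leqnn d) (size_poly_exp_leq r 2)) _; lia.
apply: leq_trans (size_scale_leq _ _) _.
by apply: leq_trans (size_poly_exp_leq s 2) _; lia.
Qed.

(** The cofactor that remains when D^c is taken out of D^k (D^c f)^(k). Each differentiation lowers
    the exponent of D by one, hence the scalar c - j. *)
Fixpoint sderiv (k : nat) (f : {poly F}) : {poly F} :=
  if k is j.+1 then D * (sderiv j f)^`() + (c%:R - j%:R) *: (D^`() * sderiv j f)
  else f.

Lemma sderivE k (f : {poly F}) : D ^+ k * (D ^+ c * f)^`(k) = D ^+ c * sderiv k f.
Proof.
have c0 : (0 < c)%N by move: (prime_gt1 pp); rewrite pc; case: (c).
elim: k f => [|k IH] f; first by rewrite expr0 mul1r.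
have := congr1 (fun q => D * q^`()) (IH f).
rewrite !derivM !deriv_exp -derivnS /= => e.
apply: (addrI (k%:R *: (D^`() * (D ^+ k * (D ^+ c * f)^`(k))))).
transitivity (D * (D^`() * D ^+ k.-1 *+ k * (D ^+ c * f)^`(k) + D ^+ k * (D ^+ c * f)^`(k.+1))).
  rewrite mulrDr; congr (_ + _); last by rewrite exprS mulrA.
  case: k {e IH} => [|k]; first by rewrite !mulr0n !mul0r mulr0 scale0r.
  rewrite -scaler_nat exprS /= -!scalerAl -!scalerAr; congr (_ *: _); ring.
rewrite derivnS e IH.
move: (sderiv k f) (D^`()) => a b.
have -> : D ^+ c = D * D ^+ c.-1 by rewrite -exprS prednK.
rewrite -!mul_polyC polyCB !polyC_natr -[X in D * (X * a + _)]mulr_natr.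
move: (D ^+ c.-1) (c%:R : {poly F}) (k%:R : {poly F}) => g z w; ring.
Qed.

Lemma size_deriv_leq (R : nzRingType) (q : {poly R}) : (size q^`() <= (size q).-1)%N.
Proof. exact: size_poly. Qed.

Lemma size_derivn_leq (R : nzRingType) k (q : {poly R}) : (size q^`(k) <= size q)%N.
Proof.
elim: k => // k IH; rewrite derivnS; apply: leq_trans (size_deriv_leq _) _.
exact: leq_trans (leq_pred _) IH.
Qed.

Lemma size_sderiv k (f : {poly F}) n : (size f <= n)%N -> (size (sderiv k f) <= n + k * d)%N.
Proof.
move=> sf; elim: k => [|k IH] /=; first by rewrite mul0n addn0.
have := size_deriv_leq D; rewrite size_D /= => s1.
apply: leq_trans (size_polyD _ _) _; rewrite geq_max; apply/andP; split.
  apply: leq_trans (size_polyMleq _ _) _; rewrite size_D.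
  move: (size_deriv_leq (sderiv k f)) IH; move: (size _) (size _) => y z.
  by rewrite mulSn; lia.
apply: leq_trans (size_scale_leq _ _) _.
apply: leq_trans (size_polyMleq _ _) _.
by move: s1 IH; move: (size _) (size _) => y z; rewrite mulSn; lia.
Qed.

(** X^(j p) has derivative 0 and behaves as a constant. The auxiliary polynomial can thus have a
    high degree without more conditions. *)
Lemma derivnM_Xp k (f : {poly F}) j : (f * 'X^(j * p))^`(k) = f^`(k) * 'X^(j * p).
Proof.
elim: k => // k IH; rewrite !derivnS IH derivM derivXn.
by rewrite mulrnA -(mulr_natr _ p) (pcharf0 pcharP) mulr0 mulr0 addr0.
Qed.

Lemma dvdp_prod_XsubC_exp (F1 : fieldType) (R : {poly F1}) (m : nat) (s : seq F1) :
  uniq s -> (forall y, y \in s -> ('X - y%:P) ^+ m %| R) ->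
  \prod_(y <- s) ('X - y%:P) ^+ m %| R.
Proof.
elim: s => [|y s IH] /=; first by rewrite big_nil dvd1p.
move=> /andP[ys us] h; rewrite big_cons Gauss_dvdp.
  by rewrite h ?mem_head // IH // => z zs; rewrite h // in_cons zs orbT.
apply: coprimep_expl; rewrite coprimep_sym coprimep_XsubC.
apply/rootPf; rewrite horner_prod prodf_seq_eq0; apply/hasPn => z zs /=.
rewrite horner_exp !hornerE expf_eq0 negb_and subr_eq0.
by rewrite (contraNneq _ ys) ?orbT // => ->.
Qed.

Section Auxiliary.
Variables (mu : nat) (eps : F).
Hypothesis (eps0 : eps != 0) (mu0 : (0 < mu)%N).
Hypothesis (mu1 : (4 * mu ^ 2 <= p)%N) (mu2 : (p < 4 * mu.+1 ^ 2)%N).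
Hypothesis (small : (113 * d * mu < p)%N).
(** [m] is the order of vanishing, [J] the number of blocks X^(j p), [delta] bounds the size of a
    coefficient of a block, and [L] the size of the polynomials whose vanishing is required. *)
Let m := (2 * mu)%N.
Let J := (mu + (3 * d + 3))%N.
Let delta := (c - d)%N.
Let L := (delta + m * d + J)%N.

Let mu_gt : (7 * d <= mu)%N. Proof. exact: stepanov_arith1 small mu2. Qed.

Let c0 : (0 < c)%N.
Proof. by move: (prime_gt1 pp); rewrite pc; case: (c). Qed.

Let c_ge : (2 * mu ^ 2 <= c)%N.
Proof. by move: mu1; rewrite pc !expnS expn0; lia. Qed.

Let unknown_count : (m * L < 2 * (J * delta))%N.
Proof. exact: stepanov_arith2. Qed.

Let I : finType := ((bool * 'I_J) * 'I_delta)%type.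

(** On the points y with D(y)^c = eps, D^k times the k-th derivative of [elt i] takes the values of
    this polynomial of low degree: eps is put for D^c, and X for X^p because y^p = y. *)
Let base (k : nat) (i : I) : {poly F} :=
  (if i.1.1 then eps *: sderiv k 'X^(i.2) else D ^+ k * ('X^(i.2))^`(k)) * 'X^(i.1.2).

Let elt (i : I) : {poly F} :=
  ((if i.1.1 then D ^+ c else 1) * 'X^(i.2)) * 'X^(i.1.2 * p).

Let size_base k i : (k < m)%N -> (size (base k i) <= L)%N.
Proof.
move=> km; apply: leq_trans (size_polyMleq _ _) _; rewrite size_polyXn.
case: i => [[b j] e] /=; have := ltn_ord j; have := ltn_ord e => he hj.
have kd : (k * d <= m * d)%N by rewrite leq_mul2r ltnW ?orbT.
set q := (X in (size X + _).-1).
have : (size q <= delta + k * d)%N.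
  rewrite /q; case: b {q}; first by apply: leq_trans (size_scale_leq _ _) _; rewrite size_sderiv ?size_polyXn.
  apply: leq_trans (size_polyMleq _ _) _.
  have h1 := size_poly_exp_leq D k; rewrite size_D /= in h1.
  have h2 : (size ('X^e : {poly F})^`(k) <= delta)%N.
    by apply: leq_trans (size_derivn_leq _ _) _; rewrite size_polyXn.
  by move: h1 h2; move: (size _) (size _) => y z; rewrite mulnC; lia.
by move: (size q) => z; rewrite /L; lia.
Qed.

Let base_elt k i y : D.[y] ^+ c = eps ->
  D.[y] ^+ k * ((elt i)^`(k)).[y] = (base k i).[y].
Proof.
move=> Dy; rewrite /elt derivnM_Xp /base !hornerM !hornerXn mulrA -horner_exp -hornerM.
congr (_ * _); last by rewrite mulnC exprM fermatF.
case: i => [[[] j] e] /=; last by rewrite mul1r.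
by rewrite sderivE hornerM horner_exp hornerZ Dy.
Qed.

(** Stepanov's method: a nonzero combination R of the [elt i] that vanishes to order m at every
    counted point has degree at least m times their number, and the degree of R is known. *)
Lemma stepanov_half :
  (2 * #|[set y | D.[y] ^+ c == eps]| <= p + 112 * d * mu)%N.
Proof.
have d_lt_c : (d < c)%N by move: mu_gt c_ge d0; rewrite !expnS expn0; nia.
(* The solution makes the combined polynomials of low degree vanish identically for all k < m, not
   merely at the counted points. *)
have [x [i0 xi0] xsol] := @linear_system_solution F ('I_m * 'I_L)%type I
   (fun t i => (base t.1 i)`_(t.2))
   ltac:(by rewrite !card_prod !card_ord card_bool; move: unknown_count; rewrite mulnA).
pose R := \sum_i x i *: elt i.
have V0 k : (k < m)%N -> \sum_i x i *: base k i = 0.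
  move=> km; apply/polyP=> l; rewrite coef0; case: (ltnP l L) => lL.
    rewrite -{2}(xsol (Ordinal km, Ordinal lL)) coef_sum.
    by apply: eq_bigr => i _; rewrite coefZ.
  apply: nth_default; apply: leq_trans (size_sum _ _ _) _.
  apply/bigmax_leqP => i _; apply: leq_trans (size_scale_leq _ _) _.
  exact: leq_trans (size_base _ km) lL.
have Rd y k : D.[y] ^+ c = eps -> (k < m)%N -> (R^`(k)).[y] = 0.
  move=> Dy km; have Dy0 : D.[y] != 0.
    apply: contraNneq eps0 => D0y; rewrite -Dy D0y expr0n.
    by rewrite (gtn_eqF c0).
  apply: (mulfI (expf_neq0 k Dy0)); rewrite mulr0.
  rewrite -[RHS](horner0 y) -(V0 k km) /R raddf_sum /= !horner_sum mulr_sumr.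
  apply: eq_bigr => i _; rewrite derivnZ !hornerZ mulrCA; congr (_ * _).
  exact: base_elt.
pose rs b (j : 'I_J) := \sum_(e < delta) x (b, j, e) *: 'X^e : {poly F}.
have rs_size b j : (size (rs b j) <= delta)%N.
  apply: leq_trans (size_sum _ _ _) _; apply/bigmax_leqP => e _.
  by apply: leq_trans (size_scale_leq _ _) _; rewrite size_polyXn.
have rsE : R = \sum_(j < J) (rs false j + rs true j * D ^+ c) * 'X^(j * p).
  rewrite /R (eq_bigr (fun i : I => x (i.1, i.2) *: elt (i.1, i.2))); last by case.
  rewrite -(pair_bigA _ (fun bj e => x (bj, e) *: elt (bj, e))) /=.
  rewrite (eq_bigr (fun bj : bool * 'I_J => \sum_e x (bj.1, bj.2, e) *: elt (bj.1, bj.2, e))); last by case.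
  rewrite -(pair_bigA _ (fun b j => \sum_e x (b, j, e) *: elt (b, j, e))) /=.
  rewrite big_bool /= -big_split /=; apply: eq_bigr => j _.
  rewrite mulrDl addrC /elt /=; congr (_ + _).
    by rewrite mulr_suml; apply: eq_bigr => e _; rewrite mul1r scalerAl.
  rewrite !mulr_suml; apply: eq_bigr => e _.
  by rewrite -!scalerAl [D ^+ c * _]mulrC.
(* If R = 0, the blocks vanish one after another from the lowest j on: the blocks still present
   beyond j are multiples of X^((j+1) p), so [stepanov_nonvanishing] applies to block j. *)
have R0 : R != 0.
  apply: contraNneq xi0 => R0.
  have all0 n : (n < J)%N -> forall j : 'I_J, j = n :> nat -> rs false j = 0 /\ rs true j = 0.
    elim/ltn_ind: n => n IH nJ j jn.
    apply: (@stepanov_nonvanishing delta) => //; rewrite ?rs_size //.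
    - by rewrite subn_gt0.
    - by move: (ltnW d_lt_c) pc; rewrite /delta; lia.
    have X0 : 'X^(j * p) != 0 :> {poly F} by rewrite expf_neq0 ?polyX_eq0.
    rewrite -(dvdp_mul2r _ _ X0) -exprD -mulSn.
    move: R0; rewrite rsE (bigD1 j) //= => /eqP; rewrite addr_eq0 => /eqP ->.
    rewrite dvdpNr; apply: (big_ind (fun q => _ %| q)); first exact: dvdp0.
      by move=> a b; apply: dvdp_add.
    move=> j' jj'; case: (ltngtP j' j) => h; last by move/val_inj: h jj' => ->; rewrite eqxx.
      have [|||-> ->] := IH j' _ _ j' => //; rewrite -?jn //.
      by rewrite mul0r addr0 mul0r dvdp0.
    by rewrite dvdp_mull // dvdp_exp2l // leq_mul2r h orbT.
  case: i0 => [[b j] e].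
  have rbj : rs b j = 0 by have [h1 h2] := all0 j (ltn_ord j) j erefl; case: b.
  apply/eqP; rewrite -(coef0 F e) -rbj /rs coef_sum (bigD1 e) //= coefZ coefXn eqxx mulr1.
  rewrite big1 ?addr0 // => e' ee'; rewrite coefZ coefXn.
  by rewrite eq_sym (inj_eq val_inj) (negPf ee') mulr0.
have sizeR : (size R <= J * p + c * d)%N.
  apply: leq_trans (size_sum _ _ _) _; apply/bigmax_leqP => -[[b j] e] _.
  apply: leq_trans (size_scale_leq _ _) _.
  apply: leq_trans (size_polyMleq _ _) _; rewrite size_polyXn /=.
  have h0 : (size ((if b then D ^+ c else 1) * 'X^e : {poly F})%R <= d * c + e.+1)%N.
    apply: leq_trans (size_polyMleq _ _) _; rewrite size_polyXn.
    case: b; last by rewrite size_poly1; lia.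
    by have := size_poly_exp_leq D c; rewrite size_D /=; move: (size _) => z; lia.
  have h2 : (j.+1 * p <= J * p)%N by rewrite leq_mul2r ltn_ord orbT.
  have h3 := ltn_ord e; have h4 : (delta < p)%N by move: pc; rewrite /delta; lia.
  by move: h0 h2 h3 h4; move: (size _) => z; rewrite mulSn (mulnC d c); lia.
set Y := [set y | _].
have : \prod_(y <- enum Y) ('X - y%:P) ^+ m %| R.
  apply: dvdp_prod_XsubC_exp; first exact: enum_uniq.
  move=> y; rewrite mem_enum inE => /eqP Dy.
  apply: (dvdp_XsubC_exp pcharF); last by move=> k; apply: Rd.
  by apply: leq_trans mu1; have := leq_pmulr mu mu0; rewrite /m !expnS expn0; clear; lia.
move=> /dvdp_leq -/(_ R0).
rewrite prodrXl; set q := (\prod_(y <- _) _).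
have q0 : q ^+ m != 0 by rewrite expf_neq0 ?monic_neq0 ?monic_prod_XsubC.
have -> : size (q ^+ m) = (#|Y| * m).+1.
  rewrite -(prednK (_ : 0 < size (q ^+ m))%N) ?size_poly_gt0 // size_exp.
  by rewrite size_prod_XsubC -cardE.
move=> h.
have {}h := leq_trans h sizeR.
exact: stepanov_arith3 d0 mu0 mu2 pc h.
Qed.
End Auxiliary.

End Stepanov.

(** * Sums of the quadratic character *)

Section QuadraticCharacter.
Local Open Scope ring_scope.

Lemma sum_bool_card (T : finType) (P : pred T) :
  \sum_y (P y)%:R = #|[set y | P y]|%:Z.
Proof.
rewrite -sum1dep_card [in RHS]big_mkcond /= -natz natr_sum.
by apply: eq_bigr => y _; case: (P y).
Qed.

Variable p : nat.
Hypothesis (pp : prime p) (po : odd p).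
Notation F := 'F_p.

(** The Legendre symbol, by Euler's criterion. *)
Definition quadchar (y : F) : int :=
  (y ^+ p./2 == 1)%:R - (y ^+ p./2 == -1)%:R.

Let pc : p = p./2.*2.+1. Proof. by rewrite -{1}(odd_double_half p) po. Qed.
Let c0 : (0 < p./2)%N. Proof. by move: (prime_gt1 pp); rewrite pc; case: (p./2). Qed.

Lemma oner_neqN1 : (1 : F) != -1.
Proof.
rewrite -subr_eq0 opprK -[1 + 1]/(2%:R) -(dvdn_pcharf (pchar_Fp pp)).
by apply/negP=> /(dvdn_leq (isT : 0 < 2)%N); move: (prime_gt1 pp) po; case: p => [|[|[|]]].
Qed.

Lemma half_power (y : F) : y != 0 -> (y ^+ p./2 == 1) || (y ^+ p./2 == -1).
Proof.
move=> y0; rewrite -eqf_sqr expr1n -exprM muln2; apply/eqP/(mulfI y0).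
by rewrite -exprS -pc mulr1 fermatF.
Qed.

Lemma quadchar0 : quadchar 0 = 0.
Proof. by rewrite /quadchar expr0n (gtn_eqF c0) eq_sym oner_eq0 eq_sym oppr_eq0 oner_eq0. Qed.

Lemma quadcharM x y : quadchar (x * y) = quadchar x * quadchar y.
Proof.
have [->|x0] := eqVneq x 0; first by rewrite mul0r quadchar0 mul0r.
have [->|y0] := eqVneq y 0; first by rewrite mulr0 quadchar0 mulr0.
have n1 := oner_neqN1; have n2 : (-1 : F) == 1 = false by rewrite eq_sym (negPf n1).
rewrite /quadchar exprMn; have /orP[/eqP->|/eqP->] := half_power x0;
  have /orP[/eqP->|/eqP->] := half_power y0;
  by rewrite ?mulr1 ?mul1r ?mulrNN ?mulr1 ?eqxx ?(negPf n1) ?n2.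
Qed.

Lemma quadchar_norm x : `|quadchar x| = (x != 0)%:R.
Proof.
have [->|x0] := eqVneq x 0; first by rewrite quadchar0.
have n1 := oner_neqN1; have n2 : (-1 : F) == 1 = false by rewrite eq_sym (negPf n1).
by rewrite /quadchar; have /orP[/eqP->|/eqP->] := half_power x0; rewrite eqxx ?(negPf n1) ?n2.
Qed.

Lemma quadchar_prod (I : Type) (r : seq I) (P : pred I) (E : I -> F) :
  quadchar (\prod_(i <- r | P i) E i) = \prod_(i <- r | P i) quadchar (E i).
Proof.
apply: (big_morph quadchar quadcharM).
by rewrite /quadchar expr1n eqxx (negPf oner_neqN1).
Qed.

(** By Stepanov's bound each of the values 1 and -1 is taken at most (p + 112 d mu) / 2 times, with
    d = #|S|, and together they are taken at least p - d times. So neither is rare and they nearly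
    cancel. *)
Theorem char_sum_bound (S : {set F}) (mu : nat) :
  (0 < mu)%N -> (4 * mu ^ 2 <= p)%N -> (p < 4 * mu.+1 ^ 2)%N -> (0 < #|S|)%N ->
  `|\sum_y quadchar (\prod_(b in S) (y - b))| <= (113 * #|S| * mu)%N%:R.
Proof.
move=> mu0 mu1 mu2 S0.
have cF : #|F| = p by rewrite card_Fp.
have [big|small] := leqP p (113 * #|S| * mu).
  apply: le_trans (ler_norm_sum _ _ _) _.
  apply: le_trans (_ : \sum_(y : F) 1 <= _); last by rewrite sumr_const cF ler_nat.
  by apply: ler_sum => y _; rewrite quadchar_norm; case: (_ != _).
(* Translating by an element outside S moves S off 0, as the expansion at 0 in Stepanov's method
   requires. *)
have [t tS] : exists t, t \notin S.
  apply/existsP; rewrite -negb_forall; apply/negP=> /forallP SF.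
  have : #|S| = #|F| by apply/eq_card => y; rewrite SF.
  rewrite cF => Sp.
  by move: small mu0; rewrite Sp; clear; nia.
pose S' := [set b - t | b in S].
have S'c : #|S'| = #|S| by rewrite card_imset //; exact: addIr.
rewrite (reindex_inj (addIr t)) /=.
rewrite (eq_bigr (fun y => quadchar (\prod_(b in S') (y - b)))); last first.
  move=> y _; congr quadchar; rewrite /S' big_imset /=; last by move=> ? ? _ _; exact: addIr.
  by apply: eq_bigr => b _; rewrite opprB addrCA addrC addrAC.
rewrite -S'c in small S0 *.
have D0 : (\prod_(b in S') ('X - b%:P)).[0] != 0.
  rewrite horner_prod prodf_seq_neq0; apply/allP=> b _; apply/implyP=> /imsetP[a aS ->].
  by rewrite !hornerE oppr_eq0 subr_eq0; apply: contraNneq tS => <-.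
pose Ns (e : F) := [set y : F | (\prod_(b in S') (y - b)) ^+ p./2 == e].
pose N e := #|Ns e|.
have NE e : N e = #|[set y | (\prod_(b in S') ('X - b%:P)).[y] ^+ p./2 == e]|.
  apply: eq_card => y; rewrite !inE horner_prod; congr (_ ^+ _ == _).
  by apply: eq_bigr => b _; rewrite !hornerE.
have Nbound e : e != 0 -> (2 * N e <= p + 112 * #|S'| * mu)%N.
  by move=> e0; rewrite NE; apply: (stepanov_half pp pc).
have N1 := Nbound 1 (oner_neq0 _).
have N2 : (2 * N (-1)%R <= p + 112 * #|S'| * mu)%N by apply: Nbound; rewrite oppr_eq0 oner_neq0.
have Nsum : (p <= N 1%R + N (-1)%R + #|S'|)%N.
  rewrite -{1}cF -cardsT; apply: leq_trans (_ : #|Ns 1%R :|: Ns (-1)%R :|: S'| <= _)%N.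
    apply/subset_leq_card/subsetP => y _; rewrite !inE.
    case yS': (y \in S'); rewrite ?orbT // orbF; apply: half_power.
    rewrite prodf_seq_neq0; apply/allP=> b _; apply/implyP=> bS.
    by rewrite subr_eq0; apply: contraFneq yS' => ->.
  apply: leq_trans (leq_card_setU _ _) _; rewrite leq_add2r; exact: leq_card_setU.
have -> : \sum_y quadchar (\prod_(b in S') (y - b)) = (N 1)%:Z - (N (-1)%R)%:Z.
  by rewrite /quadchar sumrB !sum_bool_card.
move: (N 1) (N (-1)%R) N1 N2 Nsum => a b N1 N2 Nsum; rewrite ler_norml; apply/andP.
have : (#|S'| <= #|S'| * mu)%N by rewrite leq_pmulr.
rewrite !natz; move: N1 N2; rewrite -!mulnA; move: (#|S'| * mu)%N => z *; split; lia.
Qed.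

End QuadraticCharacter.

(** * Windows of shifts: points with the same pattern of characters *)

Section Windows.
Local Open Scope ring_scope.

Lemma prod_1D_subsets (R : comPzRingType) (T : finType) (W : {set T}) (h : T -> R) :
  \prod_(b in W) (1 + h b) = \sum_(J in powerset W) \prod_(b in J) h b.
Proof.
pose g b := if b \in W then h b else 0.
have -> : \prod_(b in W) (1 + h b) = \prod_b (g b + 1).
  rewrite big_mkcond; apply: eq_bigr => b _; rewrite /g addrC.
  by case: (b \in W); rewrite ?add0r.
rewrite bigA_distr [RHS]big_mkcond; apply: eq_bigr => J _.
rewrite powersetE; case: ifP => [/subsetP JW|/negbT /subsetPn[b bJ bW]].
  rewrite [RHS]big_mkcond; apply: eq_bigr => b _.
  by rewrite /g; case: (boolP (b \in J)) => // /JW ->.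
by rewrite (bigD1 b) //= bJ /g (negPf bW) mul0r.
Qed.

Variable p : nat.
Hypothesis (pp : prime p) (po : odd p).
Notation F := 'F_p.
Variable mu : nat.
Hypothesis (mu0 : (0 < mu)%N) (mu1 : (4 * mu ^ 2 <= p)%N) (mu2 : (p < 4 * mu.+1 ^ 2)%N).
Notation chi := (@quadchar p).

Definition same_window (W : {set F}) (y z : F) :=
  [forall b in W, (chi (y - b) == chi (z - b)) && (chi (y - b) != 0)].

(** Every factor is nonnegative, and it equals 2 when the two characters agree and are not 0. *)
Lemma window_weight (W : {set F}) (y z : F) :
  (2 ^ #|W|)%N%:R * (same_window W y z)%:R <= \prod_(b in W) (1 + chi (y - b) * chi (z - b)).
Proof.
have chi3 x : chi x = -1 \/ chi x = 0 \/ chi x = 1.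
  have := quadchar_norm pp po x; case: (x != 0); move: (chi x) => c; rewrite ?natz; lia.
case: (boolP (same_window W y z)) => [/forallP h|_]; last first.
  rewrite mulr0; apply: prodr_ge0 => b _.
  by case: (chi3 (y - b)) => [->|[->|->]]; case: (chi3 (z - b)) => [->|[->|->]].
rewrite mulr1 (eq_bigr (fun=> 2%:R)) ?prodr_const ?natrX // => b bW.
have := h b; rewrite bW /= => /andP[/eqP <-].
by case: (chi3 (y - b)) => [->|[->|->]].
Qed.

Lemma chi1 : chi 1 = 1.
Proof. by rewrite /quadchar expr1n eqxx (negPf (oner_neqN1 pp po)). Qed.

Lemma char_sum_empty : \sum_(y : F) chi (\prod_(b in (set0 : {set F})) (y - b)) = p%:R.
Proof.
rewrite (eq_bigr (fun=> 1)) ?sumr_const ?card_Fp // => y _.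
by rewrite big_set0 chi1.
Qed.

(** Expanding the weight over the subsets J of W separates y from z, so each J contributes the
    square of a character sum; the empty J gives the main term p^2. *)
Theorem card_same_window (W : {set F}) :
  (2 ^ #|W| * #|[set yz : F * F | same_window W yz.1 yz.2]|
    <= p ^ 2 + 2 ^ #|W| * (113 * #|W| * mu) ^ 2)%N.
Proof.
suff : (2 ^ #|W| * #|[set yz : F * F | same_window W yz.1 yz.2]|)%N%:R
    <= (p ^ 2 + 2 ^ #|W| * (113 * #|W| * mu) ^ 2)%N%:R :> int by rewrite ler_nat.
rewrite natrM [X in _ * X <= _]natz -sum_bool_card mulr_sumr.
apply: le_trans (_ : \sum_(yz : F * F) \prod_(b in W) (1 + chi (yz.1 - b) * chi (yz.2 - b)) <= _).
  by apply: ler_sum => yz _; apply: window_weight.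
rewrite (eq_bigr (fun yz : F * F => \sum_(J in powerset W) chi (\prod_(b in J) (yz.1 - b)) * chi (\prod_(b in J) (yz.2 - b)))); last first.
  move=> yz _; rewrite prod_1D_subsets; apply: eq_bigr => J _.
  by rewrite big_split !quadchar_prod.
rewrite exchange_big /=.
rewrite (eq_bigr (fun J : {set F} => (\sum_y chi (\prod_(b in J) (y - b))) ^+ 2)); last first.
  move=> J _; by rewrite expr2 big_distrlr /= pair_bigA.
rewrite (bigD1 set0) /=; last by rewrite powersetE sub0set.
rewrite char_sum_empty natrD natrX lerD2l.
apply: le_trans (_ : \sum_(J in powerset W) ((113 * #|W| * mu) ^ 2)%N%:R <= _); last first.
  by rewrite sumr_const card_powerset natrM mulr_natl.
rewrite [X in _ <= X](bigD1 set0) ?powersetE ?sub0set //=.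
rewrite ler_wpDl ?ler0n //; apply: ler_sum => J /andP[].
rewrite powersetE => JW J0.
rewrite -real_normK ?num_real // natrX lerXn2r ?nnegrE ?normr_ge0 ?ler0n //.
apply: le_trans (char_sum_bound pp po mu0 mu1 mu2 _) _; first by rewrite card_gt0.
by rewrite ler_nat leq_mul2r leq_mul2l subset_leq_card ?orbT.
Qed.

(** Here z = y + t, and J contributes the character sum of the union of J and J - t. The hypothesis
    makes this union disjoint, so that no factor becomes a square; it has at most 2 #|J| elements,
    and 226 = 2 * 113. *)
Theorem card_same_window_diff (W : {set F}) (t : F) :
  (forall b, b \in W -> b - t \notin W) ->
  (2 ^ #|W| * #|[set y : F | same_window W y (y + t)%R]|
    <= p + 2 ^ #|W| * (226 * #|W| * mu))%N.
Proof.
move=> tW.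
suff : (2 ^ #|W| * #|[set y : F | same_window W y (y + t)%R]|)%N%:R
    <= (p + 2 ^ #|W| * (226 * #|W| * mu))%N%:R :> int by rewrite ler_nat.
rewrite natrM [X in _ * X <= _]natz -sum_bool_card mulr_sumr.
apply: le_trans (_ : \sum_(y : F) \prod_(b in W) (1 + chi (y - b) * chi (y + t - b)) <= _).
  by apply: ler_sum => y _; apply: window_weight.
pose tr (J : {set F}) := J :|: [set b - t | b in J].
have disj (J : {set F}) : J \subset W -> [disjoint J & [set b - t | b in J]].
  move=> /subsetP JW; rewrite disjoint_subset; apply/subsetP => b bJ; rewrite inE.
  apply/imsetP => -[c cJ bc]; have := tW c (JW _ cJ).
  by rewrite -bc JW.
rewrite (eq_bigr (fun y : F => \sum_(J in powerset W) chi (\prod_(b in tr J) (y - b)))); last first.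
  move=> y _; rewrite prod_1D_subsets; apply: eq_bigr => J; rewrite powersetE => JW.
  rewrite big_split /= /tr [in RHS](eq_bigl [predU J & [set b - t | b in J]]); last by move=> b; rewrite !inE.
  rewrite [in RHS]bigU ?disj // quadcharM // !quadchar_prod //.
  congr (_ * _); rewrite big_imset /=; last by move=> ? ? _ _; exact: addIr.
  by apply: eq_bigr => b _; rewrite opprB addrCA addrC addrAC.
rewrite exchange_big /= (bigD1 set0) /=; last by rewrite powersetE sub0set.
rewrite {1}/tr imset0 setU0 char_sum_empty natrD lerD2l.
apply: le_trans (_ : \sum_(J in powerset W) (226 * #|W| * mu)%N%:R <= _); last first.
  by rewrite sumr_const card_powerset -mulrnA mulnC.
rewrite [X in _ <= X](bigD1 set0) ?powersetE ?sub0set //=.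
rewrite ler_wpDl ?ler0n //; apply: ler_sum => J /andP[].
rewrite powersetE => JW J0.
apply: le_trans (ler_norm _) _.
apply: le_trans (char_sum_bound pp po mu0 mu1 mu2 _) _.
  by rewrite card_gt0 /tr setU_eq0 negb_and J0.
rewrite ler_nat leq_mul2r; apply/orP; right.
have : (#|tr J| <= #|J| + #|J|)%N.
  apply: leq_trans (leq_card_setU _ _) _; rewrite leq_add2l; exact: leq_imset_card.
move=> h; apply: leq_trans (leq_mul (leqnn 113%N) h) _.
by rewrite addnn -mul2n mulnA; exact: leq_mul (leqnn 226%N) (subset_leq_card JW).
Qed.

End Windows.

(** * Chebyshev's lower bound for the number of primes *)

Section PrimesInWindow.

Lemma sum_divn_double p m k : prime p ->
  \sum_(1 <= i < k.+1) m.*2 %/ p ^ i <= (\sum_(1 <= i < k.+1) m %/ p ^ i).*2 + k.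
Proof.
move=> pp; rewrite -addnn.
apply: (@leq_trans (\sum_(1 <= i < k.+1) (m %/ p ^ i + m %/ p ^ i + 1))).
  apply: leq_sum => i _.
  have q0 : 0 < p ^ i by rewrite expn_gt0 prime_gt0.
  rewrite -ltnS ltn_divLR //; have := ltn_ceil m q0; rewrite !(mulSn, addn1, mulnDl); lia.
by rewrite !big_split /= sum_nat_const_nat subSS subn0 muln1 addnn.
Qed.

Lemma logn_fact_trunc p n k : prime p -> n < p ^ k.+1 ->
  logn p n`! = \sum_(1 <= i < k.+1) n %/ p ^ i.
Proof.
move=> pp nk; rewrite logn_fact //.
have big_tail a b : k.+1 <= a -> \sum_(a <= i < b) n %/ p ^ i = 0.
  move=> ka; rewrite big_nat big1 // => i /andP[ai _].
  by rewrite divn_small // (leq_trans nk) // leq_exp2l ?prime_gt1 // (leq_trans ka).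
have n_tail a b : n.+1 <= a -> \sum_(a <= i < b) n %/ p ^ i = 0.
  move=> ka; rewrite big_nat big1 // => i /andP[ai _].
  by rewrite divn_small // (leq_trans (leq_trans ka ai)) // ltnW // ltn_expl ?prime_gt1.
case: (leqP n.+1 k.+1) => nk1.
  by rewrite [RHS](big_cat_nat (n := n.+1)) //= [X in _ + X]n_tail // addn0.
rewrite [LHS](big_cat_nat (n := k.+1)) //=; last exact: ltnW.
by rewrite [X in _ + X]big_tail // addn0.
Qed.

(** Legendre's formula: each power p^i <= 2m contributes floor(2m / p^i) - 2 floor(m / p^i) <= 1 to
    the exponent. *)
Lemma logn_central_bin p m : prime p -> 0 < m -> p ^ logn p 'C(m.*2, m) <= m.*2.
Proof.
move=> pp m0; set T := trunc_log p m.*2.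
have m20 : 0 < m.*2 by rewrite double_gt0.
have /andP[T1 T2] := trunc_log_bounds (prime_gt1 pp) m20.
apply: leq_trans T1; rewrite leq_exp2l ?prime_gt1 // -/T.
have mm : m <= m.*2 by rewrite -addnn leq_addl.
have e := congr1 (logn p) (bin_fact mm).
rewrite (_ : m.*2 - m = m) in e; last by lia.
rewrite !lognM ?muln_gt0 ?fact_gt0 ?bin_gt0 // in e.
rewrite !(logn_fact_trunc (k := T)) // in e; last exact: leq_ltn_trans T2.
by have := sum_divn_double m T pp; lia.
Qed.

Lemma central_bin_ge m : 2 ^ m <= 'C(m.*2, m).
Proof.
elim: m => [|m IH]; first by rewrite bin0.
rewrite doubleS binS.
have -> : 'C(m.*2.+1, m.+1) = 'C(m.*2.+1, m).
  rewrite -bin_sub; last by rewrite ltnS -addnn leq_addl.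
  by congr ('C(_, _)); lia.
have : 'C(m.*2, m) <= 'C(m.*2.+1, m) by case: m {IH} => [|m] //; rewrite binS leq_addr.
by rewrite expnS; lia.
Qed.

(** The central binomial coefficient is at least 2^m and at most (2m)^k, where k counts its prime
    divisors, none of which exceeds 2m. *)
Lemma prime_count_ge m l : 0 < m -> m.*2 < 2 ^ l ->
  m <= l * #|[set q : 'I_m.*2.+1 | prime q]|.
Proof.
move=> m0 ml; set C := 'C(m.*2, m).
have C0 : 0 < C by rewrite bin_gt0 -addnn leq_addl.
have sz : size (primes C) <= #|[set q : 'I_m.*2.+1 | prime q]|.
  have -> : size (primes C) = #|[set q : 'I_m.*2.+1 | nat_of_ord q \in primes C]|.
    rewrite cardsE cardE -(size_map val).
    have /perm_size -> : perm_eq [seq val i | i <- enum [pred x : 'I_m.*2.+1 | val x \in primes C]] (primes C); last by [].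
    apply: uniq_perm; rewrite ?primes_uniq ?map_inj_uniq ?enum_uniq //; first exact: val_inj.
    move=> q; apply/mapP/idP => [[i]|qC]; first by rewrite mem_enum inE => ? ->.
    have pq : prime q by move: qC; rewrite mem_primes => /andP[].
    have qm : q < m.*2.+1.
      rewrite ltnS; apply: leq_trans (logn_central_bin pq m0).
      rewrite -{1}(expn1 q) leq_exp2l ?prime_gt1 // logn_gt0 //.
    by exists (Ordinal qm); rewrite // mem_enum inE.
  apply/subset_leq_card/subsetP => q; rewrite !inE mem_primes => /andP[] //.
have CC : C <= m.*2 ^ size (primes C).
  rewrite {1}(prod_prime_decomp C0) prime_decompE big_map /=.
  have : forall q, q \in primes C -> q ^ logn q C <= m.*2.
    by move=> q; rewrite mem_primes => /andP[pq _]; apply: logn_central_bin.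
  elim: (primes C) => [|q s IH] h; first by rewrite big_nil.
  rewrite big_cons expnS leq_mul ?h ?mem_head // IH // => r rs.
  by rewrite h // in_cons rs orbT.
have := leq_trans (central_bin_ge m) CC.
have : m.*2 ^ size (primes C) <= (2 ^ l) ^ #|[set q : 'I_m.*2.+1 | prime q]|.
  apply: (@leq_trans ((2 ^ l) ^ size (primes C))); last by rewrite leq_pexp2l ?expn_gt0.
  by case: (size _) => // k; rewrite leq_exp2r // ltnW.
move=> h1 h2; have := leq_trans h2 h1.
by rewrite -expnM leq_exp2l.
Qed.

(** There are about Q / (2 l) primes up to Q or more, and asking for Q < 8 l q loses at most Q / (8
    l) of them. The remaining primes are all comparable to Q. *)
Theorem prime_in_window Q l : 1 < Q -> Q < 2 ^ l ->
  Q <= 8 * l * #|[set q : 'I_Q.+1 | prime q & Q < 8 * l * q]|.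
Proof.
move=> Q1 Ql; have m0 : 0 < Q./2 by rewrite half_gt0.
have mQ : Q./2.*2 <= Q by rewrite -{2}(odd_double_half Q) leq_addl.
have h := prime_count_ge m0 (leq_ltn_trans mQ Ql).
set A := [set q : 'I_Q.+1 | prime q & _].
have l0 : 0 < l by case: l Ql {h A} => //; rewrite expn0; lia.
have h2 : #|[set q : 'I_(Q./2.*2).+1 | prime q]| <= #|[set q : 'I_Q.+1 | prime q]|.
  have mQ1 : (Q./2.*2).+1 <= Q.+1 by [].
  have winj : injective (widen_ord mQ1) by move=> x y /(congr1 val)/= /val_inj.
  rewrite -(card_imset _ winj).
  by apply/subset_leq_card/subsetP => _ /imsetP[q pq ->]; move: pq; rewrite !inE.
have h3 : #|[set q : 'I_Q.+1 | prime q]| <= #|A| + Q %/ (8 * l).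
  have -> : [set q : 'I_Q.+1 | prime q] = A :|: [set q : 'I_Q.+1 | prime q & 8 * l * q <= Q].
    by apply/setP=> q; rewrite !inE -andb_orr ltnNge orNb andbT.
  apply: leq_trans (leq_card_setU _ _) _; rewrite leq_add2l.
  have [w0|w0] := posnP (Q %/ (8 * l)).
    rewrite w0 leqn0 cards_eq0; apply/eqP/setP=> q; rewrite !inE.
    apply/negP=> /andP[/prime_gt0 q0]; rewrite mulnC -leq_divRL ?muln_gt0 ?l0 // w0; lia.
  apply: (@leq_trans #|[set (inord (i : nat).+1 : 'I_Q.+1) | i : 'I_(Q %/ (8 * l))]|).
    apply/subset_leq_card/subsetP=> q; rewrite !inE => /andP[/prime_gt0 q0].
    rewrite mulnC -leq_divRL ?muln_gt0 ?l0 // => qw.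
    have qw1 : q.-1 < Q %/ (8 * l) by rewrite prednK.
    by apply/imsetP; exists (Ordinal qw1); rewrite //= prednK // inord_val.
  by apply: leq_trans (leq_imset_card _ _) _; rewrite card_ord.
have h4 : Q <= Q./2.*2.+1 by rewrite -{1}(odd_double_half Q); case: (odd Q); lia.
have h5 := leq_trunc_div Q (8 * l).
have h6 := leq_trans h (leq_mul (leqnn l) (leq_trans h2 h3)).
move: h6 h5; move: (Q %/ _) #|A| => a b; rewrite mulnDr; lia.
Qed.

End PrimesInWindow.

(** * Sets with few close pairs *)

Section PrimeField.
Local Open Scope ring_scope.
Variable p : nat.
Hypothesis pp : prime p.
Notation F := 'F_p.

Lemma natr_Fp_val (u : F) : (val u)%:R = u.
Proof. exact: natr_Zp. Qed.

Lemma ltn_val_Fp (u : F) : (val u < p)%N.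
Proof. by rewrite -[X in (_ < X)%N](Fp_cast pp) ltn_ord. Qed.

Lemma intr_eq0_Fp (m : int) : (`|m| < p)%N -> m%:~R = 0 :> F -> m = 0.
Proof.
move=> h /eqP; rewrite -(dvdz_pcharf (pchar_Fp pp)) dvdzE /= => d.
case: (posnP `|m|%N) => [/eqP|m0]; first by rewrite absz_eq0 => /eqP.
by rewrite gtnNdvd in d.
Qed.

Lemma natr_neq0_Fp q : (0 < q < p)%N -> (q%:R : F) != 0.
Proof.
move=> /andP[q0 qp]; rewrite -(dvdn_pcharf (pchar_Fp pp)).
by apply/negP=> /(dvdn_leq q0); lia.
Qed.

End PrimeField.

(** * Walks along close pairs *)

Section Walks.
Variable p : nat.
Hypothesis pp : prime p.
Notation F := 'F_p.
(** X is the vertex set of a graph: the prime q joins x and z when q (z - x) is congruent to an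
    integer of absolute value at most H. The hypotheses on [QQ] say that H / q is at most A / 2 and
    at most L / Q for each of its primes, while X is separated up to A. *)
Variables (H Q L A : nat) (QQ : seq nat) (X : {set F}).
Hypothesis (QQp : all prime QQ) (QQu : uniq QQ).
Hypothesis (QQle : all (fun q => q <= Q) QQ) (QQge : all (fun q => 2 * H <= A * q) QQ).
Hypothesis (QQH : all (fun q => H * Q <= L * q) QQ).
Hypothesis (Qp : Q < p).
Hypothesis sep : forall x a, x \in X -> 0 < a <= A -> (x + a%:R)%R \notin X.

Definition small (u : F) := (val u <= H) || (p - val u <= H).

Definition rep (u : F) : int := if val u <= H then (val u)%:Z%R else ((val u)%:Z - p%:Z)%R.

Local Open Scope ring_scope.

Lemma repE u : (rep u)%:~R = u.
Proof.
rewrite /rep; case: ifP => _; first by rewrite -pmulrn natr_Fp_val.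
by rewrite rmorphB /= -!pmulrn natr_Fp_val (pcharf0 (pchar_Fp pp)) subr0.
Qed.

Lemma rep_bound u : small u -> (`|rep u| <= H)%N.
Proof. by have := ltn_val_Fp pp u; rewrite /small /rep; case: ifP => /= [|_] *; lia. Qed.

Lemma sep_int (x z : F) (m : int) : x \in X -> z \in X -> (`|m| <= A)%N ->
  z - x = m%:~R -> z = x.
Proof.
move=> xX zX; case: (intP m) => [|n|n] h e; first by apply/eqP; rewrite -subr_eq0 e.
  have := @sep x n.+1 xX; rewrite /= in h; rewrite h => /(_ isT).
  by rewrite -[_%:R]e addrCA subrr addr0 zX.
have := @sep z n.+1 zX; rewrite abszN /= in h; rewrite h => /(_ isT).
have -> : n.+1%:R = x - z :> F by rewrite -opprB e rmorphN opprK.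
by rewrite addrCA subrr addr0 xX.
Qed.

(** The difference of y and z is the integer (h1 - h2) / q, of absolute value at most 2 H / q <= A,
    and distinct elements of X are not that close. So at most q steps along the prime q leave x. *)
Lemma step_dvd q (x y z : F) (h1 h2 : int) : q \in QQ -> y \in X -> z \in X ->
  (`|h1| <= H)%N -> (`|h2| <= H)%N -> q%:R * (y - x) = h1%:~R -> q%:R * (z - x) = h2%:~R ->
  (q%:Z %| h1 - h2)%Z -> y = z.
Proof.
move=> qQ yX zX b1 b2 e1 e2 /dvdzP[m hm].
have qp := allP QQp q qQ; have q0 := prime_gt0 qp.
have qF : (q%:R : F) != 0 by apply: (natr_neq0_Fp pp); rewrite q0 (leq_ltn_trans (allP QQle q qQ)).
apply: (@sep_int z y m) => //.
  have := allP QQge q qQ; have : (`|h1 - h2| <= 2 * H)%N by clear -b1 b2; lia.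
  by rewrite hm abszM /= => h3 h4; rewrite -(leq_pmul2r q0) (leq_trans h3).
apply: (mulfI qF); have -> : q%:R * m%:~R = (h1 - h2)%:~R :> F by rewrite hm rmorphM /= mulrC.
by rewrite rmorphB /= -e1 -e2; ring.
Qed.

(** [av] collects the primes already used, so that the primes of a walk are distinct. *)
Fixpoint valid (av : seq nat) (x : F) (w : seq (nat * F)) : bool :=
  if w is (q, z) :: w' then
    [&& q \in QQ, q \notin av, z \in X, z != x, small (q%:R * (z - x)) & valid (q :: av) z w']
  else true.

Definition denominator (w : seq (nat * F)) := \prod_(a <- w) a.1.

(** A walk with steps h_i / q_i has the rational sum of these steps attached to it; this is its
    numerator over the product of the primes. *)
Fixpoint numerator (x : F) (w : seq (nat * F)) : int :=
  if w is (q, z) :: w' then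
    rep (q%:R * (z - x)) * (denominator w')%:Z + q%:Z * numerator z w'
  else 0.

Lemma denominator_cons a w : denominator (a :: w) = (a.1 * denominator w)%N.
Proof. by rewrite /denominator big_cons. Qed.

Lemma numeratorE x w :
  (numerator x w)%:~R = (denominator w)%:R * (last x [seq a.2 | a <- w] - x).
Proof.
elim: w x => [|[q z] w IH] x /=; first by rewrite subrr mulr0.
rewrite denominator_cons natrM rmorphD !rmorphM /= IH repE -!pmulrn; ring.
Qed.

Lemma valid_fresh av x w q : valid av x w -> q \in av -> q \notin [seq a.1 | a <- w].
Proof.
elim: w av x => [|[r z] w IH] av x //= /and5P[_ rav _ _ /andP[_ vw]] qav.
rewrite in_cons negb_or (IH _ _ vw) ?in_cons ?qav ?orbT // andbT.
by apply: contraNneq rav => <-.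
Qed.

Lemma valid_uniq av x w : valid av x w -> uniq [seq a.1 | a <- w].
Proof.
elim: w av x => [|[r z] w IH] av x //= /and5P[_ rav _ _ /andP[_ vw]].
by rewrite (valid_fresh vw) ?mem_head ?(IH _ _ vw).
Qed.

Lemma valid_primes av x w q : valid av x w -> q \in [seq a.1 | a <- w] -> q \in QQ.
Proof.
elim: w av x => [|[r z] w IH] av x //= /and5P[rQ _ _ _ /andP[_ vw]].
by rewrite in_cons => /orP[/eqP->|/(IH _ _ vw)].
Qed.

Lemma dvd_denominator av x w q : valid av x w -> q \in QQ ->
  (q %| denominator w)%N = (q \in [seq a.1 | a <- w]).
Proof.
move=> vw qQ; have qp := allP QQp q qQ.
elim: w av x vw => [|[r z] w IH] av x /=.
  by rewrite /denominator big_nil dvdn1 gtn_eqF ?prime_gt1.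
move=> /and5P[rQ _ _ _ /andP[_ vw]]; rewrite denominator_cons Euclid_dvdM // (IH _ _ vw).
by rewrite in_cons dvdn_prime2 // (allP QQp).
Qed.

(** A representative divisible by q would be congruent to the representative 0 of staying at x. *)
Lemma dvdz_rep q x z : q \in QQ -> x \in X -> z \in X -> z != x -> small (q%:R * (z - x)) ->
  ~~ (q %| rep (q%:R * (z - x)))%Z.
Proof.
move=> qQ xX zX zx sm; apply: contra zx => d; apply/eqP.
apply: (@step_dvd q x z x _ 0 qQ zX xX (rep_bound sm)) => //; rewrite ?repE ?subr0 //.
by rewrite subrr mulr0.
Qed.

(** Modulo q only the term of the step along q survives, and in it neither the representative nor
    the product of the other primes is divisible by q. So the fraction is in lowest terms. *)
Lemma dvdz_numerator av x w q : x \in X -> valid av x w -> q \in [seq a.1 | a <- w] ->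
  ~~ (q %| numerator x w)%Z.
Proof.
elim: w av x => [|[r z] w IH] av x //= xX /and5P[rQ rav zX zx /andP[sm vw]].
have fr := valid_fresh vw (mem_head _ _).
rewrite in_cons; case: eqVneq => [-> _|qr /= qw].
  rewrite rpredDr; last by rewrite dvdz_mulr.
  rewrite dvdzE abszM Euclid_dvdM ?(allP QQp) // negb_or.
  rewrite (dvd_denominator vw rQ) fr andbT; exact: dvdz_rep.
have qQ := valid_primes vw qw.
rewrite rpredDl; last by rewrite dvdz_mull // dvdzE /= (dvd_denominator vw qQ).
rewrite dvdzE abszM Euclid_dvdM ?(allP QQp) // negb_or.
by rewrite [(q %| _)%N]dvdn_prime2 ?(allP QQp) // qr /=; exact: IH vw qw.
Qed.

(** Modulo the first prime the numerator is the first representative times a unit, which determines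
    the first vertex by [step_dvd]; the rest follows by induction. *)
Lemma numerator_inj av x w1 w2 : x \in X -> valid av x w1 -> valid av x w2 ->
  [seq a.1 | a <- w1] = [seq a.1 | a <- w2] -> numerator x w1 = numerator x w2 -> w1 = w2.
Proof.
elim: w1 av x w2 => [|[q z1] w1 IH] av x [|[q2 z2] w2] //= xX.
move=> /and5P[qQ qav z1X z1x /andP[sm1 v1]] /and5P[_ _ z2X z2x /andP[sm2 v2]] [e ew]; subst q2.
have -> : denominator w2 = denominator w1.
  by rewrite /denominator -(big_map fst xpredT id) -ew big_map.
move=> eN; have qp := allP QQp q qQ.
have z12 : z1 = z2.
  apply: (step_dvd qQ z1X z2X (rep_bound sm1) (rep_bound sm2)); rewrite ?repE //.
  have : (q %| (rep (q%:R * (z1 - x))%R - rep (q%:R * (z2 - x))%R) * (denominator w1)%:Z)%Z.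
    apply/dvdzP; exists (numerator z2 w2 - numerator z1 w1); move: eN; clear; lia.
  rewrite dvdzE abszM Euclid_dvdM // (dvd_denominator v1 qQ) orbC.
  by rewrite (negPf (valid_fresh v1 (mem_head _ _))).
subst z2; congr (_ :: _); apply: (IH _ _ _ z1X v1 v2 ew).
have : q%:Z * numerator z1 w1 = q%:Z * numerator z1 w2 by apply: addrI eN.
by apply: mulfI; rewrite -lt0n prime_gt0.
Qed.

(** Equal fractions in lowest terms have the same denominator, hence the same primes. *)
Lemma primes_subset x w1 w2 : x \in X -> valid [::] x w1 -> valid [::] x w2 ->
  numerator x w1 * (denominator w2)%:Z = numerator x w2 * (denominator w1)%:Z ->
  {subset [seq a.1 | a <- w1] <= [seq a.1 | a <- w2]}.
Proof.
move=> xX v1 v2 e q q1; have qQ := valid_primes v1 q1; have qp := allP QQp q qQ.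
have : (q %| numerator x w1 * (denominator w2)%:Z)%Z.
  by rewrite e dvdz_mull // dvdzE /= (dvd_denominator v1).
rewrite dvdzE abszM Euclid_dvdM // (dvd_denominator v2 qQ) => /orP[|//].
by rewrite -dvdzE => d; have := dvdz_numerator xX v1 q1; rewrite d.
Qed.

(** The fraction is a sum of [size w] terms, each of absolute value at most H / q <= L / Q. *)
Lemma numerator_bound av x w : valid av x w ->
  (`|numerator x w| * Q <= size w * L * denominator w)%N.
Proof.
elim: w av x => [|[q z] w IH] av x //= /and5P[qQ _ zX zx /andP[sm vw]].
have h1 := rep_bound sm; have h2 := IH _ _ vw; have h3 := allP QQH q qQ.
rewrite denominator_cons /=; move: (rep _) h1 => r h1.
move: (numerator z w) (denominator w) (size w) h2 => N V k h2.
have tri (a b : int) : (`|(a + b)%R| <= `|a| + `|b|)%N by clear; lia.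
have := tri (r * V%:Z) (q%:Z * N); rewrite !abszM !absz_nat.
move=> /leq_mul/(_ (leqnn Q)) h4; apply: leq_trans h4 _.
have h5 := leq_mul h1 (leqnn (V * Q)%N); have h6 := leq_mul (leqnn V) h3.
have h7 := leq_mul (leqnn q) h2.
move: h5 h6 h7; rewrite mulnDl mulSn mulnDl; clear; lia.
Qed.

Lemma denominator_gt0 av x w : valid av x w -> (0 < denominator w)%N.
Proof.
elim: w av x => [|[q z] w IH] av x /=; first by rewrite /denominator big_nil.
move=> /and5P[qQ _ _ _ /andP[_ vw]].
by rewrite denominator_cons muln_gt0 (IH _ _ vw) prime_gt0 // (allP QQp).
Qed.

Lemma denominator_le av x w : valid av x w -> (denominator w <= Q ^ size w)%N.
Proof.
elim: w av x => [|[q z] w IH] av x /=; first by rewrite /denominator big_nil.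
move=> /and5P[qQ _ _ _ /andP[_ vw]].
by rewrite denominator_cons expnS leq_mul ?(IH _ _ vw) // (allP QQle).
Qed.

Definition steps (av : seq nat) (x : F) : seq (nat * F) :=
  [seq a <- [seq (q, z) | q <- QQ, z <- enum X] |
    (a.1 \notin av) && ((a.2 != x) && small (a.1%:R * (a.2 - x)))].

Lemma stepsP av x a : a \in steps av x ->
  [&& a.1 \in QQ, a.1 \notin av, a.2 \in X, a.2 != x & small (a.1%:R * (a.2 - x))].
Proof.
rewrite mem_filter => /andP[/and3P[-> -> ->] /allpairsP[[q z] [/= qQ zX ->]]] /=.
by rewrite qQ; move: zX; rewrite mem_enum => ->.
Qed.

Lemma steps_uniq av x : uniq (steps av x).
Proof. by rewrite filter_uniq // allpairs_uniq ?enum_uniq // => -[? ?] [? ?]. Qed.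

(** Avoiding a prime q costs at most q <= Q steps, one for each residue of the representative modulo
    q. *)
Lemma steps_avoid av x : x \in X ->
  (size (steps [::] x) <= size (steps av x) + size av * Q)%N.
Proof.
move=> xX; have per q : (count (fun a => a.1 == q) (steps [::] x) <= Q)%N.
  rewrite -size_filter; set s := [seq a <- _ | _].
  have su : uniq s by rewrite filter_uniq // steps_uniq.
  have sP a : a \in s -> [&& a.1 == q, q \in QQ, a.2 \in X, a.2 != x & small (q%:R * (a.2 - x))].
    rewrite mem_filter => /andP[/eqP aq /stepsP]; rewrite aq eqxx.
    by move=> /and5P[-> _ -> -> ->].
  have [->|qQ] : s = [::] \/ q \in QQ.
    case: s {su} sP => [|a s] sP; first by left.
    by right; have := sP a (mem_head _ _) => /and3P[].
    by [].
  have qp := allP QQp q qQ; have q0 : q%:Z != 0 by rewrite -lt0n prime_gt0.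
  apply: leq_trans (allP QQle q qQ).
  pose f (a : nat * F) : nat := `|(rep (q%:R * (a.2 - x))%R %% q%:Z)%Z|%N.
  rewrite -(size_map f) -[X in (_ <= X)%N](size_iota 0); apply: uniq_leq_size.
    rewrite map_inj_in_uniq // => -[a1 a2] [b1 b2] /sP/= /and5P[/eqP-> _ aX ax asm].
    move=> /sP/= /and5P[/eqP-> _ bX bx bsm] ef; congr (_, _).
    apply: (step_dvd qQ aX bX (rep_bound asm) (rep_bound bsm)); rewrite ?repE //.
    rewrite -eqz_mod_dvd; apply/eqP.
    by rewrite -[LHS]gez0_abs ?modz_ge0 // -[RHS]gez0_abs ?modz_ge0 //; congr Posz.
  move=> _ /mapP[a _ ->]; rewrite mem_iota /= add0n /f.
  by have := ltz_pmod (rep (q%:R * (a.2 - x))) (_ : 0 < q%:Z); rewrite ltz_nat prime_gt0 // => /(_ isT); have := modz_ge0 (rep (q%:R * (a.2 - x))) q0; move: (_ %% _)%Z => r; clear; lia.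
have -> : steps av x = [seq a <- steps [::] x | a.1 \notin av].
  by rewrite /steps -filter_predI; apply: eq_filter => a.
rewrite -(count_predC (fun a => a.1 \notin av)) size_filter leq_add2l.
elim: av => [|q av IH]; first by rewrite (eq_count (a2 := pred0)) ?count_pred0 // => a.
rewrite mulSn; apply: leq_trans (leq_add (per q) IH).
rewrite -count_predUI; apply: leq_trans (leq_addr _ _).
by apply: sub_count => a /=; rewrite in_cons !negbK.
Qed.

Fixpoint walks (k : nat) (av : seq nat) (x : F) : seq (seq (nat * F)) :=
  if k is k'.+1 then [seq a :: w | a <- steps av x, w <- walks k' (a.1 :: av) a.2]
  else [:: [::]].

Lemma walks_valid k av x w : w \in walks k av x -> valid av x w /\ size w = k.
Proof.
elim: k av x w => [|k IH] av x w /=; first by rewrite inE => /eqP ->.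
move=> /allpairsPdep[[q z] [w' [/stepsP/and5P[/= h1 h2 h3 h4 h5] /IH[v' s'] ->]]] /=.
by rewrite h1 h2 h3 h4 h5 v' s'.
Qed.

Lemma walks_uniq k av x : uniq (walks k av x).
Proof.
elim: k av x => [|k IH] av x //=; apply: allpairs_uniq_dep; first exact: steps_uniq.
  by move=> a _; apply: IH.
by move=> [a w] [b w'] _ _ /= [-> ->].
Qed.

Lemma size_walks k av x D K : x \in X -> (size av + k <= K)%N ->
  (forall y, y \in X -> D + K * Q <= size (steps [::] y))%N -> (D ^ k <= size (walks k av x))%N.
Proof.
move=> xX + deg; elim: k av x xX => [|k IH] av x xX avK //=.
rewrite size_allpairs_dep.
have h1 : (D <= size (steps av x))%N.
  have := leq_trans (deg x xX) (steps_avoid av xX).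
  have : (size av * Q <= K * Q)%N by rewrite leq_mul2r; apply/orP; right; move: avK; clear; lia.
  by clear; lia.
apply: leq_trans (_ : size (steps av x) * D ^ k <= _)%N; first by rewrite expnS leq_mul2r h1 orbT.
have : {in steps av x, forall a, D ^ k <= size (walks k (a.1 :: av) a.2)}%N.
  move=> a /stepsP/and5P[_ _ aX _ _]; apply: IH => //=; move: avK; clear; lia.
elim: (steps av x) => [|a s IHs] h //=.
rewrite mulSn leq_add ?h ?mem_head // IHs // => b bs; apply: h.
by rewrite in_cons bs orbT.
Qed.

Variable k : nat.
(** Walks of length k + 1 are sorted by the value of their fraction in units of p / Q^(2 (k+1)), and
    [C] bounds the numbers of these cells. Two such fractions have a common denominator of at most
    Q^(2 (k+1)), which explains the unit. *)
Let C := (k.+1 * L * Q ^ (2 * k).+1 %/ p).+1.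
Let cell x w : int := ((numerator x w * (Q ^ (2 * k.+1))%:Z) %/ (denominator w * p)%:Z)%Z.

Let cell_bound x w : valid [::] x w -> size w = k.+1 -> (`|cell x w| <= C)%N.
Proof.
move=> vw sw; have V0 := denominator_gt0 vw; have p0 := prime_gt0 pp.
have := numerator_bound vw; rewrite sw => nb.
have nb2 : (`|numerator x w| * Q ^ (2 * k.+1) <= k.+1 * L * Q ^ (2 * k).+1 * denominator w)%N.
  rewrite mulnS add2n expnS mulnA; apply: leq_trans (leq_mul nb (leqnn _)) _.
  by rewrite -!mulnA [(denominator w * _)%N]mulnC.
have lt : (`|(numerator x w * (Q ^ (2 * k.+1))%:Z)%R| < C * (denominator w * p))%N.
  rewrite abszM absz_nat; apply: leq_ltn_trans nb2 _.
  by rewrite mulnCA mulnC ltn_pmul2l // ltn_ceil.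
have d0 : 0 < (denominator w * p)%:Z by rewrite ltz_nat muln_gt0 V0.
have h1 : - C%:Z <= cell x w by rewrite lez_divRL // mulNr -PoszM; move: lt; clear; lia.
have h2 : cell x w < C%:Z by rewrite ltz_divLR // -PoszM; move: lt; clear; lia.
by move: h1 h2; clear; lia.
Qed.

(** With a common endpoint the cross difference of the fractions is a multiple of p; in a common
    cell it is smaller than p, hence 0. *)
Let cell_inj x w1 w2 : valid [::] x w1 -> valid [::] x w2 -> size w1 = k.+1 -> size w2 = k.+1 ->
  last x [seq a.2 | a <- w1] = last x [seq a.2 | a <- w2] -> cell x w1 = cell x w2 ->
  numerator x w1 * (denominator w2)%:Z = numerator x w2 * (denominator w1)%:Z.
Proof.
move=> v1 v2 s1 s2 el ec; apply/eqP; rewrite -subr_eq0; apply/eqP.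
apply: (intr_eq0_Fp pp); last by rewrite rmorphB !rmorphM /= !numeratorE el -!pmulrn; ring.
have V1 := denominator_gt0 v1; have V2 := denominator_gt0 v2.
have b1 := denominator_le v1; have b2 := denominator_le v2; rewrite s1 in b1; rewrite s2 in b2.
have bM := leq_mul b1 b2; rewrite -expnD addnn -mul2n in bM.
have p0 := prime_gt0 pp.
have d1 : (denominator w1 * p)%:Z != 0 by rewrite -lt0n muln_gt0 V1.
have d2 : (denominator w2 * p)%:Z != 0 by rewrite -lt0n muln_gt0 V2.
have e1 := divz_eq (numerator x w1 * (Q ^ (2 * k.+1))%:Z) (denominator w1 * p)%:Z.
have e2 := divz_eq (numerator x w2 * (Q ^ (2 * k.+1))%:Z) (denominator w2 * p)%:Z.
have m1 := modz_ge0 (numerator x w1 * (Q ^ (2 * k.+1))%:Z) d1.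
have m2 := modz_ge0 (numerator x w2 * (Q ^ (2 * k.+1))%:Z) d2.
have l1 := ltz_mod (numerator x w1 * (Q ^ (2 * k.+1))%:Z) d1.
have l2 := ltz_mod (numerator x w2 * (Q ^ (2 * k.+1))%:Z) d2.
rewrite -/(cell x w1) in e1; rewrite -/(cell x w2) -ec in e2.
move: (cell x w1) (_ %% _)%Z (_ %% _)%Z e1 e2 m1 m2 l1 l2 => c r2 r1.
move: (numerator x w1) (numerator x w2) (denominator w1) (denominator w2) (Q ^ _)%N V1 V2 bM => N1 N2 U1 U2 M V1 V2 bM e1 e2 m1 m2 l1 l2.
have M0 : (0 < M)%N by apply: leq_trans bM; rewrite muln_gt0 V1.
have e3 : (N1 * U2%:Z - N2 * U1%:Z) * M%:Z = r1 * U2%:Z - r2 * U1%:Z.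
  have -> : (N1 * U2%:Z - N2 * U1%:Z) * M%:Z = (N1 * M%:Z) * U2%:Z - (N2 * M%:Z) * U1%:Z by ring.
  rewrite e1 e2 !PoszM; ring.
have up (a : int) (u v : nat) : 0 <= a -> a < (u * p)%:Z -> (0 < v)%N -> 0 <= a * v%:Z < (u * v * p)%:Z.
  move=> a0 al v0; rewrite mulr_ge0 // mulnAC PoszM ltr_pM2r //.
have /andP[g1 g2] := up r1 U1 U2 m1 l1 V2; have /andP[g3 g4] := up r2 U2 U1 m2 l2 V1.
have g5 : (`|(N1 * U2%:Z - N2 * U1%:Z)%R| * M < U1 * U2 * p)%N.
  rewrite -{1}[M]absz_nat -abszM e3; move: g4; rewrite (mulnC U2); move: g1 g2 g3; clear; lia.
rewrite -(ltn_pmul2r M0); apply: leq_trans g5 _.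
by rewrite mulnC leq_mul2l bM orbT.
Qed.

(** A walk from x is determined by its endpoint, its cell and the order in which its primes
    occur. *)
Lemma walks_le x : x \in X ->
  (size (walks k.+1 [::] x) <= #|X| * (C.*2.+1 * k.+1 ^ k.+1))%N.
Proof.
move=> xX; set W := walks k.+1 [::] x.
pose pr (w : seq (nat * F)) := [seq a.1 | a <- w].
(* The first two components fix the fraction, hence the set of primes; the third gives for each step
   the rank of its prime in the sorted list. *)
pose code w : F * ('I_C.*2.+1 * {ffun 'I_k.+1 -> 'I_k.+1}) :=
  (last x [seq a.2 | a <- w], (inord `|(cell x w + C%:Z)%R|%N,
    [ffun i : 'I_k.+1 => inord (index (nth 0%N (pr w) i) (sort leq (pr w)))])).
have cu : uniq (map code W).
  rewrite map_inj_in_uniq ?walks_uniq // => w1 w2 /walks_valid[v1 s1] /walks_valid[v2 s2] [el ec eo].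
  have {}ec : cell x w1 = cell x w2.
    have c1 := cell_bound v1 s1; have c2 := cell_bound v2 s2.
    move/(congr1 val): ec; move: c1 c2; move: (cell x w1) (cell x w2) => a b c1 c2.
    by rewrite /= !inordK; move: c1 c2; clear; lia.
  have e := cell_inj v1 v2 s1 s2 el ec.
  have epr : pr w1 = pr w2.
    have es : sort leq (pr w1) = sort leq (pr w2).
      apply/perm_sortP; [exact: leq_total|exact: leq_trans|exact: anti_leq|].
      apply: uniq_perm; rewrite ?(valid_uniq v1) ?(valid_uniq v2) // => q.
      apply/idP/idP; first exact: primes_subset xX v1 v2 e q.
      exact: primes_subset xX v2 v1 (esym e) q.
    apply: (@eq_from_nth _ 0%N); first by rewrite !size_map s1.
    rewrite size_map s1 => i ik; have := congr1 (fun f : {ffun 'I_k.+1 -> 'I_k.+1} => val (f (Ordinal ik))) eo.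
    have mem1 w : size w = k.+1 -> nth 0%N (pr w) i \in sort leq (pr w).
      by move=> sw; rewrite mem_sort mem_nth // size_map sw.
    have ilt w : size w = k.+1 -> (index (nth 0%N (pr w) i) (sort leq (pr w)) < k.+1)%N.
      by move=> sw; rewrite -sw -(size_map fst w) -(size_sort leq) index_mem mem1.
    rewrite !ffunE /= !inordK ?ilt // es => /(congr1 (nth 0%N (sort leq (pr w2)))).
    by rewrite !nth_index ?mem1 // -es mem1.
  apply: (numerator_inj xX v1 v2 epr).
  have ed : denominator w1 = denominator w2.
    by rewrite /denominator -!(big_map fst xpredT id) -/(pr w1) epr.
  have D0 : (denominator w2)%:Z != 0 by rewrite -lt0n (denominator_gt0 v2).
  by apply: (mulIf D0); rewrite e ed.
rewrite -(size_map code) -(card_uniqP cu).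
apply: leq_trans (subset_leq_card (B := setX X setT) _) _.
  apply/subsetP=> _ /mapP[w /walks_valid[vw sw] ->]; rewrite inE in_setT andbT /=.
  elim: w [::] (x) xX vw {sw} => [|[q z] w IH] av y yX //= /and5P[_ _ zX _ /andP[_ vw]].
  exact: IH vw.
by rewrite cardsX cardsT card_prod card_ffun !card_ord.
Qed.

Definition close (x z : F) : nat :=
  (\sum_(q <- QQ) ((z != x) && small (q%:R * (z - x))%R))%N.

Lemma size_steps x : size (steps [::] x) = (\sum_(z in X) close x z)%N.
Proof.
rewrite /steps size_filter -sum1_count big_mkcond big_allpairs /= exchange_big /=.
rewrite big_enum /=; apply: eq_bigr => z _; apply: eq_bigr => q _ /=.
by case: (_ && _).
Qed.

End Walks.

Section ClosePairs.
Local Open Scope ring_scope.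
Variable p : nat.
Hypothesis pp : prime p.
Notation F := 'F_p.
Variables (H Q L A : nat) (QQ : seq nat).
Hypothesis (QQp : all prime QQ) (QQu : uniq QQ).
Hypothesis (QQle : all (fun q => q <= Q)%N QQ) (QQge : all (fun q => 2 * H <= A * q)%N QQ).
Hypothesis (QQH : all (fun q => H * Q <= L * q)%N QQ).
Hypothesis (Qp : (Q < p)%N).

Lemma small_opp (u : F) : small H (- u) = small H u.
Proof.
have [->|u0] := eqVneq u 0; first by rewrite oppr0.
have pz : (val u != 0)%N by apply: contraNneq u0 => e; apply/eqP/val_inj.
have e : val (- u) = (p - val u)%N.
  have -> : - u = (p - val u)%:R.
    by rewrite natrB ?(ltnW (ltn_val_Fp pp u)) // pcharf0 ?pchar_Fp // sub0r natr_Fp_val.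
  have uz := ltn_val_Fp pp u; rewrite /= val_Fp_nat // modn_small //.
  by move: pz uz; rewrite /=; clear; lia.
by rewrite /small e subKn 1?orbC // ltnW // ltn_val_Fp.
Qed.

Lemma closeC (x z : F) : close H QQ x z = close H QQ z x.
Proof.
apply: eq_bigr => q _; rewrite eq_sym; congr (nat_of_bool (_ && _)).
by rewrite -small_opp -mulrN opprB.
Qed.

(** If all degrees were at least D + (k+1) Q, there would be D^(k+1) walks from any vertex, against
    [walks_le]. So some vertex has a smaller degree; it is deleted and the argument repeated. The
    factor 2 accounts for ordered pairs. *)
Theorem close_pairs_bound (k D : nat) (X : {set F}) :
  (forall x a, x \in X -> (0 < a <= A)%N -> x + a%:R \notin X) ->
  (#|X| * ((k.+1 * L * Q ^ (2 * k).+1 %/ p).+1.*2.+1 * k.+1 ^ k.+1) < D ^ k.+1)%N ->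
  (\sum_(x in X) \sum_(z in X) close H QQ x z <= #|X| * (2 * (D + k.+1 * Q)))%N.
Proof.
have [n] := ubnP #|X|; elim: n X => // n IH X Xn sep hD.
have [->|[x0 x0X]] := set_0Vmem X; first by rewrite big_set0.
case: (boolP [forall x in X, (D + k.+1 * Q <= size (steps H QQ X [::] x))%N]) => [/forallP deg|].
  have h1 : (D ^ k.+1 <= size (walks H QQ X k.+1 [::] x0))%N.
    by apply: (size_walks pp QQp QQu QQle QQge QQH Qp sep (K := k.+1)) => // y; apply/implyP.
  have := leq_trans h1 (walks_le pp QQp QQu QQle QQge QQH Qp sep k x0X).
  by move=> h; move: hD; rewrite ltnNge h.
rewrite negb_forall => /existsP[x]; rewrite negb_imply -ltnNge => /andP[xX degx].
rewrite size_steps in degx.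
have Xc : #|X| = #|X :\ x|.+1 by rewrite (cardsD1 x X) xX.
have := IH (X :\ x); rewrite -Xc -ltnS Xn => /(_ isT) IH'.
rewrite (big_setD1 x) //= Xc mulSn.
rewrite [X in (_ + X <= _)%N](eq_bigr (fun y => close H QQ x y + \sum_(z in X :\ x) close H QQ y z)%N); last first.
  by move=> y _; rewrite (big_setD1 x) //= closeC.
rewrite big_split /= addnA leq_add //.
  have : (\sum_(y in X :\ x) close H QQ x y <= \sum_(z in X) close H QQ x z)%N.
    by rewrite [X in (_ <= X)%N](big_setD1 x) //= leq_addl.
  move=> h; have d1 := ltnW degx; have d2 := leq_trans h d1.
  by rewrite mul2n -addnn leq_add.
apply: IH'; first by move=> y a; rewrite !inE => /andP[_ yX] /(sep y a yX); rewrite negb_and orbC => ->.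
by apply: leq_ltn_trans hD; rewrite leq_mul2r Xc leqnSn orbT.
Qed.

End ClosePairs.

(** * Comparison of two dilates by Cauchy's inequality *)

Section CrossPairs.
Variable p : nat.
Hypothesis pp : prime p.
Notation F := 'F_p.

Lemma natr_inj_Fp (i j : nat) : i < p -> j < p -> (i%:R = j%:R :> F)%R -> i = j.
Proof.
move=> ip jp /(congr1 val); rewrite /= !val_Fp_nat // !modn_small //.
Qed.

Variables (h : nat) (X : {set F}).
Hypothesis (h0 : 0 < h) (hp : 2 * h <= p).

(** The overlap of the interval [0, 2h) with its translate by d. It is at least h for |d| <= h, at
    most 2h, and 0 unless |d| <= 2h, so it sandwiches the test [small]. *)
Definition offset_count (d : F) : nat :=
  \sum_(i < 2 * h) \sum_(j < 2 * h) (i%:R == j%:R + d :> F)%R.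

Lemma offset_count_ge d : small h d -> h <= offset_count d.
Proof.
have hh : \sum_(j < 2 * h) (j < h) = h.
  rewrite -(big_mkord xpredT (fun j => nat_of_bool (j < h))) (big_cat_nat (n := h)) //=; last by rewrite mul2n -addnn leq_addl.
  rewrite (eq_big_nat _ _ (F2 := fun=> 1)); last by move=> i /andP[_ ->].
  rewrite sum_nat_const_nat subn0 muln1 big_nat big1 ?addn0 // => i /andP[hi _].
  by rewrite ltnNge hi.
rewrite /small => /orP[dh|dh]; rewrite -{1}hh /offset_count; [rewrite exchange_big /=|];
  apply: leq_sum => -[j jl] _ /=; case: ltnP => // jh.
  have il : j + val d < 2 * h by move: dh jh; lia.
  rewrite (bigD1 (Ordinal il)) //= natrD natr_Fp_val eqxx //.
have il : j + (p - val d) < 2 * h by move: dh jh; lia.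
rewrite (bigD1 (Ordinal il)) //= natrD natrB ?(ltnW (ltn_val_Fp pp d)) // natr_Fp_val.
by rewrite (pcharf0 (pchar_Fp pp)) sub0r addrNK eqxx.
Qed.

Lemma offset_count_le d : offset_count d <= 2 * h * small (2 * h) d.
Proof.
have inj1 (i1 i2 : 'I_(2 * h)) : (i1%:R = i2%:R :> F)%R -> i1 = i2.
  by move=> e; apply: val_inj; apply: natr_inj_Fp e; apply: leq_trans (ltn_ord _) hp.
case: (boolP (small (2 * h) d)) => sd.
  rewrite muln1 /offset_count exchange_big /= -[X in _ <= X]card_ord -sum1_card.
  apply: leq_sum => j _; case: (pickP (fun i : 'I_(2 * h) => (i%:R == j%:R + d :> F)%R)) => [i /eqP ei|none].
    rewrite (bigD1 i) //= big1 => [|i' ii']; first by rewrite addn0 leq_b1.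
    by apply/eqP; rewrite eqb0 -ei; apply: contra ii' => /eqP/inj1->.
  by rewrite big1 // => i _; rewrite none.
rewrite muln0 leqn0 /offset_count big1 // => i _; rewrite big1 // => j _.
apply/eqP; rewrite eqb0; apply: contra sd => /eqP e.
have := leq_trans (ltn_ord i) hp; have := leq_trans (ltn_ord j) hp => jp ip.
have -> : d = (i%:R - j%:R)%R by rewrite e addrAC subrr add0r.
case: (leqP j i) => ij; rewrite /small.
  by rewrite -natrB //= val_Fp_nat // modn_small; [have := ltn_ord i; lia | lia].
have -> : (i%:R - j%:R)%R = ((p - (j - i))%N%:R : F)%R.
  by rewrite !natrB ?(pcharf0 (pchar_Fp pp)) ?sub0r ?opprB //; lia.
by rewrite /= val_Fp_nat // modn_small; have := ltn_ord j; lia.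
Qed.

Definition dilate_count (a u : F) : nat :=
  \sum_(x in X) \sum_(i < 2 * h) (a * x + i%:R == u)%R.

Lemma dilate_countM (a b : F) :
  \sum_u dilate_count a u * dilate_count b u =
  \sum_(x in X) \sum_(z in X) offset_count (b * z - a * x)%R.
Proof.
rewrite (eq_bigr (fun u => \sum_(x in X) \sum_(z in X) \sum_(i < 2 * h) \sum_(j < 2 * h)
   (a * x + i%:R == u)%R * (b * z + j%:R == u)%R)); last first.
  move=> u _; rewrite /dilate_count big_distrlr /=; apply: eq_bigr => x _.
  by apply: eq_bigr => z _; rewrite big_distrlr.
rewrite exchange_big /=; apply: eq_bigr => x _.
rewrite exchange_big /=; apply: eq_bigr => z _.
rewrite exchange_big /=; apply: eq_bigr => i _.
rewrite exchange_big /=; apply: eq_bigr => j _.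
rewrite (bigD1 (a * x + i%:R)%R) //= eqxx mul1n big1 ?addn0; last first.
  by move=> u; rewrite eq_sym => /negPf ->.
congr nat_of_bool; rewrite -(inj_eq (addrI (- (a * x))%R)) eq_sym.
by rewrite addrA addNr add0r; congr (_ == _)%R; rewrite addrC addrAC addrC.
Qed.

Definition near_pairs H (a b : F) : nat :=
  \sum_(x in X) \sum_(z in X) small H (b * z - a * x)%R.

(** Let f_a(u) count the intervals [a x, a x + 2h) that contain u. The near pairs for (a, b) are
    controlled by the scalar product of f_a and f_b, which is at most half the sum of the two
    squared norms, and these only involve pairs within one dilate. *)
Lemma near_pairs_cross a b :
  near_pairs h a b <= near_pairs (2 * h) a a + near_pairs (2 * h) b b.
Proof.
have up c : \sum_u dilate_count c u * dilate_count c u <= 2 * h * near_pairs (2 * h) c c.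
  rewrite dilate_countM /near_pairs big_distrr /=; apply: leq_sum => x _.
  by rewrite big_distrr /=; apply: leq_sum => z _; apply: offset_count_le.
have lo : h * near_pairs h a b <= \sum_u dilate_count a u * dilate_count b u.
  rewrite dilate_countM /near_pairs big_distrr /=; apply: leq_sum => x _.
  rewrite big_distrr /=; apply: leq_sum => z _.
  by case: (boolP (small _ _)) => [/offset_count_ge|_]; rewrite ?muln1 ?muln0.
have mid : 2 * \sum_u dilate_count a u * dilate_count b u <=
    \sum_u dilate_count a u * dilate_count a u + \sum_u dilate_count b u * dilate_count b u.
  rewrite -big_split big_distrr /=; apply: leq_sum => u _.
  by rewrite !mulnn nat_Cauchy.
rewrite -(leq_pmul2l (_ : 0 < 2 * h)) ?muln_gt0 // mulnDr.
apply: leq_trans (leq_add (up a) (up b)); apply: leq_trans mid.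
by rewrite -mulnA leq_mul2l lo orbT.
Qed.

End CrossPairs.

(** Cauchy's inequality for the sizes of the fibres of f. *)
Lemma card_collisions (T U : finType) (S : {set T}) (f : T -> U) (P : {set U}) :
  {in S, forall t, f t \in P} ->
  #|S| ^ 2 <= #|P| * #|[set tt : T * T | [&& tt.1 \in S, tt.2 \in S & f tt.1 == f tt.2]]|.
Proof.
move=> fP; pose n u := #|[set t in S | f t == u]|.
have nE u : n u = \sum_(t in S) (f t == u).
  by rewrite /n -sum1dep_card big_mkcondr; apply: eq_bigr => t _; case: (_ == _).
have e1 : #|S| = \sum_(u in P) n u.
  rewrite (eq_bigr _ (fun u _ => nE u)) exchange_big /= -sum1_card.
  apply: eq_bigr => t tS; rewrite (bigD1 (f t)) ?fP //= eqxx big1 // => u /andP[_].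
  by rewrite eq_sym => /negPf ->.
have e2 : \sum_(u in P) n u * n u <= #|[set tt : T * T | [&& tt.1 \in S, tt.2 \in S & f tt.1 == f tt.2]]|.
  have -> : #|[set tt : T * T | [&& tt.1 \in S, tt.2 \in S & f tt.1 == f tt.2]]| = \sum_(u in P) n u * n u; last by [].
  rewrite -sum1dep_card -(pair_big_dep (mem S) (fun t t' => (t' \in S) && (f t == f t')) (fun _ _ => 1)) /=.
  rewrite (eq_bigr (fun u => \sum_(t in S) \sum_(t' in S) ((f t == u) * (f t' == u)))); last first.
    by move=> u _; rewrite nE big_distrlr.
  rewrite [RHS]exchange_big /=; apply: eq_bigr => t tS.
  rewrite exchange_big /= [LHS]big_mkcondr /=; apply: eq_bigr => t' t'S.
  rewrite (bigD1 (f t)) ?fP //= eqxx mul1n big1 => [|u /andP[_]]; last by rewrite eq_sym => /negPf ->.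
  by rewrite addn0 eq_sym; case: (_ == _).
rewrite e1; apply: leq_trans (leq_mul (leqnn #|P|) e2).
rewrite expnS expn1 big_distrlr /=.
rewrite -(leq_pmul2l (isT : 0 < 2)) big_distrr /=.
apply: (@leq_trans (\sum_(u in P) \sum_(v in P) (n u * n u + n v * n v))).
  apply: leq_sum => u _; rewrite big_distrr /=; apply: leq_sum => v _.
  by rewrite !mulnn nat_Cauchy.
rewrite (eq_bigr (fun u => #|P| * (n u * n u) + \sum_(v in P) n v * n v)); last first.
  by move=> u _; rewrite big_split /= sum_nat_const.
by rewrite big_split /= -big_distrr /= sum_nat_const -mulnDr addnn -mul2n mulnCA.
Qed.

(** Here k is such that Q^(k+1) lies between sqrt p / Q and sqrt p. The number of walks that
    [walks_le] allows on N <= 2 M mu / Q vertices is then below D^(k+1) for D = Q (24 M (k+1)^2 +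
    1). *)
Lemma walk_arith (N M mu Q p k : nat) :
  0 < Q -> 0 < mu -> 0 < p -> N * Q <= 2 * M * mu ->
  Q ^ (2 * k.+1) <= p -> p < Q ^ (2 * k.+2) -> 4 * mu ^ 2 <= p -> p < 4 * mu.+1 ^ 2 ->
  0 < M ->
  N * (((k.+1 * (2 * Q ^ 2) * Q ^ (2 * k).+1) %/ p).+1.*2.+1 * k.+1 ^ k.+1)
    < (Q * (24 * M * k.+1 ^ 2 + 1)) ^ k.+1.
Proof.
move=> Q0 mu0 p0 NQ Qp pQ mu1 mu2 M0; set K := k.+1.
set C := ((_ * _) %/ p).+1; set W := (24 * M * K ^ 2 + 1).
suff key : N * C.*2.+1 <= 24 * M * K * Q ^ K.
  rewrite mulnA; apply: (@leq_ltn_trans (24 * M * K * Q ^ K * K ^ K)).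
    by rewrite leq_mul2r key orbT.
  rewrite expnMn [X in X * K ^ K]mulnC -mulnA ltn_pmul2l ?expn_gt0 ?Q0 //.
  apply: (@leq_trans (W * K ^ k)).
    rewrite {1}/K expnS -/K mulnA ltn_pmul2r ?expn_gt0 // /W addn1 ltnS.
    by rewrite !expnS expn0 muln1 !mulnA.
  have KW : K <= W.
    have := leq_pmull (K ^ 2) (_ : 0 < 24 * M); rewrite muln_gt0 M0 => /(_ isT) h.
    apply: leq_trans (leq_trans h (leq_addr _ _)).
    by rewrite expnS expn1 leq_pmull.
  have KWj j : K ^ j <= W ^ j by case: j => // j; rewrite leq_exp2r.
  by rewrite [X in _ <= X]expnS leq_mul2l KWj orbT.
have sq a b : a ^ 2 < b ^ 2 -> a < b by rewrite ltn_exp2r.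
set V := K * (2 * Q ^ 2) * Q ^ (2 * k).+1.
have VE : V = 2 * K * (Q * (Q ^ K * Q ^ K)).
  have <- : Q ^ (2 * k).+1 * Q = Q ^ K * Q ^ K by rewrite -expnSr -expnD; congr (_ ^ _); rewrite /K; lia.
  by rewrite /V expnS expn1; ring.
(* V / p measures the range of the cells. Below 1 only N counts, and Q^(k+2) > 2 mu suffices;
   otherwise N V / p counts, and Q^(k+1) mu <= p is used. *)
case: (ltnP V p) => Vp.
  rewrite /C -/V divn_small //; have h : 2 * mu < Q ^ K.+1.
    apply: sq; rewrite -expnM (mulnC K.+1); apply: leq_ltn_trans pQ.
    by apply: leq_trans mu1; rewrite expnMn.
  have h2 : N <= M * Q ^ K.
    rewrite -(leq_pmul2r Q0); apply: leq_trans NQ _.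
    by rewrite (mulnC 2 M) -!mulnA leq_mul2l -expnSr ltnW ?orbT.
  apply: (@leq_trans (M * Q ^ K * 3)); first by rewrite leq_mul2r h2 orbT.
  rewrite -!mulnA [24 * _]mulnCA leq_mul2l; apply/orP; right.
  rewrite [Q ^ K * 3]mulnC mulnA leq_mul2r; apply/orP; right; rewrite /K; lia.
have h : Q ^ K * mu <= p.
  apply: leq_trans mu1; rewrite expnS expn1 mulnA leq_mul2r; apply/orP; right.
  have : Q ^ K < 2 * mu.+1.
    apply: sq; rewrite -expnM (mulnC K) expnMn; exact: leq_ltn_trans mu2.
  by move: mu0; clear; lia.
have Cp : C.*2.+1 * p <= 5 * V.
  by have := leq_trunc_div V p; rewrite /C -/V; move: Vp; move: (V %/ p) => w; nia.
have e1 : (N * Q) * (C.*2.+1 * p) <= (2 * M * mu) * (5 * V) by apply: leq_mul.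
rewrite VE in e1.
have e2 : (2 * M * mu) * (5 * (2 * K * (Q * (Q ^ K * Q ^ K)))) = Q * (20 * M * K * Q ^ K * (Q ^ K * mu)) by ring.
have e3 : (N * Q) * (C.*2.+1 * p) = Q * (N * C.*2.+1 * p) by ring.
rewrite e2 e3 leq_pmul2l // in e1.
have e4 : 20 * M * K * Q ^ K * (Q ^ K * mu) <= 20 * M * K * Q ^ K * p by rewrite leq_mul2l h orbT.
have := leq_trans e1 e4; rewrite leq_pmul2r // => e5; apply: leq_trans e5 _.
by rewrite -!mulnA leq_mul2r; apply/orP; right.
Qed.

(** Up to powers of l both C and R equal Q. The bound on pairs with a common window is then cubic in
    Q on the left and linear in Q and in M on the right; inserting N Q >= M mu leaves a bound for M
    alone. Any exponent below 40 suffices, since M will be l^40. *)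
Lemma cluster_arith (l mu M K N Q C R : nat) :
  1 < l -> 0 < mu -> 0 < M -> 0 < K -> K <= l -> 0 < Q -> 2 * C <= Q -> R <= 2 * Q ->
  Q <= 8 * l * R -> Q <= C * (8 * l) -> M * mu <= N * Q ->
  N ^ 2 * C ^ 2 * R <= l ^ 17 * mu ^ 2 * (C + 2 * R + 4 * (Q * (24 * M * K ^ 2 + 1) + K * Q)) ->
  M <= l ^ 38.
Proof.
move=> l2 mu0 M0 K0 kl Q0 CQ Rle QSc CQ2 big wb2.
have lk j : 2 ^ j <= l ^ j by case: j => // j; rewrite leq_exp2r.
have b1 : 109 * (M * K ^ 2) <= l ^ 9 * M.
  rewrite (mulnC M) mulnA leq_mul2r; apply/orP; right.
  by rewrite (expnD l 7 2) leq_mul // ?leq_exp2r //; apply: leq_trans (lk 7).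
have b2 : K <= M * K ^ 2 by rewrite expnS expn1 mulnA leq_pmull // muln_gt0 M0.
have G1 : C + 2 * R + 4 * (Q * (24 * M * K ^ 2 + 1) + K * Q) <= Q * (l ^ 9 * M).
  apply: (@leq_trans (Q * (109 * (M * K ^ 2)))); last by rewrite leq_mul2l b1 orbT.
  have -> : Q * (24 * M * K ^ 2 + 1) = 24 * (Q * (M * K ^ 2)) + Q by ring.
  move: b2; move: (M * K ^ 2) => z b2.
  have b4 : K * Q <= Q * z by rewrite mulnC leq_mul2l b2 orbT.
  have b5 : Q <= Q * z by rewrite leq_pmulr //; apply: leq_trans b2.
  by rewrite (mulnCA Q 109); move: b4 b5 Rle CQ; move: (K * Q) (Q * z); clear; lia.
have c1 : 8 * l <= l ^ 4 by rewrite (expnSr l 3) leq_mul // (lk 3).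
have c2 : Q <= l ^ 4 * C by apply: leq_trans CQ2 _; rewrite mulnC leq_mul2r c1 orbT.
have c3 : Q <= l ^ 4 * R by apply: leq_trans QSc _; rewrite leq_mul2r c1 orbT.
have c4 := leq_mul (leq_mul c2 c2) c3.
have c5 : N ^ 2 * (Q * Q * Q) <= (l ^ 4) ^ 3 * (N ^ 2 * C ^ 2 * R).
  apply: (@leq_trans (N ^ 2 * (l ^ 4 * C * (l ^ 4 * C) * (l ^ 4 * R)))); first by rewrite leq_mul2l c4 orbT.
  by rewrite leq_eqVlt; apply/orP; left; apply/eqP; ring.
have c6 := leq_trans wb2 (leq_mul (leqnn _) G1).
have c7 : (M * mu) * (M * mu) * Q <= N * Q * (N * Q) * Q := leq_mul (leq_mul big big) (leqnn Q).
have c8 : N * Q * (N * Q) * Q = N ^ 2 * (Q * Q * Q) by ring.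
rewrite c8 in c7; have c9 := leq_trans c7 (leq_trans c5 (leq_mul (leqnn _) c6)).
rewrite -(leq_pmul2l (_ : 0 < M * mu * mu * Q)); last by rewrite !muln_gt0 M0 mu0 Q0.
rewrite (_ : l ^ 38 = (l ^ 4) ^ 3 * l ^ 17 * l ^ 9); last by rewrite -expnM -!expnD.
apply: leq_trans (leq_trans _ c9) _; rewrite leq_eqVlt; apply/orP; left; apply/eqP; ring.
Qed.

(** * Collisions of the maps (x + c) / q *)

Section Injectivity.
Local Open Scope ring_scope.
Variable p : nat.
Hypothesis (pp : prime p).
Notation F := 'F_p.
Variables (X : {set F}) (A Q C : nat) (QS : {set 'I_Q.+1}) (D K : nat).
Hypothesis sep : forall x a, x \in X -> (0 < a <= A)%N -> x + a%:R \notin X.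
Hypothesis (QSp : forall q : 'I_Q.+1, q \in QS -> prime q /\ (C <= q)%N).
Hypothesis (Qp : (Q < p)%N) (CA : (C <= A)%N) (C0 : (0 < C)%N) (QCp : (2 * (Q * C) <= p)%N) (Q0 : (0 < Q)%N).
Hypothesis Hclose : (\sum_(x in X) \sum_(z in X) close (2 * (Q * C)) [seq val q | q <- enum QS] x z
   <= #|X| * (2 * (D + K * Q)))%N.

Definition mapped (t : F * 'I_C * 'I_Q.+1) : F := (t.1.1 + t.1.2%:R) / t.2%:R.

Let S := [set t : F * 'I_C * 'I_Q.+1 | (t.1.1 \in X) && (t.2 \in QS)].

Let qF (q : 'I_Q.+1) : q \in QS -> (q%:R : F) != 0.
Proof.
move=> /QSp[qp _]; apply: (natr_neq0_Fp pp); rewrite prime_gt0 //=.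
by apply: leq_ltn_trans Qp; rewrite -ltnS.
Qed.

Let mapped_eq t u : t \in S -> u \in S ->
  (mapped t == mapped u) = (u.2%:R * (t.1.1 + t.1.2%:R) == t.2%:R * (u.1.1 + u.1.2%:R)).
Proof.
rewrite !inE => /andP[_ tq] /andP[_ uq]; rewrite /mapped eqr_div ?qF //.
by rewrite [X in X == _]mulrC [X in _ == X]mulrC.
Qed.

Let pair_count (q q' : 'I_Q.+1) (x z : F) : nat :=
  (\sum_(c < C) \sum_(c' < C) (q'%:R * (x + c%:R) == q%:R * (z + c'%:R))%R)%N.

Let natC_inj (c c' : 'I_C) : c%:R = c'%:R :> F -> c = c'.
Proof.
move=> e; apply: val_inj; apply: (natr_inj_Fp pp _ _ e); apply: leq_trans (ltn_ord _) _;
  move: QCp Q0; clear; nia.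
Qed.

(** For equal primes a coincidence says that z - x is the integer c - c', of absolute value below C
    <= A, so separation gives z = x. *)
Let pair_count_diag q x z : q \in QS -> x \in X -> z \in X -> (pair_count q q x z <= C * (z == x))%N.
Proof.
move=> qS xX zX; rewrite /pair_count.
have inj0 : injective ( *%R (q%:R : F)) by apply: mulfI; apply: qF.
case: eqVneq => [->|zx].
  rewrite muln1 -[X in (_ <= X)%N]card_ord -sum1_card; apply: leq_sum => c _.
  rewrite (bigD1 c) //= big1 => [|c' cc']; first by rewrite addn0 leq_b1.
  apply/eqP; rewrite eqb0 (inj_eq inj0) (inj_eq (addrI _)).
  by apply: contra cc' => /eqP/natC_inj->.
rewrite muln0 leqn0 big1 // => c _; rewrite big1 // => c' _; apply/eqP; rewrite eqb0 (inj_eq inj0).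
apply: contra zx => /eqP e; apply/eqP.
apply: (@sep_int p A X sep x z (c%:Z - c'%:Z)) => //.
  by have := ltn_ord c; have := ltn_ord c'; move: CA; clear; lia.
rewrite rmorphB /= -!pmulrn; apply/eqP; rewrite subr_eq addrAC eq_sym subr_eq; apply/eqP.
by rewrite [c%:R + x]addrC e.
Qed.

(** Two solutions satisfy q' (c1 - c2) = q (c1' - c2') as integers, since everything is small
    against p; then q divides c1 - c2, and C <= q forces equality. A solution also gives q z - q' x
    = q' c - q c', which is small. *)
Let pair_count_off (q q' : 'I_Q.+1) x z : q \in QS -> q' \in QS -> q != q' ->
  (pair_count q q' x z <= small (Q * C) (q%:R * z - q'%:R * x)%R)%N.
Proof.
move=> qS q'S qq'; have [qp Cq] := QSp qS; have [q'p Cq'] := QSp q'S.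
have bnd (r : 'I_Q.+1) (c : 'I_C) : (r * c < Q * C)%N.
  have := ltn_ord r; have := ltn_ord c; rewrite ltnS => h1 h2.
  apply: (@leq_ltn_trans (Q * c)%N); first by rewrite leq_mul2r h2 orbT.
  by rewrite ltn_pmul2l.
have uni (c1 c1' c2 c2' : 'I_C) : q'%:R * (x + c1%:R) = q%:R * (z + c1'%:R) ->
    q'%:R * (x + c2%:R) = q%:R * (z + c2'%:R) -> c1 = c2 /\ c1' = c2'.
  move=> e1 e2.
  have e : ((q' * c1 + q * c2')%N%:R : F) = (q' * c2 + q * c1')%N%:R.
    rewrite !natrD !natrM.
    have -> : q'%:R * c1%:R = q%:R * (z + c1'%:R) - q'%:R * x :> F by rewrite -e1 mulrDr addrAC subrr add0r.
    have -> : q'%:R * c2%:R = q%:R * (z + c2'%:R) - q'%:R * x :> F by rewrite -e2 mulrDr addrAC subrr add0r.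
    ring.
  have {}e : (q' * c1 + q * c2' = q' * c2 + q * c1')%N.
    apply: (natr_inj_Fp pp _ _ e); apply: leq_trans QCp;
      have := bnd q' c1; have := bnd q c2'; have := bnd q' c2; have := bnd q c1'; clear; lia.
  have dv (r s : 'I_Q.+1) (a b c d : 'I_C) : prime r -> prime s -> r != s -> (C <= r)%N ->
      (s * a + r * b = s * c + r * d)%N -> a = c.
    move=> rp sp rs Cr h; have : (s * a = s * c %[mod r])%N.
      by rewrite -(modnMDl b) -[RHS](modnMDl d) (mulnC b) (mulnC d) addnC h addnC.
    wlog ac : a b c d h / (c <= a)%N.
      by move=> W; case: (leqP c a) => [|/ltnW] ca ee; [exact: W h ca ee|rewrite (W c d a b (esym h) ca (esym ee))].
    move/eqP; rewrite eqn_mod_dvd; last by rewrite leq_mul2l ac orbT.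
    rewrite -mulnBr Euclid_dvdM // dvdn_prime2 // (inj_eq val_inj) (negPf rs) /= => dr.
    apply: val_inj => /=; apply/eqP; rewrite eqn_leq ac andbT -subn_eq0; apply: contraTT dr.
    rewrite -lt0n => h0; apply/negP=> /(dvdn_leq h0); have := ltn_ord a; move: Cr; clear; lia.
  split; first by apply: (dv q q' _ c2' _ c1') => //; rewrite -(inj_eq val_inj) in qq'.
  by apply/esym; apply: (dv q' q _ c1 _ c2) => //; [rewrite eq_sym|rewrite addnC e addnC].
case: (boolP [exists c : 'I_C, exists c' : 'I_C, q'%:R * (x + c%:R) == q%:R * (z + c'%:R)]).
  move=> /existsP[c /existsP[c' /eqP e]].
  rewrite /pair_count (bigD1 c) //= (bigD1 c') //= e eqxx !big1; first last.
  - move=> c1' n1; apply/eqP; rewrite eqb0; apply: contra n1 => /eqP e'.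
    by have [_ ->] := uni _ _ _ _ e (etrans e e').
  - move=> c1 n1; rewrite big1 // => c1' _; apply/eqP; rewrite eqb0; apply: contra n1 => /eqP e'.
    by have [-> _] := uni _ _ _ _ e e'.
  rewrite addn0 lt0b; have -> : q%:R * z - q'%:R * x = (q' * c)%N%:R - (q * c')%N%:R :> F.
    by rewrite !natrM; move: e; rewrite !mulrDr => e; apply/eqP; rewrite subr_eq addrAC -subr_eq opprK -e addrC.
  have ip r (c1 : 'I_C) : ((r : 'I_Q.+1) * c1 < p)%N.
    by apply: leq_trans (bnd _ _) _; move: QCp; clear; lia.
  case: (leqP (q * c')%N (q' * c)%N) => hle; rewrite /small.
    rewrite -natrB //= val_Fp_nat // modn_small; last exact: leq_ltn_trans (leq_subr _ _) (ip _ _).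
    by rewrite (leq_trans (leq_subr _ _)) // ltnW.
  have -> : (q' * c)%N%:R - (q * c')%N%:R = (p - (q * c' - q' * c))%N%:R :> F.
    rewrite !natrB ?(pcharf0 (pchar_Fp pp)) ?sub0r ?opprB //; first exact: ltnW.
    by apply: leq_trans (leq_subr _ _) (ltnW (ip _ _)).
  rewrite /= val_Fp_nat // modn_small; last by have := ip q c'; move: hle; clear; lia.
  rewrite subKn; last by apply: leq_trans (leq_subr _ _) (ltnW (ip _ _)).
  by rewrite orbC (leq_trans (leq_subr _ _)) // ltnW.
rewrite negb_exists => /forallP none; rewrite /pair_count big1 // => c _.
rewrite big1 // => c' _; apply/eqP; rewrite eqb0.
by have := none c; rewrite negb_exists => /forallP.
Qed.

Let sumS (G : F * 'I_C * 'I_Q.+1 -> nat) :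
  (\sum_(t in S) G t = \sum_(q in QS) \sum_(x in X) \sum_(c < C) G (x, c, q))%N.
Proof.
rewrite (eq_bigl (fun t : F * 'I_C * 'I_Q.+1 => (t.1.1 \in X) && (t.2 \in QS))); last by move=> t; rewrite inE.
rewrite (eq_bigr (fun t => G (t.1, t.2))); last by case.
rewrite -(pair_big (fun xc : F * 'I_C => xc.1 \in X) (mem QS) (fun xc q => G (xc, q))) /= exchange_big /=.
apply: eq_bigr => q _; rewrite (pair_big (mem X) xpredT (fun x c => G (x, c, q))) /=.
by apply: eq_big => [[x c]|[x c] _] //=; rewrite andbT.
Qed.

Let E := #|[set tu : (F * 'I_C * 'I_Q.+1) * (F * 'I_C * 'I_Q.+1) |
   [&& tu.1 \in S, tu.2 \in S & mapped tu.1 == mapped tu.2]]|.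

Let energy_sum : E = (\sum_(q in QS) \sum_(q' in QS) \sum_(x in X) \sum_(z in X) pair_count q q' x z)%N.
Proof.
rewrite /E -sum1dep_card -(pair_big_dep (mem S) (fun t u => (u \in S) && (mapped t == mapped u)) (fun _ _ => 1%N)) /=.
rewrite (eq_bigr (fun t : F * 'I_C * 'I_Q.+1 => \sum_(u in S) ((u.2%:R * (t.1.1 + t.1.2%:R) == t.2%:R * (u.1.1 + u.1.2%:R))%R))%N); last first.
  move=> t tS; rewrite big_mkcondr; apply: eq_bigr => u uS.
  by rewrite mapped_eq //; case: (_ == _).
rewrite sumS; apply: eq_bigr => q _; rewrite exchange_big /=.
transitivity (\sum_(x in X) \sum_(q' in QS) \sum_(z in X) pair_count q q' x z)%N; last by rewrite exchange_big.
rewrite exchange_big /=; apply: eq_bigr => x _.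
rewrite (eq_bigr _ (fun c _ => sumS _)) /= exchange_big /=; apply: eq_bigr => q' _.
by rewrite exchange_big.
Qed.

(** Equal primes contribute #|X| C for each q. For different primes [near_pairs_cross] leads to near
    pairs within one dilate, which are the pairs z = x and the close pairs. *)
Lemma energy_bound : (E <= #|X| * #|QS| * (C + 2 * #|QS| + 4 * (D + K * Q)))%N.
Proof.
pose nn (q : 'I_Q.+1) := near_pairs X (2 * (Q * C)) (q%:R : F) q%:R.
have h1 q : q \in QS -> (\sum_(q' in QS) \sum_(x in X) \sum_(z in X) pair_count q q' x z
    <= #|X| * C + \sum_(q' in QS) (nn q' + nn q))%N.
  move=> qS; rewrite (bigD1 q) //=; apply: leq_add.
    apply: (@leq_trans (\sum_(x in X) C)); last by rewrite sum_nat_const.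
    apply: leq_sum => x xX; apply: (@leq_trans (\sum_(z in X) C * (z == x))%N).
      by apply: leq_sum => z zX; apply: pair_count_diag.
    rewrite (bigD1 x) //= eqxx muln1 big1 ?addn0 // => z /andP[_ /negPf->].
    by rewrite muln0.
  rewrite [X in (_ <= X)%N](bigD1 q) //=; apply: leq_trans (leq_addl _ _).
  apply: leq_sum => q' /andP[q'S q'q].
  apply: leq_trans (near_pairs_cross pp (h := (Q * C)%N) X _ QCp (q'%:R : F) q%:R).
    apply: leq_sum => x _; apply: leq_sum => z _; apply: pair_count_off => //.
    by rewrite eq_sym.
  by rewrite muln_gt0 Q0.
have h2 : (\sum_(q in QS) nn q <= #|X| * #|QS| + #|X| * (2 * (D + K * Q)))%N.
  apply: leq_trans (leq_add (leqnn _) Hclose).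
  rewrite mulnC -sum_nat_const.
  apply: (@leq_trans (\sum_(q in QS) (#|X| + \sum_(x in X) \sum_(z in X) ((z != x) && small (2 * (Q * C)) (q%:R * (z - x))%R)))%N).
    apply: leq_sum => q _; rewrite /nn /near_pairs -sum1_card -big_split /=.
    apply: leq_sum => x xX; rewrite (bigD1 x) //= leq_add ?leq_b1 //.
    rewrite [X in (_ <= X)%N](bigD1 x) //=; apply: leq_trans (leq_addl _ _).
    by apply: leq_sum => z /andP[_ ->]; rewrite mulrBr.
  rewrite big_split leq_add2l /close exchange_big /=.
  apply: leq_sum => x _; rewrite exchange_big /=; apply: leq_sum => z _.
  by rewrite big_map big_enum.
rewrite energy_sum; apply: (@leq_trans (\sum_(q in QS) (#|X| * C + \sum_(q' in QS) (nn q' + nn q)))%N); first exact: leq_sum.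
rewrite big_split /= sum_nat_const.
have -> : (\sum_(q in QS) \sum_(q' in QS) (nn q' + nn q) = 2 * #|QS| * \sum_(q in QS) nn q)%N.
  rewrite (eq_bigr (fun q => \sum_(q' in QS) nn q' + #|QS| * nn q)%N); last first.
    by move=> q _; rewrite big_split /= sum_nat_const.
  by rewrite big_split /= sum_nat_const -big_distrr /= addnn -mul2n mulnA.
apply: leq_trans (leq_add (leqnn _) (leq_mul (leqnn _) h2)) _.
rewrite leq_eqVlt; apply/orP; left; apply/eqP; ring.
Qed.

(** A collision of two image pairs contains a collision of their first components, counted by
    [energy_bound]; one of the two second elements is free and determines the other.
    [card_collisions] then bounds the number of image pairs from below. *)
Lemma window_pairs_bound (P : {set F * F}) :
  (forall x x' c (q : 'I_Q.+1), x \in X -> x' \in X -> (c < C)%N -> q \in QS ->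
     ((x + c%:R) / q%:R, (x' + c%:R) / q%:R) \in P) ->
  (#|X| ^ 2 * C ^ 2 * #|QS| <= #|P| * (C + 2 * #|QS| + 4 * (D + K * Q)))%N.
Proof.
move=> hP; have [X0|X0] := posnP #|X|; first by rewrite X0.
have [q0|q0] := posnP #|QS|; first by rewrite q0 muln0.
have cS : #|S| = (#|X| * C * #|QS|)%N.
  rewrite -sum1_card sumS (eq_bigr (fun=> #|X| * C)%N) ?sum_nat_const 1?mulnC // => q _.
  by rewrite card_ord muln1 mulnC.
pose f (t : F * (F * 'I_C * 'I_Q.+1)) := (mapped t.2, mapped (t.1, t.2.1.2, t.2.2)).
have /card_collisions : {in setX X S, forall t, f t \in P}.
  by move=> -[x' [[x c] q]]; rewrite !inE /= => /and3P[x'X xX qS]; apply: hP.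
set CC := #|[set tt | [&& tt.1 \in _, tt.2 \in _ & f tt.1 == f tt.2]]| => h.
have CCE : (CC <= #|X| * E)%N.
  pose g (tt : (F * (F * 'I_C * 'I_Q.+1)) * (F * (F * 'I_C * 'I_Q.+1))) := (tt.1.1, (tt.1.2, tt.2.2)).
  rewrite /E -cardsX /CC -(@card_in_imset _ _ g); last first.
    move=> [[x1 t1] [z1 u1]] [[x2 t2] [z2 u2]]; rewrite !inE /f !xpair_eqE /=.
    move=> /and3P[_ /and3P[_ _ qS] /andP[_ /eqP e1]] /and3P[_ _ /andP[_ /eqP e2]].
    rewrite /g /= => -[ex et eu]; subst x2 t2 u2; congr (_, _); congr (_, _).
    have e := etrans (esym e1) e2; rewrite /mapped /= in e.
    have q0' : u1.2%:R^-1 != 0 :> F by rewrite invr_eq0 qF.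
    exact: (addIr _ (mulIf q0' e)).
  apply/subset_leq_card/subsetP=> y /imsetP[[[x1 t1] [z1 u1]] hx ->].
  move: hx; rewrite !inE /f xpair_eqE /=.
  by move=> /and3P[/and3P[-> -> ->] /and3P[_ -> ->] /andP[-> _]].
have h2 := leq_trans h (leq_mul (leqnn _) (leq_trans CCE (leq_mul (leqnn _) energy_bound))).
rewrite cardsX cS in h2; rewrite -(leq_pmul2l (_ : 0 < #|X| ^ 2 * #|QS|)%N); last by rewrite muln_gt0 expn_gt0 X0.
apply: leq_trans (leq_trans _ h2) _; rewrite leq_eqVlt; apply/orP; left; apply/eqP; ring.
Qed.

End Injectivity.

(** * The size of a separated and unsplit set *)

Section ClusterBound.
Local Open Scope ring_scope.
Variable p : nat.
Hypothesis (pp : prime p) (po : odd p).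
Notation F := 'F_p.
Notation chi := (@quadchar p).
Variables (l mu : nat).
Hypothesis (pl : (p < 2 ^ l)%N) (lp : (l < p)%N) (l2 : (1 < l)%N).
Hypothesis (mu0 : (0 < mu)%N) (mu1 : (4 * mu ^ 2 <= p)%N) (mu2 : (p < 4 * mu.+1 ^ 2)%N).

(** The points -1, ..., -l, so that y - b runs over y + 1, ..., y + l. Since 2^l > p, the main term
    p^2 / 2^l of [card_same_window] is below p. *)
Definition test_window : {set F} := [set - (i : nat).+1%:R | i : 'I_l].

Lemma card_test_window : #|test_window| = l.
Proof.
rewrite card_imset ?card_ord // => i j /oppr_inj e; apply: val_inj; apply: succn_inj.
by apply: (natr_inj_Fp pp _ _ e); apply: leq_ltn_trans (ltn_ord _) lp.
Qed.

Lemma card_subset_exists (T : finType) (X : {set T}) n : (n <= #|X|)%N ->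
  exists2 Y : {set T}, Y \subset X & #|Y| = n.
Proof.
move=> nX; exists [set x in take n (enum X)].
  by apply/subsetP=> x; rewrite inE => /mem_take; rewrite mem_enum.
by rewrite cardsE (card_uniqP _) ?take_uniq ?enum_uniq // size_takel // -cardE.
Qed.

Lemma exponent_exists (Q : nat) : (1 < Q)%N -> (Q ^ 2 <= p)%N ->
  exists k, [/\ (Q ^ (2 * k.+1) <= p)%N, (p < Q ^ (2 * k.+2))%N & (k.+1 <= l)%N].
Proof.
move=> Q1 Qp; have Q2 : (1 < Q ^ 2)%N by rewrite -{1}(exp1n 2) ltn_exp2r.
have /andP[h1 h2] := trunc_log_bounds Q2 (prime_gt0 pp).
have t0 : (0 < trunc_log (Q ^ 2) p)%N by rewrite trunc_log_gt0 Q2 /=; move: Qp Q2; clear; lia.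
exists (trunc_log (Q ^ 2) p).-1; rewrite !expnM !prednK //; split=> //.
have : (2 ^ trunc_log (Q ^ 2) p < 2 ^ l)%N.
  by apply: leq_ltn_trans pl; apply: leq_trans h1; rewrite leq_exp2r.
by rewrite ltn_exp2l // => /ltnW.
Qed.

Lemma same_window_bound :
  (#|[set yz : F * F | same_window test_window yz.1 yz.2]| <= l ^ 17 * mu ^ 2)%N.
Proof.
have := card_same_window pp po mu0 mu1 mu2 test_window; rewrite card_test_window.
set P := #|_| => h.
have p2 : (p ^ 2 <= 2 ^ l * p)%N by rewrite expnS expn1 leq_mul2r ltnW ?orbT.
have h1 : (P <= p + (113 * l * mu) ^ 2)%N.
  rewrite -(leq_pmul2l (_ : 0 < 2 ^ l)%N) ?expn_gt0 // mulnDr.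
  by apply: leq_trans h _; rewrite leq_add2r.
have lk k : (2 ^ k <= l ^ k)%N by case: k => // k; rewrite leq_exp2r.
have c1 : (p <= l ^ 4 * mu ^ 2)%N.
  apply: leq_trans (ltnW mu2) _; apply: (@leq_trans (2 ^ 4 * mu ^ 2)); last by rewrite leq_mul2r lk orbT.
  rewrite (_ : 2 ^ 4 = 4 * 2 ^ 2)%N // -mulnA leq_mul2l -expnMn leq_exp2r //=; lia.
have c2 : ((113 * l * mu) ^ 2 <= l ^ 16 * mu ^ 2)%N.
  rewrite expnMn leq_mul2r; apply/orP; right.
  rewrite (_ : l ^ 16 = (l ^ 7 * l) ^ 2)%N; last by rewrite -expnSr -expnM.
  rewrite leq_exp2r // leq_mul2r; apply/orP; right; apply: leq_trans (lk 7%N); by [].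
apply: leq_trans h1 _; apply: leq_trans (leq_add c1 c2) _; rewrite -mulnDl leq_mul2r.
apply/orP; right; apply: (@leq_trans (2 * l ^ 16)).
  by rewrite mul2n -addnn leq_add2r leq_exp2l.
by rewrite (expnS l 16) leq_mul2r l2 orbT.
Qed.

(** By contradiction: the pairs of X would produce too many pairs with a common test window. The
    condition Q (l + 4) <= A leaves room for the shifts c + q i with c < C, q <= Q and i <= l, at
    which all characters on X agree. *)
Lemma cluster_main (X : {set F}) (A Q : nat) :
  (forall x a, x \in X -> (0 < a <= A)%N -> x + a%:R \notin X) ->
  (forall x a, x \in X -> (0 < a <= A)%N -> x + a%:R != 0) ->
  (forall x x' a, x \in X -> x' \in X -> (0 < a <= A)%N -> chi (x + a%:R) = chi (x' + a%:R)) ->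
  (1 < Q)%N -> (Q ^ 2 <= p)%N -> (Q * (l + 4) <= A)%N ->
  (#|X| * Q <= l ^ 40 * mu)%N.
Proof.
move=> sepX nzX cstX Q1 Q2 QA; rewrite leqNgt; apply/negP=> big.
set M := (l ^ 40)%N in big; have M0 : (0 < M)%N by rewrite expn_gt0 ltnW.
have Q0 : (0 < Q)%N by apply: ltnW.
have Qmu : (Q < 4 * mu)%N.
  have : (Q < 2 * mu.+1)%N by rewrite -(ltn_exp2r _ _ (isT : 0 < 2)%N) expnMn (leq_ltn_trans Q2).
  by move: mu0; clear; lia.
have M4 : (4 <= M)%N.
  apply: (@leq_trans (l ^ 2)); last by rewrite leq_pexp2l // ltnW.
  by apply: (@leq_trans (2 ^ 2)%N) => //; rewrite leq_exp2r.
(* Only a subset with M mu < #|Y| Q <= 2 M mu is used, because [walk_arith] needs an upper bound on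
   the number of vertices. *)
have [Y YX cY] : exists2 Y : {set F}, Y \subset X & #|Y| = (M * mu %/ Q).+1.
  by apply: card_subset_exists; rewrite ltn_divLR.
have YQ1 : (M * mu < #|Y| * Q)%N by rewrite cY ltn_ceil.
have YQ2 : (#|Y| * Q <= 2 * M * mu)%N.
  rewrite cY mulSn; have := leq_trunc_div (M * mu) Q.
  have : (4 * mu <= M * mu)%N by rewrite leq_mul2r M4 orbT.
  by move: Qmu; clear; lia.
move/subsetP: YX => YX.
have sep x a : x \in Y -> (0 < a <= A)%N -> x + a%:R \notin Y.
  by move=> /YX xX /(sepX x a xX); apply: contra => /YX.
have Ql : (Q < 2 ^ l)%N by apply: leq_trans pl; rewrite ltnS; apply: leq_trans Q2; rewrite expnS expn1 leq_pmull.
have Qp : (Q < p)%N by apply: leq_trans Q2; rewrite expnS expn1 ltn_Pmull.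
pose QS := [set q : 'I_Q.+1 | prime q & (Q < 8 * l * q)%N].
(* The largest choice, up to rounding, that is at most every prime in [QS], as the injectivity
   argument demands. *)
pose C := (Q %/ (8 * l)).+1.
have l0 : (0 < 8 * l)%N by rewrite muln_gt0 /= (ltnW l2).
have QSc : (Q <= 8 * l * #|QS|)%N := prime_in_window Q1 Ql.
have CQ : (2 * C <= Q)%N.
  have : (Q %/ (8 * l) <= Q %/ 8)%N by apply: leq_div2l => //; rewrite leq_pmulr // ltnW.
  by rewrite /C; move: Q1; clear; lia.
have QSP q : q \in QS -> prime q /\ (C <= q)%N.
  by rewrite inE => /andP[qp qQ]; rewrite /C ltn_divLR // mulnC.
pose QQ := [seq val q | q <- enum QS].
have QQP q : q \in QQ -> exists2 q' : 'I_Q.+1, q' \in QS & q = q'.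
  by move=> /mapP[q' q'S ->]; exists q'; rewrite // -mem_enum.
have C0 : (0 < C)%N by [].
have [k [k1 k2 kl]] := exponent_exists Q1 Q2.
pose D := (Q * (24 * M * k.+1 ^ 2 + 1))%N.
have Hclose : (\sum_(x in Y) \sum_(z in Y) close (2 * (Q * C)) QQ x z <= #|Y| * (2 * (D + k.+1 * Q)))%N.
  apply: (@close_pairs_bound p pp _ Q (2 * Q ^ 2) A) => //.
  - by apply/allP=> q /QQP[q' /QSP[? _] ->].
  - by rewrite map_inj_uniq ?enum_uniq //; exact: val_inj.
  - by apply/allP=> q /QQP[q' _ ->]; rewrite -ltnS.
  - apply/allP=> q /QQP[q' /QSP[_ Cq] ->].
    apply: (@leq_trans (Q * (l + 4) * q')%N); last by rewrite leq_mul2r QA orbT.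
    rewrite -mulnA (_ : 2 * (2 * (Q * C)) = Q * (4 * C))%N; last by ring.
    by rewrite leq_mul2l leq_mul ?orbT // leq_addl.
  - apply/allP=> q /QQP[q' /QSP[_ Cq] ->].
    rewrite (_ : 2 * (Q * C) * Q = 2 * Q ^ 2 * C)%N; last by ring.
    by rewrite leq_mul2l Cq orbT.
  exact: (walk_arith Q0 mu0 (prime_gt0 pp) YQ2 k1 k2 mu1 mu2 M0).
have lA : (l + 4 <= A)%N by apply: leq_trans QA; rewrite leq_pmull.
have QA4 : (Q + Q * l <= A)%N by apply: leq_trans QA; rewrite -mulnS leq_mul2l addnS ltnS leq_addr orbT.
pose P := [set yz : F * F | same_window test_window yz.1 yz.2].
have hP x x' c (q : 'I_Q.+1) : x \in Y -> x' \in Y -> (c < C)%N -> q \in QS ->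
     ((x + c%:R) / q%:R, (x' + c%:R) / q%:R) \in P.
  move=> xY x'Y cC qS; have [qp _] := QSP _ qS; have q0 := prime_gt0 qp.
  have qF : (q%:R : F) != 0 by apply: (natr_neq0_Fp pp); rewrite q0 (leq_ltn_trans _ Qp) // -ltnS.
  rewrite inE /=; apply/forallP=> b; apply/implyP=> /imsetP[i _ ->]; rewrite opprK.
  have aA : (0 < c + q * i.+1 <= A)%N.
    rewrite addn_gt0 muln_gt0 q0 orbT /=; apply: leq_trans QA4; apply: leq_add.
      by move: CQ cC; clear; lia.
    by apply: leq_mul; [rewrite -ltnS|].
  (* This identity turns the window at (x + c) / q into characters at shifts of x itself. *)
  have sh (y : F) : (y + c%:R) / q%:R + i.+1%:R = (y + (c + q * i.+1)%N%:R) / q%:R.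
    by rewrite natrD natrM addrA [RHS]mulrDl [q%:R * _]mulrC mulfK.
  rewrite !sh !quadcharM // (cstX x x' _ (YX _ xY) (YX _ x'Y) aA) eqxx /=.
  rewrite -quadcharM // -normr_eq0 quadchar_norm // mulf_neq0 ?invr_eq0 //.
  exact: nzX (YX _ x'Y) aA.
have QCp : (2 * (Q * C) <= p)%N.
  by apply: leq_trans Q2; rewrite expnS expn1 mulnCA leq_mul2l CQ orbT.
have CA : (C <= A)%N by move: CQ QA4; clear; nia.
have wb := window_pairs_bound pp sep QSP Qp CA C0 QCp Q0 Hclose hP.
have wb2 := leq_trans wb (leq_mul same_window_bound (leqnn _)).
have Rle : (#|QS| <= 2 * Q)%N.
  by apply: leq_trans (max_card _) _; rewrite card_ord; move: Q0; clear; lia.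
have CQ2 : (Q <= C * (8 * l))%N by rewrite ltnW // ltn_ceil.
have := cluster_arith l2 mu0 M0 (ltn0Sn k) kl Q0 CQ Rle QSc CQ2 (ltnW YQ1) wb2.
by rewrite leq_exp2l.
Qed.

Definition separated (A : nat) (X : {set F}) :=
  forall x a, x \in X -> (0 < a <= A)%N -> x + a%:R \notin X.

(** A zero of x + a falls into the second class, together with the nonsquares; zeros are set aside
    before characters are compared. *)
Definition unsplit (A : nat) (X : {set F}) :=
  forall a, (0 < a <= A)%N ->
    (forall x, x \in X -> (x + a%:R) ^+ p./2 = 1) \/
    (forall x, x \in X -> (x + a%:R) ^+ p./2 != 1).

Lemma unsplit_quadchar A X x y a : unsplit A X -> x \in X -> y \in X -> (0 < a <= A)%N ->
  x + a%:R != 0 -> y + a%:R != 0 -> chi (x + a%:R) = chi (y + a%:R).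
Proof.
move=> uX xX yX aA x0 y0; have := half_power pp po x0; have := half_power pp po y0.
have := oner_neqN1 pp po; rewrite /quadchar.
case: (uX a aA) => h; first by rewrite !h.
by rewrite (negPf (h _ xX)) (negPf (h _ yX)) /= => _ -> ->.
Qed.

Lemma separated_lt A X : separated A X -> (1 < #|X|)%N -> (A < p)%N.
Proof.
move=> sX /card_gt1P[x [y [xX yX xy]]]; rewrite ltnNge; apply/negP=> pA.
have := sX x (val (y - x)) xX; rewrite natr_Fp_val addrCA subrr addr0 yX.
rewrite (leq_trans (ltnW (ltn_val_Fp pp _)) pA) andbT lt0n => h.
have /eqP e : val (y - x) == 0%N by apply: contraT => /h.
by move: xy; rewrite eq_sym -subr_eq0 -(natr_Fp_val (y - x)) e eqxx.
Qed.

(** For two points x and y of X the translates x + c with c < A - l share their test window with y +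
    c, apart from zeros. [card_same_window_diff] with t = y - x allows O(l mu) such points only; its
    hypothesis holds because x and y are not close. *)
Lemma separated_bound A X : separated A X -> unsplit A X -> (1 < #|X|)%N -> (A <= l ^ 9 * mu)%N.
Proof.
move=> sX uX N1; have Ap := separated_lt sX N1.
have /card_gt1P[x [y [xX yX xy]]] := N1.
have lk j : (2 ^ j <= l ^ j)%N by case: j => // j; rewrite leq_exp2r.
have l9 : (230 * l <= l ^ 9)%N by rewrite (expnSr l 8) leq_mul // (leq_trans _ (lk 8%N)).
case: (leqP l A) => lA; last first.
  apply: (@leq_trans (l ^ 9)); last by rewrite leq_pmulr.
  by apply: leq_trans (ltnW lA) _; rewrite -{1}(expn1 l) leq_exp2l.
set W := test_window; set t := y - x.
have tW b : b \in W -> b - t \notin W.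
  move=> /imsetP[i _ ->]; apply/imsetP=> -[j _ e].
  have : y = x; last by move=> yx; rewrite yx eqxx in xy.
  apply: (@sep_int p A X sX x y (j%:Z - i%:Z)) => //.
    by have := ltn_ord i; have := ltn_ord j; move: lA; clear; lia.
  rewrite rmorphB /= -!pmulrn -/t.
  have -> : t = j.+1%:R - i.+1%:R by rewrite -[j.+1%:R]opprK -e; ring.
  by rewrite !mulrSr; ring.
have := card_same_window_diff pp po mu0 mu1 mu2 tW; rewrite card_test_window.
set Sm := [set _ | _] => hS.
have {}hS : (#|Sm| <= 1 + 226 * l * mu)%N.
  rewrite -(leq_pmul2l (_ : 0 < 2 ^ l)%N) ?expn_gt0 // mulnDr muln1.
  by apply: leq_trans hS _; rewrite leq_add2r ltnW.
pose T := [set x + (c : nat)%:R | c : 'I_(A - l)].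
have cT : #|T| = (A - l)%N.
  rewrite card_imset ?card_ord // => c c' /addrI e; apply: val_inj.
  apply: (natr_inj_Fp pp _ _ e); apply: leq_trans (ltn_ord _) _; move: Ap; clear; lia.
(* The translates lost to a zero of x + a or of y + a lie in W or in W - t. *)
have TS : T \subset Sm :|: W :|: [set b - t | b in W].
  apply/subsetP=> z /imsetP[c _ ->]; rewrite !inE.
  case: (boolP (x + c%:R \in W)) => [_|zW]; first by rewrite orbT.
  case: (boolP (_ \in [set b - t | b in W])) => [_|zWt]; rewrite ?orbT // !orbF.
  apply/forallP=> b; apply/implyP=> bW; case/imsetP: (bW) => i _ bi; rewrite bi opprK.
  have e1 : x + c%:R + i.+1%:R = x + (c + i.+1)%N%:R by rewrite natrD addrA.
  have e2 : x + c%:R + t + i.+1%:R = y + (c + i.+1)%N%:R by rewrite /t natrD; ring.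
  have n1 : x + (c + i.+1)%N%:R != 0.
    by rewrite -e1 addr_eq0 -bi; apply: contraNneq zW => ->.
  have n2 : y + (c + i.+1)%N%:R != 0.
    rewrite -e2 addr_eq0 -bi; apply: contraNneq zWt => e; apply/imsetP; exists b => //.
    by rewrite -e addrK.
  have aA : (0 < c + i.+1 <= A)%N.
    by have := ltn_ord i; have := ltn_ord c; clear; lia.
  rewrite e1 e2 (unsplit_quadchar uX xX yX aA n1 n2) eqxx /=.
  by rewrite -normr_eq0 quadchar_norm // n2.
have := subset_leq_card TS; rewrite cT.
have := leq_card_setU (Sm :|: W) [set b - t | b in W]; have := leq_card_setU Sm W.
have := leq_imset_card (fun b => b - t) W; rewrite card_test_window.
move: #|_ :|: _| #|_ :|: _| #|[set b - t | b in W]| #|Sm| hS => a1 a2 a3 a4 hS h1 h2 h3 h4.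
apply: leq_trans (leq_mul l9 (leqnn mu)).
have : (l <= l * mu)%N by rewrite leq_pmulr.
move: h1 (leq_of_leqif h2) (leq_of_leqif h3) h4 hS l2; rewrite -!mulnA.
by move: (l * mu)%N; clear; lia.
Qed.

Lemma cluster_bound_aux A X : separated A X -> unsplit A X -> (1 < #|X|)%N ->
  (#|X| * A <= l ^ 50 * (#|X| + mu))%N.
Proof.
move=> sX uX N1; have b0 := separated_bound sX uX N1.
(* At most one point of X has a zero among its shifts, as two such points -a and -b would be too
   close. Dropping it costs at most a factor 2. *)
pose X0 := [set x in X | [forall a : 'I_A, x + a.+1%:R != 0]].
have X0P x : x \in X0 -> x \in X /\ forall a, (0 < a <= A)%N -> x + a%:R != 0.
  rewrite inE => /andP[-> /forallP h]; split=> // -[//|a] aA.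
  exact: h (Ordinal (aA : (a < A)%N)).
have X01 : (#|X :\: X0| <= 1)%N.
  rewrite leqNgt; apply/negP=> /card_gt1P[x [y []]].
  rewrite !inE => /andP[+ xX] /andP[+ yX] xy; rewrite xX yX /= !negb_forall.
  move=> /existsP[a]; rewrite negbK addr_eq0 => /eqP xa.
  move=> /existsP[b]; rewrite negbK addr_eq0 => /eqP yb.
  move/eqP: xy; apply; apply/esym.
  apply: (@sep_int p A X sX x y (a%:Z - b%:Z)) => //.
    by have := ltn_ord a; have := ltn_ord b; clear; lia.
  by rewrite xa yb rmorphB /= -!pmulrn !mulrSr; ring.
have X0X : X0 \subset X by apply/subsetP=> x /X0P[].
have XX0 : (#|X| <= #|X0|.*2)%N.
  by have := cardsDS X0X; have := subset_leq_card X0X; move: X01 N1; clear; lia.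
have lk j : (2 ^ j <= l ^ j)%N by case: j => // j; rewrite leq_exp2r.
have l40 : (0 < l ^ 40)%N by rewrite expn_gt0 ltnW.
have l5 : (4 * (l + 4) <= l ^ 5)%N.
  apply: (@leq_trans (12 * l)); first by move: l2; clear; lia.
  by rewrite (expnSr l 4) leq_mul // (leq_trans _ (lk 4%N)).
have l4 : (0 < l + 4)%N by rewrite addnS.
case: (leqP (A %/ (l + 4)) 1) => hQ.
  have : (A <= 4 * (l + 4))%N.
    by have := ltn_ceil A l4; move: hQ; move: (A %/ _)%N => w; clear; nia.
  move=> h; apply: (@leq_trans (l ^ 50 * #|X|)); last by rewrite leq_mul2l leq_addr orbT.
  rewrite mulnC leq_mul2r; apply/orP; right; apply: leq_trans h (leq_trans l5 _).
  by rewrite leq_exp2l.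
apply: (@leq_trans (l ^ 50 * mu)); last by rewrite leq_mul2l leq_addl orbT.
(* The best Q is A / (l + 4), but Q^2 <= p limits it to 2 mu. In the limited case #|X| is at most a
   power of l, and [separated_bound] takes care of A. *)
have key Q : (1 < Q)%N -> (Q <= A %/ (l + 4))%N -> (Q <= 2 * mu)%N -> (#|X0| * Q <= l ^ 40 * mu)%N.
  move=> Q1 QA Qmu; apply: (@cluster_main X0 A) => //.
  - by move=> x a /X0P[xX _] /(sX x a xX); apply: contra => /X0P[].
  - by move=> x a /X0P[_ h] /h.
  - move=> x y a /X0P[xX hx] /X0P[yX hy] aA.
    by apply: (unsplit_quadchar uX) => //; [apply: hx|apply: hy].
  - by apply: leq_trans mu1; rewrite (_ : 4 = 2 ^ 2)%N // -expnMn leq_exp2r.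
  by rewrite -leq_divRL.
case: (leqP (A %/ (l + 4)) (2 * mu)) => hmu.
  have k1 := key _ hQ (leqnn _) hmu.
  have AQ : (A <= 2 * (A %/ (l + 4)) * (l + 4))%N.
    by have := ltn_ceil A l4; move: hQ; move: (A %/ _)%N => w; clear; nia.
  apply: leq_trans (leq_mul XX0 AQ) _.
  apply: (@leq_trans (l ^ 40 * mu * (4 * (l + 4)))).
    apply: leq_trans (leq_mul k1 (leqnn _)); rewrite -mul2n.
    by rewrite leq_eqVlt; apply/orP; left; apply/eqP; ring.
  rewrite mulnAC leq_mul2r; apply/orP; right; apply: leq_trans (leq_mul (leqnn _) l5) _.
  by rewrite -expnD leq_exp2l.
have m1 : (1 < 2 * mu)%N by move: mu0; clear; lia.
have := key _ m1 (ltnW hmu) (leqnn _); rewrite mulnA leq_pmul2r // => k2.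
have k3 : (#|X| <= l ^ 40)%N by apply: leq_trans XX0 _; rewrite -muln2.
apply: leq_trans (leq_mul k3 b0) _; rewrite mulnA leq_mul2r -expnD leq_exp2l //.
by rewrite orbT.
Qed.

End ClusterBound.

Theorem cluster_bound (p l s A : nat) (X : {set 'F_p}) :
  prime p -> odd p -> p < 2 ^ l -> l < p -> 1 < l -> p <= s ^ 2 ->
  separated A X -> unsplit A X -> 1 < #|X| -> #|X| * A <= l ^ 50 * (#|X| + s).
Proof.
move=> pp po pl lp l2 ps sX uX N1.
have [mu /andP[mu1 mu2]] : exists mu, 4 * mu ^ 2 <= p < 4 * mu.+1 ^ 2.
  elim: (p) => [|n [m /andP[h1 h2]]]; first by exists 0.
  case: (ltnP n.+1 (4 * m.+1 ^ 2)) => h3; first by exists m; rewrite h3 (leq_trans h1).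
  by exists m.+1; rewrite h3 !expnS !expn0; move: h2; rewrite !expnS expn0; lia.
have mus : mu <= s.
  rewrite -(leq_exp2r _ _ (isT : 0 < 2)); apply: leq_trans ps; apply: leq_trans mu1.
  by rewrite leq_pmull.
(* [mu] = 0 means p < 4, and then A < p is already enough. *)
have [m0|m0] := posnP mu.
  apply: (@leq_trans (l ^ 50 * #|X|)); last by rewrite leq_mul2l leq_addr orbT.
  rewrite mulnC leq_mul2r; apply/orP; right.
  apply: leq_trans (ltnW (separated_lt pp sX N1)) _; apply: leq_trans (ltnW mu2) _.
  rewrite m0; apply: (@leq_trans (l ^ 2)); last by rewrite leq_exp2l.
  by apply: (@leq_trans (2 ^ 2)) => //; rewrite leq_exp2r.
apply: leq_trans (cluster_bound_aux pp po pl lp l2 m0 mu1 mu2 sX uX N1) _.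
by rewrite leq_mul2l leq_add2l mus orbT.
Qed.

(** * Programs and their cost *)

Section BitLength.

Lemma bitlen_gt0 k : 0 < bitlen k. Proof. by []. Qed.

Lemma bitlen_leP k b : 0 < b -> (bitlen k <= b) = (k < 2 ^ b).
Proof.
move=> b0; rewrite /bitlen; case: k => [|k]; first by rewrite trunc_log0 b0 expn_gt0.
have /andP[h1 h2] := trunc_log_bounds (isT : 1 < 2) (isT : 0 < k.+1).
apply/idP/idP => h; first by apply: leq_trans h2 _; rewrite leq_exp2l.
by rewrite -(ltn_exp2l _ _ (isT : 1 < 2)) (leq_ltn_trans h1).
Qed.

Lemma ltn_bitlen k : k < 2 ^ bitlen k.
Proof. by rewrite -bitlen_leP. Qed.

Lemma leq_bitlen a b : a <= b -> bitlen a <= bitlen b.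
Proof. by move=> ab; rewrite bitlen_leP // (leq_ltn_trans ab) // ltn_bitlen. Qed.

Lemma bitlenD a b : bitlen (a + b) <= bitlen a + bitlen b.
Proof.
rewrite bitlen_leP ?addn_gt0 ?bitlen_gt0 // expnD.
have ha := ltn_bitlen a; have hb := ltn_bitlen b.
have : 1 < 2 ^ bitlen a by rewrite -{1}(expn0 2) ltn_exp2l.
have : 1 < 2 ^ bitlen b by rewrite -{1}(expn0 2) ltn_exp2l.
by move: ha hb; move: (2 ^ _) (2 ^ _) => x y; nia.
Qed.

Lemma bitlenM a b : bitlen (a * b) <= bitlen a + bitlen b.
Proof.
by rewrite bitlen_leP ?addn_gt0 ?bitlen_gt0 // expnD ltn_mul ?ltn_bitlen.
Qed.

(** No operation does more than add the lengths of its arguments, so over a memory with entries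
    below W a value has at most [expr_size e] times [bitlen W] bits. *)
Fixpoint expr_size (e : expr) : nat :=
  match e with
  | Const k => bitlen k
  | Read _ => 1
  | Op _ a b => expr_size a + expr_size b
  end.

Fixpoint expr_cost (e : expr) : nat :=
  match e with
  | Const k => bitlen k
  | Read a => expr_cost a + expr_size a + 1
  | Op _ a b => expr_cost a + expr_cost b + (expr_size a + expr_size b + expr_size a * expr_size b)
  end.

(** A number depending on the program text only: the constant factor of the time bound. *)
Fixpoint cmd_cost (c : cmd) : nat :=
  match c with
  | Skip => 1
  | Write a e => expr_cost a + expr_cost e + expr_size a + 1
  | Seq c1 c2 => cmd_cost c1 + cmd_cost c2
  | If e c1 c2 => (expr_cost e).+1 + cmd_cost c1 + cmd_cost c2
  | While e c => (expr_cost e).+1 + cmd_cost c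
  end.

Variables (W : nat).
Let w := bitlen W.

Lemma eval_size (m : memory) e : (forall i, m i < W) -> bitlen (eval m e) <= expr_size e * w.
Proof.
move=> mW; elim: e => [k|a _|o a ha b hb] /=; first by rewrite leq_pmulr.
  by rewrite mul1n leq_bitlen // ltnW.
rewrite mulnDl; case: o => /=.
- exact: leq_trans (bitlenD _ _) (leq_add ha hb).
- apply: leq_trans (leq_trans ha (leq_addr _ _)); apply: leq_bitlen; exact: leq_subr.
- exact: leq_trans (bitlenM _ _) (leq_add ha hb).
- apply: leq_trans (leq_trans ha (leq_addr _ _)); apply: leq_bitlen; exact: leq_div.
- apply: leq_trans (leq_trans ha (leq_addr _ _)); apply: leq_bitlen; exact: leq_mod.
Qed.

Let w1 : 0 < w. Proof. by []. Qed.
Let ww k : k * w <= k * w ^ 2.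
Proof. by rewrite leq_mul2l expnS expn1 leq_pmulr ?orbT. Qed.

Lemma eval_cost_le (m : memory) e : (forall i, m i < W) -> eval_cost m e <= expr_cost e * w ^ 2.
Proof.
move=> mW; elim: e => [k|a ha|o a ha b hb] /=; first by rewrite leq_pmulr // expn_gt0 w1.
  rewrite !mulnDl; apply: leq_add; last by rewrite (leq_trans _ (ww 1)) // mul1n leq_bitlen // ltnW.
  by apply: leq_add => //; apply: leq_trans (ww _); apply: eval_size.
rewrite !mulnDl; apply: leq_add; first exact: leq_add.
have sa := eval_size a mW; have sb := eval_size b mW.
have h1 : bitlen (eval m a) + bitlen (eval m b) <= expr_size a * w ^ 2 + expr_size b * w ^ 2 + expr_size a * expr_size b * w ^ 2.
  apply: leq_trans (leq_addr _ _); apply: leq_add; [exact: leq_trans sa (ww _)|exact: leq_trans sb (ww _)].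
have h2 : bitlen (eval m a) * bitlen (eval m b) <= expr_size a * w ^ 2 + expr_size b * w ^ 2 + expr_size a * expr_size b * w ^ 2.
  apply: leq_trans (leq_addl _ _); apply: leq_trans (leq_mul sa sb) _.
  by rewrite leq_eqVlt; apply/orP; left; apply/eqP; ring.
by case: o.
Qed.

(* [uexec] counts elementary commands and requires every stored number to be below [W]. *)
Inductive uexec : cmd -> memory -> memory -> nat -> Prop :=
| uexec_skip m : uexec Skip m m 1
| uexec_write m a e : eval m e < W -> uexec (Write a e) m (update m (eval m a) (eval m e)) 1
| uexec_seq c1 c2 m1 m2 m3 t1 t2 :
    uexec c1 m1 m2 t1 -> uexec c2 m2 m3 t2 -> uexec (Seq c1 c2) m1 m3 (t1 + t2)
| uexec_if e c1 c2 m1 m2 t :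
    uexec (if eval m1 e != 0 then c1 else c2) m1 m2 t -> uexec (If e c1 c2) m1 m2 t.+1
| uexec_while_stop e c m : eval m e = 0 -> uexec (While e c) m m 1
| uexec_while_step e c m1 m2 m3 t1 t2 :
    eval m1 e <> 0 -> uexec c m1 m2 t1 -> uexec (While e c) m2 m3 t2 ->
    uexec (While e c) m1 m3 (t1 + t2).+1.

(** From here on it suffices to count commands. The sizes of numbers enter through the square of the
    bit length of W, because the schoolbook operations are quadratic. *)
Lemma uexec_exec c m m' k : uexec c m m' k -> (forall i, m i < W) ->
  (forall i, m' i < W) /\ exists2 t, exec c m m' t & t <= cmd_cost c * k * w ^ 2.
Proof.
have w2 : 0 < w ^ 2 by rewrite expn_gt0 w1.
elim=> {c m m' k}.
- by move=> m mW; split=> //; exists 1; [constructor|rewrite !muln1 mul1n].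
- move=> m a e eW mW; split; first by move=> i; rewrite /update /=; case: ifP.
  eexists; first by constructor.
  rewrite muln1 /= !mulnDl; apply: leq_add; last first.
    by rewrite (leq_trans _ (ww 1)) // mul1n leq_bitlen // ltnW.
  apply: leq_add; last by apply: leq_trans (ww _); apply: eval_size.
  by apply: leq_add; apply: eval_cost_le.
- move=> c1 c2 m1 m2 m3 t1 t2 _ ih1 _ ih2 /ih1[/ih2[m3W [t2' e2 le2]] [t1' e1 le1]].
  split=> //; exists (t1' + t2'); first by econstructor; eauto.
  apply: leq_trans (leq_add le1 le2) _; rewrite -mulnDl leq_mul2r; apply/orP; right.
  by rewrite /=; move: (cmd_cost c1) (cmd_cost c2) => a b; clear; nia.
- move=> e c1 c2 m1 m2 t _ ih mW; have [m2W [t' e' le']] := ih mW.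
  split=> //; eexists; first by constructor; eauto.
  have ec := eval_cost_le e mW.
  apply: (@leq_trans ((expr_cost e).+1 * w ^ 2 + t')).
    by rewrite leq_add2r mulSn; move: ec; lia.
  apply: leq_trans (leq_add (leqnn _) le') _; rewrite -mulnDl leq_mul2r; apply/orP; right.
  by rewrite /=; case: (_ != 0); move: (cmd_cost c1) (cmd_cost c2) (expr_cost e) => a b d; clear; nia.
- move=> e c m e0 mW; split=> //; eexists; first by constructor.
  have ec := eval_cost_le e mW; rewrite muln1 /= mulnDl mulSn; move: ec w2; lia.
move=> e c m1 m2 m3 t1 t2 e0 _ ih1 _ ih2 mW.
have [m2W [t1' e1 le1]] := ih1 mW; have [m3W [t2' e2 le2]] := ih2 m2W.
split=> //; eexists; first by econstructor; eauto.
have ec := eval_cost_le e mW.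
apply: (@leq_trans ((expr_cost e).+1 * w ^ 2 + t1' + t2')).
  by rewrite !leq_add2r mulSn; move: ec w2; lia.
apply: leq_trans (leq_add (leq_add (leqnn _) le1) le2) _.
rewrite -!mulnDl leq_mul2r; apply/orP; right.
by rewrite /=; move: (cmd_cost c) (expr_cost e) => a d; clear; nia.
Qed.

End BitLength.

(** * Registers and a program logic with step budgets *)

Section Programs.

Definition cell (r : nat) (e : expr) : expr := Op AAdd (Const r) (Op AMul (Const 64) e).
Definition Arr (r : nat) (e : expr) : expr := Read (cell r e).
Definition Var (r : nat) : expr := Arr r (Const 0).
Definition SetA (r : nat) (e v : expr) : cmd := Write (cell r e) v.
Definition SetV (r : nat) (v : expr) : cmd := SetA r (Const 0) v.

(* Register r is the arithmetic progression of addresses r, r + 64, r + 128, ... *)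
Definition get (m : memory) (r i : nat) : nat := m (r + 64 * i).

Lemma eval_Const m k : eval m (Const k) = k. Proof. by []. Qed.

Lemma eval_Arr m r e : eval m (Arr r e) = get m r (eval m e). Proof. by []. Qed.

Lemma eval_Var m r : eval m (Var r) = get m r 0. Proof. by []. Qed.

Lemma eval_Add m a b : eval m (Op AAdd a b) = eval m a + eval m b. Proof. by []. Qed.

Lemma eval_Sub m a b : eval m (Op ASub a b) = eval m a - eval m b. Proof. by []. Qed.

Lemma eval_Mul m a b : eval m (Op AMul a b) = eval m a * eval m b. Proof. by []. Qed.

Lemma eval_Div m a b : eval m (Op ADiv a b) = eval m a %/ eval m b. Proof. by []. Qed.

Lemma eval_Mod m a b : eval m (Op AMod a b) = eval m a %% eval m b. Proof. by []. Qed.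

Definition evalE := (eval_Const, eval_Var, eval_Arr, eval_Add, eval_Sub, eval_Mul, eval_Div, eval_Mod).

Lemma get_update m r e v r' i' : r < 64 -> r' < 64 ->
  get (update m (eval m (cell r e)) v) r' i' =
  if (r' == r) && (i' == eval m e) then v else get m r' i'.
Proof.
move=> r64 r'64; rewrite /get /update /cell /=; set i := eval m e.
have -> : (r' + 64 * i' == r + 64 * i) = (r' == r) && (i' == i); last by [].
apply/eqP/andP => [h|[/eqP-> /eqP->]] //; suff: r' = r /\ i' = i by case=> -> ->.
by lia.
Qed.

(** Addresses are computed at run time, so this is a syntactic test: only a write of the shape made
    by [cell] is known to stay in its register, and any other write counts as touching all
    registers. *)
Fixpoint mods (c : cmd) (r : nat) : bool :=
  match c with
  | Skip => false
  | Write (Op AAdd (Const s) (Op AMul (Const k) _)) _ => [|| s == r, 64 <= s | k != 64]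
  | Write _ _ => true
  | Seq c1 c2 => mods c1 r || mods c2 r
  | If _ c1 c2 => mods c1 r || mods c2 r
  | While _ c => mods c r
  end.

Variable W : nat.

Lemma uexec_frame c m m' k : uexec W c m m' k ->
  forall r i, r < 64 -> ~~ mods c r -> get m' r i = get m r i.
Proof.
elim=> {c m m' k} //.
- move=> m a e _ r i r64.
  case: a => // o [s||] //=; case: o => // -[||o [k||] b] //; case: o => //.
  rewrite !negb_or negbK => /and3P[sr s64 /eqP->].
  have := @get_update m s b (eval m e) r i; rewrite -ltnNge in s64 => /(_ s64 r64).
  by rewrite eq_sym (negPf sr).
- move=> c1 c2 m1 m2 m3 t1 t2 _ ih1 _ ih2 r i r64 /=; rewrite negb_or => /andP[h1 h2].
  by rewrite ih2 // ih1.
- move=> e c1 c2 m1 m2 t _ ih r i r64 /=; rewrite negb_or => /andP[h1 h2].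
  by rewrite ih //; case: ifP.
by move=> e c m1 m2 m3 t1 t2 _ _ ih1 _ ih2 r i r64 h; rewrite ih2 // ih1.
Qed.

(** A weakest precondition with a step budget; sequences of commands are verified by nesting
    postconditions. *)
Definition run (c : cmd) (K : nat) (Q : memory -> Prop) (m : memory) : Prop :=
  exists m' k, [/\ uexec W c m m' k, k <= K & Q m'].

Lemma run_weaken c K K' (Q Q' : memory -> Prop) m : K <= K' -> (forall m', Q m' -> Q' m') ->
  run c K Q m -> run c K' Q' m.
Proof. by move=> KK QQ [m' [k [h1 h2 h3]]]; exists m', k; split; [|exact: leq_trans KK|exact: QQ]. Qed.

(** The frame property is handed to the postcondition, so that every call records which registers it
    left alone. *)
Lemma run_frame c K Q m :
  run c K (fun m' => (forall r i, r < 64 -> ~~ mods c r -> get m' r i = get m r i) -> Q m') m ->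
  run c K Q m.
Proof. by move=> [m' [k [h1 h2 h3]]]; exists m', k; split=> //; apply: h3; exact: uexec_frame h1. Qed.

Lemma run_skip Q m : Q m -> run Skip 1 Q m.
Proof. by exists m, 1; split=> //; constructor. Qed.

Lemma run_seq c1 c2 K1 K2 Q m : run c1 K1 (run c2 K2 Q) m -> run (Seq c1 c2) (K1 + K2) Q m.
Proof.
move=> [m1 [k1 [h1 l1 [m2 [k2 [h2 l2 q]]]]]]; exists m2, (k1 + k2).
by split=> //; [econstructor; eauto|exact: leq_add].
Qed.

Lemma run_if e c1 c2 K Q m :
  (eval m e != 0 -> run c1 K Q m) -> (eval m e = 0 -> run c2 K Q m) -> run (If e c1 c2) K.+1 Q m.
Proof.
move=> h1 h2; have [m' [k [h3 h4 h5]]] : run (if eval m e != 0 then c1 else c2) K Q m.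
  by case: eqP => [/h2//|/eqP/h1].
by exists m', k.+1; split=> //; constructor.
Qed.

Lemma run_write a e Q m : eval m e < W -> Q (update m (eval m a) (eval m e)) -> run (Write a e) 1 Q m.
Proof. by move=> eW q; eexists; exists 1; split; [constructor| |exact: q]. Qed.

Lemma run_SetA r e v Q m : r < 64 -> eval m v < W ->
  (forall m', (forall r' i', r' < 64 ->
     get m' r' i' = if (r' == r) && (i' == eval m e) then eval m v else get m r' i') -> Q m') ->
  run (SetA r e v) 1 Q m.
Proof. by move=> r64 vW h; apply: run_write => //; apply: h => r' i' r'64; apply: get_update. Qed.

Lemma run_SetV r v Q m : r < 64 -> eval m v < W ->
  (forall m', (forall r' i', r' < 64 ->
     get m' r' i' = if (r' == r) && (i' == 0) then eval m v else get m r' i') -> Q m') ->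
  run (SetV r v) 1 Q m.
Proof. by move=> r64 vW h; apply: run_SetA. Qed.

Lemma run_while (I : nat -> memory -> Prop) (K : nat -> nat) n e c (Q : memory -> Prop) m : I 0 m ->
  (forall i m', i < n -> I i m' -> eval m' e <> 0 /\ run c (K i) (I i.+1) m') ->
  (forall m', I n m' -> eval m' e = 0 /\ Q m') ->
  run (While e c) (\sum_(i < n) (K i).+1).+1 Q m.
Proof.
elim: n I K m => [|n IH] I K m I0 step stop.
  by rewrite big_ord0; have [e0 q] := stop m I0; exists m, 1; split=> //; constructor.
have [e0 [m1 [k1 [h1 l1 I1]]]] := step 0 m isT I0.
have [m2 [k2 [h2 l2 q]]] := IH (fun i => I i.+1) (fun i => K i.+1) m1 I1 (fun i m' => step i.+1 m') stop.
exists m2, (k1 + k2).+1; split=> //; first by apply: uexec_while_step; eauto.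
by rewrite big_ord_recl /= !ltnS addSn -addnS leq_add.
Qed.

(* The loop counter sits at index 0 of register j and the bound at index 1. *)
Definition For (j : nat) (e : expr) (c : cmd) : cmd :=
  Seq (SetA j (Const 1) e) (Seq (SetV j (Const 0))
    (While (Op ASub (Arr j (Const 1)) (Var j)) (Seq c (SetV j (Op AAdd (Var j) (Const 1)))))).

(** The body does not write to register j, so counter and bound survive it. The stability hypothesis
    makes the invariant indifferent to register j, which the loop itself changes. *)
Lemma run_For j e c n (K : nat -> nat) (I : nat -> memory -> Prop) (Q : memory -> Prop) m :
  j < 64 -> ~~ mods c j -> eval m e = n -> n < W ->
  (forall i m1 m2, (forall r i, r < 64 -> r != j -> get m2 r i = get m1 r i) -> I i m1 -> I i m2) ->
  I 0 m ->
  (forall i m', i < n -> I i m' -> get m' j 0 = i -> run c (K i) (I i.+1) m') ->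
  (forall m', I n m' -> Q m') ->
  run (For j e c) (\sum_(i < n) (K i + 2) + 3) Q m.
Proof.
move=> j64 jc en nW stab I0 step fin.
apply: (@run_weaken _ (1 + (1 + (\sum_(i < n) (K i + 1).+1).+1)) _ Q Q) => //.
  have -> : \sum_(i < n) (K i + 1).+1 = \sum_(i < n) (K i + 2) by apply: eq_bigr => i _; rewrite addn1 addn2.
  by rewrite !add1n addn3.
apply: run_seq; apply: run_SetA => //; first by rewrite en.
move=> m1 h1; apply: run_seq; apply: run_SetV => //; first exact: leq_ltn_trans nW.
move=> m2 h2.
pose I' i m' := [/\ I i m', get m' j 0 = i & get m' j 1 = n].
apply: (@run_while I' (fun i => K i + 1)).
- split; last by rewrite h2 //= andbF h1 // eqxx /= en.
    apply: stab I0 => r i r64 rj; rewrite h2 // (negPf rj) /= h1 // (negPf rj) //.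
  by rewrite h2 // !eqxx.
- move=> i m' i_n [Ii ji jn]; split; first by rewrite !evalE ji jn; lia.
  apply: run_seq; apply: run_frame.
  have [m3 [k3 [u3 l3 I3]]] := step i m' i_n Ii ji.
  exists m3, k3; split=> // fr; have j0 := fr j 0 j64 jc; have j1 := fr j 1 j64 jc.
  apply: run_SetV => //; first by rewrite !evalE j0 ji addn1; apply: leq_ltn_trans nW.
  move=> m4 h4; split; last by rewrite h4 // andbF j1.
    by apply: stab I3 => r i' r64 rj; rewrite h4 // (negPf rj).
  by rewrite !evalE j0 ji addn1 in h4; rewrite h4 // !eqxx.
by move=> m' [In jn j1]; split; [rewrite !evalE jn j1 subnn|exact: fin].
Qed.

(* r[i] := v for i < n; v may read the counter in register 3 and the entries of r
   computed before. *)
Definition Tab (r : nat) (n v : expr) : cmd := For 3 n (SetA r (Var 3) v).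

Lemma run_Tab r ne v n (F : nat -> nat) (Q : memory -> Prop) m :
  r < 64 -> r != 3 -> eval m ne = n -> n < W ->
  (forall i m', i < n -> get m' 3 0 = i ->
     (forall r' i', r' < 64 -> r' != 3 -> r' != r -> get m' r' i' = get m r' i') ->
     (forall k, k < i -> get m' r k = F k) -> (forall k, i <= k -> get m' r k = get m r k) ->
     eval m' v = F i /\ F i < W) ->
  (forall m', (forall k, k < n -> get m' r k = F k) -> (forall k, n <= k -> get m' r k = get m r k) ->
     (forall r' i', r' < 64 -> r' != 3 -> r' != r -> get m' r' i' = get m r' i') -> Q m') ->
  run (Tab r ne v) (3 * n + 3) Q m.
Proof.
move=> r64 r3 en nW step fin.
pose I i m' := [/\ forall k, k < i -> get m' r k = F k, forall k, i <= k -> get m' r k = get m r k &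
  forall r' i', r' < 64 -> r' != 3 -> r' != r -> get m' r' i' = get m r' i'].
apply: (@run_weaken _ (\sum_(i < n) (1 + 2) + 3) _ Q Q) => //.
  by rewrite sum_nat_const card_ord mulnC.
apply: (@run_For 3 ne _ n (fun=> 1) I) => //.
- by rewrite /= orbF negb_or r3 -ltnNge.
- move=> i m1 m2 h [h1 h2 h3]; split=> [k ki|k ki|r' i' r'64 r'3 r'r].
  + by rewrite h // h1.
  + by rewrite h // h2.
  by rewrite h // h3.
- move=> i m' i_n [h1 h2 h3] ji; have [ev FW] := step i m' i_n ji h3 h1 h2.
  apply: run_SetA => //; first by rewrite ev.
  move=> m1 h; rewrite !evalE ji ev in h; split.
  + move=> k; rewrite ltnS leq_eqVlt h // eqxx /=; case: eqP => [->//|_ /= ki]; exact: h1.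
  + by move=> k ki; rewrite h // eqxx gtn_eqF //= h2 // ltnW.
  by move=> r' i' r'64 r'3 r'r; rewrite h // (negPf r'r) /= h3.
by move=> m' [h1 h2 h3]; apply: fin.
Qed.

(* r[i] := out after register 5 has accumulated v over the counter k < n2 in register 4. *)
Definition SumTab (r : nat) (n n2 v out : expr) : cmd :=
  For 3 n (Seq (SetV 5 (Const 0))
    (Seq (For 4 n2 (SetV 5 (Op AAdd (Var 5) v))) (SetA r (Var 3) out))).

Lemma run_SumTab r ne n2e v out n n2 (G : nat -> nat -> nat) (F : nat -> nat) (Q : memory -> Prop) m :
  r < 64 -> 5 < r -> eval m ne = n -> n < W -> n2 < W ->
  (forall i m', i < n -> get m' 3 0 = i ->
     (forall r' i', r' < 64 -> 5 < r' -> r' != r -> get m' r' i' = get m r' i') ->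
     eval m' n2e = n2) ->
  (forall i k m', i < n -> k < n2 -> get m' 3 0 = i -> get m' 4 0 = k ->
     (forall r' i', r' < 64 -> 5 < r' -> r' != r -> get m' r' i' = get m r' i') ->
     eval m' v = G i k) ->
  (forall i, i < n -> \sum_(k < n2) G i k < W) ->
  (forall i m', i < n -> get m' 3 0 = i -> get m' 5 0 = \sum_(k < n2) G i k ->
     (forall r' i', r' < 64 -> 5 < r' -> r' != r -> get m' r' i' = get m r' i') ->
     eval m' out = F i /\ F i < W) ->
  (forall m', (forall k, k < n -> get m' r k = F k) ->
     (forall r' i', r' < 64 -> 5 < r' -> r' != r -> get m' r' i' = get m r' i') -> Q m') ->
  run (SumTab r ne n2e v out) (n * (3 * n2 + 7) + 3) Q m.
Proof.
move=> r64 r5 en nW n2W h1 h2 h3 h4 fin.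
have nr k : k <= 5 -> (k == r) = false by move=> k5; apply: ltn_eqF; exact: leq_trans r5.
pose I i m' := (forall k, k < i -> get m' r k = F k) /\
  forall r' i', r' < 64 -> 5 < r' -> r' != r -> get m' r' i' = get m r' i'.
apply: (@run_weaken _ (\sum_(i < n) ((3 * n2 + 5) + 2) + 3) _ Q Q) => //.
  by rewrite sum_nat_const card_ord leq_add2r leq_mul2l; apply/orP; right; lia.
have Wp : 0 < W by apply: leq_ltn_trans nW.
apply: (@run_For 3 ne _ n (fun=> 3 * n2 + 5) I) => //.
- by rewrite /= eq_sym nr // leqNgt r64.
- move=> i m1 m2 h [a1 a2]; split=> [k ki|r' i' r'64 r'5 r'r].
    by rewrite h // ?a1 // eq_sym nr.
  by rewrite h ?a2 // gtn_eqF // (leq_trans _ r'5).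
- move=> i m' i_n [a1 a2] ji.
  apply: (@run_weaken _ (1 + ((\sum_(k < n2) (1 + 2) + 3) + 1)) _ (I i.+1) (I i.+1)) => //.
    by rewrite sum_nat_const card_ord; lia.
  apply: run_seq; apply: run_SetV => // m1 e1; apply: run_seq.
  pose J k mm := [/\ get mm 3 0 = i, get mm 5 0 = \sum_(l < k) G i l,
    forall k, k < i -> get mm r k = F k &
    forall r' i', r' < 64 -> 5 < r' -> r' != r -> get mm r' i' = get m r' i'].
  apply: (@run_For 4 n2e _ n2 (fun=> 1) J) => //.
  + apply: (h1 i) => //; first by rewrite e1.
    by move=> r' i' r'64 r'5 r'r; rewrite e1 // (gtn_eqF r'5) /= a2.
  + move=> k mm mm' h [b1 b2 b3 b4]; split; rewrite ?h //.
      by move=> l li; rewrite h ?b3 // eq_sym nr.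
    by move=> r' i' r'64 r'5 r'r; rewrite h ?b4 // gtn_eqF // (leq_trans _ r'5).
  + split; rewrite ?big_ord0 ?e1 //.
      by move=> k ki; rewrite e1 // (gtn_eqF r5) a1.
    by move=> r' i' r'64 r'5 r'r; rewrite e1 // (gtn_eqF r'5) /= a2.
  + move=> k mm kn [b1 b2 b3 b4] jk.
    have ev := h2 i k mm i_n kn b1 jk b4.
    have sW : \sum_(l < k.+1) G i l < W.
      apply: leq_ltn_trans (h3 i i_n); rewrite -!(big_mkord xpredT (G i)).
      by rewrite [X in _ <= X](big_cat_nat (n := k.+1)) //= leq_addr.
    apply: run_SetV => //; first by rewrite !evalE ev b2 -(big_ord_recr k (op := addn) (G i)).
    move=> m2 e2; rewrite !evalE ev b2 in e2; split; rewrite ?e2 //.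
    * by rewrite big_ord_recr.
    * by move=> l li; rewrite e2 // (gtn_eqF r5) b3.
    by move=> r' i' r'64 r'5 r'r; rewrite e2 // (gtn_eqF r'5) /= b4.
  move=> m2 [b1 b2 b3 b4]; have [ev FW] := h4 i m2 i_n b1 b2 b4.
  apply: run_SetA => //; first by rewrite ev.
  move=> m3 e3; rewrite !evalE b1 ev in e3; split.
    move=> k; rewrite ltnS leq_eqVlt e3 // eqxx /=; case: eqP => [->//|_ /= ki]; exact: b3.
  by move=> r' i' r'64 r'5 r'r; rewrite e3 // (negPf r'r) /= b4.
by move=> m' [a1 a2]; apply: fin.
Qed.

End Programs.

(** * Multiplication of polynomials *)

Section Transform.
Local Open Scope ring_scope.
Variables (R : comNzRingType) (v : nat) (om : R).
Let D := (2 ^ v)%N.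
Let K := (2 * D)%N.
Hypothesis omD : om ^+ D = -1.

Let D0 : (0 < D)%N. Proof. by rewrite expn_gt0. Qed.
Let K0 : (0 < K)%N. Proof. by rewrite muln_gt0. Qed.

Lemma expr_om_mod a : om ^+ (a %% K) = om ^+ a.
Proof.
have omK : om ^+ K = 1 by rewrite /K mulnC exprM omD sqrrN expr1n.
by rewrite {2}(divn_eq a K) exprD mulnC exprM omK expr1n mul1r.
Qed.

Lemma geometric_sum_pow2 (x : R) n : \sum_(e < 2 ^ n) x ^+ e = \prod_(t < n) (1 + x ^+ (2 ^ t)).
Proof.
elim: n => [|n IH]; first by rewrite big_ord1 big_ord0 expr0.
rewrite big_ord_recr /= -IH expnS mul2n -addnn big_split_ord /=.
rewrite mulrDr mulr1 mulr_suml; congr (_ + _); apply: eq_bigr => e _.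
by rewrite -exprD addnC.
Qed.

(** The ring may have zero divisors, so the sum cannot be killed by multiplying it with om^a - 1.
    But K is a power of 2, the sum is a product of factors 1 + om^(a 2^t), and one of them is 1 +
    om^(D b) with b odd, which is 0. *)
Lemma sum_om a : \sum_(e < K) om ^+ (a * e) = if (K %| a)%N then K%:R else 0.
Proof.
have -> : \sum_(e < K) om ^+ (a * e) = \sum_(e < K) (om ^+ a) ^+ e.
  by apply: eq_bigr => e _; rewrite exprM.
case: ifP => Ka.
  rewrite -expr_om_mod (eqP (Ka : a %% K == 0)%N) expr0.
  by rewrite (eq_bigr (fun=> 1)) ?sumr_const ?card_ord // => e _; rewrite expr1n.
have a0 : (0 < a)%N by case: (posnP a) Ka => // ->; rewrite dvdn0.
rewrite /K /D -expnS geometric_sum_pow2.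
have [b bo ab] := pfactor_coprime (isT : prime 2) a0; rewrite coprime2n in bo.
set j := logn 2 a in ab.
have jv : (j <= v)%N.
  rewrite leqNgt; apply/negP=> vj; move: Ka; rewrite ab dvdn_mull //.
  by rewrite /K /D -expnS dvdn_exp2l.
rewrite (bigD1 (Ordinal (leq_subr j v : (v - j < v.+1)%N))) //= -exprM ab -mulnA -expnD.
by rewrite subnKC // mulnC exprM omD -signr_odd bo expr1 subrr mul0r.
Qed.

Lemma sum_ord_mul (V : nmodType) (a b : nat) (F : nat -> V) :
  \sum_(i < a * b) F i = \sum_(d < a) \sum_(j < b) F (d * b + j)%N.
Proof.
elim: a => [|a IH]; first by rewrite mul0n !big_ord0.
rewrite big_ord_recr /= -IH mulSn addnC big_split_ord /=; congr (_ + _).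
Qed.

Definition conv (len : nat) (x y : nat -> R) (m : nat) : R :=
  \sum_(i < len) \sum_(j < len) (x i * y j) *+ (i + j == m)%N.

(** An array holds polynomials of length D len one after another. Each is cut into D pieces of
    length len, the coefficients of a second variable, which is evaluated at the K powers of om: the
    entry (E K + e) len + i is coefficient i of the value of block E at om^e. With K = 2 D points
    the products do not wrap around. *)
Definition split_eval (len : nat) (y : nat -> R) (I : nat) : R :=
  \sum_(d < D) y ((I %/ len %/ K) * (D * len) + d * len + I %% len)%N *
    om ^+ ((d * (I %/ len %% K)) %% K).

(** The inverse transform without its division by K; the factors K are carried along and removed at
    the very end. *)
Definition inverse_eval (len : nat) (z : nat -> R) (I : nat) : R :=
  let F := (I %/ (2 * len))%N in
  \sum_(e < K) z ((F %/ K * K + e) * (2 * len) + I %% (2 * len))%N *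
    om ^+ ((K - (F %% K * e) %% K) %% K).

(** The second variable is replaced by the power of exponent len of the first. A product of pieces
    has length 2 len, so the upper half of piece d - 1 is added to the lower half of piece d. *)
Definition overlap_add (len : nat) (c : nat -> R) (I : nat) : R :=
  let E := (I %/ (2 * D * len))%N in
  let d := (I %% (2 * D * len) %/ len)%N in
  let i := (I %% len)%N in
  c ((E * K + d) * (2 * len) + i)%N +
  (if d is d'.+1 then c ((E * K + d') * (2 * len) + (len + i))%N else 0).

Section Level.
Variables (len : nat) (ya yb z : nat -> R) (kappa : R) (E : nat).
Hypothesis len0 : (0 < len)%N.
Let za := split_eval len ya.
Let zb := split_eval len yb.
Hypothesis zE : forall e m, (e < K)%N -> (m < 2 * len)%N ->
  z ((E * K + e) * (2 * len) + m)%N =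
  kappa * conv len (fun i => za ((E * K + e) * len + i)%N) (fun i => zb ((E * K + e) * len + i)%N) m.

Let A d i := ya (E * (D * len) + d * len + i)%N.
Let B d i := yb (E * (D * len) + d * len + i)%N.

Let split_evalE y e i : (e < K)%N -> (i < len)%N ->
  split_eval len y ((E * K + e) * len + i)%N =
  \sum_(d < D) y (E * (D * len) + d * len + i)%N * om ^+ (d * e).
Proof.
move=> eK il; rewrite /split_eval (divnMDl _ _ len0) (divn_small il) addn0 (divnMDl _ _ K0) (divn_small eK) addn0.
rewrite !modnMDl (modn_small il) (modn_small eK).
by apply: eq_bigr => d _; rewrite expr_om_mod.
Qed.

Lemma expr_om_neg d e : (d <= K)%N -> om ^+ ((K - (d * e) %% K) %% K) = om ^+ ((K - d) * e).
Proof.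
move=> dK; have omK : om ^+ K = 1 by rewrite /K mulnC exprM omD sqrrN expr1n.
have inj x y : om ^+ (d * e) * x = 1 -> om ^+ (d * e) * y = 1 -> x = y.
  by move=> hx hy; rewrite -[x]mulr1 -hy mulrA [x * _]mulrC hx mul1r.
apply: inj; rewrite ?expr_om_mod -exprD.
  by rewrite -expr_om_mod -modnDml subnKC ?modnn ?expr0 // ltnW // ltn_mod.
by rewrite -mulnDl subnKC // exprM omK expr1n.
Qed.

Lemma dvdn_offset a d : (a < K)%N -> (d < K)%N -> (K %| a + (K - d))%N = (a == d).
Proof.
move=> aK dK; case: (ltngtP a d) => ad.
- by rewrite gtnNdvd //; lia.
- have -> : (a + (K - d) = K + (a - d))%N by lia.
  by rewrite dvdn_addr // gtnNdvd //; lia.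
by rewrite ad subnKC ?dvdnn ?eqxx //; apply: ltnW.
Qed.

Lemma inverse_evalE d i : (d < K)%N -> (i < 2 * len)%N ->
  inverse_eval len z ((E * K + d) * (2 * len) + i)%N =
  K%:R * kappa * \sum_(d1 < D) \sum_(i1 < len) \sum_(d2 < D) \sum_(i2 < len)
    (A d1 i1 * B d2 i2) *+ ((d1 + d2 == d)%N && (i1 + i2 == i)%N).
Proof.
move=> dK il; have len2 : (0 < 2 * len)%N by rewrite muln_gt0.
rewrite /inverse_eval (divnMDl _ _ len2) (divn_small il) addn0 (divnMDl _ _ K0) (divn_small dK) addn0.
rewrite !modnMDl (modn_small dK) (modn_small il).
pose T (d1 : 'I_D) (i1 : 'I_len) (d2 : 'I_D) (i2 : 'I_len) (e : nat) :=
  kappa * (A d1 i1 * B d2 i2) *+ (i1 + i2 == i)%N * om ^+ ((d1 + d2 + (K - d)) * e).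
transitivity (\sum_(d1 < D) \sum_(i1 < len) \sum_(d2 < D) \sum_(i2 < len) \sum_(e < K) T d1 i1 d2 i2 e); last first.
  rewrite mulr_sumr; apply: eq_bigr => d1 _; rewrite mulr_sumr; apply: eq_bigr => i1 _.
  rewrite mulr_sumr; apply: eq_bigr => d2 _; rewrite mulr_sumr; apply: eq_bigr => i2 _.
  have d12 : (d1 + d2 < K)%N by have := ltn_ord d1; have := ltn_ord d2; rewrite /K; lia.
  rewrite -mulr_sumr sum_om dvdn_offset //; move: K%:R (A _ _) (B _ _) => k x y.
  by case: (_ =P d) => _; case: (_ =P i) => _ /=; rewrite ?mulr1n ?mulr0n ?mulr0 ?mul0r //; ring.
transitivity (\sum_(e < K) \sum_(d1 < D) \sum_(i1 < len) \sum_(d2 < D) \sum_(i2 < len) T d1 i1 d2 i2 e); last first.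
  rewrite exchange_big; apply: eq_bigr => d1 _; rewrite exchange_big; apply: eq_bigr => i1 _.
  by rewrite exchange_big; apply: eq_bigr => d2 _; rewrite exchange_big.
apply: eq_bigr => e _; rewrite expr_om_neg 1?ltnW // zE //.
rewrite exchange_big /= /conv mulr_sumr mulr_suml; apply: eq_bigr => i1 _.
transitivity (\sum_(i2 < len) \sum_(d1 < D) \sum_(d2 < D) T d1 i1 d2 i2 e); last first.
  by rewrite exchange_big; apply: eq_bigr => d1 _; rewrite exchange_big.
rewrite mulr_sumr mulr_suml; apply: eq_bigr => i2 _.
rewrite /za /zb !split_evalE // big_distrlr /= -sumrMnl mulr_sumr mulr_suml.
apply: eq_bigr => d1 _; rewrite -sumrMnl mulr_sumr mulr_suml; apply: eq_bigr => d2 _.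
rewrite /T -/(A _ _) -/(B _ _) !mulnDl !exprD.
case: (_ == _); rewrite ?mulr1n ?mulr0n ?mulr0 ?mul0r //; ring.
Qed.

Lemma carry_split s t d i : (t < 2 * len)%N -> (i < len)%N ->
  (((s == d) && (t == i)) + (if d is d'.+1 then (s == d') && (t == len + i) else false) =
   (s * len + t == d * len + i))%N.
Proof.
move=> t2 il; have dm a b r q : (r < len)%N -> (q < len)%N -> (a * len + r == b * len + q)%N = (a == b) && (r == q).
  move=> rl ql; apply/eqP/andP => [e|[/eqP-> /eqP->//]].
  have := congr1 (fun x => x %/ len)%N e; have := congr1 (fun x => x %% len)%N e.
  by rewrite /= !modnMDl !divnMDl // !divn_small // !addn0 !modn_small // => -> ->; rewrite !eqxx.
case: (ltnP t len) => tl.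
  rewrite dm //; case: d => [|d]; first by rewrite addn0.
  by rewrite [t == (len + i)%N]ltn_eqF ?andbF ?addn0 // ltn_addr.
have [u ut] : exists u, t = (len + u)%N by exists (t - len)%N; rewrite subnKC.
rewrite ut addnA -mulSnr dm //; last by move: t2; rewrite ut; lia.
rewrite [(len + u == i)%N]gtn_eqF ?andbF ?add0n ?ltn_addr //.
by case: d => // d; rewrite eqn_add2l eqSS.
Qed.

(** One level of the recursion: products of length len at the K points yield products of length D
    len, and the scalar kappa picks up a factor K. *)
Theorem overlap_addE m : (m < 2 * (D * len))%N ->
  overlap_add len (inverse_eval len z) (E * (2 * (D * len)) + m)%N =
  K%:R * kappa * conv (D * len) (fun i => ya (E * (D * len) + i)%N) (fun i => yb (E * (D * len) + i)%N) m.
Proof.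
move=> mD; have DL : (2 * D * len = 2 * (D * len))%N by rewrite mulnA.
have DL0 : (0 < 2 * (D * len))%N by rewrite !muln_gt0 D0.
have dK : (m %/ len < K)%N by rewrite ltn_divLR // /K -mulnA.
have il : (m %% len < len)%N by rewrite ltn_mod.
have ml : ((E * (2 * (D * len)) + m) %% len = m %% len)%N by rewrite !mulnA modnMDl.
rewrite /overlap_add DL (divnMDl _ _ DL0) (divn_small mD) addn0 modnMDl (modn_small mD) ml.
rewrite inverse_evalE //; last by apply: leq_trans il _; rewrite leq_pmull.
have -> : (if (m %/ len)%N is d'.+1 then inverse_eval len z ((E * K + d') * (2 * len) + (len + m %% len))%N else 0) =
   K%:R * kappa * \sum_(d1 < D) \sum_(i1 < len) \sum_(d2 < D) \sum_(i2 < len)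
    (A d1 i1 * B d2 i2) *+ (if (m %/ len)%N is d'.+1 then (d1 + d2 == d')%N && (i1 + i2 == len + m %% len)%N else false).
  case: (m %/ len)%N dK => [|d'] dK.
    by rewrite big1 ?mulr0 // => d1 _; rewrite big1 // => i1 _; rewrite big1 // => d2 _; rewrite big1.
  by rewrite inverse_evalE //; [exact: ltnW|rewrite mul2n -addnn ltn_add2l].
rewrite -mulrDr; congr (_ * _).
pose a i := ya (E * (D * len) + i)%N; pose b i := yb (E * (D * len) + i)%N.
rewrite /conv (sum_ord_mul D len (fun i => \sum_(j < D * len) (a i * b j) *+ (i + j == m)%N)).
rewrite -big_split; apply: eq_bigr => d1 _; rewrite -big_split; apply: eq_bigr => i1 _.
rewrite (sum_ord_mul D len (fun j => (a (d1 * len + i1)%N * b j) *+ (d1 * len + i1 + j == m)%N)).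
rewrite -big_split; apply: eq_bigr => d2 _.
rewrite -big_split; apply: eq_bigr => i2 _ /=; rewrite -mulrnDr carry_split //; last first.
  by have := ltn_ord i1; have := ltn_ord i2; lia.
rewrite -divn_eq /a /b /A /B !addnA; congr (_ *+ (nat_of_bool (_ == m))).
by rewrite mulnDl; lia.
Qed.
End Level.
End Transform.

Declare Scope prog_scope.
Delimit Scope prog_scope with prog.
Bind Scope prog_scope with cmd.
Infix "[+]" := (Op AAdd) (at level 50, left associativity) : prog_scope.
Infix "[-]" := (Op ASub) (at level 50, left associativity) : prog_scope.
Infix "[*]" := (Op AMul) (at level 40, left associativity) : prog_scope.
Infix "[/]" := (Op ADiv) (at level 40, left associativity) : prog_scope.
Infix "[%]" := (Op AMod) (at level 40, left associativity) : prog_scope.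
Infix ";;" := Seq (at level 61, right associativity) : prog_scope.
Notation "# n" := (Const n) (at level 1, format "# n") : prog_scope.

Lemma mul_add_ltn a A b B : a < A -> b < B -> a * B + b < A * B.
Proof. move=> aA bB; apply: (@leq_trans (a.+1 * B)); first by rewrite mulSnr ltn_add2l.
by rewrite leq_mul2r aA orbT. Qed.

Lemma leq_pow2_shift v : 4 <= v -> v + 9 <= 2 ^ v.
Proof.
move=> /subnKC<-; elim: (v - 4) => // k IH; rewrite addnS expnS; move: IH; set x := 2 ^ _; lia.
Qed.

(** Overflow control: K^t times a coefficient of the product, a sum of at most N terms below p^2, is
    to be recovered from its residue modulo p^D + 1. Since D^(t-1) < N <= 2 p the left side is at
    most p^(v + 9), and v + 9 <= 2^v for v >= 4, which is the origin of the lower bound 4. *)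
Lemma dft_size_bound p v N t : 1 < p -> 4 <= v -> N <= 2 * p -> (if t is s.+1 then (2 ^ v) ^ s < N else true) ->
  (2 * 2 ^ v) ^ t * N * p ^ 2 <= p ^ (2 ^ v).
Proof.
move=> p1 v4 Np ht; have p0 : 0 < p by lia.
have pv : p ^ (v + 9) <= p ^ (2 ^ v) by rewrite leq_pexp2l // leq_pow2_shift.
apply: leq_trans pv; case: t ht => [_|s sN].
  rewrite expn0 mul1n; apply: (@leq_trans (p ^ 4)).
    by rewrite (expnS p 3) (expnS p 2) mulnA leq_mul // (leq_trans Np) // leq_mul.
  by rewrite leq_pexp2l //; lia.
have s2 : 2 ^ s <= N.
  by apply: leq_trans (ltnW sN); rewrite -expnM leq_pexp2l //; case: (v) v4 => // w _; nia.
have -> : (2 * 2 ^ v) ^ s.+1 * N * p ^ 2 = 2 ^ s * (2 ^ v) ^ s * N * (2 ^ v.+1 * p ^ 2).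
  by rewrite expnMn !expnS !expn0; ring.
have N3 : 2 ^ s * (2 ^ v) ^ s * N <= 2 ^ 3 * p ^ 3.
  apply: (@leq_trans (N ^ 3)); last by rewrite -expnMn leq_exp2r.
  by rewrite !expnS expn0 muln1 mulnA !leq_mul // ltnW.
apply: leq_trans (leq_mul N3 (leqnn _)) _.
have -> : 2 ^ 3 * p ^ 3 * (2 ^ v.+1 * p ^ 2) = 2 ^ (v + 4) * p ^ 5.
  by rewrite mulnACA -!expnD; congr (2 ^ _ * _); lia.
rewrite -[v + 9](_ : v + 4 + 5 = _) ?expnD ?leq_mul //; last by lia.
by rewrite leq_exp2r; lia.
Qed.

Lemma conv_coef (R : comNzRingType) len (x y : nat -> R) m : m < len ->
  conv len x y m = (\sum_(i < m.+1) x i * y (m - i)%N)%R.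
Proof.
move=> ml; rewrite /conv -!(big_mkord xpredT (fun i => \sum_(j < len) (x i * y j) *+ ((i + j)%N == m))%R).
rewrite (big_cat_nat (n := m.+1)) //= [X in (_ + X)%R]big_nat_cond [X in (_ + X)%R]big1 ?addr0.
  rewrite big_mkord; apply: eq_bigr => i _; have im : i <= m by have := ltn_ord i.
  have jl : m - i < len by apply: leq_ltn_trans ml; apply: leq_subr.
  rewrite (bigD1 (Ordinal jl)) //= subnKC // eqxx big1 ?addr0 ?mulr1n // => j.
  by rewrite -val_eqE /= => jm; rewrite (_ : (i + j == m)%N = false) ?mulr0n //; apply/eqP; move/eqP: jm; lia.
move=> i /andP[/andP[mi _] _]; rewrite big1 // => j _.
by rewrite (_ : (i + j == m)%N = false) ?mulr0n //; apply/eqP; lia.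
Qed.

(** * The multiplication program *)

Section Multiplication.
Variables (p v W : nat).
Let D := 2 ^ v.
Let K := 2 * D.
Let M := p ^ D + 1.
Hypotheses (pp : prime p) (v4 : 4 <= v) (pv : 2 * p <= D ^ v) (MW : M ^ 3 <= W).
Let R := 'Z_M.

(** The root of unity is p itself, as p^D = -1 modulo M, so none has to be searched for; register 9
    tabulates its powers. *)
Definition env (m : memory) :=
  [/\ get m 0 0 = p, get m 6 0 = v, get m 7 0 = D, get m 8 0 = M &
      (forall i, i < K -> get m 9 i = p ^ i %% M) /\ get m 10 0 = v * v].

Lemma env_mods c m m' : all (fun r => ~~ mods c r) [:: 0; 6; 7; 8; 9; 10] ->
  (forall r i, r < 64 -> ~~ mods c r -> get m' r i = get m r i) -> env m -> env m'.
Proof.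
move=> /and5P[c0 c6 c7 c8 /and3P[c9 c10 _]] fr [h0 h6 h7 h8 [h9 h10]]; split; rewrite ?fr //.
by split; rewrite ?fr // => i iK; rewrite fr // h9.
Qed.

Let D0 : 0 < D. Proof. by rewrite expn_gt0. Qed.
Let D1 : 1 < D. Proof. by rewrite -{1}(expn0 2) ltn_exp2l; lia. Qed.
Let K0 : 0 < K. Proof. by rewrite muln_gt0. Qed.
Let p1 : 1 < p. Proof. exact: prime_gt1. Qed.
Let M1 : 1 < M. Proof. by rewrite /M addn1 ltnS expn_gt0 prime_gt0. Qed.
Let KM : K <= M.
Proof.
rewrite /K /D -expnS; apply: (@leq_trans (2 ^ D)); last first.
  by rewrite /M; apply: leq_trans (leq_addr _ _); rewrite leq_exp2r.
rewrite leq_exp2l //; have := leq_pow2_shift v4; rewrite -/D; lia.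
Qed.
(** The largest intermediate numbers are sums of at most K <= M products of two residues, hence the
    requirement M^3 <= W. *)
Let sumW n (F : nat -> nat) : n <= K -> (forall i, i < n -> F i < M * M) -> \sum_(i < n) F i < W.
Proof.
move=> nK FM; have [->|n0] := posnP n; first by rewrite big_ord0; apply: leq_trans MW; rewrite expn_gt0; lia.
apply: (@leq_trans (n * (M * M))); last by apply: leq_trans MW; rewrite !expnS expn0 muln1 leq_mul // (leq_trans nK).
apply: (@leq_ltn_trans (\sum_(i < n) (M * M).-1)).
  by apply: leq_sum => i _; have := FM i (ltn_ord i); lia.
by rewrite sum_nat_const card_ord ltn_mul2l n0; lia.
Qed.
Let MltW x : x < M -> x < W.
Proof. by move=> xM; apply: leq_trans MW; rewrite !expnS; nia. Qed.

Let KW : K < W.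
Proof. by apply: leq_ltn_trans KM _; apply: leq_trans MW; rewrite !expnS; nia. Qed.

Let vW : v < W.
Proof. by apply: leq_ltn_trans KW; apply: leq_trans (ltnW (ltn_expl v (isT : 1 < 2))) _; rewrite leq_pmull. Qed.
Let pM : p <= M.
Proof. by rewrite /M; apply: leq_trans (leq_addr _ _); rewrite -{1}(expn1 p) leq_pexp2l //; lia. Qed.

Definition om : R := (p%:R)%R.
Lemma omD : (om ^+ D = -1)%R.
Proof.
apply/eqP; rewrite -addr_eq0 /om -natrX -(natrD _ _ 1) -/M.
by rewrite -(Zp_nat_mod M1) modnn.
Qed.

Local Open Scope prog_scope.

Definition split_level r := SumTab 17 (Var 19) (Var 7)
   (Arr r (Var 3 [/] Var 18 [/] (#2 [*] Var 7) [*] (Var 7 [*] Var 18) [+] Var 4 [*] Var 18 [+] Var 3 [%] Var 18)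
     [*] Arr 9 (Var 4 [*] (Var 3 [/] Var 18 [%] (#2 [*] Var 7)) [%] (#2 [*] Var 7)))
   (Var 5 [%] Var 8) ;;
  Tab r (Var 19) (Arr 17 (Var 3)).

(* Entries of a register read as elements of the ring of integers modulo M. *)
Definition residues (m : memory) r n (y : nat -> R) :=
  forall i, i < n -> get m r i < M /\ ((get m r i)%:R = y i)%R.

Lemma run_split_level r len E (y : nat -> R) m (Q : memory -> Prop) : r \in [:: 15; 16] -> env m ->
  get m 18 0 = len -> get m 19 0 = E * K * len -> 0 < len -> E * K * len < M ->
  residues m r (E * (D * len)) y ->
  (forall m', residues m' r (E * K * len) (split_eval v om len y) -> Q m') ->
  run W (split_level r) (E * K * len * (3 * D + 10) + 6) Q m.
Proof.
move=> rr [e0 e6 e7 e8 [e9 e10]] e18 e19 len0 cM hy fin.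
have [r64 r3 r17 r5] : [/\ r < 64, r != 3, r != 17 & 5 < r] by move: rr; rewrite !inE => /orP[]/eqP->.
set cnt := E * K * len in e19 cM *.
have cW : cnt < W := MltW cM.
pose G i k := get m r (i %/ len %/ K * (D * len) + k * len + i %% len) * (p ^ ((k * (i %/ len %% K)) %% K) %% M).
pose F i := (\sum_(k < D) G i k) %% M.
have idx i k : i < cnt -> k < D -> i %/ len %/ K * (D * len) + k * len + i %% len < E * (D * len).
  move=> ic kD; rewrite mulnA -mulnDl mulnA; apply: mul_add_ltn; last by rewrite ltn_mod.
  by apply: mul_add_ltn => //; rewrite !ltn_divLR.
have GM i k : i < cnt -> k < D -> G i k < M * M.
  by move=> ic kD; rewrite /G ltn_mul ?ltn_mod //; [case: (hy _ (idx i k ic kD))|lia].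
apply: (@run_weaken _ _ ((cnt * (3 * D + 7) + 3) + (3 * cnt + 3)) _ Q Q) => //; first by lia.
apply: run_seq; apply: (@run_SumTab _ 17 _ _ _ _ cnt D G F) => //.
- by apply: MltW; apply: leq_trans KM; rewrite /K; lia.
- by move=> i m' ic j3 fr; rewrite !evalE fr.
- by move=> i k m' ic kD j3 j4 fr; rewrite !evalE j3 j4 !fr // e18 e7 /G -/K (e9 _ (ltn_pmod _ K0)).
- by move=> i ic; apply: sumW; [rewrite /K; lia|move=> k kD; exact: GM].
- move=> i m' ic j3 j5 fr; rewrite !evalE j5 fr // e8; split=> //.
  by apply: MltW; rewrite ltn_mod; lia.
move=> m1 h1 fr1; apply: (@run_Tab _ r _ _ cnt F) => //.
- by rewrite !evalE fr1.
- move=> i m' ic j3 fr _ _; rewrite !evalE j3 fr // ?(eq_sym 17) // h1 //; split=> //.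
  by apply: MltW; rewrite ltn_mod; lia.
move=> m2 h2 _ _; apply: fin => i ic.
rewrite h2 //; split; first by rewrite ltn_mod; lia.
rewrite /F (Zp_nat_mod M1) natr_sum /split_eval; apply: eq_bigr => k _.
rewrite natrM; have [_ ->] := hy _ (idx i k ic (ltn_ord k)).
by rewrite (Zp_nat_mod M1) natrX.
Qed.

(* The entry of index d-1 is fetched with weight 1-(1-d), which is 0 when d = 0. *)
Definition merge_level :=
  SumTab 15 (Var 19) (#2 [*] Var 7)
    (Arr 17 ((Var 3 [/] (#2 [*] Var 18) [/] (#2 [*] Var 7) [*] (#2 [*] Var 7) [+] Var 4) [*] (#2 [*] Var 18)
              [+] Var 3 [%] (#2 [*] Var 18))
     [*] Arr 9 ((#2 [*] Var 7 [-] (Var 3 [/] (#2 [*] Var 18) [%] (#2 [*] Var 7) [*] Var 4) [%] (#2 [*] Var 7)) [%] (#2 [*] Var 7)))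
    (Var 5 [%] Var 8) ;;
  SetV 19 (Var 19 [/] #2) ;;
  Tab 17 (Var 19)
    ((Arr 15 ((Var 3 [/] (#2 [*] Var 7 [*] Var 18) [*] (#2 [*] Var 7)
        [+] Var 3 [%] (#2 [*] Var 7 [*] Var 18) [/] Var 18) [*] (#2 [*] Var 18) [+] Var 3 [%] Var 18)
      [+] (#1 [-] (#1 [-] Var 3 [%] (#2 [*] Var 7 [*] Var 18) [/] Var 18)) [*]
       Arr 15 ((Var 3 [/] (#2 [*] Var 7 [*] Var 18) [*] (#2 [*] Var 7)
        [+] (Var 3 [%] (#2 [*] Var 7 [*] Var 18) [/] Var 18 [-] #1)) [*] (#2 [*] Var 18) [+] (Var 18 [+] Var 3 [%] Var 18)))
     [%] Var 8).

Lemma run_merge_level len E (z : nat -> R) m (Q : memory -> Prop) : env m ->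
  get m 18 0 = len -> get m 19 0 = E * K * (2 * len) -> 0 < len -> E * K * (2 * len) < M ->
  residues m 17 (E * K * (2 * len)) z ->
  (forall m', get m' 19 0 = E * (2 * (D * len)) ->
     residues m' 17 (E * (2 * (D * len))) (overlap_add v len (inverse_eval v om len z)) -> Q m') ->
  run W merge_level (E * K * (2 * len) * (3 * K + 10) + 7) Q m.
Proof.
move=> [e0 e6 e7 e8 [e9 e10]] e18 e19 len0 cM hy fin.
have half : E * K * (2 * len) %/ 2 = E * (2 * (D * len)).
  by rewrite [2 * len]mulnC !mulnA mulnK // !mulnA.
set cnt := E * K * (2 * len) in e19 cM half hy *.
have cW : cnt < W := MltW cM.
have half_cnt : E * (2 * (D * len)) <= cnt by rewrite -half leq_div.
have len2 : 0 < 2 * len by rewrite muln_gt0.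
have DL0 : 0 < 2 * D * len by rewrite !muln_gt0 D0.
pose ix i k := (i %/ (2 * len) %/ K * K + k) * (2 * len) + i %% (2 * len).
pose G i k := get m 17 (ix i k) * (p ^ ((K - (i %/ (2 * len) %% K * k) %% K) %% K) %% M).
pose F i := (\sum_(k < K) G i k) %% M.
have idx i k : i < cnt -> k < K -> ix i k < cnt.
  move=> ic kK; apply: mul_add_ltn; last by rewrite ltn_mod.
  by apply: mul_add_ltn => //; rewrite !ltn_divLR.
have GM i k : i < cnt -> k < K -> G i k < M * M.
  by move=> ic kK; rewrite /G ltn_mul ?ltn_mod //; [case: (hy _ (idx i k ic kK))|lia].
have FR i : i < cnt -> ((F i)%:R = inverse_eval v om len z i :> R)%R.
  move=> ic; rewrite /F (Zp_nat_mod M1) natr_sum /inverse_eval; apply: eq_bigr => k _.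
  by rewrite natrM; have [_ ->] := hy _ (idx i k ic (ltn_ord k)); rewrite (Zp_nat_mod M1) natrX.
pose dd i := i %% (2 * D * len) %/ len.
pose i1 i d := (i %/ (2 * D * len) * K + d) * (2 * len) + i %% len.
pose i2 i d := (i %/ (2 * D * len) * K + d) * (2 * len) + (len + i %% len).
have ddK i : dd i < K by rewrite ltn_divLR // ltn_mod.
have i1c i d : i < E * (2 * (D * len)) -> d < K -> i1 i d < cnt.
  move=> ic dK; apply: mul_add_ltn; last by have := ltn_pmod i len0; lia.
  by apply: mul_add_ltn => //; rewrite ltn_divLR // -mulnA.
have i2c i d : i < E * (2 * (D * len)) -> d < K -> i2 i d < cnt.
  move=> ic dK; apply: mul_add_ltn; last by have := ltn_pmod i len0; lia.
  by apply: mul_add_ltn => //; rewrite ltn_divLR // -mulnA.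
pose H i := (F (i1 i (dd i)) + (1 - (1 - dd i)) * F (i2 i (dd i - 1))) %% M.
apply: (@run_weaken _ _ ((cnt * (3 * K + 7) + 3) + (1 + (3 * (E * (2 * (D * len))) + 3))) _ Q Q) => //; first by lia.
apply: run_seq; apply: (@run_SumTab _ 15 _ _ _ _ cnt K G F) => //.
- by move=> i m' ic j3 fr; rewrite !evalE fr // e7.
- by move=> i k m' ic kK j3 j4 fr; rewrite !evalE j3 j4 !fr // e18 e7 /G -/K (e9 _ (ltn_pmod _ K0)).
- by move=> i ic; apply: sumW; [|move=> k kK; exact: GM].
- move=> i m' ic j3 j5 fr; rewrite !evalE j5 fr // e8; split=> //.
  by apply: MltW; rewrite ltn_mod; lia.
move=> m1 h1 fr1; apply: run_seq; apply: run_SetV => //.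
  by rewrite !evalE fr1 // e19 half (leq_ltn_trans half_cnt).
move=> m2 h2; rewrite !evalE fr1 // e19 half in h2.
apply: (@run_Tab _ 17 _ _ (E * (2 * (D * len))) H) => //.
- by rewrite !evalE h2.
- exact: leq_ltn_trans half_cnt cW.
- move=> i m' ic j3 fr _ _;
  have g7 : get m' 7 0 = D by rewrite fr // h2 //= fr1.
  have g8 : get m' 8 0 = M by rewrite fr // h2 //= fr1.
  have g18 : get m' 18 0 = len by rewrite fr // h2 //= fr1.
  have g15 k : get m' 15 k = get m1 15 k by rewrite fr // h2.
  rewrite !evalE j3 g7 g8 g18 !g15 -/K -/(dd i).
  rewrite -/(i1 i (dd i)) -/(i2 i (dd i - 1)) !h1 ?i1c ?i2c //; last first.
  + by apply: leq_ltn_trans (ddK i); apply: leq_subr.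
  split=> //; by apply: MltW; rewrite ltn_mod; lia.
move=> m3 h3 _ fr3; apply: fin; first by rewrite fr3 // h2.
move=> i ic; rewrite h3 //; split; first by rewrite ltn_mod; lia.
rewrite /H (Zp_nat_mod M1) natrD natrM FR ?i1c // /overlap_add -/(dd i).
congr (_ + _)%R; case edd: (dd i) => [|d'] //=; first by rewrite mul0r.
rewrite subn1 /= FR ?i2c // ?mul1r //; by apply: leq_ltn_trans (ddK i); rewrite edd.
Qed.

(** Finds the least t with N <= D^t. Its minimality gives D^(t-1) < N, on which the overflow bound
    and the running time rest. *)
Definition grow_length :=
  SetV 18 #1 ;; SetV 20 #0 ;;
  While (Var 13 [-] Var 18) (SetV 18 (Var 18 [*] Var 7) ;; SetV 20 (Var 20 [+] #1)).

Lemma run_grow_length N m (Q : memory -> Prop) : env m -> 0 < N <= 2 * p -> get m 13 0 = N ->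
  (forall m' t, get m' 18 0 = D ^ t -> get m' 20 0 = t -> N <= D ^ t -> t <= v ->
     (if t is s.+1 then D ^ s < N else true) -> Q m') ->
  run W grow_length (3 * v + 3) Q m.
Proof.
move=> [e0 e6 e7 e8 _] /andP[N0 N2p] e13 fin.
have ex : exists t, N <= D ^ t by exists v; apply: leq_trans pv.
case: (ex_minnP ex) => t tN tmin.
have tv : t <= v by apply: tmin; apply: leq_trans pv.
have lt s : s < t -> D ^ s < N by move=> st; rewrite ltnNge; apply/negP => /tmin; lia.
apply: (@run_weaken _ _ (1 + (1 + (\sum_(i < t) (1 + 1).+1).+1)) _ Q Q) => //.
  by rewrite sum_nat_const card_ord; lia.
have DW s : s <= t -> D ^ s < W.
  move=> st; apply: MltW; apply: (@leq_ltn_trans (D * (2 * p))).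
    case: s st => [|s] st; first by rewrite expn0 muln_gt0 D0; lia.
    by rewrite expnS leq_mul2l; apply/orP; right; apply: leq_trans (ltnW (lt s st)) _.
  have : 2 ^ (v + 2) * p <= p ^ D.
    apply: (@leq_trans (p ^ (v + 9))); last by rewrite leq_pexp2l ?leq_pow2_shift //; lia.
    rewrite (_ : v + 9 = v + 2 + 7); last by lia.
    rewrite (expnD p) leq_mul // ?leq_exp2r //; first by lia.
    by rewrite -{1}(expn1 p) leq_exp2l.
  by rewrite expnD -/D /M; have := D0; nia.
have tW : t < W by apply: leq_ltn_trans tv vW.
apply: run_seq; apply: run_SetV => //; first exact: (DW 0).
move=> m1 h1; apply: run_seq; apply: run_SetV => //; first exact: leq_ltn_trans tW.
move=> m2 h2.
pose I i m' := [/\ get m' 18 0 = D ^ i, get m' 20 0 = i, get m' 13 0 = N & get m' 7 0 = D].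
apply: (@run_while _ I (fun=> 1 + 1)).
- by split; rewrite h2 //= h1.
- move=> i m' it [i18 i20 i13 i7]; split; first by rewrite !evalE i13 i18; have := lt i it; lia.
  apply: run_seq; apply: run_SetV => //; rewrite !evalE i18 i7 -expnSr; first exact: DW.
  move=> m3 h3; apply: run_SetV => //; rewrite !evalE h3 //= i20 addn1; first exact: leq_ltn_trans tW.
  by move=> m4 h4; split; rewrite h4 //= h3.
move=> m' [i18 i20 i13 i7]; split; first by rewrite !evalE i13 i18; apply/eqP.
by apply: (fin m' t) => //; case: (t) lt => // s; apply.
Qed.

(** Truncated subtraction serves as a condition: 1 - (i + 1 - N) is 1 for i < N and 0 otherwise. The
    same device replaces case distinctions in the programs below. *)
Definition pad_operand r s := Tab r (Var 19) ((#1 [-] (Var 3 [+] #1 [-] Var 13)) [*] Arr s (Var 3)).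
Definition forward_levels :=
  For 22 (Var 20) (SetV 18 (Var 18 [/] Var 7) ;; SetV 19 (#2 [*] Var 19) ;; split_level 15 ;; split_level 16).
(** Pieces have length 1 here, and their products occupy length 2, so that each product is followed
    by a 0. *)
Definition pointwise_product :=
  SetV 19 (#2 [*] Var 19) ;;
  Tab 17 (Var 19) ((Arr 15 (Var 3 [/] #2) [*] Arr 16 (Var 3 [/] #2)) [%] Var 8 [*] (#1 [-] Var 3 [%] #2)).
Definition backward_levels :=
  SetV 21 #1 ;;
  For 22 (Var 20) (merge_level ;; SetV 18 (Var 18 [*] Var 7) ;; SetV 21 (Var 21 [*] (#2 [*] Var 7))).

(** Operands in registers 11 and 12, length N in 13; register 14 receives the first N coefficients
    of the product. Register 21 has accumulated K^t, and the division by it is exact. *)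
Definition MUL :=
  grow_length ;; SetV 19 (Var 18) ;; pad_operand 15 11 ;; pad_operand 16 12 ;;
  forward_levels ;; pointwise_product ;; backward_levels ;;
  Tab 14 (Var 13) (Arr 17 (Var 3) [/] Var 21 [%] Var 0).

Fixpoint transform t (y : nat -> R) j : nat -> R :=
  if j is j'.+1 then split_eval v om (D ^ (t - j)) (transform t y j') else y.

Lemma run_pad_operand (r s L N : nat) m (Q : memory -> Prop) : r \in [:: 15; 16] -> s \in [:: 11; 12] ->
  get m 19 0 = L -> get m 13 0 = N -> L < M -> (forall i, i < N -> get m s i < p) ->
  (forall m', residues m' r L (fun i => if i < N then ((get m s i)%:R)%R else 0%R) -> Q m') ->
  run W (pad_operand r s) (3 * L + 3) Q m.
Proof.
move=> rr ss e19 e13 LM sp fin.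
have [r64 s64 r3 s3 [rs r13]] : [/\ r < 64, s < 64, r != 3, s != 3 & s != r /\ 13 != r].
  by move: rr ss; rewrite !inE => /orP[]/eqP-> /orP[]/eqP->.
pose F i := if i < N then get m s i else 0.
have FM i : F i < M by rewrite /F; case: ifP => [iN|_]; [exact: leq_trans (sp i iN) pM|exact: ltnW M1].
apply: (@run_Tab _ r _ _ L F) => //; first exact: MltW.
  move=> i m' it j3 fr _ _; rewrite !evalE j3 !fr // e13; split; last exact: MltW.
  by rewrite /F; case: ltnP => iN; [rewrite (_ : i + 1 - N = 0) ?mul1n //; lia | rewrite (_ : 1 - _ = 0) ?mul0n //; lia].
move=> m' h _ _; apply: fin => i iL; rewrite h //; split=> //.
by rewrite /F; case: ifP.
Qed.

Section Levels.
Variables (t : nat).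
Hypotheses (tv : t <= v) (KtM : 2 * K ^ t < M).
Let C := 2 * K ^ t.

Let Dt0 j : 0 < D ^ j. Proof. by rewrite expn_gt0 D0. Qed.
Let Kt0 j : 0 < K ^ j. Proof. by rewrite expn_gt0 K0. Qed.
Let cntC j : j <= t -> K ^ j * D ^ (t - j) <= K ^ t.
Proof.
move=> jt; rewrite -{2}(subnKC jt) expnD leq_mul2l; apply/orP; right.
by case: (t - j) => // s; rewrite leq_exp2r // /K; lia.
Qed.

Lemma run_forward_levels a b m (Q : memory -> Prop) : env m ->
  get m 18 0 = D ^ t -> get m 19 0 = D ^ t -> get m 20 0 = t ->
  residues m 15 (D ^ t) a -> residues m 16 (D ^ t) b ->
  (forall m', get m' 18 0 = 1 -> get m' 19 0 = K ^ t ->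
     residues m' 15 (K ^ t) (transform t a t) -> residues m' 16 (K ^ t) (transform t b t) -> Q m') ->
  run W forward_levels (t * (2 * (C * (3 * D + 10) + 6) + 4) + 3) Q m.
Proof.
move=> me e18 e19 e20 ra rb fin.
pose cnt j := K ^ j * D ^ (t - j).
pose I j m' := [/\ env m', get m' 18 0 = D ^ (t - j), get m' 19 0 = cnt j,
   residues m' 15 (cnt j) (transform t a j) & residues m' 16 (cnt j) (transform t b j)].
apply: (@run_weaken _ _ (\sum_(i < t) (2 * (C * (3 * D + 10) + 6) + 2 + 2) + 3) _ Q) => //.
  by rewrite sum_nat_const card_ord leq_add2r leq_mul2l; apply/orP; right; lia.
apply: (@run_For _ 22 _ _ t (fun=> 2 * (C * (3 * D + 10) + 6) + 2) I) => //.
- exact: leq_ltn_trans tv vW.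
- move=> i m1 m2 h [i1 i2 i3 i4 i5].
  have res r : r \in [:: 15; 16] -> forall n y, residues m1 r n y -> residues m2 r n y.
    by move=> rr n y hr k kn; rewrite h; [exact: hr| |]; move: rr; rewrite !inE => /orP[]/eqP->.
  split; rewrite ?h //; try exact: res.
  by case: i1 => ? ? ? ? [g9 ?]; split; rewrite ?h //; split; rewrite ?h // => k kK; rewrite h // g9.
- by split; rewrite /cnt ?subn0 ?mul1n.
- move=> i m' it [i1 i2 i3 i4 i5] _.
  set len := D ^ (t - i.+1).
  have lenE : D ^ (t - i) = D * len by rewrite /len -expnS; congr (_ ^ _); lia.
  have cntE : cnt i.+1 = K ^ i * K * len by rewrite /cnt expnSr.
  have cntS : cnt i.+1 <= K ^ t by apply: cntC.
  have cntM : cnt i.+1 < M by apply: leq_ltn_trans cntS _; lia.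
  apply: (@run_weaken _ _ (1 + (1 + ((cnt i.+1 * (3 * D + 10) + 6) + (cnt i.+1 * (3 * D + 10) + 6)))) _ (I i.+1)) => //.
    have : cnt i.+1 * (3 * D + 10) <= C * (3 * D + 10) by rewrite leq_mul2r; apply/orP; right; rewrite /C; lia.
    by lia.
  have [g0 g6 g7 g8 g9] := i1.
  apply: run_seq; apply: run_frame; apply: run_SetV => //; rewrite !evalE i2 g7 lenE mulKn //.
    apply: MltW; apply: leq_ltn_trans cntM; rewrite cntE leq_pmull // muln_gt0 Kt0 //.
  move=> m1 h1 fr1; have e1 := env_mods (c := SetV 18 (Var 18 [/] Var 7)) isT fr1 i1.
  have cE : 2 * cnt i = cnt i.+1 by rewrite cntE /cnt lenE /K; lia.
  apply: run_seq; apply: run_frame; apply: run_SetV => //; rewrite !evalE h1 //= i3 cE; first exact: MltW.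
  move=> m2 h2 fr2; have e2 := env_mods (c := SetV 19 (#2 [*] Var 19)) isT fr2 e1.
  have g18 : get m2 18 0 = len by rewrite h2 //= h1.
  have g19 : get m2 19 0 = K ^ i * K * len by rewrite h2 //= cntE.
  have res r : r \in [:: 15; 16] -> forall y, residues m' r (cnt i) y -> residues m2 r (K ^ i * (D * len)) y.
    move=> rr y hr k kn; rewrite fr2 ?fr1; try by move: rr; rewrite !inE => /orP[]/eqP->.
    by apply: hr; rewrite /cnt lenE.
  have len0 : 0 < len by apply: Dt0.
  rewrite cntE in cntM *.
  apply: run_seq; apply: run_frame; apply: (run_split_level (E := K ^ i) (len := len) (y := transform t a i)) => //.
    exact: res.
  move=> m3 r3 fr3; have e3 := env_mods (c := split_level 15) isT fr3 e2.
  apply: run_frame; apply: (run_split_level (E := K ^ i) (len := len) (y := transform t b i)) => //; rewrite ?fr3 //.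
    by move=> k kn; rewrite fr3 //; apply: (res 16).
  move=> m4 r4 fr4; have e4 := env_mods (c := split_level 16) isT fr4 e3.
  by split=> //; rewrite ?cntE ?fr4 ?fr3 // => k kn; rewrite fr4 //; apply: r3.
by move=> m' [i1 i2 i3 i4 i5]; apply: fin; move: i2 i3 i4 i5; rewrite /cnt subnn muln1.
Qed.

Lemma run_pointwise_product a b m (Q : memory -> Prop) : env m -> get m 19 0 = K ^ t ->
  residues m 15 (K ^ t) a -> residues m 16 (K ^ t) b ->
  (forall m', get m' 19 0 = C ->
     residues m' 17 C (fun i => if odd i then 0%R else (a i./2 * b i./2)%R) -> Q m') ->
  run W pointwise_product (3 * C + 4) Q m.
Proof.
move=> [e0 e6 e7 e8 _] e19 ra rb fin.
apply: (@run_weaken _ _ (1 + (3 * C + 3)) _ Q) => //; first by lia.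
apply: run_seq; apply: run_SetV => //; rewrite !evalE e19; first exact: MltW.
move=> m1 h1.
pose F i := if odd i then 0 else (get m 15 i./2 * get m 16 i./2) %% M.
have FM i : F i < M by rewrite /F; case: ifP => _; [exact: ltnW M1|exact: ltn_pmod _ (ltnW M1)].
apply: (@run_Tab _ 17 _ _ C F) => //; first by rewrite !evalE h1.
- exact: MltW.
- move=> i m' iC j3 fr _ _.
  have g8 : get m' 8 0 = M by rewrite fr // h1.
  have g15 k : get m' 15 k = get m 15 k by rewrite fr // h1.
  have g16 k : get m' 16 k = get m 16 k by rewrite fr // h1.
  rewrite !evalE j3 g8 g15 g16 divn2 modn2 /F; split; last by apply: MltW; exact: FM i.
  by case: (odd i); rewrite ?muln1 ?muln0.
move=> m' h _ fr; apply: fin; first by rewrite fr // h1.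
move=> i iC; rewrite h //; split=> //; rewrite /F; case: ifP => // oi.
have iK : i./2 < K ^ t by move: iC; rewrite /C -{1}(odd_double_half i) oi add0n -mul2n ltn_mul2l.
by rewrite (Zp_nat_mod M1) natrM; have [_ ->] := ra _ iK; have [_ ->] := rb _ iK.
Qed.

Lemma run_backward_levels a b m (Q : memory -> Prop) : env m ->
  get m 18 0 = 1 -> get m 19 0 = C -> get m 20 0 = t ->
  residues m 17 C (fun i => if odd i then 0%R else (transform t a t i./2 * transform t b t i./2)%R) ->
  (forall m', get m' 21 0 = K ^ t ->
     residues m' 17 (2 * D ^ t) (fun i => ((K ^ t)%:R * conv (D ^ t) a b i)%R) -> Q m') ->
  run W backward_levels (t * (C * (3 * K + 10) + 11) + 4) Q m.
Proof.
move=> me e18 e19 e20 rc fin.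
pose cnt j := K ^ (t - j) * (2 * D ^ j).
pose val (m : memory) i : R := ((get m 17 i)%:R)%R.
(* After j levels K^(t-j) blocks remain, each holding K^j times the product of the corresponding
   blocks of forward level t - j. *)
pose I j m' := [/\ env m', get m' 18 0 = D ^ j, get m' 19 0 = cnt j /\ get m' 21 0 = K ^ j,
   forall k, k < cnt j -> get m' 17 k < M &
   forall E k, E < K ^ (t - j) -> k < 2 * D ^ j -> val m' (E * (2 * D ^ j) + k) =
     ((K ^ j)%:R * conv (D ^ j) (fun i => transform t a (t - j) (E * D ^ j + i)%N)
                                (fun i => transform t b (t - j) (E * D ^ j + i)%N) k)%R].
apply: (@run_weaken _ _ (1 + (\sum_(i < t) (C * (3 * K + 10) + 7 + 2 + 2) + 3)) _ Q) => //.
  rewrite sum_nat_const card_ord [X in _ <= X]addnC -[4]/(1 + 3) -addnA leq_add2l [X in X <= _]addnC leq_add2l leq_mul2l.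
  by apply/orP; right; lia.
apply: run_seq; apply: run_frame; apply: run_SetV => //; first by apply: MltW; rewrite !evalE; exact: M1.
move=> m0 h0 fr0; have e0 := env_mods (c := SetV 21 #1) isT fr0 me.
apply: (@run_For _ 22 _ _ t (fun=> C * (3 * K + 10) + 7 + 2) I) => //.
- by rewrite !evalE h0.
- exact: leq_ltn_trans tv vW.
- move=> i m1 m2 h [i1 i2 [i3 i4] i5 i6]; split; rewrite ?h //.
  + by case: i1 => ? ? ? ? [g9 ?]; split; rewrite ?h //; split; rewrite ?h // => k kK; rewrite h // g9.
  + by move=> k kc; rewrite h // i5.
  by move=> E k EK kD; rewrite /val h // -i6.
- split=> //; rewrite ?h0 //.
  + by rewrite /= e19 /cnt subn0 expn0 muln1 mulnC.
  + by move=> k; rewrite /cnt subn0 expn0 muln1 mulnC h0 // => /rc[].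
  move=> E k; rewrite subn0 expn0 !muln1 !mul1r => EK k2; rewrite /val h0 //=.
  have kC : E * 2 + k < C by rewrite /C (mulnC 2); apply: mul_add_ltn.
  have [_ ->] := rc _ kC; rewrite oddD oddM andbF /= /conv big_ord1 big_ord1.
  by case: k k2 kC => [|[|//]] _ _ /=; rewrite ?addn0 ?muln2 ?doubleK ?mulr1n ?mulr0n.
- move=> i m1 it [i1 i2 [i3 i4] i5 i6] _.
  set len := D ^ i in i2 *; set E := K ^ (t - i.+1).
  have EK : K ^ (t - i) = E * K by rewrite /E -expnSr; congr (_ ^ _); lia.
  have cE : cnt i = E * K * (2 * len) by rewrite /cnt EK.
  have cC : cnt i <= C.
    rewrite /cnt /C mulnCA leq_mul2l /=; have := cntC (leq_subr i t).
    by rewrite subKn // ltnW.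
  have cS : cnt i.+1 = E * (2 * (D * len)) by rewrite /cnt expnS.
  have len0 : 0 < len by apply: Dt0.
  have Kle j : j <= t -> K ^ j < W.
    move=> jt; apply: MltW; apply: leq_ltn_trans KtM; apply: leq_trans (_ : K ^ t <= _); last by rewrite leq_pmull.
    by rewrite leq_pexp2l // K0.
  have Dle j : j <= t -> D ^ j < W.
    by move=> jt; apply: leq_ltn_trans (Kle j jt); case: (j) => // s; rewrite leq_exp2r // /K; lia.
  apply: (@run_weaken _ _ ((cnt i * (3 * K + 10) + 7) + (1 + 1)) _ (I i.+1)) => //.
    by apply: leq_add => //; rewrite leq_add2r leq_mul2r cC orbT.
  rewrite cE; apply: run_seq; apply: run_frame; apply: (run_merge_level (len := len) (E := E) (z := val m1)) => //.
  + by rewrite i3.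
  + by rewrite -cE; apply: leq_ltn_trans cC _.
  + by move=> k; rewrite -cE => kc; split=> //; apply: i5.
  move=> m2 g19 r2 fr2; have e2 := env_mods (c := merge_level) isT fr2 i1.
  have g18 : get m2 18 0 = len by rewrite fr2.
  have g21 : get m2 21 0 = K ^ i by rewrite fr2.
  have g7 : get m2 7 0 = D by case: e2.
  apply: run_seq; apply: run_frame; apply: run_SetV => //; rewrite !evalE g18 g7 /len -expnSr; first exact: Dle.
  move=> m3 h3 fr3; have e3 := env_mods (c := SetV 18 (Var 18 [*] Var 7)) isT fr3 e2.
  have g7' : get m3 7 0 = D by case: e3.
  apply: run_frame; apply: run_SetV => //; rewrite !evalE g7' h3 //= g21 -expnSr; first exact: Kle.
  move=> m4 h4 fr4; have e4 := env_mods (c := SetV 21 (Var 21 [*] (#2 [*] Var 7))) isT fr4 e3.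
  split; rewrite ?h4 //= ?h3 //=.
  + by rewrite g19 cS.
  + by move=> k kc; rewrite h4 // h3 //=; case: (r2 k); rewrite -?cS.
  move=> E1 k E1K kD; rewrite /val h4 //= h3 //= expnS.
  have kc : E1 * (2 * (D * len)) + k < E * (2 * (D * len)).
    by apply: mul_add_ltn; rewrite // -expnS.
  have [_ ->] := r2 _ kc.
  have tt : t - i = (t - i.+1).+1 by lia.
  rewrite (@overlap_addE _ v om omD len (fun k => transform t a (t - i.+1) k) (fun k => transform t b (t - i.+1) k) _ (K ^ i)%:R) //.
    by rewrite -natrM -/K -(expnS K i).
  move=> e k' eK kl.
  rewrite i6 // ?EK; last by apply: mul_add_ltn.
    by rewrite tt /= (_ : t - (t - i.+1).+1 = i) //; lia.
  by rewrite /len -(expnS D).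
move=> m' [i1 i2 [i3 i4] i5 i6]; apply: (fin _ i4) => k kD; split.
  by apply: i5; rewrite /cnt subnn mul1n.
have := i6 0 k; rewrite subnn expn0 /val add0n => -> //.
Qed.

End Levels.
(** A level costs about D operations per entry and, as 2 D values replace D pieces, doubles the
    length. With at most v levels and 2^v = D, this is a fixed power of D for each coefficient. *)
Lemma run_MUL N m (Q : memory -> Prop) : env m -> 0 < N <= 2 * p -> get m 13 0 = N ->
  (forall i, i < N -> get m 11 i < p) -> (forall i, i < N -> get m 12 i < p) ->
  (forall m', (forall i, i < N -> get m' 14 i = (\sum_(j < i.+1) get m 11 j * get m 12 (i - j)) %% p) -> Q m') ->
  run W MUL (N * D ^ 7) Q m.
Proof.
move=> me N2p e13 a_p b_p fin; have /andP[N0 Np] := N2p.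
suff body : forall m1 t, env m1 -> (forall i, get m1 11 i = get m 11 i) -> (forall i, get m1 12 i = get m 12 i) ->
    get m1 13 0 = N -> get m1 18 0 = D ^ t -> get m1 20 0 = t -> N <= D ^ t -> t <= v ->
    (if t is s.+1 then D ^ s < N else true) ->
    run W (match MUL with Seq _ c => c | c => c end) (N * D ^ 7 - (3 * v + 3)) Q m1.
  apply: (@run_weaken _ _ (3 * v + 3 + (N * D ^ 7 - (3 * v + 3))) _ Q Q) => //.
    rewrite subnKC //; have : v < D by rewrite ltn_expl.
    have : 3 * D <= D ^ 7 by rewrite (expnS D 6) mulnC leq_mul2l; apply/orP; right; rewrite !expnS; nia.
    by nia.
  apply: run_seq; apply: run_frame; apply: (@run_grow_length N) => // m1 t h18 h20 tN tv ts fr.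
  have e1 := env_mods (c := grow_length) isT fr me.
  by apply: (body m1 t) => //; rewrite ?fr // => i; rewrite fr.
move=> {me e13} m1 t me e11 e12 e13 e18 e20 tN tv ts.
have B : K ^ t * N * p ^ 2 <= p ^ D by apply: dft_size_bound.
have Kt0 : 0 < K ^ t by rewrite expn_gt0 K0.
have KtM : 2 * K ^ t < M.
  rewrite /M addn1 ltnS; apply: leq_trans B; rewrite mulnC -mulnA leq_mul2l; apply/orP; right.
  by rewrite -[2]mul1n leq_mul // (leq_trans p1) // -{1}(expn1 p) leq_exp2l.
have DtK : D ^ t <= K ^ t by case: (t) => // s; rewrite leq_exp2r // /K; lia.
set C := 2 * K ^ t in KtM.
pose a i : R := if i < N then ((get m 11 i)%:R)%R else 0%R.
pose b i : R := if i < N then ((get m 12 i)%:R)%R else 0%R.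
apply: (@run_weaken _ _ (1 + ((3 * D ^ t + 3) + ((3 * D ^ t + 3) + ((t * (2 * (C * (3 * D + 10) + 6) + 4) + 3) +
   ((3 * C + 4) + ((t * (C * (3 * K + 10) + 11) + 4) + (3 * N + 3))))))) _ Q Q) => //.
  have CN : C <= 4 * N * D ^ 2.
    rewrite /C; case: (t) ts tv => [|s] sN sv; first by rewrite expn0; have := D0; rewrite !expnS; nia.
    rewrite /K expnMn !expnS expn0 muln1.
    have : 2 ^ s <= D by rewrite leq_exp2l // ltnW.
    move=> s2D; have xx : 2 ^ s * D ^ s <= D * N := leq_mul s2D (ltnW sN).
    have -> : 2 * (2 * 2 ^ s * (D * D ^ s)) = 4 * (2 ^ s * D ^ s) * D by lia.
    have -> : 4 * N * (D * D) = 4 * (D * N) * D by lia.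
    exact: leq_mul (leq_mul (leqnn 4) xx) (leqnn D).
  have vD : v < D by rewrite ltn_expl.
  have D16 : 16 <= D by rewrite -[16]/(2 ^ 4) leq_exp2l.
  have C1 : 0 < C by rewrite muln_gt0.
  have DtC : D ^ t <= C by rewrite /C; lia.
  have CD3 : 1 + (3 * D ^ t + 3 + (3 * D ^ t + 3 + (t * (2 * (C * (3 * D + 10) + 6) + 4) + 3 +
     (3 * C + 4 + (t * (C * (3 * K + 10) + 11) + 4 + (3 * N + 3)))))) <= 16 * C * D ^ 2.
    apply: (@leq_trans (1 + (3 * C + 3 + (3 * C + 3 + (D * (2 * (C * (3 * D + 10) + 6) + 4) + 3 +
     (3 * C + 4 + (D * (C * (3 * K + 10) + 11) + 4 + (3 * C + 3)))))))); last first.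
      rewrite /K !expnS expn0 muln1; move: C1 D16; move: (C) (D) => c d; clear; nia.
    have tD : t <= D by lia.
    have NC : N <= C by lia.
    have m1' : t * (2 * (C * (3 * D + 10) + 6) + 4) <= D * (2 * (C * (3 * D + 10) + 6) + 4) by rewrite leq_mul2r tD orbT.
    have m2' : t * (C * (3 * K + 10) + 11) <= D * (C * (3 * K + 10) + 11) by rewrite leq_mul2r tD orbT.
    by move: m1' m2'; lia.
  have CN' : 16 * C * D ^ 2 <= N * D ^ 6.
    apply: (@leq_trans (16 * (4 * N * D ^ 2) * D ^ 2)); first exact: leq_mul (leq_mul (leqnn 16) CN) (leqnn _).
    have -> : 16 * (4 * N * D ^ 2) * D ^ 2 = N * D ^ 4 * 64 by rewrite -[4]/(2 + 2) expnD; lia.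
    rewrite -[6]/(4 + 2) (expnD D 4 2) mulnA leq_mul2l; apply/orP; right; rewrite expnS expn1; nia.
  have ND7 : N * D ^ 6 + (3 * v + 3) <= N * D ^ 7.
    have : 1 <= N * D ^ 5 by rewrite muln_gt0 N0 expn_gt0 D0.
    rewrite !(expnS D) !expn0 !muln1; move: vD D16; move: (D) => d; clear; set x := d * (d * (d * (d * d))); nia.
  by move: CD3 CN' ND7; lia.
apply: run_seq; apply: run_frame; apply: run_SetV => //; rewrite !evalE e18; first by apply: MltW; lia.
move=> m2 h2 fr2; have e2 := env_mods (c := SetV 19 (Var 18)) isT fr2 me.
apply: run_seq; apply: run_frame; apply: (run_pad_operand (L := D ^ t) (N := N)) => //.
- by rewrite h2.
- by rewrite h2.
- lia.
- by move=> i iN; rewrite h2 //= e11 a_p.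
move=> m3 r3 fr3; have e3 := env_mods (c := pad_operand 15 11) isT fr3 e2.
apply: run_seq; apply: run_frame; apply: (run_pad_operand (L := D ^ t) (N := N)) => //.
- by rewrite fr3 // h2.
- by rewrite fr3 // h2.
- lia.
- by move=> i iN; rewrite fr3 // h2 //= e12 b_p.
move=> m4 r4 fr4; have e4 := env_mods (c := pad_operand 16 12) isT fr4 e3.
apply: run_seq; apply: run_frame; apply: (run_forward_levels (t := t) tv _ (a := a) (b := b)) => //.
- by rewrite fr4 // fr3 // h2.
- by rewrite fr4 // fr3 // h2.
- by rewrite fr4 // fr3 // h2.
- by move=> i it; rewrite fr4 //; have := r3 i it; rewrite h2 //= e11.
- by move=> i it; have := r4 i it; rewrite fr3 // h2 //= e12.
move=> m5 g18 g19 r15 r16 fr5; have e5 := env_mods (c := forward_levels) isT fr5 e4.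
apply: run_seq; apply: run_frame; apply: (run_pointwise_product tv KtM e5 g19 r15 r16) => //.
move=> m6 h19 r6 fr6; have e6 := env_mods (c := pointwise_product) isT fr6 e5.
apply: run_seq; apply: run_frame; apply: (run_backward_levels tv KtM e6 _ h19 _ r6) => //.
- by rewrite fr6 // g18.
- by rewrite fr6 // fr5 // fr4 // fr3 // h2.
move=> m7 g21 r7 fr7; have [g0 _ _ _ _] := env_mods (c := backward_levels) isT fr7 e6.
have g13 : get m7 13 0 = N by rewrite fr7 // fr6 // fr5 // fr4 // fr3 // h2.
pose S i := \sum_(j < i.+1) get m 11 j * get m 12 (i - j).
(* Below M the residue is the integer K^t S i itself, so it may be divided by K^t before it is
   reduced modulo p. *)
have SM i : i < N -> K ^ t * S i < M.
  move=> iN; rewrite /M addn1 ltnS; apply: leq_trans B; rewrite -mulnA leq_mul2l; apply/orP; right.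
  apply: (@leq_trans (\sum_(j < i.+1) p ^ 2)); last by rewrite sum_nat_const card_ord leq_mul2r iN orbT.
  apply: leq_sum => j _; have jN : j < N by apply: leq_trans (ltn_ord j) iN.
  by rewrite expnS expn1; apply: leq_mul; apply: ltnW; [exact: a_p|apply: b_p; exact: leq_ltn_trans (leq_subr _ _) iN].
have g17 i : i < N -> get m7 17 i = K ^ t * S i.
  move=> iN; have iD : i < 2 * D ^ t by lia.
  have [lt eq] := r7 i iD; rewrite conv_coef in eq; last by lia.
  have : ((get m7 17 i)%:R = (K ^ t * S i)%:R :> R)%R.
    rewrite eq natrM natr_sum; congr (_ * _)%R; apply: eq_bigr => j _; rewrite natrM /a /b.
    by rewrite (leq_trans (ltn_ord j) iN) (leq_ltn_trans (leq_subr _ _) iN).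
  by move/(congr1 (@nat_of_ord _)); rewrite !(val_Zp_nat M1) !modn_small // SM.
apply: (@run_Tab _ 14 _ _ N (fun i => S i %% p)) => //.
- by apply: MltW; apply: leq_ltn_trans tN _; apply: leq_ltn_trans DtK _; move: KtM; rewrite /C; lia.
- move=> i m' iN j3 fr _ _; have f0 : get m' 0 0 = p by rewrite fr.
  have f21 : get m' 21 0 = K ^ t by rewrite fr.
  have f17 : get m' 17 i = K ^ t * S i by rewrite fr // g17.
  rewrite !evalE j3 f0 f21 f17 mulKn //; split=> //.
  by apply: MltW; apply: leq_trans pM; rewrite ltn_pmod //; lia.
by move=> m' h _ _; apply: fin.
Qed.

End Multiplication.

(** * Power series and root sets *)

Section TruncatedPolynomials.
Local Open Scope ring_scope.
Variable F : fieldType.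
Implicit Types P Q G T Y g : {poly F}.

Definition coef_eq N P Q := forall i, (i < N)%N -> P`_i = Q`_i.

Lemma coef_eq_refl N P : coef_eq N P P. Proof. by []. Qed.

Lemma coef_eq_sym N P Q : coef_eq N P Q -> coef_eq N Q P.
Proof. by move=> h i iN; rewrite h. Qed.

Lemma coef_eq_trans N P Q G : coef_eq N P Q -> coef_eq N Q G -> coef_eq N P G.
Proof. by move=> h1 h2 i iN; rewrite h1 // h2. Qed.

Lemma coef_eqW N N' P Q : (N' <= N)%N -> coef_eq N P Q -> coef_eq N' P Q.
Proof. by move=> NN h i iN; apply: h; apply: leq_trans NN. Qed.

Lemma coef_eqM N P P' Q Q' : coef_eq N P P' -> coef_eq N Q Q' -> coef_eq N (P * Q) (P' * Q').
Proof.
move=> hP hQ i iN; rewrite !coefM; apply: eq_bigr => j _.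
by rewrite hP ?hQ //; [exact: leq_ltn_trans (leq_subr _ _) iN|exact: leq_trans (ltn_ord j) iN].
Qed.

Lemma coef_eqD N P P' Q Q' : coef_eq N P P' -> coef_eq N Q Q' -> coef_eq N (P + Q) (P' + Q').
Proof. by move=> hP hQ i iN; rewrite !coefD hP ?hQ. Qed.

Lemma coef_eqN N P P' : coef_eq N P P' -> coef_eq N (- P) (- P').
Proof. by move=> hP i iN; rewrite !coefN hP. Qed.

Lemma coef_eq_deriv N P Q : coef_eq N P Q -> coef_eq N.-1 P^`() Q^`().
Proof. by move=> h i iN; rewrite !coef_deriv h //; case: N iN h. Qed.

Lemma coef_eq0M N M P Q : coef_eq N P 0 -> coef_eq M Q 0 -> coef_eq (N + M) (P * Q) 0.
Proof.
move=> hP hQ i iN; rewrite coefM coef0 big1 // => j _.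
have [jN|Nj] := ltnP j N; first by rewrite hP // coef0 mul0r.
by rewrite hQ ?coef0 ?mulr0 //; have := ltn_ord j; lia.
Qed.

Definition revp n P := \poly_(i < n.+1) P`_(n - i).

Lemma coef_revp n P i : (i <= n)%N -> (revp n P)`_i = P`_(n - i).
Proof. by move=> iN; rewrite coef_poly ltnS iN. Qed.

Lemma revpX n i c : (i <= n)%N -> revp n (c *: 'X^i) = c *: 'X^(n - i).
Proof.
move=> iN; apply/polyP => k; rewrite coef_poly !coefZ !coefXn ltnS.
have [kn|kn] := leqP k n; last by rewrite gtn_eqF ?mulr0 //; apply: leq_ltn_trans kn; apply: leq_subr.
by congr (_ * (nat_of_bool _)%:R); lia.
Qed.

Lemma revp_sum n (I : Type) (r : seq I) (C : pred I) (E : I -> {poly F}) :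
  revp n (\sum_(i <- r | C i) E i) = \sum_(i <- r | C i) revp n (E i).
Proof.
apply/polyP => k; rewrite coef_sum coef_poly; case: ltnP => kn.
  by rewrite coef_sum; apply: eq_bigr => i _; rewrite coef_poly kn.
by rewrite big1 // => i _; rewrite coef_poly ltnNge kn.
Qed.

Lemma poly_sumX n P : (size P <= n)%N -> P = \sum_(i < n) P`_i *: 'X^i.
Proof. by move=> Pn; rewrite -poly_def; apply/polyP => i; rewrite coef_poly; case: ltnP => // /(leq_trans Pn) h; rewrite nth_default. Qed.

Lemma revpM a b P Q : (size P <= a.+1)%N -> (size Q <= b.+1)%N ->
  revp (a + b) (P * Q) = revp a P * revp b Q.
Proof.
move=> Pa Qb; rewrite {1}(poly_sumX Pa) {2}(poly_sumX Pa) {1}(poly_sumX Qb) {2}(poly_sumX Qb).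
rewrite !revp_sum mulr_suml revp_sum mulr_suml; apply: eq_bigr => i _.
rewrite mulr_sumr revp_sum mulr_sumr; apply: eq_bigr => j _.
have ia : (i <= a)%N by rewrite -ltnS.
have jb : (j <= b)%N by rewrite -ltnS.
rewrite -scalerAl -scalerAr scalerA -exprD !revpX ?leq_add //.
by rewrite -scalerAl -scalerAr scalerA -exprD; congr (_ *: 'X^_); lia.
Qed.

Lemma modp_unique g (q r T : {poly F}) : (size r < size g)%N -> T = q * g + r -> T %% g = r.
Proof. by move=> rg ->; rewrite modpD modp_mull add0r modp_small. Qed.

(** Reversal turns T = q g + r into rev T = rev q rev g modulo X^N, so the quotient is read off from
    rev T times the inverse J of rev g. *)
Lemma modp_by_reversal N g (J T : {poly F}) : (0 < N)%N -> size g = N.+1 -> (size T <= 2 * N)%N ->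
  coef_eq N (J * revp N g) 1 ->
  T %% g = T - (\poly_(i < N) (revp (2 * N).-1 T * J)`_(N.-1 - i)) * g.
Proof.
move=> N0 gN TN JG; set q := \poly_(i < N) _.
have qN : (size q <= N.-1.+1)%N by rewrite prednK // size_poly.
apply: (@modp_unique g q); last by rewrite addrC subrK.
rewrite gN ltnS; apply/leq_sizeP => k Nk; rewrite coefB.
have [k2|k2] := leqP (2 * N) k.
  rewrite [T`_k]nth_default; last exact: leq_trans k2.
  by rewrite nth_default ?subrr //; apply: leq_trans (size_polyMleq _ _) _; rewrite gN; move: qN N0 k2; case: (size q) => [|s]; lia.
pose i := ((2 * N).-1 - k)%N.
have iN : (i < N)%N by rewrite /i; lia.
have kE : k = ((2 * N).-1 - i)%N by rewrite /i; lia.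
have nE : ((2 * N).-1 = N.-1 + N)%N by lia.
have cr (X : {poly F}) : X`_k = (revp (2 * N).-1 X)`_i by rewrite coef_revp -?kE //; lia.
rewrite !cr {2}nE revpM ?gN //.
have qE : coef_eq N (revp N.-1 q) (revp (2 * N).-1 T * J).
  move=> j jN; rewrite coef_revp; last by lia.
  have j2 : (N.-1 - j < N)%N by lia.
  have j3 : (N.-1 - (N.-1 - j) = j)%N by lia.
  by rewrite coef_poly j2 j3.
rewrite (coef_eqM qE (@coef_eq_refl N _) iN) -mulrA.
by rewrite (coef_eqM (@coef_eq_refl N (revp (2 * N).-1 T)) JG iN) mulr1 subrr.
Qed.

Lemma pchar_expr_inverse p N G : p \in [pchar F] -> (N <= p)%N -> G`_0 = 1 -> coef_eq N (G ^+ p.-1 * G) 1.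
Proof.
move=> cp Np G0 i iN; have pp := pcharf_prime cp; rewrite -exprSr prednK ?prime_gt0 //.
have cpP : p \in [pchar {poly F}] by rewrite pchar_poly.
have -> : G = 1 + (\poly_(k < (size G).-1) G`_k.+1) * 'X.
  apply/polyP => k; rewrite coefD coef1 coefMX; case: k => [|k] /=; first by rewrite G0 addr0.
  by rewrite add0r coef_poly; case: ltnP => // h; rewrite nth_default //; lia.
rewrite -(pFrobenius_autE cpP) rmorphD rmorph1 /= pFrobenius_autE exprMn.
by rewrite coefD coefMXn (leq_trans iN Np) addr0.
Qed.

(* Newton's method for Y' = -Q Y: the residual r = Y' + Q Y of the next iterate is (D-1) r,
   and D - 1 vanishes to one order more than r. *)
Lemma newton_step N (K : nat) (Q Y J D : {poly F}) : coef_eq N (J * Y) 1 -> (forall k, (0 < k < N)%N -> k%:R != 0 :> F) ->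
  D`_0 = 1 -> coef_eq N.-1 D^`() (- (Q + Y^`() * J)) ->
  coef_eq (minn K N.-1) (Y^`() + Q * Y) 0 ->
  coef_eq (minn (2 * K).+1 N.-1) ((Y * D)^`() + Q * (Y * D)) 0.
Proof.
move=> JY char D0 D' r0; set r := Y^`() + Q * Y in r0.
have JY' : coef_eq N.-1 (J * Y) 1 by apply: coef_eqW JY; exact: leq_pred.
have D'J : coef_eq N.-1 D^`() (- (r * J)).
  apply: coef_eq_trans D' _; apply: coef_eqN; rewrite /r mulrDl addrC; apply: coef_eqD => //.
  rewrite -mulrA [Y * J]mulrC -{1}[Q]mulr1; apply: coef_eqM => //; exact: coef_eq_sym.
have D1 : coef_eq (minn K N.-1).+1 (D - 1) 0.
  move=> [|i] iK; first by rewrite coefB D0 coef1 subrr coef0.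
  have iN : (i < N.-1)%N by move: iK; rewrite ltnS leq_min => /andP[].
  have k0 : i.+1%:R != 0 :> F by apply: char; move: iN; case: (N).
  have iK' : (i < minn K N.-1)%N by [].
  have rJ0 : (r * J)`_i = 0 by rewrite (coef_eqM r0 (@coef_eq_refl _ J) iK') mul0r coef0.
  have := D'J i iN; rewrite coef_deriv coefN rJ0 oppr0.
  by rewrite coefB coef1 subr0 coef0 -mulr_natr => /eqP; rewrite mulf_eq0 (negPf k0) orbF => /eqP.
have -> : (Y * D)^`() + Q * (Y * D) = (D - 1) * r + Y * (D^`() + r * J) + (r - r * (J * Y)).
  by rewrite derivM /r; ring.
have m1 : (minn (2 * K).+1 N.-1 <= N.-1)%N by exact: geq_minr.
apply: (@coef_eq_trans _ _ (0 + 0 + 0)); last by rewrite !addr0.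
apply: coef_eqD; first apply: coef_eqD.
- move=> i; rewrite leq_min => /andP[i2K iN].
  by apply: (coef_eq0M D1 r0); case: (leqP K N.-1) => KN; lia.
- apply: coef_eqW m1 _ ; rewrite -[0](mulr0 Y); apply: coef_eqM => // i iN.
  by rewrite coefD D'J // coefN addNr coef0.
apply: coef_eqW m1 _; rewrite -[0](subrr r); apply: coef_eqD => //; apply: coef_eqN.
by rewrite -{2}[r]mulr1; apply: coef_eqM.
Qed.

(** The equation determines the coefficient of index i + 1 from the earlier ones, after division by
    i + 1. *)
Lemma newton_unique N (Q Y Z : {poly F}) : (forall k, (0 < k < N)%N -> k%:R != 0 :> F) -> Y`_0 = Z`_0 ->
  coef_eq N.-1 (Y^`() + Q * Y) 0 -> coef_eq N.-1 (Z^`() + Q * Z) 0 -> coef_eq N Y Z.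
Proof.
move=> char YZ0 rY rZ; elim/ltn_ind => -[|i] IH iN; first exact: YZ0.
have iN1 : (i < N.-1)%N by case: N iN {rY rZ char IH}.
have := rY i iN1; have := rZ i iN1; rewrite !coefD !coef_deriv !coef0.
have -> : (Q * Z)`_i = (Q * Y)`_i.
  rewrite !coefM; apply: eq_bigr => j _; rewrite IH //; first by have := ltn_ord j; lia.
  by apply: leq_ltn_trans iN; apply: leq_trans (leq_subr _ _) _.
move/eqP; rewrite addr_eq0 => /eqP eZ /eqP; rewrite addr_eq0 -eZ => /eqP eY.
have k0 : i.+1%:R != 0 :> F by apply: char.
by apply: (mulIf k0); rewrite !mulr_natr.
Qed.
End TruncatedPolynomials.

(** * Sets of roots: power sums, Newton's identities, Taylor shift *)

Section RootSets.
Local Open Scope ring_scope.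
Variable F : finFieldType.
Implicit Types (X S : {set F}) (x y z : F).

Definition root_poly X : {poly F} := \prod_(x in X) ('X - x%:P).
Definition rev_root_poly X : {poly F} := \prod_(x in X) (1 - x *: 'X).

Lemma size_root_poly X : size (root_poly X) = #|X|.+1.
Proof. by rewrite /root_poly -big_enum /= size_prod_XsubC -cardE. Qed.

Lemma monic_root_poly X : root_poly X \is monic.
Proof. exact: monic_prod_XsubC. Qed.

Lemma root_polyE X y : ((root_poly X).[y] == 0) = (y \in X).
Proof. by rewrite /root_poly -big_enum /= -/(root _ _) root_prod_XsubC mem_enum. Qed.

Lemma root_polyD1 X x : x \in X -> root_poly X = ('X - x%:P) * root_poly (X :\ x).
Proof. exact: big_setD1. Qed.

Lemma rev_root_polyD1 X x : x \in X -> rev_root_poly X = (1 - x *: 'X) * rev_root_poly (X :\ x).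
Proof. exact: big_setD1. Qed.

Lemma revp_root_poly X : revp #|X| (root_poly X) = rev_root_poly X.
Proof.
have [n Xn] := ubnP #|X|; elim: n X Xn => // n IH X Xn.
have [->|[x xX]] := set_0Vmem X.
  rewrite cards0 /root_poly /rev_root_poly !big_set0; apply/polyP => i.
  by rewrite coef_poly !coef1; case: i.
rewrite (root_polyD1 xX) (rev_root_polyD1 xX) (cardsD1 x) xX revpM ?size_XsubC ?size_root_poly // IH; last first.
  by move: Xn; rewrite (cardsD1 x) xX.
congr (_ * _); apply/polyP => i; rewrite coef_poly !coefB coef1 coefZ coefX coefC.
by case: i => [|[|i]]; rewrite coefX /= ?subn0 ?subnn /= ?mulr0 ?mulr1 ?subr0 ?sub0r.
Qed.

Lemma coef_root_poly X i : (i <= #|X|)%N -> (root_poly X)`_i = (rev_root_poly X)`_(#|X| - i).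
Proof. by move=> iX; rewrite -revp_root_poly coef_revp ?leq_subr // subKn. Qed.

Lemma coef0_rev_root_poly X : (rev_root_poly X)`_0 = 1.
Proof.
rewrite -horner_coef0 horner_prod big1 // => x _.
by rewrite !hornerE ?mulr0 ?subr0.
Qed.

Definition geometric N x : {poly F} := \poly_(k < N) x ^+ k.

Lemma geometricM N x : coef_eq N ((1 - x *: 'X) * geometric N x) 1.
Proof.
move=> i iN; rewrite mulrBl mul1r -scalerAl coefB coefZ coefXM coef1 !coef_poly.
case: i iN => [|i] iN /=; first by rewrite iN mulr0 subr0.
by rewrite iN (ltnW iN) exprS subrr.
Qed.

Lemma deriv_root_poly X x : x \in X -> (root_poly X)^`().[x] = (root_poly (X :\ x)).[x].
Proof.
move=> xX; rewrite (root_polyD1 xX) derivM derivXsubC mul1r hornerD hornerM.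
by rewrite hornerXsubC subrr mul0r addr0.
Qed.

(* Both sides interpolate the same values on X; the coefficients of h/g are then power sums. *)
Lemma power_sums_by_division X S (h J : {poly F}) (i : nat) : S \subset X -> (size h <= #|X|)%N ->
  (forall x, x \in X -> h.[x] = (x \in S)%:R * (root_poly X)^`().[x]) ->
  coef_eq #|X| (J * revp #|X| (root_poly X)) 1 -> (i < #|X|)%N ->
  (revp #|X|.-1 h * J)`_i = \sum_(x in S) x ^+ i.
Proof.
move=> SX hX hval JR iX; have X0 : (0 < #|X|)%N by apply: leq_ltn_trans iX.
have sz x : x \in S -> size (root_poly (X :\ x)) = #|X|.
  by move=> xS; rewrite size_root_poly [in RHS](cardsD1 x) (subsetP SX).
have -> : h = \sum_(x in S) root_poly (X :\ x).
  apply/eqP; rewrite -subr_eq0; apply: contraT => nz.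
  have := max_poly_roots nz _ (enum_uniq X); rewrite -cardE ltnNge.
  have -> : (size (h - \sum_(x in S) root_poly (X :\ x))%R <= #|X|)%N.
    rewrite (leq_trans (size_polyD _ _)) // geq_max hX size_polyN.
    by apply: (leq_trans (size_sum _ _ _)); apply/bigmax_leqP => x xS; rewrite sz.
  apply; apply/allP => z; rewrite mem_enum => zX; rewrite /root hornerD hornerN horner_sum hval //.
  case zS: (z \in S).
    rewrite (bigD1 z) //= big1 ?addr0 => [|x /andP[xS xz]]; first by rewrite mul1r deriv_root_poly // subrr.
    by apply/eqP; rewrite root_polyE !inE eq_sym xz zX.
  rewrite mul0r sub0r oppr_eq0 big1 // => x xS.
  by apply/eqP; rewrite root_polyE !inE zX andbT; apply: contraFneq zS => ->.
rewrite revp_sum mulr_suml coef_sum; apply: eq_bigr => x xS; have xX := subsetP SX x xS.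
have -> : #|X|.-1 = #|X :\ x| by rewrite (cardsD1 x X) xX.
rewrite revp_root_poly; have -> : x ^+ i = (geometric #|X| x)`_i by rewrite coef_poly iX.
rewrite revp_root_poly (rev_root_polyD1 xX) in JR.
have gX := @geometricM #|X| x.
apply: (@coef_eq_trans _ _ _ _ _ _ _ _ iX); first apply: (@coef_eq_sym _ _ (rev_root_poly (X :\ x) * J * ((1 - x *: 'X) * geometric #|X| x))).
  by rewrite -[X in coef_eq _ _ X]mulr1; apply: coef_eqM.
have -> : rev_root_poly (X :\ x) * J * ((1 - x *: 'X) * geometric #|X| x) =
  J * ((1 - x *: 'X) * rev_root_poly (X :\ x)) * geometric #|X| x by ring.
by rewrite -[X in coef_eq _ _ X]mul1r; apply: coef_eqM.
Qed.

Lemma deriv_rev_root_poly S : (rev_root_poly S)^`() = - \sum_(x in S) x *: rev_root_poly (S :\ x).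
Proof.
have [n Sn] := ubnP #|S|; elim: n S Sn => // n IH S Sn.
have [->|[x xS]] := set_0Vmem S.
  by rewrite /rev_root_poly !big_set0 derivC oppr0.
rewrite (big_setD1 x xS) {1}(rev_root_polyD1 xS) derivM IH; last by move: Sn; rewrite (cardsD1 x) xS.
rewrite derivB derivC derivZ derivX sub0r mulNr opprD alg_polyC mul_polyC; congr (_ + _).
rewrite mulrN mulr_sumr; congr (- _); apply: eq_bigr => y; rewrite !inE => /andP[yx yS].
rewrite -scalerAr; congr (_ *: _).
have xSy : x \in S :\ y by rewrite !inE eq_sym yx.
by rewrite (rev_root_polyD1 xSy); congr (_ * rev_root_poly _); apply/setP => z; rewrite !inE andbCA.
Qed.

(** Logarithmic derivative: for the reversed polynomial Y of S, -Y' / Y is the sum of x / (1 - x X)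
    over S, whose coefficients are the power sums. *)
Lemma newton_identities S N : coef_eq N
  ((rev_root_poly S)^`() + (\poly_(k < N) \sum_(x in S) x ^+ k.+1) * rev_root_poly S) 0.
Proof.
have -> : \poly_(k < N) \sum_(x in S) x ^+ k.+1 = \sum_(x in S) x *: geometric N x.
  apply/polyP => k; rewrite coef_poly coef_sum; case: ltnP => kN.
    by apply: eq_bigr => x _; rewrite coefZ coef_poly kN exprS.
  by rewrite big1 // => x _; rewrite coefZ coef_poly ltnNge kN mulr0.
have -> : (rev_root_poly S)^`() = - \sum_(x in S) x *: rev_root_poly (S :\ x).
  exact: deriv_rev_root_poly.
move=> i iN; rewrite mulr_suml -sumrN -big_split /= coef_sum coef0 big1 // => x xS.
rewrite -scalerAl -scalerN -scalerDr coefZ (rev_root_polyD1 xS) mulrCA mulrA coefD coefN.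
rewrite [(_ * geometric N x) ](@mulrC _ _ (geometric N x)) .
have := coef_eqM (@geometricM N x) (@coef_eq_refl _ N (rev_root_poly (S :\ x))) iN.
by rewrite mul1r mulrC => ->; rewrite addNr mulr0.
Qed.

(** After scaling by factorials the coefficients of g(X + a) form one convolution. It is written
    with the reversed indices N - j, so that a truncated product computes it. *)
Lemma taylor_shift N (g : {poly F}) a x : (size g <= N.+1)%N -> (forall k, (0 < k <= N)%N -> k%:R != 0 :> F) ->
  g.[x + a] = \sum_(k < N.+1) (\sum_(j < (N - k).+1) g`_(N - j) * ((N - j)`!)%:R * (a ^+ (N - k - j) / ((N - k - j)`!)%:R))
     / (k`!)%:R * x ^+ k.
Proof.
move=> gN char.
have fact_neq0 k : (k <= N)%N -> (k`!)%:R != 0 :> F.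
  elim: k => [|k IH] kN; first by rewrite fact0 oner_neq0.
  by rewrite factS natrM; apply: mulf_neq0; [apply: char|apply: IH; apply: ltnW].
rewrite (horner_coef_wide _ gN).
transitivity (\sum_(k < N.+1) \sum_(i < N.+1 | (k <= i)%N) g`_i * (a ^+ (i - k) * x ^+ k *+ 'C(i, k))).
  rewrite (exchange_big_dep xpredT) //=; apply: eq_bigr => i _.
  rewrite addrC exprDn mulr_sumr (big_ord_widen_cond N.+1 xpredT (fun k => g`_i * (a ^+ (i - k) * x ^+ k *+ 'C(i, k)))) //.
apply: eq_bigr => k _; rewrite !mulr_suml.
have kN : (k <= N)%N by rewrite -ltnS.
rewrite (reindex_inj rev_ord_inj) /=.
rewrite (big_ord_widen_cond N.+1 xpredT (fun j => g`_(N - j) * (N - j)`!%:R * (a ^+ (N - k - j) / (N - k - j)`!%:R) / k`!%:R * x ^+ k)); last by rewrite ltnS leq_subr.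
apply: eq_big => [j|j kj]; first by rewrite subSS; have := ltn_ord j; lia.
rewrite subSS; set i := (N - j)%N.
have ki : (k <= i)%N by move: kj; rewrite subSS.
have iN : (i <= N)%N by apply: leq_subr.
have -> : (N - k - j = i - k)%N by rewrite /i; lia.
have := bin_fact ki => /(congr1 (fun n => n%:R : F)); rewrite !natrM => e.
rewrite -e -mulr_natr; have k0 := fact_neq0 k kN.
have ik0 := fact_neq0 (i - k)%N (leq_trans (leq_subr _ _) iN).
by field; rewrite k0 ik0.
Qed.
End RootSets.

(** * The root finder *)

Local Open Scope prog_scope.

(** For a loop whose number of rounds is not known in advance: the invariant together with a
    successful test has to imply i < B. *)
Lemma run_while_bound W (I : nat -> memory -> Prop) (K : nat -> nat) B e c (Q : memory -> Prop) m : I 0 m ->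
  (forall i m', I i m' -> eval m' e <> 0 -> i < B /\ run W c (K i) (I i.+1) m') ->
  (forall i m', I i m' -> eval m' e = 0 -> Q m') ->
  run W (While e c) (\sum_(i < B) (K i).+1).+1 Q m.
Proof.
move=> I0 step stop; rewrite -(big_mkord xpredT (fun i => (K i).+1)).
suff h k i m' : I i m' -> k = B - i -> run W (While e c) (\sum_(i <= j < B) (K j).+1).+1 Q m' by exact: h I0 (erefl _).
elim: k i m' => [|k IH] i m' Ii kB.
  case: (eqVneq (eval m' e) 0) => [e0|/eqP e0]; last by have [iB _] := step i m' Ii e0; lia.
  by exists m', 1; split=> //; [exact: (@uexec_while_stop _ _ _ _ e0)|exact: stop Ii e0].
case: (eqVneq (eval m' e) 0) => [e0|/eqP e0].
  by exists m', 1; split=> //; [exact: (@uexec_while_stop _ _ _ _ e0)|exact: stop Ii e0].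
have [iB [m1 [k1 [h1 l1 I1]]]] := step i m' Ii e0.
have [|m2 [k2 [h2 l2 q]]] := IH i.+1 m1 I1; first by lia.
exists m2, (k1 + k2).+1; split=> //; first by apply: uexec_while_step; eauto.
by rewrite big_ltn // !ltnS addSn -addnS leq_add.
Qed.

(** Dyadic blocks: each of the 2^k terms from a = 2^k up to 2^(k+1) is at most x / 2^k. *)
Lemma sum_divn_le x k : \sum_(1 <= a < 2 ^ k) x %/ a <= k * x.
Proof.
elim: k => [|k IH]; first by rewrite expn0 big_geq.
have k1 : 0 < 2 ^ k by rewrite expn_gt0.
rewrite (big_cat_nat (n := 2 ^ k)) //=; last by rewrite leq_exp2l.
rewrite mulSn addnC; apply: leq_add; last exact: IH.
apply: (@leq_trans (\sum_(2 ^ k <= a < 2 ^ k.+1) x %/ 2 ^ k)).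
  rewrite big_nat_cond [X in _ <= X]big_nat_cond; apply: leq_sum => a /andP[/andP[ka _] _].
  exact: leq_div2l.
rewrite sum_nat_const_nat expnS mul2n -addnn addnK mulnC; exact: leq_trunc_div.
Qed.

(* The input occupies consecutive cells; its coefficients are moved to register 2 from the last one
   downwards, with the counter in a cell beyond the input. *)
Definition spread :=
  SetA 3 (Var 1) (Var 1) ;;
  While (Arr 3 (Var 1))
    (SetA 2 (Arr 3 (Var 1)) (Read (#2 [+] Arr 3 (Var 1))) ;; SetA 3 (Var 1) (Arr 3 (Var 1) [-] #1)).

Lemma run_spread W n p (c : nat -> nat) m (Q : memory -> Prop) : 0 < n < W -> m 0 = p -> m 1 = n ->
  (forall j, j <= n -> m (2 + j) = c j) -> (forall j, c j < W) ->
  (forall m', get m' 0 0 = p -> get m' 1 0 = n -> (forall j, j <= n -> get m' 2 j = c j) -> Q m') ->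
  run W spread (3 * n + 2) Q m.
Proof.
move=> /andP[n0 nW] m_0 m_1 mc cW fin.
pose I t m' := [/\ m' 0 = p, m' 1 = n, m' (3 + 64 * n) = n - t,
  forall j, n - t < j <= n -> m' (2 + 64 * j) = c j & forall j, j <= n - t -> m' (2 + j) = c j].
have e1 m' : m' 1 = n -> eval m' (Var 1) = n by [].
have e3 m' : m' 1 = n -> eval m' (cell 3 (Var 1)) = 3 + 64 * n by move=> h; rewrite /cell eval_Add eval_Mul !eval_Const e1.
have e3' m' t : m' 1 = n -> m' (3 + 64 * n) = t -> eval m' (Arr 3 (Var 1)) = t.
  by move=> h1 h3; rewrite -h3 -(e3 m' h1).
have upd (m' : memory) a x : update m' a x a = x by rewrite /update /= eqxx.
have updN (m' : memory) a x b : b <> a -> update m' a x b = m' b.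
  by move=> /eqP/negPf h; rewrite /update /= h.
apply: (@run_weaken _ _ (1 + (\sum_(t < n) (1 + 1).+1).+1) _ Q Q) => //.
  by rewrite sum_nat_const card_ord; lia.
apply: run_seq; apply: run_write; rewrite e1 // e3 //.
apply: (@run_while _ I (fun=> 1 + 1)).
- split; first by rewrite updN //; lia.
  + by rewrite updN //; lia.
  + by rewrite upd subn0.
  + by move=> j; lia.
  by move=> j jn; rewrite updN; [apply: mc; lia|lia].
- move=> t m' tn [i0 i1 i3 ihi ilo]; split; first by rewrite (e3' _ _ i1 i3); lia.
  have e2 : eval m' (cell 2 (Arr 3 (Var 1))) = 2 + 64 * (n - t) by rewrite /cell eval_Add eval_Mul !eval_Const (e3' _ _ i1 i3).
  have er : eval m' (Read (#2 [+] Arr 3 (Var 1))) = c (n - t).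
    by rewrite -(ilo _ (leqnn _)) -(e3' _ _ i1 i3).
  apply: run_seq; apply: run_write; rewrite ?er // e2.
  set m1 := update m' _ _.
  have m1N b : b <> 2 + 64 * (n - t) -> m1 b = m' b by exact: updN.
  have j1 : m1 1 = n by rewrite m1N //; lia.
  have j3 : m1 (3 + 64 * n) = n - t by rewrite m1N //; lia.
  have es : eval m1 (Arr 3 (Var 1) [-] #1) = n - t.+1 by rewrite eval_Sub (e3' _ _ j1 j3) eval_Const; lia.
  apply: run_write; rewrite es; first by lia.
  rewrite e3 //; split; first by rewrite updN ?m1N //; lia.
  + by rewrite updN //; lia.
  + by rewrite upd.
  + move=> j jn; rewrite updN; last by lia.
    case: (eqVneq j (n - t)) => [->|/eqP ne]; first by rewrite /m1 upd.
    by rewrite m1N; [apply: ihi; lia|lia].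
  by move=> j jn; rewrite updN; [rewrite m1N; [apply: ilo; lia|lia]|lia].
move=> m' [i0 i1 i3 ihi ilo]; rewrite subnn in i3 ihi ilo; split; first exact: e3'.
apply: fin => // j jn; case: (posnP j) => [->|j0].
  by rewrite /get muln0 addn0 -(ilo 0) // addn0.
by rewrite /get ihi // j0.
Qed.

(** * Procedures on polynomials modulo g *)

Section Procedures.
Variables (p v W : nat).
Let D := 2 ^ v.
Let M := p ^ D + 1.
Hypotheses (pp : prime p) (v4 : 4 <= v) (pv : 2 * p <= D ^ v) (MW : M ^ 3 <= W).
Notation env := (env p v).
Notation F := 'F_p.
Notation poly_p := {poly 'F_p}.

Let p1 : 1 < p. Proof. exact: prime_gt1. Qed.
Let p0 : 0 < p. Proof. exact: prime_gt0. Qed.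
Let D16 : 16 <= D. Proof. by rewrite -[16]/(2 ^ 4) leq_exp2l. Qed.
Let p_pow : p < 2 ^ (v * v).
Proof. by rewrite expnM -/D; apply: leq_trans pv; have := p1; lia. Qed.
Let pM : p < M.
Proof. by rewrite /M addn1 ltnS -{1}(expn1 p) leq_exp2l // expn_gt0. Qed.
Let MW' x : x <= M -> x < W.
Proof. by move=> xM; apply: leq_trans MW; rewrite !expnS expn0 muln1; have : 2 <= M; [rewrite /M; lia|nia]. Qed.
Let pW : 2 * p < W.
Proof. by apply: leq_trans MW; rewrite !expnS expn0 muln1; have := (p1, pM); nia. Qed.
Let v2D : 2 * v <= D.
Proof.
have h := leq_pow2_shift v4; rewrite /D; case: (v) h => // w.
by have := ltn_expl w (isT : 1 < 2); rewrite expnS; lia.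
Qed.
Let vvW : v * v < W.
Proof.
apply: leq_trans MW.
have DM : D < M by rewrite /M addn1 ltnS ltnW // ltn_expl.
by rewrite !expnS expn0 muln1; have := v2D; nia.
Qed.
Let pD : 2 * D + 1 <= p ^ D.
Proof.
apply: (@leq_trans (2 ^ D)); last by rewrite leq_exp2r ?expn_gt0.
have := leq_pow2_shift v4; rewrite -/D => h; apply: (@leq_trans (2 ^ (v + 2))).
  by rewrite expnD -/D; lia.
by rewrite leq_exp2l //; lia.
Qed.
Let valW (x : F) : val x < W.
Proof. by apply: ltn_trans (ltn_val_Fp pp x) _; apply: leq_ltn_trans pW; rewrite mul2n -addnn leq_addr. Qed.

Lemma val_natF k : val (k%:R : F)%R = k %% p.
Proof. exact: val_Fp_nat. Qed.

Lemma val1F : val (1 : F)%R = 1.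
Proof. by rewrite -[1%R]/(1%:R)%R val_natF modn_small // prime_gt1. Qed.

Definition holds (m : memory) r n (P : poly_p) := forall i, i < n -> get m r i = val (P`_i)%R.

Lemma holds_frame m m' r n P : (forall i, get m' r i = get m r i) -> holds m r n P -> holds m' r n P.
Proof. by move=> h hP i iN; rewrite h hP. Qed.

Lemma holds_coef_eq m r n P Q : coef_eq n P Q -> holds m r n P -> holds m r n Q.
Proof. by move=> h hP i iN; rewrite hP // h. Qed.

Lemma run_Tab_poly r ne e n (P : poly_p) (Q : memory -> Prop) m :
  r < 64 -> r != 3 -> eval m ne = n -> n <= 2 * p ->
  (forall i m', i < n -> get m' 3 0 = i ->
     (forall r' i', r' < 64 -> r' != 3 -> r' != r -> get m' r' i' = get m r' i') ->
     (forall k, k < i -> get m' r k = val (P`_k)%R) -> eval m' e = val (P`_i)%R) ->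
  (forall m', holds m' r n P -> Q m') ->
  run W (Tab r ne e) (3 * n + 3) Q m.
Proof.
move=> r64 r3 en np step fin; apply: (@run_Tab _ r _ _ n (fun i => val (P`_i)%R)) => //.
- exact: leq_ltn_trans np pW.
- by move=> i m' i_n j3 fr h _; split=> //; apply: step.
by move=> m' h _ _; apply: fin.
Qed.

Definition copy r s := Tab r (Var 28) (Arr s (Var 3)).

Lemma run_copy r s N P m (Q : memory -> Prop) : r < 64 -> r != 3 -> s < 64 -> s != 3 -> s != r ->
  get m 28 0 = N -> N <= 2 * p -> holds m s N P ->
  (forall m', holds m' r N P -> Q m') -> run W (copy r s) (3 * N + 3) Q m.
Proof.
move=> r64 r3 s64 s3 sr e28 Np hP fin; apply: (@run_Tab_poly r _ _ N P) => //.
by move=> i m' iN j3 fr _; rewrite !evalE j3 fr // hP.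
Qed.

Lemma run_MUL_poly N P Q m (C : memory -> Prop) : env m -> 0 < N <= 2 * p -> get m 13 0 = N ->
  holds m 11 N P -> holds m 12 N Q ->
  (forall m', holds m' 14 N (P * Q)%R -> C m') -> run W MUL (N * D ^ 7) C m.
Proof.
move=> me Np e13 hP hQ fin; apply: (run_MUL pp v4 pv MW me Np e13) => [i iN|i iN|m' h].
- by rewrite hP // ltn_val_Fp.
- by rewrite hQ // ltn_val_Fp.
apply: fin => i iN; rewrite h // coefM -(val_Fp_nat pp) natr_sum; congr (val _); apply: eq_bigr => j _.
have jN : j < N by apply: leq_trans (ltn_ord j) iN.
have ijN : i - j < N by apply: leq_ltn_trans (leq_subr _ _) iN.
by rewrite natrM hP // hQ // !natr_Fp_val.
Qed.

(* Below the modulus g is monic of degree N; register 27 holds the inverse of its reversal. *)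
Definition modulus (m : memory) N (g : poly_p) :=
  [/\ get m 28 0 = N, 0 < N <= p, size g = N.+1, holds m 26 N g &
      exists2 J, coef_eq N (J * revp N g) 1 & holds m 27 N J].

Lemma modulus_mods c m m' N g : all (fun r => ~~ mods c r) [:: 26; 27; 28] ->
  (forall r i, r < 64 -> ~~ mods c r -> get m' r i = get m r i) -> modulus m N g -> modulus m' N g.
Proof.
move=> /and4P[c26 c27 c28 _] fr [e28 Np sg h26 [J JR h27]]; split; rewrite ?fr //.
  by apply: holds_frame h26 => i; rewrite fr.
by exists J => //; apply: holds_frame h27 => i; rewrite fr.
Qed.

(** Factors in registers 24 and 25, result in 29. Three products are formed: the full one of length
    2 N, the reversed quotient by means of the stored inverse, and quotient times modulus, of which
    the N low coefficients are enough. *)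
Definition MODMUL :=
  SetV 13 (#2 [*] Var 28) ;;
  Tab 11 (Var 13) ((#1 [-] (Var 3 [+] #1 [-] Var 28)) [*] Arr 24 (Var 3)) ;;
  Tab 12 (Var 13) ((#1 [-] (Var 3 [+] #1 [-] Var 28)) [*] Arr 25 (Var 3)) ;;
  MUL ;;
  Tab 30 (Var 13) (Arr 14 (Var 3)) ;;
  Tab 11 (Var 28) (Arr 30 (#2 [*] Var 28 [-] #1 [-] Var 3)) ;;
  copy 12 27 ;;
  SetV 13 (Var 28) ;;
  MUL ;;
  Tab 11 (Var 28) (Arr 14 (Var 28 [-] #1 [-] Var 3)) ;;
  copy 12 26 ;;
  MUL ;;
  Tab 29 (Var 28) ((Arr 30 (Var 3) [+] (Var 0 [-] Arr 14 (Var 3))) [%] Var 0).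

Lemma run_pad r s L N P m (Q : memory -> Prop) : r \in [:: 11; 12] -> s \in [:: 24; 25] ->
  get m 13 0 = L -> get m 28 0 = N -> L <= 2 * p -> holds m s N P -> size P <= N ->
  (forall m', holds m' r L P -> Q m') ->
  run W (Tab r (Var 13) ((#1 [-] (Var 3 [+] #1 [-] Var 28)) [*] Arr s (Var 3))) (3 * L + 3) Q m.
Proof.
move=> rr ss e13 e28 Lp hP sP fin.
have [r64 s64 r3 s3 [rs r28]] : [/\ r < 64, s < 64, r != 3, s != 3 & s != r /\ 28 != r].
  by move: rr ss; rewrite !inE => /orP[]/eqP-> /orP[]/eqP->.
apply: (@run_Tab_poly r _ _ L P) => // i m' iL j3 fr _; rewrite !evalE j3 !fr // e28.
case: (ltnP i N) => iN; first by rewrite (_ : i + 1 - N = 0) ?mul1n ?hP //; lia.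
by rewrite (_ : 1 - _ = 0) ?mul0n ?nth_default //; [exact: leq_trans iN|lia].
Qed.

Lemma val_subF (x y : F) : (val x + (p - val y)) %% p = val (x - y)%R.
Proof.
rewrite -(val_Fp_nat pp); congr (val _); rewrite natrD natrB ?natr_Fp_val; last by rewrite ltnW // ltn_val_Fp.
by rewrite pchar_Fp_0 // sub0r.
Qed.

Lemma run_MODMUL N g P Q m (C : memory -> Prop) : env m -> modulus m N g ->
  holds m 24 N P -> holds m 25 N Q -> size P <= N -> size Q <= N ->
  (forall m', holds m' 29 N ((P * Q) %% g)%R -> C m') ->
  run W MODMUL (N * D ^ 8) C m.
Proof.
move=> me mg hP hQ sP sQ fin; have [e28 /andP[N0 Np] sg h26 [J JR h27]] := mg.
set T := (P * Q)%R; have sT : size T <= 2 * N.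
  by apply: leq_trans (size_polyMleq _ _) _; lia.
pose T' := (revp (2 * N).-1 T)%R.
pose q := (\poly_(i < N) (T' * J)`_(N.-1 - i))%R.
have Tmod : (T %% g = T - q * g)%R by apply: modp_by_reversal.
have L2 : 2 * N <= 2 * p by rewrite leq_mul2l.
have N2 : 0 < N <= 2 * p by rewrite N0; lia.
apply: (@run_weaken _ _ (1 + ((3 * (2 * N) + 3) + ((3 * (2 * N) + 3) + ((2 * N) * D ^ 7 + ((3 * (2 * N) + 3) +
  ((3 * N + 3) + ((3 * N + 3) + (1 + (N * D ^ 7 + ((3 * N + 3) + ((3 * N + 3) + (N * D ^ 7 + (3 * N + 3))))))))))))) _ C C) => //.
  by rewrite (expnS D 7); have : 16 * 16 <= D ^ 7; [rewrite (expnD D 1 6) leq_mul // ?expn1 // (leq_trans D16) // -{1}(expn1 D) leq_exp2l //; lia|nia].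
apply: run_seq; apply: run_frame; apply: run_SetV => //; rewrite !evalE e28; first exact: leq_ltn_trans L2 pW.
move=> m1 h1 fr1; have me1 := env_mods (c := SetV 13 (#2 [*] Var 28)) isT fr1 me.
apply: run_seq; apply: run_frame; apply: (run_pad (L := 2 * N) (N := N) (P := P)) => //; try by rewrite h1.
  by apply: holds_frame hP => i; rewrite h1.
move=> m2 h11 fr2; have me2 := env_mods (c := Tab 11 _ _) isT fr2 me1.
apply: run_seq; apply: run_frame; apply: (run_pad (L := 2 * N) (N := N) (P := Q)) => //; try by rewrite fr2 // h1.
  by apply: holds_frame hQ => i; rewrite fr2 // h1.
move=> m3 h12 fr3; have me3 := env_mods (c := Tab 12 _ _) isT fr3 me2.
apply: run_seq; apply: run_frame; apply: (run_MUL_poly (N := 2 * N) (P := P) (Q := Q)) => //.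
- by rewrite muln_gt0 N0.
- by rewrite fr3 // fr2 // h1.
- by apply: holds_frame h11 => i; rewrite fr3.
move=> m4 h14 fr4; have me4 := env_mods (c := MUL) isT fr4 me3.
apply: run_seq; apply: run_frame; apply: (@run_Tab_poly 30 _ _ (2 * N) T) => //.
- by rewrite !evalE fr4 // fr3 // fr2 // h1.
- by move=> i m' iN j3 fr _; rewrite !evalE j3 fr // h14.
move=> m5 h30 fr5; have me5 := env_mods (c := Tab 30 _ _) isT fr5 me4.
have mg5 : modulus m5 N g.
  apply: (modulus_mods _ fr5) => //; apply: (modulus_mods _ fr4) => //; apply: (modulus_mods _ fr3) => //.
  by apply: (modulus_mods _ fr2) => //; apply: (modulus_mods _ fr1).
have [e28' _ _ _ _] := mg5.
apply: run_seq; apply: run_frame; apply: (@run_Tab_poly 11 _ _ N T') => //.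
- lia.
- move=> i m' iN j3 fr _; rewrite !evalE j3 !fr // e28' h30; last by lia.
  by rewrite coef_revp ?subn1 //; lia.
move=> m6 h11' fr6; have me6 := env_mods (c := Tab 11 _ _) isT fr6 me5.
have mg6 := modulus_mods (c := Tab 11 _ _) isT fr6 mg5; have [e28a _ _ _ [J' JR' h27']] := mg6.
apply: run_seq; apply: run_frame; apply: (run_copy (N := N) (P := J')) => //.
  by lia.
move=> m7 h12' fr7; have me7 := env_mods (c := copy 12 27) isT fr7 me6.
have mg7 := modulus_mods (c := copy 12 27) isT fr7 mg6; have [e28b _ _ _ _] := mg7.
apply: run_seq; apply: run_frame; apply: run_SetV => //; rewrite !evalE e28b; first by apply: leq_ltn_trans pW; lia.
move=> m8 h8 fr8; have me8 := env_mods (c := SetV 13 (Var 28)) isT fr8 me7.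
have mg8 := modulus_mods (c := SetV 13 (Var 28)) isT fr8 mg7.
apply: run_seq; apply: run_frame; apply: (run_MUL_poly (N := N) (P := T') (Q := J')) => //.
- by rewrite h8.
- by apply: holds_frame h11' => i; rewrite fr8 // fr7.
- by apply: holds_frame h12' => i; rewrite fr8.
move=> m9 h14' fr9; have me9 := env_mods (c := MUL) isT fr9 me8.
have mg9 := modulus_mods (c := MUL) isT fr9 mg8; have [e28c _ _ _ _] := mg9.
pose q' := (\poly_(i < N) (T' * J')`_(N.-1 - i))%R.
have Tmod' : (T %% g = T - q' * g)%R by apply: modp_by_reversal.
apply: run_seq; apply: run_frame; apply: (@run_Tab_poly 11 _ _ N q') => //.
- lia.
- move=> i m' iN j3 fr _; rewrite !evalE j3 !fr // e28c subn1 h14'; last by lia.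
  by rewrite coef_poly iN.
move=> m10 hq fr10; have me10 := env_mods (c := Tab 11 _ _) isT fr10 me9.
have mg10 := modulus_mods (c := Tab 11 _ _) isT fr10 mg9; have [e28d _ _ h26d _] := mg10.
apply: run_seq; apply: run_frame; apply: (run_copy (N := N) (P := g)) => //.
  by lia.
move=> m11 hg fr11; have me11 := env_mods (c := copy 12 26) isT fr11 me10.
have mg11 := modulus_mods (c := copy 12 26) isT fr11 mg10.
apply: run_seq; apply: run_frame; apply: (run_MUL_poly (N := N) (P := q') (Q := g)) => //.
- by rewrite fr11 // fr10 // fr9 // h8.
- by apply: holds_frame hq => i; rewrite fr11.
move=> m12 hqg fr12; have [e0 _ _ _ _] := env_mods (c := MUL) isT fr12 me11.
have mg12 := modulus_mods (c := MUL) isT fr12 mg11; have [e28f _ _ _ _] := mg12.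
apply: (@run_Tab_poly 29 _ _ N (T %% g)%R) => //; first by lia.
move=> i m' iN j3 fr _; rewrite !evalE j3 !fr // e0 hqg //.
rewrite fr12 // fr11 // fr10 // fr9 // fr8 // fr7 // fr6 // h30; last by lia.
by rewrite val_subF Tmod' coefB.
Qed.

(** Binary powering from the lowest bit: base in register 31, exponent in 32, result in 33. Register
    10 holds v * v, which bounds the bit length of p. *)
Definition POWMOD :=
  Tab 33 (Var 28) (#1 [-] Var 3) ;;
  For 23 (Var 10) (
    (If (Var 32 [%] #2) (copy 24 33 ;; copy 25 31 ;; MODMUL ;; copy 33 29) Skip) ;;
    copy 24 31 ;; copy 25 31 ;; MODMUL ;; copy 31 29 ;; SetV 32 (Var 32 [/] #2)).

Lemma run_POWMOD N g B e m (C : memory -> Prop) : env m -> modulus m N g ->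
  holds m 31 N B -> size B <= N -> get m 32 0 = e -> e < 2 ^ (v * v) -> e < W ->
  (forall m', holds m' 33 N (B ^+ e %% g)%R -> C m') ->
  run W POWMOD (N * D ^ 10) C m.
Proof.
move=> me mg hB sB e32 ev eW fin; have [e28 /andP[N0 Np] sg _ _] := mg.
have N2 : N <= 2 * p by lia.
have e10 : get m 10 0 = v * v by case: me => ? ? ? ? [].
have vD : v < D by rewrite ltn_expl.
have gn0 : (g != 0)%R by rewrite -size_poly_eq0 sg.
have smod (X : poly_p) : size (X %% g)%R <= N by rewrite -ltnS -sg ltn_modp.
pose K := (2 * (N * D ^ 8) + 6 * (3 * N + 3) + 2).
apply: (@run_weaken _ _ ((3 * N + 3) + (\sum_(i < v * v) (K + 2) + 3)) _ C C) => //.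
  rewrite sum_nat_const card_ord.
  have D8 : 256 <= D ^ 8.
    by apply: (@leq_trans (D ^ 2)); [rewrite (leq_mul D16 D16)|rewrite leq_exp2l //; lia].
  have ND8 : K + 2 <= N * D ^ 8 * 3 by rewrite /K; nia.
  have v2 : v * v * 4 <= D ^ 2 by rewrite -mulnn; have := leq_mul v2D v2D; clear; lia.
  have N8 : N * 256 <= N * D ^ 8 by rewrite leq_mul2l D8 orbT.
  have -> : N * D ^ 10 = N * D ^ 8 * D ^ 2 by rewrite -mulnA -expnD.
  have x1 : N * D ^ 8 <= v * v * (N * D ^ 8) by rewrite leq_pmull // muln_gt0; lia.
  have x2 : v * v * (K + 2) <= v * v * (N * D ^ 8 * 3) by rewrite leq_mul2l ND8 orbT.
  have x3 : N * D ^ 8 * (v * v * 4) <= N * D ^ 8 * D ^ 2 by rewrite leq_mul2l v2 orbT.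
  clear ND8 v2; clearbody K.
  by move: (v * v) (N * D ^ 8) (D ^ 2) K x1 x2 x3 N8 N0 => vv x d2 k; clear; lia.
apply: run_seq; apply: run_frame; apply: (@run_Tab_poly 33 _ _ N 1%R) => //.
  by move=> i m' iN j3 fr _; rewrite !evalE j3 coef1; case: i iN {j3 fr} => [|i] _ /=; rewrite ?val1F ?subSS ?sub0n.
move=> m1 h33 fr1; have me1 := env_mods (c := Tab 33 _ _) isT fr1 me.
have mg1 := modulus_mods (c := Tab 33 _ _) isT fr1 mg.
pose I i m' := [/\ env m', modulus m' N g, get m' 32 0 = e %/ 2 ^ i,
  holds m' 33 N (B ^+ (e %% 2 ^ i) %% g)%R & holds m' 31 N (B ^+ (2 ^ i) %% g)%R].
apply: (@run_For _ 23 _ _ (v * v) (fun=> K) I) => //.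
- by rewrite evalE fr1.
- move=> i m2 m3 h [i1 [i21 i22 i23 i24 [J JR i25]] i3 i4 i5].
  have res r n P : r < 64 -> r != 23 -> holds m2 r n P -> holds m3 r n P.
    by move=> r64 r23; apply: holds_frame => k; rewrite h.
  split; rewrite ?h //; try exact: res.
  + by case: i1 => ? ? ? ? [g9 ?]; split; rewrite ?h //; split; rewrite ?h // => k kK; rewrite h // g9.
  + by split; rewrite ?h //; [exact: res|exists J => //; exact: res].
- split; rewrite ?expn0 ?divn1 ?modn1 ?expr0 ?expr1 ?fr1 //.
  + by rewrite modp_small // size_poly1 sg.
  + by rewrite modp_small ?sg //; apply: holds_frame hB => i; rewrite fr1.
- move=> i m2 iv [i1 i2 i3 i4 i5] _.
  pose J m' := [/\ env m', modulus m' N g, get m' 32 0 = e %/ 2 ^ i,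
    holds m' 33 N (B ^+ (e %% 2 ^ i.+1) %% g)%R & holds m' 31 N (B ^+ (2 ^ i) %% g)%R].
  have eS : e %% 2 ^ i.+1 = odd (e %/ 2 ^ i) * 2 ^ i + e %% 2 ^ i.
    rewrite {1}(divn_eq e (2 ^ i)) expnS -modn2.
    rewrite {1}(divn_eq (e %/ 2 ^ i) 2) mulnDl -addnA -mulnA modnMDl modn_small //.
    have : e %/ 2 ^ i %% 2 < 2 by rewrite ltn_mod.
    have : e %% 2 ^ i < 2 ^ i by rewrite ltn_mod expn_gt0.
    by case: (_ %% 2) => [|[|//]]; lia.
  apply: (@run_weaken _ _ (((3 * N + 3) + ((3 * N + 3) + (N * D ^ 8 + (3 * N + 3)))).+1 +
    ((3 * N + 3) + ((3 * N + 3) + (N * D ^ 8 + ((3 * N + 3) + 1))))) _ (I i.+1)) => //; first by rewrite /K; lia.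
  have [e28' _ _ _ _] := i2.
  apply: run_seq; apply: (@run_weaken _ _ _ _ J _ _ (leqnn _)); last first.
    apply: run_if; rewrite !evalE i3 modn2 => od; last first.
      apply: (@run_weaken _ _ 1 _ J J) => //; first by lia.
      apply: run_skip; split=> //; rewrite eS; case: (odd _) od => //= _.
    have od' : odd (e %/ 2 ^ i) by case: (odd _) od.
    apply: run_seq; apply: run_frame; apply: (run_copy (N := N) (P := (B ^+ (e %% 2 ^ i) %% g)%R)) => //.
    move=> m3 h24 fr3; have me3 := env_mods (c := copy 24 33) isT fr3 i1.
    have mg3 := modulus_mods (c := copy 24 33) isT fr3 i2.
    apply: run_seq; apply: run_frame; apply: (run_copy (N := N) (P := (B ^+ (2 ^ i) %% g)%R)) => //; rewrite ?fr3 //.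
      by apply: holds_frame i5 => k; rewrite fr3.
    move=> m4 h25 fr4; have me4 := env_mods (c := copy 25 31) isT fr4 me3.
    have mg4 := modulus_mods (c := copy 25 31) isT fr4 mg3.
    apply: run_seq; apply: run_frame; apply: (run_MODMUL me4 mg4 (P := (B ^+ (e %% 2 ^ i) %% g)%R) (Q := (B ^+ (2 ^ i) %% g)%R)) => //.
      by apply: holds_frame h24 => k; rewrite fr4.
    move=> m5 h29 fr5; have me5 := env_mods (c := MODMUL) isT fr5 me4.
    have mg5 := modulus_mods (c := MODMUL) isT fr5 mg4; have [e28a _ _ _ _] := mg5.
    apply: run_frame; apply: (run_copy (N := N) (P := ((B ^+ (e %% 2 ^ i) %% g) * (B ^+ (2 ^ i) %% g) %% g)%R)) => //.
    move=> m6 h33' fr6; split.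
    + exact: (env_mods (c := copy 33 29) isT fr6 me5).
    + exact: (modulus_mods (c := copy 33 29) isT fr6 mg5).
    + by rewrite fr6 // fr5 // fr4 // fr3.
    + by rewrite eS od' mul1n addnC exprD -modp_mul mulrC -modp_mul mulrC.
    by apply: holds_frame i5 => k; rewrite fr6 // fr5 // fr4 // fr3.
  move=> m3 [me3 mg3 e32' h33' h31]; have [e28a _ _ _ _] := mg3.
  apply: run_seq; apply: run_frame; apply: (run_copy (N := N) (P := (B ^+ (2 ^ i) %% g)%R)) => //.
  move=> m4 h24 fr4; have me4 := env_mods (c := copy 24 31) isT fr4 me3.
  have mg4 := modulus_mods (c := copy 24 31) isT fr4 mg3; have [e28b _ _ _ _] := mg4.
  apply: run_seq; apply: run_frame; apply: (run_copy (N := N) (P := (B ^+ (2 ^ i) %% g)%R)) => //.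
    by apply: holds_frame h31 => k; rewrite fr4.
  move=> m5 h25 fr5; have me5 := env_mods (c := copy 25 31) isT fr5 me4.
  have mg5 := modulus_mods (c := copy 25 31) isT fr5 mg4.
  apply: run_seq; apply: run_frame; apply: (run_MODMUL me5 mg5 (P := (B ^+ (2 ^ i) %% g)%R) (Q := (B ^+ (2 ^ i) %% g)%R)) => //.
    by apply: holds_frame h24 => k; rewrite fr5.
  move=> m6 h29 fr6; have me6 := env_mods (c := MODMUL) isT fr6 me5.
  have mg6 := modulus_mods (c := MODMUL) isT fr6 mg5; have [e28c _ _ _ _] := mg6.
  apply: run_seq; apply: run_frame; apply: (run_copy (N := N) (P := ((B ^+ (2 ^ i) %% g) * (B ^+ (2 ^ i) %% g) %% g)%R)) => //.
  move=> m7 h31' fr7; have me7 := env_mods (c := copy 31 29) isT fr7 me6.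
  have mg7 := modulus_mods (c := copy 31 29) isT fr7 mg6.
  have e7 : get m7 32 0 = e %/ 2 ^ i by rewrite fr7 // fr6 // fr5 // fr4.
  apply: run_frame; apply: run_SetV => //; rewrite !evalE e7.
    by apply: leq_ltn_trans eW; rewrite (leq_trans (leq_div _ _)) // leq_div.
  move=> m8 h8 fr8; split.
  + exact: (env_mods (c := SetV 32 _) isT fr8 me7).
  + exact: (modulus_mods (c := SetV 32 _) isT fr8 mg7).
  + by rewrite h8 //= -divnMA -expnSr.
  + by apply: holds_frame h33' => k; rewrite fr8 // fr7 // fr6 // fr5 // fr4.
  rewrite expnS mul2n -addnn exprD -modp_mul mulrC -modp_mul.
  by apply: holds_frame h31' => k; rewrite fr8.
move=> m' [_ _ _ h _]; apply: fin; by rewrite modn_small in h.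
Qed.

Definition INVSERIES :=
  Tab 26 (Var 28) #0 ;; Tab 27 (Var 28) (#1 [-] Var 3) ;; copy 31 34 ;; SetV 32 (Var 0 [-] #1) ;; POWMOD.

Lemma coef_modXn N (P : poly_p) : coef_eq N (P %% 'X^N)%R P.
Proof.
move=> i iN; rewrite {2}(divp_eq P 'X^N) coefD coefMXn iN add0r //.
Qed.

Lemma run_one r N m (Q : memory -> Prop) : r < 64 -> r != 3 -> get m 28 0 = N -> N <= 2 * p ->
  (forall m', holds m' r N 1%R -> Q m') -> run W (Tab r (Var 28) (#1 [-] Var 3)) (3 * N + 3) Q m.
Proof.
move=> r64 r3 e28 Np fin; apply: (@run_Tab_poly r _ _ N 1%R) => //.
by move=> i m' iN j3 fr _; rewrite !evalE j3 coef1; case: i iN {j3 fr} => [|i] _ /=; rewrite ?val1F ?subSS ?sub0n.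
Qed.

(* If G has constant term 1 then G^p = 1 modulo X^p, so that G^(p-1) inverts G. *)
Lemma run_INVSERIES N (G : poly_p) m (C : memory -> Prop) : env m -> get m 28 0 = N -> 0 < N <= p ->
  holds m 34 N G -> size G <= N -> (G`_0 = 1)%R ->
  (forall m' J, coef_eq N (J * G) 1 -> size J <= N -> holds m' 33 N J -> C m') ->
  run W INVSERIES (N * D ^ 10 + 9 * N + 10) C m.
Proof.
move=> me e28 /andP[N0 Np] hG sG G0 fin; have N2 : N <= 2 * p by lia.
apply: (@run_weaken _ _ ((3 * N + 3) + ((3 * N + 3) + ((3 * N + 3) + (1 + N * D ^ 10)))) _ C C) => //; first by lia.
apply: run_seq; apply: run_frame; apply: (@run_Tab_poly 26 _ _ N 'X^N) => //.
  by move=> i m' iN j3 fr _; rewrite !evalE coefXn ltn_eqF.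
move=> m1 h26 fr1; have me1 := env_mods (c := Tab 26 _ _) isT fr1 me.
apply: run_seq; apply: run_frame; apply: (@run_one 27 N) => //; first by rewrite fr1.
move=> m2 h27 fr2; have me2 := env_mods (c := Tab 27 _ _) isT fr2 me1.
(* The reversal of X^N is 1, its own inverse; the low coefficients in register 26 are all 0. *)
have mg2 : modulus m2 N 'X^N.
  split; rewrite ?fr2 ?fr1 ?N0 ?size_polyXn //; first by apply: holds_frame h26 => i; rewrite fr2.
  by exists 1%R => //; have := @revpX F N N 1%R (leqnn N); rewrite !scale1r subnn expr0 => ->; rewrite mulr1.
apply: run_seq; apply: run_frame; apply: (run_copy (N := N) (P := G)) => //; rewrite ?fr2 ?fr1 //.
  by apply: holds_frame hG => i; rewrite fr2 // fr1.
move=> m3 h31 fr3; have me3 := env_mods (c := copy 31 34) isT fr3 me2.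
have mg3 := modulus_mods (c := copy 31 34) isT fr3 mg2; have [e0 _ _ _ _] := me3.
apply: run_seq; apply: run_frame; apply: run_SetV => //; rewrite !evalE e0.
  by apply: leq_ltn_trans pW; lia.
move=> m4 h4 fr4; have me4 := env_mods (c := SetV 32 _) isT fr4 me3.
have mg4 := modulus_mods (c := SetV 32 _) isT fr4 mg3.
apply: (run_POWMOD me4 mg4 (B := G) (e := p.-1)) => //.
- by apply: holds_frame h31 => i; rewrite fr4.
- by rewrite h4 //= subn1.
- by apply: leq_ltn_trans p_pow; exact: leq_pred.
- by apply: leq_ltn_trans pW; lia.
move=> m5 h5; apply: fin h5; last by rewrite -ltnS -(size_polyXn F N) ltn_modp -size_poly_eq0 size_polyXn.
apply: coef_eq_trans (coef_eqM (@coef_modXn N _) (@coef_eq_refl _ N G)) _.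
apply: pchar_expr_inverse Np G0; exact: pchar_Fp.
Qed.

(** Register 34 receives the reversal of g below degree N. The leading coefficient 1 is not stored
    in register 35, so the entry of index 0 is supplied by hand. *)
Definition SETMOD :=
  Tab 34 (Var 28) ((#1 [-] Var 3) [+] (#1 [-] (#1 [-] Var 3)) [*] Arr 35 (Var 28 [-] Var 3)) ;;
  INVSERIES ;; copy 27 33 ;; copy 26 35.

Lemma run_SETMOD N g m (C : memory -> Prop) : env m -> get m 28 0 = N -> 0 < N <= p ->
  (g \is monic)%R -> size g = N.+1 -> holds m 35 N g ->
  (forall m', modulus m' N g -> C m') ->
  run W SETMOD (N * D ^ 10 + 18 * N + 20) C m.
Proof.
move=> me e28 /andP[N0 Np] gm sg hg fin; have N2 : N <= 2 * p by lia.
apply: (@run_weaken _ _ ((3 * N + 3) + ((N * D ^ 10 + 9 * N + 10) + ((3 * N + 3) + (3 * N + 3)))) _ C C) => //; first by lia.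
pose G := (\poly_(i < N) g`_(N - i))%R.
have gN : (g`_N = 1)%R by have := monicP gm; rewrite lead_coefE sg.
apply: run_seq; apply: run_frame; apply: (@run_Tab_poly 34 _ _ N G) => //.
  move=> i m' iN j3 fr _; rewrite !evalE j3 !fr // e28 coef_poly iN.
  case: i iN {j3 fr} => [|i] iN; first by rewrite !subn0 gN subnn mul0n addn0 val1F.
  by rewrite subSS sub0n subn0 add0n mul1n hg //; lia.
move=> m1 h34 fr1; have me1 := env_mods (c := Tab 34 _ _) isT fr1 me.
apply: run_seq; apply: run_frame; apply: (run_INVSERIES (N := N) (G := G)) => //; rewrite ?fr1 ?N0 ?size_poly //.
  by rewrite coef_poly N0 subn0 gN.
move=> m2 J JG sJ h33 fr2; have e28' : get m2 28 0 = N by rewrite fr2 // fr1.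
apply: run_seq; apply: run_frame; apply: (run_copy (N := N) (P := J)) => //.
move=> m3 h27 fr3.
apply: run_frame; apply: (run_copy (N := N) (P := g)) => //; rewrite ?fr3 //.
  by apply: holds_frame hg => i; rewrite fr3 // fr2 // fr1.
move=> m4 h26 fr4; apply: fin; split; rewrite ?fr4 ?fr3 ?N0 //.
exists J; last by apply: holds_frame h27 => i; rewrite fr4.
apply: coef_eq_trans JG; apply: coef_eqM => // i iN.
by rewrite coef_revp 1?ltnW // coef_poly iN.
Qed.

Lemma env_agree j m1 m2 : 10 < j -> (forall r i, r < 64 -> r != j -> get m2 r i = get m1 r i) -> env m1 -> env m2.
Proof.
move=> j10 h [h0 h6 h7 h8 [h9 h10]].
have g r i : r <= 10 -> get m2 r i = get m1 r i.
  by move=> r10; apply: h; [apply: leq_ltn_trans r10 _|apply/eqP => rj; move: j10; rewrite -rj ltnNge r10].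
by split; rewrite ?g //; split; rewrite ?g // => i iK; rewrite g // h9.
Qed.

Lemma modp_natr k : ((k %% p)%:R = k%:R :> F)%R.
Proof. by apply: val_inj; rewrite /= !val_Fp_nat // modn_mod. Qed.

Lemma natr_oppF k : k <= p -> ((p - k)%:R = - k%:R :> F)%R.
Proof. by move=> kp; rewrite natrB // pchar_Fp_0 // sub0r. Qed.

Definition inverse_table (m : memory) n := forall i, 0 < i <= n -> get m 39 i = val (i%:R^-1 : F)%R.

(** A round improves the precision from 2^i - 1 to 2^(i+1) - 1, and v * v rounds suffice because p <
    2^(v v). All rounds run at full length N, which costs only a factor v^2. *)
Definition NEWTON :=
  Tab 37 (Var 28) (#1 [-] Var 3) ;;
  For 38 (Var 10) (
    copy 34 37 ;; INVSERIES ;; SetV 13 (Var 28) ;;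
    Tab 11 (Var 28) ((Var 3 [+] #1) [*] ((#1 [-] (Var 3 [+] #2 [-] Var 28)) [*] Arr 37 (Var 3 [+] #1)) [%] Var 0) ;;
    copy 12 33 ;; MUL ;;
    Tab 12 (Var 28) ((#1 [-] Var 3) [+] (#1 [-] (#1 [-] Var 3)) [*]
      ((Var 0 [-] (Arr 36 (Var 3) [+] Arr 14 (Var 3 [-] #1)) [%] Var 0) [*] Arr 39 (Var 3) [%] Var 0)) ;;
    copy 11 37 ;; MUL ;; copy 37 14).

(** With Z = Y' J and with the coefficients of Q equal to those of T moved down by one, this is the
    solution E of E' = -(Q + Y' J) with constant term 1, truncated at N. The divisions by i are
    possible as N < p. *)
Definition newton_factor N (T Z : poly_p) : poly_p :=
  (\poly_(i < N) (if i is k.+1 then - (T`_i + Z`_k) * i%:R^-1 else 1))%R.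

Lemma run_NEWTON N (T Q : poly_p) m (C : memory -> Prop) : env m -> get m 28 0 = N -> 0 < N < p ->
  inverse_table m N -> holds m 36 N T -> (forall k, k < N.-1 -> (Q`_k = T`_k.+1)%R) ->
  (forall m' (Y : poly_p), holds m' 37 N Y -> size Y <= N -> (Y`_0 = 1)%R ->
     coef_eq N.-1 (Y^`() + Q * Y) 0 -> C m') ->
  run W NEWTON (N * D ^ 13) C m.
Proof.
move=> me e28 /andP[N0 Np] inv hT QT fin; have N2 : N <= 2 * p by lia.
have e10 : get m 10 0 = v * v by case: me => ? ? ? ? [].
have char k : 0 < k < N -> (k%:R != 0 :> F)%R.
  by move=> /andP[k0 kN]; apply: natr_neq0_Fp => //; rewrite ?k0 (ltn_trans kN).
pose K := N * D ^ 10 + 9 * N + 10 + 2 * (N * D ^ 7) + 6 * (3 * N + 3) + 1.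
apply: (@run_weaken _ _ ((3 * N + 3) + (\sum_(i < v * v) (K + 2) + 3)) _ C C) => //.
  rewrite sum_nat_const card_ord.
  have x0 : 4 * (v * v) <= D ^ 2 by rewrite expnS expn1; have := leq_mul v2D v2D; lia.
  have D10 : 16 <= D ^ 10 by rewrite (leq_trans D16) // -{1}(expn1 D) leq_exp2l //; lia.
  have x1 : N * D ^ 7 <= N * D ^ 10 by rewrite leq_mul2l leq_exp2l ?orbT //; lia.
  have x2 : N * 16 <= N * D ^ 10 by rewrite leq_mul2l D10 orbT.
  have KX : K + 2 <= 9 * (N * D ^ 10) by rewrite /K; lia.
  have x3 : v * v * (K + 2) <= v * v * (9 * (N * D ^ 10)) by rewrite leq_mul2l KX orbT.
  have -> : N * D ^ 13 = N * D ^ 10 * D ^ 2 * D by rewrite (expnD D 11 2) (expnD D 10 1) expn1; lia.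
  have x4 : N * D ^ 10 * (4 * (v * v)) <= N * D ^ 10 * D ^ 2 by rewrite leq_mul2l x0 orbT.
  have x5 : N * D ^ 10 * D ^ 2 * 16 <= N * D ^ 10 * D ^ 2 * D by rewrite leq_mul2l D16 orbT.
  have x6 : N * D ^ 10 <= N * D ^ 10 * (v * v) by rewrite leq_pmulr // muln_gt0; lia.
  clear KX; clearbody K; move: (N * D ^ 10) (v * v) (D ^ 2) x2 x3 x4 x5 x6 => x vv d2.
  by move: (D) (K) => d k; move: N0; clear; lia.
apply: run_seq; apply: run_frame; apply: (run_one (N := N)) => //.
move=> m1 h37 fr1; have me1 := env_mods (c := Tab 37 _ _) isT fr1 me.
pose I i m' := [/\ env m', get m' 28 0 = N, inverse_table m' N, holds m' 36 N T &
  exists2 Y : poly_p, holds m' 37 N Y &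
    [/\ size Y <= N, (Y`_0 = 1)%R & coef_eq (minn (2 ^ i).-1 N.-1) (Y^`() + Q * Y) 0]].
apply: (@run_For _ 38 _ _ (v * v) (fun=> K) I) => //.
- by rewrite evalE fr1.
- move=> i m2 m3 h [i1 i2 i3 i4 [Y i5 i6]].
  split; rewrite ?h //; first exact: env_agree h i1.
  + by move=> k kN; rewrite h // i3.
  + by apply: holds_frame i4 => k; rewrite h.
  by exists Y => //; apply: holds_frame i5 => k; rewrite h.
- split; rewrite ?fr1 //.
  + by move=> k kN; rewrite fr1 // inv.
  + by apply: holds_frame hT => k; rewrite fr1.
  exists 1%R => //; split; rewrite ?size_poly1 ?coef1 // => k.
  by rewrite expn0 min0n.
- move=> i m2 iv [i1 i2 i3 i4 [Y i5 [sY Y0 rY]]] _.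
  apply: (@run_weaken _ _ ((3 * N + 3) + ((N * D ^ 10 + 9 * N + 10) + (1 + ((3 * N + 3) + ((3 * N + 3) + (N * D ^ 7 +
   ((3 * N + 3) + ((3 * N + 3) + (N * D ^ 7 + (3 * N + 3)))))))))) _ (I i.+1)) => //; first by rewrite /K; lia.
  apply: run_seq; apply: run_frame; apply: (run_copy (N := N) (P := Y)) => //.
  move=> m3 h34 fr3; have me3 := env_mods (c := copy 34 37) isT fr3 i1.
  apply: run_seq; apply: run_frame; apply: (run_INVSERIES (N := N) (G := Y)) => //; rewrite ?fr3 ?N0 ?(ltnW Np) //.
  move=> m4 J JY sJ h33 fr4; have me4 := env_mods (c := INVSERIES) isT fr4 me3.
  have a28 : get m4 28 0 = N by rewrite fr4 // fr3.
  apply: run_seq; apply: run_frame; apply: run_SetV => //; rewrite !evalE a28; first by apply: leq_ltn_trans pW.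
  move=> m5 h5 fr5; have me5 := env_mods (c := SetV 13 (Var 28)) isT fr5 me4; have [e0 _ _ _ _] := me5.
  have b28 : get m5 28 0 = N by rewrite fr5.
  have h37' : holds m5 37 N Y by apply: holds_frame i5 => k; rewrite fr5 // fr4 // fr3.
  apply: run_seq; apply: run_frame; apply: (@run_Tab_poly 11 _ _ N Y^`()%R) => //.
    move=> k m' kN j3 fr _; rewrite !evalE j3 !fr // e0 b28 coef_deriv.
    case: (ltnP k.+1 N) => k1N.
      rewrite (_ : k + 2 - N = 0); last by lia.
      rewrite subn0 mul1n addn1 h37' // -val_natF //; congr (val _).
      by rewrite natrM natr_Fp_val mulr_natl.
    rewrite (_ : 1 - _ = 0); last by lia.
    by rewrite mul0n muln0 mod0n nth_default ?mul0rn // (leq_trans sY).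
  move=> m6 h11 fr6; have me6 := env_mods (c := Tab 11 _ _) isT fr6 me5.
  apply: run_seq; apply: run_frame; apply: (run_copy (N := N) (P := J)) => //; first by rewrite fr6.
    by apply: holds_frame h33 => k; rewrite fr6 // fr5.
  move=> m7 h12 fr7; have me7 := env_mods (c := copy 12 33) isT fr7 me6.
  apply: run_seq; apply: run_frame; apply: (run_MUL_poly (N := N) (P := Y^`()%R) (Q := J)) => //.
  + by rewrite N0.
  + by rewrite fr7 // fr6 // h5.
  + by apply: holds_frame h11 => k; rewrite fr7.
  move=> m8 h14 fr8; have me8 := env_mods (c := MUL) isT fr8 me7; have [c0 _ _ _ _] := me8.
  have c28 : get m8 28 0 = N by rewrite fr8 // fr7 // fr6.
  have h36 : holds m8 36 N T by apply: holds_frame i4 => k; rewrite fr8 // fr7 // fr6 // fr5 // fr4 // fr3.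
  have h39 : inverse_table m8 N by move=> k kN; rewrite fr8 // fr7 // fr6 // fr5 // fr4 // fr3 // i3.
  pose E := newton_factor N T (Y^`() * J)%R.
  apply: run_seq; apply: run_frame; apply: (@run_Tab_poly 12 _ _ N E) => //.
    move=> k m' kN j3 fr _; rewrite !evalE j3 !fr // c0 coef_poly kN.
    case: k kN {j3} => [|k] kN; first by rewrite subn0 subnn mul0n addn0 val1F.
    rewrite -[RHS]/(val (- (T`_k.+1 + (Y^`() * J)`_k) * k.+1%:R^-1 : F)%R).
    rewrite !subSS sub0n !subn0 add0n mul1n h36 // h14 ?(ltnW kN) // h39 ?(ltnW kN) // -val_natF //.
    congr (val _); rewrite natrM natr_oppF ?modp_natr ?natrD ?natr_Fp_val //.
    by rewrite ltnW // ltn_pmod.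
  move=> m9 h12' fr9; have me9 := env_mods (c := Tab 12 _ _) isT fr9 me8.
  apply: run_seq; apply: run_frame; apply: (run_copy (N := N) (P := Y)) => //; first by rewrite fr9.
    by apply: holds_frame h37' => k; rewrite fr9 // fr8 // fr7 // fr6.
  move=> m10 h11' fr10; have me10 := env_mods (c := copy 11 37) isT fr10 me9.
  apply: run_seq; apply: run_frame; apply: (run_MUL_poly (N := N) (P := Y) (Q := E)) => //.
  + by rewrite N0.
  + by rewrite fr10 // fr9 // fr8 // fr7 // fr6 // h5.
  + by apply: holds_frame h12' => k; rewrite fr10.
  move=> m11 h14' fr11; have me11 := env_mods (c := MUL) isT fr11 me10.
  have d28 : get m11 28 0 = N by rewrite fr11 // fr10 // fr9.
  apply: run_frame; apply: (run_copy (N := N) (P := (Y * E)%R)) => //.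
  move=> m12 h37'' fr12; have me12 := env_mods (c := copy 37 14) isT fr12 me11.
  split; rewrite ?fr12 //.
  + by move=> k kN; rewrite fr12 // fr11 // fr10 // fr9 // h39.
  + by apply: holds_frame h36 => k; rewrite fr12 // fr11 // fr10 // fr9.
  pose Y1 := (\poly_(k < N) (Y * E)`_k)%R.
  have Y1E : coef_eq N (Y * E)%R Y1 by move=> k kN; rewrite coef_poly kN.
  have E0 : (E`_0 = 1)%R by rewrite coef_poly N0.
  exists Y1; first exact: holds_coef_eq Y1E h37''.
  split; first exact: size_poly.
    by rewrite -Y1E // coefM big_ord1 Y0 E0 mulr1.
  have E' : coef_eq N.-1 E^`() (- (Q + Y^`() * J)).
    move=> k kN; have kN' : k.+1 < N by lia.
    rewrite coef_deriv coef_poly kN' coefN coefD QT // -[LHS]mulr_natr -mulrA mulVf ?mulr1 //; exact: char.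
  have := newton_step JY char E0 E' rY.
  rewrite (_ : (2 * (2 ^ i).-1).+1 = (2 ^ i.+1).-1); last by rewrite expnS; case: (2 ^ i) (expn_gt0 2 i) => // x _; lia.
  apply: coef_eq_trans; apply: (@coef_eqW _ N.-1); first exact: geq_minr.
  apply: coef_eqD; first by apply: coef_eq_deriv; apply: coef_eq_sym.
  apply: coef_eqM => //; apply: coef_eqW (coef_eq_sym Y1E); exact: leq_pred.
move=> m' [i1 i2 i3 i4 [Y i5 [sY Y0 rY]]]; apply: fin i5 sY Y0 _.
by move: rY; rewrite (minn_idPr _) //; lia.
Qed.

(** * The splitting step *)

Definition tables (m : memory) n :=
  [/\ inverse_table m n, forall i, i <= n -> get m 42 i = val ((i`!)%:R : F)%R &
      forall i, i <= n -> get m 43 i = val ((i`!)%:R^-1 : F)%R].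

Definition state n m (X : {set F}) := [/\ env m, tables m n & modulus m #|X| (root_poly X)].

(** Keeping X when no element passes the test ensures that the set never becomes empty. *)
Definition restrict (X : {set F}) (w : poly_p) :=
  let S := [set x in X | w.[x] != 0]%R in if S == set0 then X else S.

(** Register 40 holds w. The power sum of exponent 0 is #|S|, an exact residue because #|S| <= n <
    p; the test succeeds when 0 < #|S| < #|X|, and only then is a new polynomial built. *)
Definition STEP :=
  copy 31 40 ;; SetV 32 (Var 0 [-] #1) ;; POWMOD ;; copy 24 33 ;;
  Tab 25 (Var 28) ((Var 3 [+] #1) [*] ((#1 [-] (Var 3 [+] #2 [-] Var 28)) [*] Arr 26 (Var 3 [+] #1)
    [+] (#1 [-] (Var 28 [-] (Var 3 [+] #1)))) [%] Var 0) ;;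
  MODMUL ;; SetV 13 (Var 28) ;; Tab 11 (Var 28) (Arr 29 (Var 28 [-] #1 [-] Var 3)) ;; copy 12 27 ;; MUL ;;
  copy 36 14 ;;
  If (Var 36 [*] (Var 28 [-] Var 36))
    (NEWTON ;; SetV 28 (Var 36) ;; Tab 35 (Var 28) (Arr 37 (Var 28 [-] Var 3)) ;; SETMOD) Skip.

Lemma horner_modp (g P : poly_p) x : (g.[x] = 0 -> (P %% g).[x] = P.[x])%R.
Proof. by move=> gx; rewrite {2}(divp_eq P g) hornerD hornerM gx mulr0 add0r. Qed.

Lemma tables_mods c m m' n : all (fun r => ~~ mods c r) [:: 39; 42; 43] ->
  (forall r i, r < 64 -> ~~ mods c r -> get m' r i = get m r i) -> tables m n -> tables m' n.
Proof.
move=> /and4P[c39 c42 c43 _] fr [h1 h2 h3]; split=> i iN; rewrite fr //; [exact: h1|exact: h2|exact: h3].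
Qed.

Lemma run_STEP n (X : {set F}) (w : poly_p) m (C : memory -> Prop) : state n m X -> #|X| <= n < p ->
  holds m 40 #|X| w -> size w <= #|X| ->
  (forall m', state n m' (restrict X w) -> C m') ->
  run W STEP (#|X| * D ^ 14) C m.
Proof.
move=> [me tb mg] /andP[Xn np] hw sw fin; set N := #|X| in mg hw sw Xn *; set g := root_poly X in mg.
have [e28 /andP[N0 _] _ _ _] := mg.
have Np : N <= p by lia.
have N2 : N <= 2 * p by lia.
have sg : size g = N.+1 by exact: size_root_poly.
have gn0 : (g != 0)%R by rewrite -size_poly_eq0 sg.
have gN : (g`_N = 1)%R by have := monicP (monic_root_poly X); rewrite lead_coefE -/g sg.
pose S := [set x in X | w.[x] != 0]%R.
have SX : S \subset X by apply/subsetP => x; rewrite inE => /andP[].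
pose e := (w ^+ p.-1 %% g)%R.
pose h := ((e * g^`()) %% g)%R.
have g0 x : x \in X -> (g.[x] = 0)%R by move=> xX; apply/eqP; rewrite root_polyE.
have smod (P : poly_p) : size (P %% g)%R <= N by rewrite -ltnS -sg ltn_modp.
have hval x : x \in X -> (h.[x] = (x \in S)%:R * g^`().[x])%R.
  move=> xX; rewrite horner_modp ?g0 // hornerM horner_modp ?g0 // horner_exp inE xX /=.
  congr (_ * _)%R; case: eqP => [->|/eqP wx]; first by rewrite expr0n -subn1 subn_eq0 leqNgt p1.
  by apply: (mulfI wx); rewrite -exprS prednK // fermatF // mulr1.
pose K := N * D ^ 10 + N * D ^ 8 + N * D ^ 7 + N * D ^ 13 + (N * D ^ 10 + 18 * N + 20) + 7 * (3 * N + 3) + 4.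
have ND j : j <= 13 -> N * D ^ j <= N * D ^ 13 by move=> j13; rewrite leq_mul2l leq_exp2l ?j13 ?orbT //; lia.
apply: (@run_weaken _ _ ((3 * N + 3) + (1 + (N * D ^ 10 + ((3 * N + 3) + ((3 * N + 3) + (N * D ^ 8 + (1 + ((3 * N + 3) +
  ((3 * N + 3) + (N * D ^ 7 + ((3 * N + 3) + (N * D ^ 13 + (1 + ((3 * N + 3) + (N * D ^ 10 + 18 * N + 20)))).+1))))))))))) _ C C) => //.
  have -> : N * D ^ 14 = N * D ^ 13 * D by rewrite (expnD D 13 1) expn1; lia.
  have x1 := ND 10 isT; have x2 := ND 8 isT; have x3 := ND 7 isT.
  have x4 : N * D ^ 13 * 16 <= N * D ^ 13 * D by rewrite leq_mul2l D16 orbT.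
  have x5 : N * 256 <= N * D ^ 13.
    by rewrite leq_mul2l; apply/orP; right; apply: (@leq_trans (D ^ 2)); [rewrite (leq_mul D16 D16)|rewrite leq_exp2l //; lia].
  by lia.
apply: run_seq; apply: run_frame; apply: (run_copy (N := N) (P := w)) => //.
move=> m1 h31 fr1; have me1 := env_mods (c := copy 31 40) isT fr1 me.
have mg1 := modulus_mods (c := copy 31 40) isT fr1 mg; have [a0 _ _ _ _] := me1.
apply: run_seq; apply: run_frame; apply: run_SetV => //; rewrite !evalE a0; first by apply: leq_ltn_trans pW; lia.
move=> m2 h2 fr2; have me2 := env_mods (c := SetV 32 _) isT fr2 me1.
have mg2 := modulus_mods (c := SetV 32 _) isT fr2 mg1.
apply: run_seq; apply: run_frame; apply: (run_POWMOD me2 mg2 (B := w) (e := p.-1)) => //.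
- by apply: holds_frame h31 => i; rewrite fr2.
- by rewrite h2 //= subn1.
- by apply: leq_ltn_trans p_pow; exact: leq_pred.
- by apply: leq_ltn_trans pW; lia.
move=> m3 h33 fr3; have me3 := env_mods (c := POWMOD) isT fr3 me2.
have mg3 := modulus_mods (c := POWMOD) isT fr3 mg2; have [b28 _ _ _ _] := mg3.
apply: run_seq; apply: run_frame; apply: (run_copy (N := N) (P := e)) => //.
move=> m4 h24 fr4; have me4 := env_mods (c := copy 24 33) isT fr4 me3.
have mg4 := modulus_mods (c := copy 24 33) isT fr4 mg3; have [c28 _ _ c26 _] := mg4; have [c0 _ _ _ _] := me4.
apply: run_seq; apply: run_frame; apply: (@run_Tab_poly 25 _ _ N g^`()%R) => //.
  move=> k m' kN j3 fr _; rewrite !evalE j3 !fr // c0 c28 coef_deriv.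
  rewrite -[RHS](_ : val (((k + 1) * val (g`_k.+1)%R)%:R : F)%R = _); last first.
    by congr (val _); rewrite natrM natr_Fp_val addn1 mulr_natl.
  rewrite val_natF // !addn1; case: (ltnP k.+1 N) => k1N.
    rewrite (_ : k + 2 - N = 0); last by lia.
    rewrite (_ : 1 - (N - k.+1) = 0); last by lia.
    by rewrite subn0 mul1n addn0 c26.
  have kE : k.+1 = N by apply/eqP; rewrite eqn_leq k1N andbT.
  rewrite kE gN val1F // (_ : 1 - (k + 2 - N) = 0); last by lia.
  by rewrite subnn subn0 mul0n add0n.
move=> m5 h25 fr5; have me5 := env_mods (c := Tab 25 _ _) isT fr5 me4.
have mg5 := modulus_mods (c := Tab 25 _ _) isT fr5 mg4.
apply: run_seq; apply: run_frame; apply: (run_MODMUL me5 mg5 (P := e) (Q := g^`()%R)) => //.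
- by apply: holds_frame h24 => i; rewrite fr5.
- exact: smod.
- by rewrite -ltnS -sg lt_size_deriv.
move=> m6 h29 fr6; have me6 := env_mods (c := MODMUL) isT fr6 me5.
have mg6 := modulus_mods (c := MODMUL) isT fr6 mg5; have [d28 _ _ _ _] := mg6.
apply: run_seq; apply: run_frame; apply: run_SetV => //; rewrite !evalE d28; first by apply: leq_ltn_trans pW.
move=> m7 h7 fr7; have me7 := env_mods (c := SetV 13 _) isT fr7 me6.
have mg7 := modulus_mods (c := SetV 13 _) isT fr7 mg6; have [k28 _ _ _ _] := mg7.
apply: run_seq; apply: run_frame; apply: (@run_Tab_poly 11 _ _ N (revp N.-1 h)) => //.
  move=> k m' kN j3 fr _; rewrite !evalE j3 !fr // k28 fr7 // h29 ?coef_revp ?subn1 //; lia.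
move=> m8 h11 fr8; have me8 := env_mods (c := Tab 11 _ _) isT fr8 me7.
have mg8 := modulus_mods (c := Tab 11 _ _) isT fr8 mg7; have [l28 _ _ _ [J JR h27]] := mg8.
apply: run_seq; apply: run_frame; apply: (run_copy (N := N) (P := J)) => //.
move=> m9 h12 fr9; have me9 := env_mods (c := copy 12 27) isT fr9 me8.
have mg9 := modulus_mods (c := copy 12 27) isT fr9 mg8.
apply: run_seq; apply: run_frame; apply: (run_MUL_poly (N := N) (P := revp N.-1 h) (Q := J)) => //.
- by rewrite N0.
- by rewrite fr9 // fr8 // h7.
- by apply: holds_frame h11 => i; rewrite fr9.
move=> m10 h14 fr10; have me10 := env_mods (c := MUL) isT fr10 me9.
have mg10 := modulus_mods (c := MUL) isT fr10 mg9; have [o28 _ _ _ _] := mg10.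
pose T := (revp N.-1 h * J)%R.
have TS i : i < N -> (T`_i = \sum_(x in S) x ^+ i)%R by move=> iN; exact: (power_sums_by_division SX (smod _ : size h <= N) hval JR iN).
apply: run_seq; apply: run_frame; apply: (run_copy (N := N) (P := T)) => //.
move=> m11 h36 fr11; have me11 := env_mods (c := copy 36 14) isT fr11 me10.
have mg11 := modulus_mods (c := copy 36 14) isT fr11 mg10; have [q28 _ _ _ _] := mg11.
have tb11 : tables m11 n.
  apply: (tables_mods _ fr11) => //; apply: (tables_mods _ fr10) => //; apply: (tables_mods _ fr9) => //.
  apply: (tables_mods _ fr8) => //; apply: (tables_mods _ fr7) => //; apply: (tables_mods _ fr6) => //.
  apply: (tables_mods _ fr5) => //; apply: (tables_mods _ fr4) => //; apply: (tables_mods _ fr3) => //.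
  by apply: (tables_mods _ fr2) => //; apply: (tables_mods _ fr1).
have SN : #|S| <= N by exact: subset_leq_card.
have g36 : get m11 36 0 = #|S|.
  rewrite h36 // TS // (eq_bigr (fun=> 1%R)); last by move=> x _; rewrite expr0.
  by rewrite sumr_const val_natF // modn_small //; apply: leq_ltn_trans np; apply: leq_trans Xn.
apply: run_if; rewrite !evalE g36 q28.
  rewrite muln_eq0 negb_or cards_eq0 subn_eq0 -ltnNge => /andP[S0 SltN].
  have S0' : 0 < #|S| by rewrite lt0n cards_eq0.
  pose Q := (\poly_(k < N.-1) \sum_(x in S) x ^+ k.+1)%R : poly_p.
  apply: run_seq; apply: run_frame; apply: (run_NEWTON (N := N) (T := T) (Q := Q)) => //.
  - by rewrite N0; lia.
  - by move=> i iN; case: tb11 => h39 _ _; apply: h39; lia.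
  - by move=> k kN; rewrite coef_poly kN TS //; lia.
  move=> m12 Y h37 sY Y0 rY fr12; have me12 := env_mods (c := NEWTON) isT fr12 me11.
  have tb12 := tables_mods (c := NEWTON) isT fr12 tb11.
  have YS : coef_eq N Y (rev_root_poly S).
    apply: newton_unique rY _; rewrite ?coef0_rev_root_poly //.
      by move=> k /andP[k0 kN]; apply: natr_neq0_Fp => //; rewrite k0; lia.
    exact: newton_identities.
  apply: run_seq; apply: run_frame; apply: run_SetV => //; rewrite !evalE fr12 // g36.
    by apply: leq_ltn_trans pW; lia.
  move=> m13 h13 fr13; have me13 := env_mods (c := SetV 28 _) isT fr13 me12.
  have tb13 := tables_mods (c := SetV 28 _) isT fr13 tb12.
  have r28 : get m13 28 0 = #|S| by rewrite h13.
  apply: run_seq; apply: (@run_weaken _ _ (3 * #|S| + 3) _ _ _ m13 _ (fun m' H => H)); first by lia.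
  apply: run_frame; apply: (@run_Tab_poly 35 _ _ #|S| (root_poly S)) => //; first by lia.
    move=> k m' kN j3 fr _; rewrite !evalE j3 !fr // r28 fr13 // h37; last by lia.
    by rewrite YS; [rewrite coef_root_poly // ltnW|exact: leq_ltn_trans (leq_subr _ _) SltN].
  move=> m14 h35 fr14; have me14 := env_mods (c := Tab 35 _ _) isT fr14 me13.
  have tb14 := tables_mods (c := Tab 35 _ _) isT fr14 tb13.
  apply: (@run_weaken _ _ (#|S| * D ^ 10 + 18 * #|S| + 20) _ _ _ m14 _ (fun m' H => H)).
    by rewrite leq_add2r leq_add // leq_mul // ltnW.
  apply: run_frame; apply: (run_SETMOD (g := root_poly S)) => //.
  - by rewrite fr14.
  - by rewrite S0'; lia.
  - exact: monic_root_poly.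
  - exact: size_root_poly.
  move=> m15 mg15 fr15; apply: fin; rewrite /restrict -/S (negPf S0); split=> //.
    exact: (env_mods (c := SETMOD) isT fr15 me14).
  exact: (tables_mods (c := SETMOD) isT fr15 tb14).
move=> /eqP; rewrite muln_eq0 cards_eq0 subn_eq0 => SS.
apply: (@run_weaken _ _ 1 _ C C) => //; first by lia.
apply: run_skip; apply: fin; rewrite /restrict -/S; case/orP: SS => [->|NS]; first by split.
have -> : S = X by apply/eqP; rewrite eqEcard SX.
by case: ifP; split.
Qed.

Definition SHIFTSTEP :=
  Tab 31 (Var 28) ((#1 [-] Var 3) [*] Var 41 [+] (#1 [-] (Var 3 [-] #1)) [*] (#1 [-] (#1 [-] Var 3))) ;;
  SetV 32 (Var 0 [/] #2) ;; POWMOD ;;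
  Tab 40 (Var 28) ((Arr 33 (Var 3) [+] (#1 [-] Var 3) [*] (Var 0 [-] #1)) [%] Var 0) ;;
  STEP.

(** The assumption 1 < #|X| makes X + a a reduced residue modulo g, of two coefficients. *)
Lemma run_SHIFTSTEP n (X : {set F}) a m (C : memory -> Prop) : state n m X -> #|X| <= n < p -> 1 < #|X| ->
  get m 41 0 = a -> a < p ->
  (forall m' w, (forall x, x \in X -> w.[x] = (x + a%:R) ^+ p./2 - 1)%R -> state n m' (restrict X w) -> C m') ->
  run W SHIFTSTEP (#|X| * D ^ 15) C m.
Proof.
move=> st /andP[Xn np] X2 e41 ap fin; have [me tb mg] := st; set N := #|X| in mg Xn X2 *; set g := root_poly X in mg.
have [e28 /andP[N0 _] _ _ _] := mg.
have N2 : N <= 2 * p by lia.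
have sg : size g = N.+1 by exact: size_root_poly.
have gn0 : (g != 0)%R by rewrite -size_poly_eq0 sg.
have g0 x : x \in X -> (g.[x] = 0)%R by move=> xX; apply/eqP; rewrite root_polyE.
pose B : poly_p := ('X + (a%:R)%:P)%R.
have sB : size B <= N by rewrite size_XaddC.
pose P : poly_p := (B ^+ p./2 %% g)%R.
have sP : size P <= N by rewrite -ltnS -sg ltn_modp.
pose w : poly_p := (P - 1)%R.
have sw : size w <= N by rewrite (leq_trans (size_polyD _ _)) // geq_max sP size_polyN size_poly1.
apply: (@run_weaken _ _ ((3 * N + 3) + (1 + (N * D ^ 10 + ((3 * N + 3) + N * D ^ 14)))) _ C C) => //.
  have -> : N * D ^ 15 = N * D ^ 14 * D by rewrite (expnD D 14 1) expn1; lia.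
  have x1 : N * D ^ 10 <= N * D ^ 14 by rewrite leq_mul2l leq_exp2l ?orbT //; lia.
  have x4 : N * D ^ 14 * 16 <= N * D ^ 14 * D by rewrite leq_mul2l D16 orbT.
  have x5 : N * 1 <= N * D ^ 14 by rewrite leq_mul2l expn_gt0; apply/orP; right; lia.
  by lia.
apply: run_seq; apply: run_frame; apply: (@run_Tab_poly 31 _ _ N B) => //.
  move=> k m' kN j3 fr _; rewrite !evalE j3 !fr // e41 coefD coefX coefC.
  case: k kN {j3} => [|[|k]] kN.
  - rewrite -[RHS]/(val (0 + a%:R : F)%R) add0r val_natF // modn_small // [LHS](_ : _ = a) //; lia.
  - by rewrite -[RHS]/(val (1 + 0 : F)%R) addr0 val1F.
  - rewrite -[RHS]/(val (0 + 0 : F)%R) addr0 (_ : 1 - k.+2 = 0); last by lia.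
    by rewrite (_ : 1 - (k.+2 - 1) = 0) ?mul0n //; lia.
move=> m1 h31 fr1; have me1 := env_mods (c := Tab 31 _ _) isT fr1 me.
have mg1 := modulus_mods (c := Tab 31 _ _) isT fr1 mg; have [a0 _ _ _ _] := me1.
apply: run_seq; apply: run_frame; apply: run_SetV => //; rewrite !evalE a0.
  by apply: leq_ltn_trans (leq_div _ _) _; apply: leq_ltn_trans pW; lia.
move=> m2 h2 fr2; have me2 := env_mods (c := SetV 32 _) isT fr2 me1.
have mg2 := modulus_mods (c := SetV 32 _) isT fr2 mg1.
have hp : p./2 <= p by rewrite -divn2 leq_div.
apply: run_seq; apply: run_frame; apply: (run_POWMOD me2 mg2 (B := B) (e := p./2)) => //.
- by apply: holds_frame h31 => i; rewrite fr2.
- by rewrite h2 //= divn2.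
- exact: leq_ltn_trans p_pow.
- by apply: leq_ltn_trans pW; lia.
move=> m3 h33 fr3; have me3 := env_mods (c := POWMOD) isT fr3 me2.
have mg3 := modulus_mods (c := POWMOD) isT fr3 mg2; have [b28 _ _ _ _] := mg3; have [c0 _ _ _ _] := me3.
apply: run_seq; apply: run_frame; apply: (@run_Tab_poly 40 _ _ N w) => //.
  move=> k m' kN j3 fr _; rewrite !evalE j3 !fr // c0 h33 // coefB coef1 -val_natF //.
  congr (val _); rewrite natrD natr_Fp_val natrM natr_oppF // mulrN; congr (_ - _)%R.
  by case: (k) => [|k']; rewrite ?subSS ?sub0n ?subn0 ?mulr1 ?mul0r.
move=> m4 h40 fr4; have me4 := env_mods (c := Tab 40 _ _) isT fr4 me3.
have mg4 := modulus_mods (c := Tab 40 _ _) isT fr4 mg3.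
apply: (run_STEP (n := n) (w := w)) => //.
- split=> //; apply: (tables_mods _ fr4) => //; apply: (tables_mods _ fr3) => //.
  by apply: (tables_mods _ fr2) => //; apply: (tables_mods _ fr1).
- by rewrite Xn.
move=> m5; apply: fin => x xX.
by rewrite hornerD hornerN hornerC horner_modp ?g0 // horner_exp hornerD hornerX hornerC.
Qed.

Definition TAYLORSTEP :=
  SetV 13 (Var 28 [+] #1) ;;
  Tab 11 (Var 13) (((#1 [-] Var 3) [+] (#1 [-] (#1 [-] Var 3)) [*] Arr 26 (Var 28 [-] Var 3)) [*] Arr 42 (Var 28 [-] Var 3) [%] Var 0) ;;
  Tab 12 (Var 13) ((#1 [-] Var 3) [+] (#1 [-] (#1 [-] Var 3)) [*] (Arr 12 (Var 3 [-] #1) [*] Var 41 [*] Arr 39 (Var 3) [%] Var 0)) ;;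
  MUL ;;
  Tab 40 (Var 28) ((Arr 14 (Var 28 [-] Var 3) [*] Arr 43 (Var 3) [+] (Var 0 [-] Arr 26 (Var 3))) [%] Var 0) ;;
  STEP.

Lemma run_TAYLORSTEP n (X : {set F}) a m (C : memory -> Prop) : state n m X -> #|X| <= n < p ->
  get m 41 0 = a ->
  (forall m' w, (forall x, x \in X -> w.[x] = (root_poly X).[x + a%:R])%R -> state n m' (restrict X w) -> C m') ->
  run W TAYLORSTEP (#|X| * D ^ 15) C m.
Proof.
move=> st /andP[Xn np] e41 fin; have [me tb mg] := st; set N := #|X| in mg Xn *; set g := root_poly X in mg fin.
have [e28 /andP[N0 _] _ _ _] := mg.
have N2 : N <= 2 * p by lia.
have N12 : N.+1 <= 2 * p by lia.
have sg : size g = N.+1 by exact: size_root_poly.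
have gN : (g`_N = 1)%R by have := monicP (monic_root_poly X); rewrite lead_coefE -/g sg.
have g0 x : x \in X -> (g.[x] = 0)%R by move=> xX; apply/eqP; rewrite root_polyE.
have char k : 0 < k <= N -> (k%:R != 0 :> F)%R.
  by move=> /andP[k0 kN]; apply: natr_neq0_Fp => //; rewrite k0; lia.
pose U : poly_p := (\poly_(j < N.+1) (g`_(N - j) * ((N - j)`!)%:R))%R.
pose E : poly_p := (\poly_(j < N.+1) (a%:R ^+ j / (j`!)%:R))%R.
pose c k := ((U * E)`_(N - k) / (k`!)%:R)%R.
pose w : poly_p := (\poly_(k < N) (c k - g`_k))%R.
have shift (x : F) : (g.[x + a%:R] = \sum_(k < N.+1) c k * x ^+ k)%R.
  rewrite (@taylor_shift _ N) ?sg //; apply: eq_bigr => k _; congr (_ / _ * _)%R.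
  rewrite coefM; apply: eq_bigr => j _; rewrite !coef_poly.
  have kN : k <= N by rewrite -ltnS.
  have jk : j <= N - k by rewrite -ltnS.
  by rewrite !ifT //; lia.
have cN : (c N = 1)%R.
  have fN : ((N`!)%:R != 0 :> F)%R.
    elim: (N) char => [|k IH] char; first by rewrite fact0 oner_neq0.
    rewrite factS natrM; apply: mulf_neq0; first by apply: char; rewrite leqnn.
    by apply: IH => i /andP[i0 ik]; apply: char; rewrite i0 ltnW.
  by rewrite /c subnn coefM big_ord1 !coef_poly /= subn0 gN mul1r fact0 expr0 divr1 mulr1 divff.
have wval x : x \in X -> (w.[x] = g.[x + a%:R])%R.
  move=> xX; rewrite shift big_ord_recr /= cN mul1r.
  have := g0 x xX; rewrite (horner_coef g) sg big_ord_recr /= gN mul1r => /eqP; rewrite addr_eq0 => /eqP xN.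
  rewrite horner_poly -[X in (_ + X)%R]opprK -xN -sumrB; apply: eq_bigr => k _.
  by rewrite mulrBl.
apply: (@run_weaken _ _ (1 + ((3 * N.+1 + 3) + ((3 * N.+1 + 3) + (N.+1 * D ^ 7 + ((3 * N + 3) + N * D ^ 14))))) _ C C) => //.
  have -> : N * D ^ 15 = N * D ^ 14 * D by rewrite (expnD D 14 1) expn1; lia.
  have x1 : N.+1 * D ^ 7 <= 2 * (N * D ^ 14).
    rewrite mulnA; apply: leq_mul; first by lia.
    by rewrite leq_exp2l //; lia.
  have x4 : N * D ^ 14 * 16 <= N * D ^ 14 * D by rewrite leq_mul2l D16 orbT.
  have x5 : N * 16 <= N * D ^ 14.
    by rewrite leq_mul2l; apply/orP; right; apply: leq_trans D16 _; rewrite -{1}(expn1 D) leq_exp2l //; lia.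
  by lia.
apply: run_seq; apply: run_frame; apply: run_SetV => //; rewrite !evalE e28 addn1; first exact: leq_ltn_trans pW.
move=> m1 h1 fr1; have me1 := env_mods (c := SetV 13 _) isT fr1 me.
have mg1 := modulus_mods (c := SetV 13 _) isT fr1 mg; have [a28 _ _ a26 _] := mg1; have [a0 _ _ _ _] := me1.
have tb1 := tables_mods (c := SetV 13 _) isT fr1 tb; have [t39 t42 t43] := tb1.
apply: run_seq; apply: run_frame; apply: (@run_Tab_poly 11 _ _ N.+1 U) => //; first by rewrite evalE h1.
  move=> k m' kN j3 fr _; rewrite !evalE j3 !fr // a0 a28 coef_poly kN t42; last by lia.
  rewrite -val_natF //; congr (val _); rewrite natrM natr_Fp_val; congr (_ * _)%R.
  case: k kN {j3} => [|k] kN; first by rewrite subn0 subnn mul0n addn0 subn0 gN.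
  by rewrite subSS sub0n subn0 add0n mul1n a26 ?natr_Fp_val //; lia.
move=> m2 h11 fr2; have me2 := env_mods (c := Tab 11 _ _) isT fr2 me1; have [b0 _ _ _ _] := me2.
have mg2 := modulus_mods (c := Tab 11 _ _) isT fr2 mg1.
have tb2 := tables_mods (c := Tab 11 _ _) isT fr2 tb1; have [s39 _ _] := tb2.
apply: run_seq; apply: run_frame; apply: (@run_Tab_poly 12 _ _ N.+1 E) => //; first by rewrite evalE fr2 // h1.
  move=> k m' kN j3 fr prev; rewrite !evalE j3 (fr 41) // (fr 39) // (fr 0) // b0 coef_poly kN.
  case: k kN {j3} prev => [|k] kN prev.
    by rewrite subn0 subnn mul0n addn0 expr0 fact0 divr1 val1F.
  rewrite !subSS sub0n !subn0 add0n mul1n prev // s39; last by lia.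
  rewrite coef_poly (ltnW kN) fr2 // fr1 // e41 -val_natF //; congr (val _).
  by rewrite factS !natrM !natr_Fp_val exprS invfM; ring.
move=> m3 h12 fr3; have me3 := env_mods (c := Tab 12 _ _) isT fr3 me2.
have mg3 := modulus_mods (c := Tab 12 _ _) isT fr3 mg2.
have tb3 := tables_mods (c := Tab 12 _ _) isT fr3 tb2.
apply: run_seq; apply: run_frame; apply: (run_MUL_poly (N := N.+1) (P := U) (Q := E)) => //.
- by rewrite fr3 // fr2 // h1.
- by apply: holds_frame h11 => i; rewrite fr3.
move=> m4 h14 fr4; have me4 := env_mods (c := MUL) isT fr4 me3; have [d0 _ _ _ _] := me4.
have mg4 := modulus_mods (c := MUL) isT fr4 mg3; have [d28 _ _ d26 _] := mg4.
have tb4 := tables_mods (c := MUL) isT fr4 tb3; have [_ _ u43] := tb4.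
apply: run_seq; apply: run_frame; apply: (@run_Tab_poly 40 _ _ N w) => //.
  move=> k m' kN j3 fr _; rewrite !evalE j3 !fr // d0 d28 coef_poly kN h14; last by rewrite ltnS leq_subr.
  rewrite u43 1?ltnW ?(leq_trans kN) // d26 // -val_natF //; congr (val _).
  rewrite natrD natrM !natr_Fp_val natr_oppF ?natr_Fp_val //.
  by rewrite ltnW // ltn_val_Fp.
move=> m5 h40 fr5; have me5 := env_mods (c := Tab 40 _ _) isT fr5 me4.
have mg5 := modulus_mods (c := Tab 40 _ _) isT fr5 mg4.
apply: (run_STEP (n := n) (w := w)) => //.
- by split=> //; apply: (tables_mods _ fr5).
- by rewrite Xn.
- exact: size_poly.
by move=> m6; apply: fin.
Qed.

(** * Invariants of the search and its length *)

Lemma restrict_sub (X : {set F}) w : restrict X w \subset X.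
Proof. by rewrite /restrict; case: ifP => // _; apply/subsetP => x; rewrite inE => /andP[]. Qed.

Lemma restrict_neq0 (X : {set F}) w : X != set0 -> restrict X w != set0.
Proof. by rewrite /restrict; case: ifP => // /negbT. Qed.

Lemma unsplit_restrict a (X : {set F}) w : unsplit a X ->
  (forall x, x \in X -> w.[x] = (x + a.+1%:R) ^+ p./2 - 1)%R -> unsplit a.+1 (restrict X w).
Proof.
move=> uX hw b /andP[b0]; rewrite leq_eqVlt => /orP[/eqP->|ba]; last first.
  have b_le : 0 < b <= a by rewrite b0 -ltnS.
  by have [h|h] := uX b b_le; [left|right] => x /(subsetP (restrict_sub X w)) /h.
rewrite /restrict; case: ifP => [/eqP S0|_]; [left|right] => x.
  move=> xX; have := in_set0 x; rewrite -S0 inE xX /= => /negbFE; rewrite hw // subr_eq0 => /eqP //.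
by rewrite inE => /andP[xX]; rewrite hw // subr_eq0.
Qed.

Lemma unsplit_sub a (X Y : {set F}) : Y \subset X -> unsplit a X -> unsplit a Y.
Proof. by move=> /subsetP YX uX b ba; have [h|h] := uX b ba; [left|right] => x /YX /h. Qed.

Lemma separated_sub a (X Y : {set F}) : Y \subset X -> separated a X -> separated a Y.
Proof. by move=> /subsetP YX sX x b /YX xX ba; apply: contra (sX x b xX ba); exact: YX. Qed.

Lemma translate_closed (X : {set F}) (b : F) : b != 0%R -> X != set0 ->
  (forall x, x \in X -> (x + b)%R \in X) -> #|X| = p.
Proof.
move=> b0 /set0Pn[x xX] cl.
have it k : (x + b *+ k)%R \in X.
  by elim: k => [|k IH]; [rewrite mulr0n addr0|rewrite mulrSr addrA cl].
suff -> : X = setT by rewrite cardsT card_Fp.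
apply/setP => y; rewrite inE; have := it (val ((y - x) / b)%R).
by rewrite -mulr_natr natr_Fp_val mulrC divfK // addrC subrK => ->.
Qed.

(** The elements x with x + a + 1 outside X are kept. There are some, since otherwise X would be
    closed under a translation and would be all of F_p; this is why the case n = p is treated
    apart. *)
Lemma separated_restrict a (X : {set F}) w : separated a X -> a.+1 < p -> X != set0 -> #|X| < p ->
  (forall x, x \in X -> w.[x] = (root_poly X).[x + a.+1%:R])%R -> separated a.+1 (restrict X w).
Proof.
move=> sX ap X0 Xp hw.
have hS x : x \in X -> (w.[x] != 0)%R = ((x + a.+1%:R)%R \notin X).
  by move=> xX; rewrite hw // root_polyE.
have S0 : [set x in X | w.[x] != 0]%R != set0.
  apply/negP => /eqP S0; have := Xp; rewrite (@translate_closed X (a.+1%:R)%R) ?ltnn //.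
    by apply: natr_neq0_Fp.
  move=> x xX; have := in_set0 x; rewrite -S0 inE xX hS //= => /negbFE //.
rewrite /restrict (negPf S0) => x b; rewrite inE => /andP[xX]; rewrite hS // => xa /andP[b0].
rewrite leq_eqVlt => /orP[/eqP->|ba]; rewrite inE negb_and; first by rewrite xa.
by rewrite sX // b0.
Qed.

(** For distinct x and y in X the residues of y - x and x - y both exceed a, and they add up to
    p. *)
Lemma separated_succ_lt a (X : {set F}) : separated a X -> 1 < #|X| -> a.+1 < p.
Proof.
move=> sX /card_gt1P[x [y [xX yX xy]]].
have yx : (y - x != 0)%R by rewrite subr_eq0 eq_sym.
have h (u w : F) : u \in X -> w \in X -> u != w -> a < val (w - u)%R.
  move=> uX wX uw; rewrite ltnNge; apply/negP => le.
  have v0 : 0 < val (w - u)%R by rewrite lt0n; apply: contra uw => /eqP e; rewrite eq_sym -subr_eq0; apply/eqP; apply: val_inj; exact: e.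
  have := sX u (val (w - u)%R) uX; rewrite v0 le natr_Fp_val addrC subrK wX => /(_ isT) //.
have h1 := h x y xX yX xy; have h2 : a < val (x - y)%R by apply: h => //; rewrite eq_sym.
have : (val (y - x)%R + val (x - y)%R) %% p = 0.
  rewrite -val_natF // natrD !natr_Fp_val addrC subrKA subrr //.
have l1 := ltn_val_Fp pp (y - x)%R; have l2 := ltn_val_Fp pp (x - y)%R.
move: h1 h2 l1 l2; move: (val _) (val _) => A B h1 h2 l1 l2 /eqP; rewrite -/(dvdn p (A + B)) => /dvdnP[q e].
by case: q e => [|[|q]] e; lia.
Qed.

(** For a >= 2 L the term L #|X| in #|X| a <= L (#|X| + s) is at most half of the left side, which
    leaves #|X| a <= 2 L s. *)
Definition cluster_size n s a := let L := (v * v) ^ 50 in if a < 2 * L then n else (2 * L * s) %/ a.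

Lemma card_cluster n s a (X : {set F}) : p <= s ^ 2 -> separated a X -> unsplit a X -> 1 < #|X| -> #|X| <= n < p ->
  #|X| <= cluster_size n s a.
Proof.
move=> ps sX uX X2 /andP[Xn np]; rewrite /cluster_size; set L := (v * v) ^ 50.
have ap := separated_succ_lt sX X2.
have podd : odd p by case: (even_prime pp) => // p2; move: np Xn X2 p2; move: (#|X|) => N; clear; lia.
have L0 : 0 < L by rewrite expn_gt0 muln_gt0; lia.
have bound : #|X| * a <= L * (#|X| + s).
  (* For p <= v * v [cluster_bound] does not apply, but a < p makes the claim trivial. *)
  have [lp|lp] := ltnP (v * v) p.
    have vv1 : 1 < v * v by rewrite (leq_trans _ (leq_mul v4 v4)).
    have plt : p < 2 ^ (v * v) by rewrite expnM; apply: leq_trans pv; rewrite mul2n -addnn -addn1 leq_add2l.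
    exact: (cluster_bound pp podd plt lp vv1 ps sX uX X2).
  apply: (@leq_trans (#|X| * (v * v))); first by rewrite leq_mul2l (leq_trans (ltnW (ltnW ap)) lp) orbT.
  rewrite mulnC; apply: leq_mul; last exact: leq_addr.
  by rewrite /L -{1}(expn1 (v * v)) leq_pexp2l // muln_gt0; lia.
clearbody L; case: ltnP => // aL; rewrite leq_divRL; last by apply: leq_trans aL; rewrite muln_gt0.
have : #|X| * (2 * L) <= #|X| * a by rewrite leq_mul2l aL orbT.
move: (#|X|) bound => N; clear; lia.
Qed.

(** The first 2 L rounds count n each, and the others form a harmonic sum; this is the source of n +
    sqrt p. *)
Lemma sum_cluster_size n s B : B <= 2 ^ (v * v) ->
  \sum_(a < B) cluster_size n s a <= 2 * (v * v) ^ 50 * n + (v * v) * (2 * (v * v) ^ 50 * s).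
Proof.
move=> Bv; set L := (v * v) ^ 50.
apply: (@leq_trans (\sum_(a < B) (if a < 2 * L then n else 0) + \sum_(a < B) (if 0 < a then (2 * L * s) %/ a else 0))).
  rewrite -big_split; apply: leq_sum => a _; rewrite /cluster_size -/L.
  case: ltnP => aL; first exact: leq_addr.
  by rewrite ifT ?add0n //; apply: leq_trans aL; rewrite muln_gt0 expn_gt0 muln_gt0; lia.
apply: leq_add.
  have -> : \sum_(a < B) (if a < 2 * L then n else 0) = minn B (2 * L) * n.
    elim: (B) => [|b IH]; first by rewrite big_ord0 min0n.
    rewrite big_ord_recr /= IH; case: ltnP => h.
      by rewrite (minn_idPl h) mulSn addnC.
    by rewrite (minn_idPr (leqW h)) addn0.
  by rewrite leq_mul2r geq_minr orbT.
rewrite -(big_mkord xpredT (fun a => if 0 < a then (2 * L * s) %/ a else 0)).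
apply: leq_trans (sum_divn_le _ _).
case: B Bv => [|B] Bv; first by rewrite big_geq.
rewrite big_ltn // ltnn add0n (big_cat_nat (n := B.+1) (p := 2 ^ (v * v))) //=.
apply: leq_trans (leq_addr _ _); rewrite big_nat_cond [X in _ <= X]big_nat_cond.
by apply: leq_sum => a /andP[/andP[a0 _] _]; rewrite a0.
Qed.

(** Beyond this number [cluster_size] is at most 1, so a single root is left. *)
Definition search_length s := minn p (2 * (v * v) ^ 50 * s.+1).

Lemma cluster_size_search_length n s a : a < p -> 1 < cluster_size n s a -> a < search_length s.
Proof.
move=> ap; rewrite /cluster_size /search_length leq_min ap /=; move: ((v * v) ^ 50) => L.
case: (ltnP a (2 * L)) => aL; first by move=> _; apply: leq_trans aL _; rewrite leq_pmulr.
move=> h; have a0 : 0 < a by case: (a) h => //; rewrite divn0.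
rewrite leq_divRL // in h; rewrite mulnS; move: aL h a0; clear; move: (2 * L * s) => x; lia.
Qed.

Definition search :=
  SetV 41 #0 ;;
  While (Var 28 [-] #1) (SetV 41 (Var 41 [+] #1) ;; SHIFTSTEP ;; TAYLORSTEP).

Lemma run_search n s (X : {set F}) m (C : memory -> Prop) : p <= s ^ 2 -> state n m X -> X != set0 -> #|X| <= n < p ->
  (forall m' x, x \in X -> state n m' [set x] -> C m') ->
  run W search ((\sum_(a < search_length s) (2 * (cluster_size n s a * D ^ 15)).+2).+2) C m.
Proof.
move=> ps st X0 Xnp fin; have /andP[Xn np] := Xnp.
(* After round a the surviving set Y is separated and unsplit up to a. Its size is bounded at the
   head of the next round, before that round is paid for. *)
pose I a m' := get m' 41 0 = a /\ exists2 Y : {set F}, state n m' Y &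
  [/\ Y \subset X, Y != set0, separated a Y & unsplit a Y].
have Ynp (Y : {set F}) : Y \subset X -> #|Y| <= n < p.
  by move=> YX; rewrite np andbT (leq_trans (subset_leq_card YX)).
apply: (@run_weaken _ _ (1 + (\sum_(a < search_length s) (2 * (cluster_size n s a * D ^ 15)).+2).+1) _ C C) => //.
have state_mods c m1 m2 (Y : {set F}) : all (fun r => ~~ mods c r) [:: 0; 6; 7; 8; 9; 10; 26; 27; 28; 39; 42; 43] ->
  (forall r i, r < 64 -> ~~ mods c r -> get m2 r i = get m1 r i) -> state n m1 Y -> state n m2 Y.
  move=> al fr [h1 h2 h3]; split.
  - by apply: (env_mods _ fr) => //; move: al => /= /and5P[-> -> -> -> /and3P[-> -> _]].
  - by apply: (tables_mods _ fr) => //; move: al => /=; do 9!case/andP=> _; move=> /and3P[-> -> /andP[-> _]].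
  by apply: (modulus_mods _ fr) => //; move: al => /=; do 6!case/andP=> _; move=> /and4P[-> -> -> _].
apply: run_seq; apply: run_frame; apply: run_SetV => //; first by rewrite evalE; lia.
move=> m1 h1 fr1.
apply: (@run_while_bound _ I (fun a => (2 * (cluster_size n s a * D ^ 15)).+1)).
- split; first by rewrite h1.
  exists X; first exact: (state_mods (SetV 41 #0) _ _ _ isT fr1 st).
  split=> //; first by move=> x b _ /andP[b0]; rewrite leqNgt b0.
  by move=> b /andP[b0]; rewrite leqNgt b0.
- move=> a m2 [e41 [Y stY [YX Y0 sY uY]]].
  have [_ _ [e28 _ _ _ _]] := stY; rewrite !evalE e28 => /eqP Y2.
  have Y1 : 1 < #|Y| by lia.
  have ap := separated_succ_lt sY Y1; have Yc := card_cluster ps sY uY Y1 (Ynp Y YX).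
  split; first by apply: (cluster_size_search_length (n := n)); [exact: ltnW ap|exact: leq_trans Y1 Yc].
  apply: (@run_weaken _ _ (1 + (#|Y| * D ^ 15 + #|Y| * D ^ 15)) _ (I a.+1)) => //.
    by rewrite add1n ltnS addnn -mul2n leq_mul2l leq_mul2r Yc orbT.
  apply: run_seq; apply: run_frame; apply: run_SetV => //; rewrite !evalE e41 addn1.
    by apply: ltn_trans ap _; lia.
  move=> m3 h3 fr3; have st3 := state_mods (SetV 41 (Var 41 [+] #1)) _ _ _ isT fr3 stY.
  apply: run_seq; apply: run_frame; apply: (run_SHIFTSTEP (a := a.+1) st3) => //; first exact: Ynp.
    by rewrite h3.
  move=> m4 w hw st4 fr4; set Z := restrict Y w in st4.
  have ZY : Z \subset Y by exact: restrict_sub.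
  have Z0 : Z != set0 by exact: restrict_neq0.
  apply: (@run_weaken _ _ (#|Z| * D ^ 15) _ (I a.+1) (I a.+1)) => //.
    by rewrite leq_mul2r subset_leq_card ?orbT.
  apply: run_frame; apply: (run_TAYLORSTEP (a := a.+1) st4) => //.
  + by apply: Ynp; exact: subset_trans YX.
  + by rewrite fr4 // h3.
  move=> m5 w' hw' st5 fr5; split; first by rewrite fr5 // fr4 // h3.
  exists (restrict Z w') => //; split.
  + by apply: subset_trans (subset_trans (restrict_sub _ _) ZY) YX.
  + exact: restrict_neq0.
  + apply: separated_restrict => //; first exact: separated_sub sY.
    by have /andP[Zn _] := Ynp Z (subset_trans ZY YX); lia.
  by apply: unsplit_sub (restrict_sub _ _) _; exact: unsplit_restrict.
move=> a m2 [_ [Y stY [YX Y0 _ _]]]; have [_ _ [e28 _ _ _ _]] := stY; rewrite !evalE e28 => Y1.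
have /cards1P[x xE] : #|Y| == 1 by rewrite eqn_leq -subn_eq0 Y1 eqxx lt0n cards_eq0.
by apply: (fin m2 x); [apply: (subsetP YX); rewrite xE inE|rewrite -xE].
Qed.

(** * Tables, normalization, parameters and the whole program *)

Definition build_tables :=
  Tab 39 (Var 1 [+] #1) ((#1 [-] (Var 3 [-] #1)) [*] (#1 [-] (#1 [-] Var 3)) [+]
    (Var 0 [-] (Var 0 [/] Var 3) [*] Arr 39 (Var 0 [%] Var 3) [%] Var 0) [%] Var 0) ;;
  Tab 42 (Var 1 [+] #1) ((#1 [-] Var 3) [+] Var 3 [*] Arr 42 (Var 3 [-] #1) [%] Var 0) ;;
  Tab 43 (Var 1 [+] #1) ((#1 [-] Var 3) [+] (#1 [-] (#1 [-] Var 3)) [*] (Arr 43 (Var 3 [-] #1) [*] Arr 39 (Var 3) [%] Var 0)).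

(** From p = (p / i) i + (p mod i). The remainder is smaller than i, so its inverse is already in
    the table. *)
Lemma inverse_recurrence i : 1 < i < p -> ((i%:R)^-1 = - ((p %/ i)%:R * ((p %% i)%:R)^-1) :> F)%R.
Proof.
move=> /andP[i1 ip]; have i0 : (i%:R != 0 :> F)%R by apply: natr_neq0_Fp => //; rewrite ip; lia.
have r0 : ((p %% i)%:R != 0 :> F)%R.
  have ri : p %% i < i by rewrite ltn_mod ltnW.
  apply: natr_neq0_Fp => //; rewrite (ltn_trans ri ip) andbT lt0n.
  by apply/negP => /eqP/eqP ip0; have := primeP pp => -[_ /(_ i ip0)] /orP[] /eqP; lia.
have e : ((p %/ i)%:R * i%:R + (p %% i)%:R = 0 :> F)%R.
  by rewrite -natrM -natrD -divn_eq pchar_Fp_0.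
have /eqP := e; rewrite addr_eq0 => /eqP qi.
by apply: (mulIf i0); rewrite mulVf // mulNr mulrAC qi mulNr opprK divff.
Qed.

Lemma run_build_tables n m (C : memory -> Prop) : env m -> get m 1 0 = n -> n < p ->
  (forall m', tables m' n -> C m') -> run W build_tables (9 * n + 18) C m.
Proof.
move=> me e1 np fin; have n2 : n.+1 <= 2 * p by lia.
have [e0 _ _ _ _] := me.
apply: (@run_weaken _ _ ((3 * n.+1 + 3) + ((3 * n.+1 + 3) + (3 * n.+1 + 3))) _ C C) => //; first by lia.
pose I : poly_p := (\poly_(i < n.+1) (i%:R)^-1)%R.
pose A : poly_p := (\poly_(i < n.+1) (i`!)%:R)%R.
pose B : poly_p := (\poly_(i < n.+1) (i`!)%:R^-1)%R.
apply: run_seq; apply: run_frame; apply: (@run_Tab_poly 39 _ _ n.+1 I) => //; first by rewrite !evalE e1 addn1.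
  move=> i m' iN j3 fr prev; rewrite !evalE j3 (fr 0) // e0 coef_poly iN.
  case: i iN {j3} prev => [|[|i]] iN prev.
  - by rewrite divn0 mul0n mod0n !subn0 modnn subnn muln0 invr0.
  - rewrite modn1 prev // coef_poly invr0 muln0 mod0n subn0 modnn invr1 val1F //.
  have ip : 1 < i.+2 < p by lia.
  rewrite (_ : 1 - (i.+2 - 1) = 0) ?mul0n ?add0n; last by lia.
  have rn : p %% i.+2 < i.+2 by rewrite ltn_mod.
  rewrite prev // coef_poly (ltn_trans rn iN) (inverse_recurrence ip) -[LHS](val_natF); congr (val _).
  by rewrite natr_oppF // ?modp_natr ?natrM ?natr_Fp_val // ltnW // ltn_mod.
move=> m1 h39 fr1; have g0 : get m1 0 0 = p by rewrite fr1.
apply: run_seq; apply: run_frame; apply: (@run_Tab_poly 42 _ _ n.+1 A) => //; first by rewrite !evalE fr1 // e1 addn1.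
  move=> i m' iN j3 fr prev; rewrite !evalE j3 (fr 0) // g0 coef_poly iN.
  case: i iN {j3} prev => [|i] iN prev; first by rewrite mul0n mod0n addn0 fact0 val1F.
  rewrite subSS sub0n add0n subSS subn0 prev // coef_poly (ltnW iN) -val_natF //; congr (val _).
  by rewrite natrM natr_Fp_val factS natrM.
move=> m2 h42 fr2; have k0 : get m2 0 0 = p by rewrite fr2.
apply: run_frame; apply: (@run_Tab_poly 43 _ _ n.+1 B) => //; first by rewrite !evalE fr2 // fr1 // e1 addn1.
  move=> i m' iN j3 fr prev; rewrite !evalE j3 (fr 0) // (fr 39) // k0 coef_poly iN.
  case: i iN {j3} prev => [|i] iN prev; first by rewrite subn0 subnn mul0n addn0 fact0 invr1 val1F.
  rewrite !subSS sub0n !subn0 add0n mul1n prev // fr2 // h39 // !coef_poly (ltnW iN) iN -val_natF //; congr (val _).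
  by rewrite natrM !natr_Fp_val factS natrM invfM mulrC.
move=> m3 h43 fr3; apply: fin; split=> i.
- by move=> /andP[i0 iN]; rewrite fr3 // fr2 // h39 // coef_poly ltnS iN.
- by move=> iN; rewrite fr3 // h42 // coef_poly ltnS iN.
by move=> iN; rewrite h43 // coef_poly ltnS iN.
Qed.

Definition normalize :=
  SetV 28 #1 ;; SetV 26 #0 ;; SetV 27 #1 ;; SetV 31 (Arr 2 (Var 1)) ;; SetV 32 (Var 0 [-] #2) ;; POWMOD ;;
  SetV 28 (Var 1) ;; Tab 35 (Var 28) (Arr 2 (Var 3) [*] Var 33 [%] Var 0) ;; SETMOD.

(* The inverse of the leading coefficient is its (p-2)-th power, computed modulo the polynomial X. *)
Lemma run_normalize n (f : poly_p) m (C : memory -> Prop) : env m -> get m 1 0 = n -> 0 < n <= p ->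
  holds m 2 n.+1 f -> size f = n.+1 ->
  (forall m', modulus m' n ((lead_coef f)^-1 *: f)%R -> C m') ->
  run W normalize (n * D ^ 11) C m.
Proof.
move=> me e1 /andP[n0 np] hf sf fin; have np2 : n <= 2 * p by lia.
have D10 : 256 <= D ^ 10.
  by apply: (@leq_trans (D ^ 2)); [rewrite (leq_mul D16 D16)|rewrite leq_exp2l //; lia].
apply: (@run_weaken _ _ (1 + (1 + (1 + (1 + (1 + (1 * D ^ 10 + (1 + ((3 * n + 3) + (n * D ^ 10 + 18 * n + 20))))))))) _ C C) => //.
  rewrite (expnD D 10 1) expn1 mulnA.
  have : n * D ^ 10 * 16 <= n * D ^ 10 * D by rewrite leq_mul2l D16 orbT.
  have : n * 256 <= n * D ^ 10 by rewrite leq_mul2l D10 orbT.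
  have : D ^ 10 <= n * D ^ 10 by rewrite leq_pmull.
  by move: (n * D ^ 10) (D ^ 10) n0 D10 => x y; lia.
set c := lead_coef f in fin; have c0 : (c != 0)%R by rewrite lead_coef_eq0 -size_poly_eq0 sf.
have cE : (f`_n = c)%R by rewrite /c lead_coefE sf.
apply: run_seq; apply: run_frame; apply: run_SetV => //; first by apply: MW'; rewrite evalE /M; lia.
move=> m1 h1 fr1; have me1 := env_mods (c := SetV 28 _) isT fr1 me.
apply: run_seq; apply: run_frame; apply: run_SetV => //; first by apply: MW'; rewrite evalE /M; lia.
move=> m2 h2 fr2; have me2 := env_mods (c := SetV 26 _) isT fr2 me1.
apply: run_seq; apply: run_frame; apply: run_SetV => //; first by apply: MW'; rewrite evalE /M; lia.
move=> m3 h3 fr3; have me3 := env_mods (c := SetV 27 _) isT fr3 me2.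
have g2 : get m3 2 n = val c by rewrite fr3 // fr2 // fr1 // hf // cE.
have g1 : get m3 1 0 = n by rewrite fr3 // fr2 // fr1.
apply: run_seq; apply: run_frame; apply: run_SetV => //; rewrite !evalE g1 g2.
  by apply: MW'; apply: ltnW; apply: ltn_trans pM; exact: ltn_val_Fp.
move=> m4 h4 fr4; have me4 := env_mods (c := SetV 31 _) isT fr4 me3; have [a0 _ _ _ _] := me4.
apply: run_seq; apply: run_frame; apply: run_SetV => //; rewrite !evalE a0; first by apply: MW'; lia.
move=> m5 h5 fr5; have me5 := env_mods (c := SetV 32 _) isT fr5 me4.
have mg5 : modulus m5 1 'X.
  split.
  - by rewrite fr5 // fr4 // fr3 // fr2 // h1.
  - by rewrite p0.
  - by rewrite size_polyX.
  - by move=> [|//] _; rewrite fr5 // fr4 // fr3 // h2 //= coefX.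
  exists 1%R; last by move=> [|//] _; rewrite fr5 // fr4 // h3 // coef1 val1F.
  by move=> [|//] _; rewrite mul1r coef_poly /= coefX coef1.
apply: run_seq; apply: run_frame; apply: (run_POWMOD me5 mg5 (B := c%:P%R) (e := p - 2)) => //.
- by move=> [|//] _; rewrite fr5 // h4 // coefC.
- exact: size_polyC_leq1.
- by rewrite h5.
- by apply: leq_ltn_trans p_pow; lia.
- by apply: MW'; lia.
move=> m6 h33 fr6; have me6 := env_mods (c := POWMOD) isT fr6 me5.
have g33 : get m6 33 0 = val (c^-1)%R.
  rewrite h33 //; congr (val _); rewrite -polyC_exp modp_small ?size_polyX ?ltnS ?size_polyC_leq1 // coefC /=.
  apply: (mulfI c0); rewrite -exprS mulfV // (_ : (p - 2).+1 = p.-1); last by lia.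
  by apply: (mulfI c0); rewrite -exprS prednK // fermatF // mulr1.
have k1 : get m6 1 0 = n by rewrite fr6 // fr5 // fr4.
apply: run_seq; apply: run_frame; apply: run_SetV => //; rewrite !evalE k1; first by apply: MW'; lia.
move=> m7 h7 fr7; have me7 := env_mods (c := SetV 28 _) isT fr7 me6; have [b0 _ _ _ _] := me7.
have k28 : get m7 28 0 = n by rewrite h7.
have sc : size (c^-1 *: f)%R = n.+1 by rewrite size_scale ?invr_eq0.
apply: run_seq; apply: run_frame; apply: (@run_Tab_poly 35 _ _ n (c^-1 *: f)%R) => //.
  move=> i m' iN j3 fr _; rewrite !evalE j3 !fr // b0 coefZ (fr7 33) // g33.
  rewrite fr7 // fr6 // fr5 // fr4 // fr3 // fr2 // fr1 // hf; last by lia.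
  by rewrite -val_natF //; congr (val _); rewrite natrM !natr_Fp_val mulrC.
move=> m8 h8 fr8; have me8 := env_mods (c := Tab 35 _ _) isT fr8 me7.
apply: (run_SETMOD me8) h8 fin => //.
- by rewrite fr8.
- by rewrite n0.
by rewrite monicE lead_coefZ mulVf.
Qed.

(** Register 44 holds 2^(u u) while u grows from 4, updated by (u + 1)^2 = u^2 + 2 u + 1. The least
    u with 2 p <= 2^(u u) = (2^u)^u makes at most u levels in base 2^u sufficient. *)
Definition parameters :=
  SetV 6 #4 ;; SetV 7 #16 ;; SetV 44 (Var 7 [*] Var 7 [*] Var 7 [*] Var 7) ;;
  While (#2 [*] Var 0 [-] Var 44)
    (SetV 44 (Var 44 [*] (#2 [*] (Var 7 [*] Var 7))) ;; SetV 7 (#2 [*] Var 7) ;; SetV 6 (Var 6 [+] #1)) ;;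
  SetV 10 (Var 6 [*] Var 6) ;;
  SetV 8 #1 ;; For 45 (Var 7) (SetV 8 (Var 8 [*] Var 0)) ;; SetV 8 (Var 8 [+] #1) ;;
  Tab 9 (#2 [*] Var 7) ((#1 [-] Var 3) [+] (#1 [-] (#1 [-] Var 3)) [*] (Arr 9 (Var 3 [-] #1) [*] Var 0 [%] Var 8)).

Lemma run_parameters m (C : memory -> Prop) : get m 0 0 = p -> (forall u, 4 <= u < v -> 2 ^ (u * u) < 2 * p) ->
  (forall m', env m' -> C m') -> run W parameters (20 * D) C m.
Proof.
move=> e0 vmin fin.
have vD : v < D by rewrite ltn_expl.
have pp4 : p ^ 16 <= p ^ D by rewrite leq_exp2l.
have p16 : 2 ^ 16 <= p ^ 16 by rewrite leq_exp2r.
have XW u : 4 <= u <= v -> 2 ^ (u * u) < W.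
  move=> /andP[u4 uv]; apply: MW'; move: u4; rewrite leq_eqVlt => /orP[/eqP<-|u4].
    by rewrite /M; apply: leq_trans p16 (leq_trans pp4 (leq_addr _ _)).
  have u1 : 4 <= u.-1 < v by lia.
  have uu : u * u = u.-1 * u.-1 + (2 * u).-1 by nia.
  rewrite uu expnD; apply: (@leq_trans (2 * p * 2 ^ (2 * u).-1)); first by rewrite leq_mul2r ltnW ?orbT ?vmin.
  have -> : 2 * p * 2 ^ (2 * u).-1 = p * 2 ^ (2 * u) by rewrite -[in RHS](@prednK (2 * u)) ?expnS; lia.
  apply: (@leq_trans (p * p ^ (2 * u))); first by rewrite leq_mul2l leq_exp2r ?orbT //; lia.
  rewrite -expnS /M; apply: leq_trans (leq_addr _ _); rewrite leq_exp2l //.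
  have v2 k : 2 * (k + 4) < 2 ^ (k + 4) by elim: k => // k IH; rewrite addSn expnS; lia.
  by have := v2 (v - 4); rewrite subnK //; rewrite /D; lia.
have DW : D < W by apply: MW'; rewrite /M; lia.
apply: (@run_weaken _ _ (1 + (1 + (1 + ((\sum_(i < v - 4) (1 + (1 + 1)).+1).+1 + (1 + (1 + ((\sum_(i < D) (1 + 2) + 3) +
  (1 + (3 * (2 * D) + 3))))))))) _ C C) => //.
  by rewrite !sum_nat_const !card_ord; lia.
apply: run_seq; apply: run_frame; apply: run_SetV => //; first by apply: MW'; rewrite evalE /M; lia.
move=> m1 h1 fr1.
apply: run_seq; apply: run_frame; apply: run_SetV => //; first by apply: MW'; rewrite evalE /M; lia.
move=> m2 h2 fr2.
have g7 : get m2 7 0 = 2 ^ 4 by rewrite h2.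
have X4 : eval m2 (Var 7 [*] Var 7 [*] Var 7 [*] Var 7) = 2 ^ (4 * 4).
  by rewrite !evalE g7 -!expnD.
apply: run_seq; apply: run_frame; apply: run_SetV; [by []|by rewrite X4; exact: (XW 4 v4)|].
move=> m3 h3 fr3; rewrite X4 in h3.
pose I i m' := [/\ get m' 0 0 = p, get m' 6 0 = 4 + i, get m' 7 0 = 2 ^ (4 + i) & get m' 44 0 = 2 ^ ((4 + i) * (4 + i))].
apply: run_seq; apply: (@run_while _ I (fun=> 1 + (1 + 1))).
- by split; rewrite h3 //= h2 //= h1.
- move=> i m' iv [i0 i6 i7 i44]; split.
    rewrite !evalE i0 i44; have := vmin (4 + i); rewrite leq_addr (_ : 4 + i < v); last by lia.
    by move=> /(_ isT); rewrite -subn_gt0; case: (_ - _).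
  have sq : 2 ^ ((4 + i) * (4 + i)) * (2 * (2 ^ (4 + i) * 2 ^ (4 + i))) = 2 ^ ((4 + i.+1) * (4 + i.+1)).
    by rewrite -[2 * _]/(2 ^ 1 * _) -!expnD; congr (2 ^ _); lia.
  apply: run_seq; apply: run_SetV => //; rewrite !evalE i44 i7 sq; first by apply: XW; lia.
  move=> m4 h4; have s7 : 2 * 2 ^ (4 + i) = 2 ^ (4 + i.+1) by rewrite addnS expnS.
  apply: run_seq; apply: run_SetV => //; rewrite !evalE h4 //= i7 s7.
    by apply: leq_ltn_trans DW; rewrite leq_exp2l //; lia.
  move=> m5 h5; apply: run_SetV => //; rewrite !evalE h5 //= h4 //= i6 addn1 -addnS.
    by apply: leq_ltn_trans DW; apply: ltnW; apply: leq_ltn_trans vD; lia.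
  by move=> m6 h6; split; rewrite h6 //= h5 //= h4.
move=> m4 [i0 i6 i7 i44]; rewrite (subnKC v4) in i6 i7 i44; split.
  by rewrite !evalE i0 i44; apply/eqP; rewrite subn_eq0 expnM.
apply: run_seq; apply: run_frame; apply: run_SetV => //; rewrite !evalE i6.
  by apply: leq_ltn_trans (XW v _); [exact: ltnW (ltn_expl _ _)|rewrite v4 leqnn].
move=> m5 h5 fr5.
apply: run_seq; apply: run_frame; apply: run_SetV => //; first by apply: MW'; rewrite evalE /M; lia.
move=> m6 h6 fr6.
pose J i m' := get m' 8 0 = p ^ i /\ get m' 0 0 = p.
have powW i : i <= D -> p ^ i < W by move=> iD; apply: MW'; rewrite /M; apply: leq_trans (leq_addr _ _); rewrite leq_exp2l.
apply: run_seq; apply: run_frame; apply: (@run_For _ 45 _ _ D (fun=> 1) J) => //.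
- by rewrite evalE h6 //= h5.
- by move=> i m' m'' h [j8 j0]; split; rewrite h.
- by split; rewrite h6 //= h5.
- move=> i m' iD [j8 j0] _; apply: run_SetV => //; rewrite !evalE j8 j0 -expnSr; first exact: powW.
  by move=> m'' h; split; rewrite h.
move=> m7 [j8 j0] fr7.
apply: run_seq; apply: run_frame; apply: run_SetV => //; rewrite !evalE j8; first exact: MW'.
move=> m8 h8 fr8.
have k7 : get m8 7 0 = D by rewrite fr8 // fr7 // fr6 // fr5.
have k8 : get m8 8 0 = M by rewrite h8.
have k0 : get m8 0 0 = p by rewrite fr8.
have M0 : 0 < M by rewrite /M addn1.
apply: run_frame; apply: (@run_Tab _ 9 _ _ (2 * D) (fun i => p ^ i %% M)) => //.
- by rewrite !evalE k7.
- by apply: MW'; rewrite /M; lia.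
- move=> i m' iD j3 fr prev _; rewrite !evalE j3 (fr 0) // (fr 8) // k0 k8; split; last first.
    by apply: MW'; apply: ltnW; rewrite ltn_mod.
  case: i iD {j3} prev => [|i] iD prev; first by rewrite subn0 subnn mul0n addn0 modn_small // /M; lia.
  by rewrite subSS sub0n subn0 add0n mul1n subSS subn0 prev // modnMml -expnSr.
move=> m9 h9 _ _ fr9; apply: fin; split; rewrite ?fr9 //.
  by rewrite fr8 // fr7 // fr6 // fr5.
split; first by move=> i iD; rewrite h9.
by rewrite fr8 // fr7 // fr6 // h5.
Qed.

(** For n = p every residue is a root and 0 is returned. Otherwise the search ends with g = X - x,
    so p minus its constant coefficient, modulo p, is x. *)
Definition root_finder :=
  spread ;; parameters ;;
  If (Var 0 [-] Var 1)
    (build_tables ;; normalize ;; search ;; SetV 0 ((Var 0 [-] Var 26) [%] Var 0))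
    (SetV 0 #0).

Hypothesis vmin : forall u, 4 <= u < v -> 2 ^ (u * u) < 2 * p.

(** 119 = 102 + 15 + 2: the sizes sum up to at most 2 D^102 (n + s), where D^102 bounds L v^2; a
    step costs D^15 per element; and D^2 >= 256 absorbs the numerical factors. *)
Lemma root_finder_cost n s : 0 < n < p -> 0 < s ->
  3 * n + 2 + (20 * D + (9 * n + 18 + (n * D ^ 11 + ((\sum_(a < search_length s) (2 * (cluster_size n s a * D ^ 15)).+2).+2 + 1))).+1)
  <= (n + s) * D ^ 119.
Proof.
move=> /andP[n0 np] s0.
have vD : v <= D by rewrite ltnW // ltn_expl.
have Dk j k : j <= k -> D ^ j <= D ^ k by move=> jk; rewrite leq_pexp2l // expn_gt0.
set T := n + s; have T1 : 1 <= T := leq_trans n0 (leq_addr _ _).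
have nT : n <= T := leq_addr _ _.
have sT : s.+1 <= 2 * T by move: n0; rewrite /T; clear; lia.
have TE k : k * T = k * n + k * s by rewrite /T mulnDr.
clearbody T.
set L := (v * v) ^ 50.
have LD : L <= D ^ 100 by rewrite /L (expnM D 2 50) leq_exp2r // expnS expn1 leq_mul.
have L0 : 0 < L by rewrite expn_gt0 muln_gt0; lia.
set B := search_length s.
have Bp : B <= 2 ^ (v * v).
  apply: leq_trans (geq_minl _ _) _; rewrite expnM; apply: leq_trans pv; lia.
have BL : B <= 2 * L * s.+1 by exact: geq_minr.
have S1 : \sum_(a < B) (2 * (cluster_size n s a * D ^ 15)).+2 = 2 * D ^ 15 * (\sum_(a < B) cluster_size n s a) + 2 * B.
  rewrite big_distrr /= -[2 * B]mulnC -[B in B * 2]card_ord -sum_nat_const -big_split /=.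
  by apply: eq_bigr => a _; rewrite -addn2; congr (_ + _); rewrite mulnCA mulnC mulnA.
rewrite S1; have S2 := sum_cluster_size n s Bp.
rewrite -/L in S2; clearbody B; move: (\sum_(a < B) _) S2 => S S2 {S1}.
have vv : v * v <= D ^ 2 by rewrite expnS expn1 leq_mul.
have SD : S <= 2 * (D ^ 102 * T).
  apply: (leq_trans S2); rewrite [2 * (_ * T)]mulnA TE.
  apply: leq_add.
    by rewrite leq_mul2r leq_mul2l (leq_trans LD) ?orbT // Dk.
  rewrite mulnA leq_mul2r; apply/orP; right.
  by have := leq_mul vv LD; rewrite -expnD => h; rewrite mulnCA leq_mul2l h.
have SD' : 2 * D ^ 15 * S <= 4 * (D ^ 117 * T).
  have := leq_mul (leqnn (2 * D ^ 15)) SD.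
  have -> : 2 * D ^ 15 * (2 * (D ^ 102 * T)) = 4 * (D ^ 15 * D ^ 102 * T) by clear; lia.
  by rewrite -expnD.
have BD : 2 * B <= 8 * (D ^ 117 * T).
  have : L * s.+1 <= D ^ 117 * (2 * T).
    by apply: leq_mul; [apply: leq_trans LD _; exact: Dk|].
  by move: BL; rewrite -mulnA; move: (L * s.+1) (D ^ 117) => x y; clear; lia.
have D117 : D <= D ^ 117 by rewrite -{1}(expn1 D) Dk.
have N1 : n * D ^ 11 <= D ^ 117 * T by rewrite mulnC leq_mul // Dk.
have N2 : D <= D ^ 117 * T by apply: leq_trans D117 _; rewrite leq_pmulr.
have N3 : T <= D ^ 117 * T by rewrite leq_pmull // expn_gt0 /D expn_gt0.
have -> : T * D ^ 119 = D ^ 117 * T * (D * D) by rewrite (expnD D 117 2) -mulnn mulnCA mulnA.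
have DD : 16 * 16 <= D * D by rewrite leq_mul.
have : D ^ 117 * T * (16 * 16) <= D ^ 117 * T * (D * D) by rewrite leq_mul2l DD orbT.
move: SD' BD N1 N2 N3 nT D16 T1; move: (D ^ 117 * T) (2 * D ^ 15 * S) (n * D ^ 11) (D * D) (2 * B) => x y z w b; move: (D) => d; clear; lia.
Qed.

Lemma run_root_finder n s (f : poly_p) (X : {set F}) : 0 < n <= p -> size f = n.+1 -> 0 < s -> p <= s ^ 2 ->
  f = (lead_coef f *: root_poly X)%R ->
  run W root_finder ((n + s) * D ^ 119) (fun m' => exists2 x : F, root f x & m' 0 = val x) (input f).
Proof.
move=> /andP[n0 np] sf s0 ps fX.
have c0 : (lead_coef f != 0)%R by rewrite lead_coef_eq0 -size_poly_eq0 sf.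
have Xn : #|X| = n by apply/eqP; rewrite -eqSS -size_root_poly -sf fX size_scale.
have rX x : x \in X -> root f x by move=> xX; rewrite fX rootZ // /root root_polyE.
have get0 (m' : memory) : m' 0 = get m' 0 0 by [].
case: (ltngtP n p) np => // [np|np] _.
  apply: run_weaken (root_finder_cost (s := s) _ s0) _ _; [by rewrite n0|by move=> m' h; exact: h|].
  apply: run_seq; apply: (@run_spread _ n p (fun j => val (f`_j)%R)) => //.
  - by rewrite n0; lia.
  - by rewrite /= sf.
  move=> m1 g0 g1 g2.
  apply: run_seq; apply: run_frame; apply: (run_parameters g0 vmin) => m2 e2 fr2.
  have k1 : get m2 1 0 = n by rewrite fr2.
  have [k0 _ _ _ _] := e2.
  apply: run_if; rewrite !evalE k0 k1; last by lia.
  move=> _; apply: run_seq; apply: run_frame; apply: (run_build_tables e2 k1 np) => m3 tb3 fr3.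
  have e3 := env_mods (c := build_tables) isT fr3 e2.
  apply: run_seq; apply: run_frame; apply: (run_normalize e3 (n := n) (f := f)) => //.
  - by rewrite fr3.
  - by rewrite n0 ltnW.
  - by move=> j jn; rewrite fr3 // fr2 // g2.
  move=> m4 mg4 fr4; have e4 := env_mods (c := normalize) isT fr4 e3.
  have tb4 := tables_mods (c := normalize) isT fr4 tb3.
  have st4 : state n m4 X.
    split=> //; rewrite Xn; have : ((lead_coef f)^-1 *: f = root_poly X)%R by rewrite {2}fX scalerA mulVf // scale1r.
    by move=> <-.
  apply: run_seq; apply: (run_search ps st4).
  - by rewrite -cards_eq0 Xn; lia.
  - by rewrite Xn leqnn.
  move=> m5 x xX [[h0 _ _ _ _] _ [h28 _ _ h26 _]].
  apply: run_SetV => //; rewrite !evalE h0.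
    by apply: ltn_trans (_ : p < _); [rewrite ltn_mod; lia|lia].
  move=> m6 h6; exists x; first exact: rX.
  rewrite get0 h6 // eqxx /= h26 ?cards1 //.
  have -> : ((root_poly [set x])`_0 = - x)%R by rewrite /root_poly big_set1 coefB coefX coefC sub0r.
  by have := val_subF (0 : F)%R (- x)%R; rewrite sub0r opprK => <-; rewrite add0n.
have XT : X = setT by apply/eqP; rewrite eqEcard subsetT cardsT card_Fp // Xn np leqnn.
apply: (@run_weaken _ _ (3 * n + 2 + (20 * D + 2)) _ _ _ _ _ (fun m' H => H)).
  have D1 : 16 <= D ^ 119 by apply: (@leq_trans (D ^ 1)); [rewrite expn1 -[16]/(2 ^ 4) leq_exp2l|rewrite leq_pexp2l // expn_gt0].
  have := ltn_expl v (isT : 1 < 2); rewrite -/D => vD.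
  have D2 : D * 16 <= D ^ 119.
    apply: (@leq_trans (D * D)); first by rewrite leq_mul2l -[16]/(2 ^ 4) leq_exp2l // v4 orbT.
    by rewrite mulnn leq_exp2l // -{1}(expn0 2) ltn_exp2l //; lia.
  have n2 : 1 * (D * 16) <= n * D ^ 119 by rewrite leq_mul.
  have n3 : n * 16 <= n * D ^ 119 by rewrite leq_mul2l D1 orbT.
  have n4 : 1 * (D * 16) <= s * D ^ 119 by rewrite leq_mul.
  rewrite mulnDl; move: n2 n3 n4 vD v4 n0; clear; move: (n * D ^ 119) (s * D ^ 119) => x y; lia.
apply: run_seq; apply: (@run_spread _ n p (fun j => val (f`_j)%R)) => //.
- by rewrite n0; lia.
- by rewrite /= sf.
move=> m1 g0 g1 g2.
apply: run_seq; apply: run_frame; apply: (run_parameters g0 vmin) => m2 e2 fr2.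
have k1 : get m2 1 0 = n by rewrite fr2.
have [k0 _ _ _ _] := e2.
apply: run_if; rewrite !evalE k0 k1 np subnn // => _.
apply: run_SetV => //; first by rewrite evalE; lia.
move=> m3 h3; exists 0%R; first by apply: rX; rewrite XT inE.
by rewrite get0 h3.
Qed.

End Procedures.

(** * From the input polynomial to bit operations *)

Lemma split_root_poly (F : finFieldType) (f : {poly F}) : f != 0%R -> squarefree_poly f -> fully_splits f ->
  exists X : {set F}, f = (lead_coef f *: root_poly X)%R.
Proof.
move=> f0 sqf [rs frs].
have sq z : ~ (('X - z%:P) ^+ 2 %| \prod_(z <- rs) ('X - z%:P))%R.
  move=> h; have := sqf ('X - z%:P)%R; rewrite (eqp_dvdr _ frs) h => /(_ isT).
  by rewrite poly_unitE size_XsubC.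
have urs : uniq rs.
  elim: (rs) sq => //= z s IH sq; apply/andP; split.
    apply/negP => zs; apply: (sq z); rewrite big_cons expr2 dvdp_mul2l ?polyXsubC_eq0 //.
    by rewrite (big_rem z zs) dvdp_mulr.
  by apply: IH => y h; apply: (sq y); rewrite big_cons dvdp_mull.
exists [set z in rs]; have -> : root_poly [set z in rs] = (\prod_(z <- rs) ('X - z%:P))%R.
  rewrite /root_poly [RHS](big_uniq _ urs) /=; apply: eq_bigl => z; by rewrite inE.
have := eqp_eq frs; rewrite (monicP (monic_prod_XsubC _ _ _)) scale1r; exact.
Qed.

Lemma exists_scale p : exists v, (4 <= v) && (2 * p <= (2 ^ v) ^ v).
Proof.
exists (p + 4); rewrite leq_addl /= -expnM; apply: (@leq_trans (2 ^ (p + 1))).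
  by rewrite addn1 expnS leq_mul2l ltnW ?orbT // ltn_expl.
by rewrite leq_exp2l //; nia.
Qed.

Definition scale p := ex_minn (exists_scale p).

Lemma scaleP p : let v := scale p in
  [/\ 4 <= v, 2 * p <= (2 ^ v) ^ v & forall u, 4 <= u < v -> 2 ^ (u * u) < 2 * p].
Proof.
rewrite /scale; case: ex_minnP => v /andP[v4 pv] vmin; split=> // u /andP[u4 uv].
by rewrite ltnNge expnM; apply/negP => h; have := vmin u; rewrite u4 h => /(_ isT); rewrite leqNgt uv.
Qed.

(** W = M^3 has at most D^3 bits, because M has about v^2 D bits and 4 v^2 <= D^2. The square of
    this length raises the exponent from 119 to 125. *)
Lemma exec_root_finder p n s (f : {poly 'F_p}) : prime p -> 0 < n -> size f = n.+1 ->
  squarefree_poly f -> fully_splits f -> p <= s ^ 2 ->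
  exists2 t, finds_root root_finder f t &
    t <= cmd_cost root_finder * ((n + s) * 2 ^ (125 * scale p)).
Proof.
move=> pp n0 sf sqf spl ps; have p1 := prime_gt1 pp; have [v4 pv vmin] := scaleP p.
set v := scale p in v4 pv vmin *; set D := 2 ^ v.
have f0 : (f != 0)%R by rewrite -size_poly_eq0 sf.
have [X fX] := split_root_poly f0 sqf spl.
have np : n <= p.
  have c0 : (lead_coef f != 0)%R by rewrite lead_coef_eq0.
  have -> : n = #|X| by apply/eqP; rewrite -eqSS -sf fX size_scale // size_root_poly.
  by apply: leq_trans (max_card _) _; rewrite card_Fp.
have s0 : 0 < s by case: (s) ps => //; rewrite exp0n; lia.
pose M := p ^ D + 1; pose W := M ^ 3.
have pM : p < M by rewrite /M addn1 ltnS -{1}(expn1 p) leq_exp2l // expn_gt0.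
have pW : p < W by rewrite /W !expnS expn0 muln1; nia.
have np' : 0 < n <= p by rewrite n0.
have [m' [k [ex kK [x rx m0]]]] := run_root_finder pp v4 pv (leqnn W) vmin np' sf s0 ps fX.
have iW i : input f i < W.
  case: i => [|[|i]] //=; first by rewrite sf; lia.
  by apply: ltn_trans (ltn_val_Fp pp _) _.
have [_ [t et tle]] := uexec_exec ex iW.
exists t; first by exists m' => //; exists x.
apply: leq_trans tle _; rewrite -mulnA leq_mul2l; apply/orP; right.
have vD : 2 * v <= D.
  have h := leq_pow2_shift v4; rewrite /D; case: (v) h => // w.
  by have := ltn_expl w (isT : 1 < 2); rewrite expnS; lia.
have bW : bitlen W <= D ^ 3.
  apply: (@leq_trans (3 * (v * v * D) + 1)).
    rewrite addn1 bitlen_leP //; apply: (@leq_ltn_trans (2 ^ (3 * (v * v * D)))); last by rewrite ltn_exp2l.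
    rewrite /W [3 * _]mulnC expnM leq_exp2r //.
    rewrite /M; have : p ^ D * 2 <= 2 ^ (v * v * D).
      apply: (@leq_trans ((2 * p) ^ D)).
        by rewrite expnMn mulnC leq_mul2r -{1}(expn1 2) leq_exp2l // expn_gt0 orbT.
      by rewrite expnM leq_exp2r ?expn_gt0 // (expnM 2 v v).
    have : 0 < p ^ D by rewrite expn_gt0; lia.
    by move: (p ^ D) (2 ^ _) => a b; clear; lia.
  have v2 : v * v * 4 <= D ^ 2 by rewrite -mulnn; have := leq_mul vD vD; clear; lia.
  have : v * v * 4 * D <= D ^ 2 * D by rewrite leq_mul2r v2 orbT.
  have vv : 1 <= v * v * D by rewrite !muln_gt0 expn_gt0; lia.
  by rewrite -expnSr; move: (v * v) vv => y; clear; lia.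
apply: (@leq_trans ((n + s) * D ^ 119 * (D ^ 3) ^ 2)); first by apply: leq_mul => //; rewrite leq_exp2r.
by rewrite -mulnA -expnM -expnD /D -expnM [v * _]mulnC.
Qed.

From mathcomp Require Import all_classical all_reals all_analysis.

Import GRing.Theory numFieldNormedType.Exports.
Local Open Scope classical_set_scope.
Local Open Scope ring_scope.

(** * The exponent tends to zero *)

Section Exponent.
Variable R : realType.
Implicit Types (p : nat).

(** Solves p^eps = C 2^(c v) for eps, where v = [scale p]. *)
Definition exponent (C c : nat) p : R :=
  (ln (C%:R : R) + (c * scale p)%:R * ln 2) / ln (p%:R : R).

Lemma ln2_gt0 : 0 < ln (2 : R).
Proof. by rewrite ln_gt0 // ltr1n. Qed.

(** By minimality v - 1 is not admissible, so 2^((v - 1)^2) < 2 p and v grows like the square root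
    of log p. *)
Lemma scale_ln p : (1 < p)%N -> (4 < scale p)%N ->
  ((scale p).-1%:R ^+ 2 : R) * ln 2 <= ln 2 + ln (p%:R : R).
Proof.
move=> p1 v5; have [v4 _ /(_ (scale p).-1)] := scaleP p; set v := scale p in v4 v5 *.
have -> : (4 <= v.-1 < v)%N by lia.
move=> /(_ isT) lt; have p0 : (0 : R) < p%:R by rewrite ltr0n; lia.
rewrite -lnM ?posrE // -natrX mulr_natl -lnXn //.
have le : (2 ^+ (v.-1 ^ 2) : R) <= 2 * p%:R.
  by rewrite -natrX -natrM ler_nat -mulnn; apply: ltnW lt.
by rewrite ler_ln ?posrE //; exact: mulr_gt0.
Qed.

(** No square root of ln p is taken: w <= d w^2 + 1 / d for every d > 0, applied to w = v - 1, gives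
    v ln 2 <= d ln p + O(1), and d is chosen proportional to e. *)
Lemma exponent_cvg0 C c : (0 < C)%N -> exponent C c @ \oo --> (0 : R).
Proof.
move=> C0; apply/cvgrPdist_le => e e0.
pose d : R := e / (2 * (c%:R + 1)).
have c0 : 0 <= c%:R :> R by rewrite ler0n.
have d0 : 0 < d by rewrite divr_gt0 // mulr_gt0 // ltr_wpDl.
(* A collects the terms that do not grow with p, and p is taken so large that A <= (e / 2) ln p. *)
pose A : R := ln (C%:R) + c%:R * (4 * ln 2 + d * ln 2 + ln 2 / d).
exists (Num.truncn (expR (2 * A / e))).+2 => // p /= Np.
have p1 : (1 < p)%N by lia.
have pR : (1 : R) < p%:R by rewrite ltr1n.
have u0 : 0 < ln (p%:R : R) by rewrite ln_gt0.
set u := ln (p%:R : R) in u0.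
have l2 := ln2_gt0.
have uA : 2 * A / e <= u.
  rewrite -[X in X <= _]expRK ler_ln ?posrE ?expR_gt0 ?ltr0n //; last by lia.
  by rewrite (le_trans (ltW (truncnS_gt _))) // ler_nat; exact: ltnW Np.
have lC : 0 <= ln (C%:R : R) by rewrite ln_ge0 // ler1n.
have vb : (scale p)%:R * ln 2 <= 4 * ln 2 + d * ln 2 + ln 2 / d + d * u.
  have [v5|v4] := ltnP 4 (scale p); last first.
    rewrite -!addrA ler_wpDr //; first by rewrite !addr_ge0 ?divr_ge0 ?mulr_ge0 // ltW.
    by rewrite ler_pM2r // ler_nat.
  have := scale_ln p1 v5; rewrite -/u; set w := (scale p).-1%:R : R => wu.
  have -> : (scale p)%:R = w + 1 :> R by rewrite /w natr1 prednK //; lia.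
  have wle : w <= d * w ^+ 2 + 1 / d.
    have := sqr_ge0 (d * w - 1); have dd : d * (1 / d) = 1 by rewrite mulrC divfK // gt_eqF.
    by move=> h; rewrite -(ler_pM2l d0) mulrDr dd; nra.
  have : w * ln 2 <= d * (ln 2 + u) + ln 2 / d.
    apply: (le_trans (ler_wpM2r (ltW l2) wle)); rewrite mulrDl -mulrA div1r [d^-1 * _]mulrC lerD2r ler_pM2l //.
  by rewrite mulrDl mul1r; lra.
have num : ln C%:R + (c * scale p)%:R * ln 2 <= A + c%:R * d * u.
  rewrite /A natrM -mulrA; have := ler_wpM2l c0 vb; rewrite !mulrDr; lra.
have pos : 0 <= exponent C c p by rewrite divr_ge0 ?addr_ge0 ?mulr_ge0 // ltW.
rewrite sub0r normrN ger0_norm // /exponent -/u ler_pdivrMr //; apply: le_trans num _.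
have A1 : A <= e / 2 * u by move: uA; rewrite ler_pdivrMr //; lra.
have A2 : c%:R * d <= e / 2.
  rewrite /d mulrA ler_pdivrMr ?mulr_gt0 ?ltr_wpDl //; have : 0 <= e by exact: ltW.
  by move: c0; nra.
have := ler_wpM2r (ltW u0) A2; lra.
Qed.
End Exponent.

Theorem theorem8 (R : realType) :
  exists (c : cmd) (eps : nat -> R),
    eps @ \oo --> (0%R : R) /\
    forall (p n : nat) (f : {poly 'F_p}),
      prime p -> (1 <= n)%N -> size f = n.+1 ->
      squarefree_poly f -> fully_splits f ->
      exists2 t : nat, finds_root c f t &
        t%:R <= (n%:R + p%:R `^ (1 / 2)) * p%:R `^ eps p.
Proof.
have := exec_root_finder; move: (cmd_cost root_finder) => k exec_finder.
(* The least s with p <= s^2 is at most 2 sqrt p, hence the factor 2; the successor makes C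
   positive. *)
pose C := (2 * k.+1)%N.
exists root_finder, (@exponent R C 125); split; first exact: exponent_cvg0.
move=> p n f pp n1 sf sqf spl; have p1 := prime_gt1 pp.
have exs : exists s, (p <= s ^ 2)%N by exists p; rewrite -mulnn leq_pmulr // prime_gt0.
case: (ex_minnP exs) => s ps smin.
have [t ft tle] := exec_finder _ _ _ _ pp n1 sf sqf spl ps.
exists t => //.
have p0 : (0 : R) < p%:R by rewrite ltr0n prime_gt0.
have sqp : (s%:R : R) <= 2 * p%:R `^ (1 / 2).
  rewrite div1r (powR12_sqrt (ltW p0)).
  have s0 : (0 < s)%N by case: (s) ps => //; rewrite exp0n //; lia.
  have s1 : (s.-1%:R : R) <= Num.sqrt p%:R.
    rewrite -[X in X <= _]ger0_norm // -sqrtr_sqr ler_wsqrtr // -natrX ler_nat.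
    by rewrite leqNgt; apply/negP => lt; have := smin s.-1 (ltnW lt); lia.
  have : 1 <= Num.sqrt (p%:R : R) by rewrite -[X in X <= _]sqrtr1 ler_wsqrtr // ler1n prime_gt0.
  have -> : (s%:R : R) = s.-1%:R + 1 by rewrite natr1 prednK.
  by move: (Num.sqrt _) s1 => x s1 x1; rewrite mulr2n mulrDl mul1r lerD.
have eps_pow : (p%:R : R) `^ exponent R C 125 p = C%:R * 2 ^+ (125 * scale p).
  rewrite /powR gt_eqF // /exponent mulfVK; last by rewrite gt_eqF // ln_gt0 // ltr1n.
  rewrite expRD lnK ?posrE ?ltr0n //; congr (_ * _).
  by rewrite mulr_natl -lnXn // lnK ?posrE ?exprn_gt0.
rewrite eps_pow; apply: (@le_trans _ _ ((k * ((n + s) * 2 ^ (125 * scale p)))%N%:R)); first by rewrite ler_nat.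
rewrite /C !natrM natrD natrX -natr1.
set y : R := 2 ^+ _; set r := p%:R `^ _ in sqp *.
have k0 : (0 : R) <= k%:R by [].
have y0 : 0 <= y by rewrite exprn_ge0.
have n0 : (0 : R) <= n%:R by [].
have r0 : 0 <= r by exact: powR_ge0.
rewrite mulrA [X in _ <= X]mulrA ler_wpM2r //; nra.
Qed.
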